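(* There exists a constant $\zeta<2$ such that for every elastica $\gamma\colon[0,\infty)\to\mathbb R^2$ that is rotated so that it lifts to an extremal trajectory of the Engel group $\mathbf E$, one has $$t_{\rm cut}^{\mathbf E}(\gamma)\le t_{\rm cut}^{\mathbf C}(\gamma)\le \zeta\cdot t_{\rm cut}^{\mathbf E}(\gamma)$$ (as an inequality in $(0,+\infty]$).
   Context: Cartan group. $\mathbf C=\mathbb R^5$ with coordinates $(x,y,z,v,w)$; horizontal curves are solutions of $\dot x=u_1$, $\dot y=u_2$, $\dot z=\frac{-u_1y+u_2x}{2}$, $\dot v=u_2\frac{x^2+y^2}{2}$, $\dot w=-u_1\frac{x^2+y^2}{2}$, with length $\int\sqrt{u_1^2+u_2^2}\,dt$. Engel group. $\mathbf E=\mathbb R^4$ with coordinates $(x,y,z,v)$; horizontal curves are the solutions of the first four of these equations, with the same length functional. A Lipschitz planar curve $\gamma=(x,y)$ with $\gamma(0)=0$ has a unique horizontal lift starting at $0$ in each of $\mathbf C$ and $\mathbf E$. A (unit speed) elastica is a curve $\gamma$ with $\gamma(0)=0$, $\dot\gamma=(\cos\theta,\sin\theta)$, $\dot\theta=c$, $\dot c=-\alpha\sin(\theta-\beta)$ for some constants $\alpha\ge0$, $\beta\in S^1$; these are exactly the planar projections of the arc length parametrized extremal trajectories of $\mathbf C$ starting at the identity $0$ (straight lines, circles, inflectional, non-inflectional and critical elasticae). An elastica lifts to an extremal trajectory of $\mathbf E$ exactly when it can be written in this way with $\alpha\cos\beta=0$, i.e. $\dot\theta=c$, $\dot c=a\cos\theta$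 for some constant $a\in\mathbb R$. For such an elastica, $t_{\rm cut}^{\mathbf C}(\gamma)$ (respectively $t_{\rm cut}^{\mathbf E}(\gamma)$) is the supremum of $T>0$ such that the horizontal lift of $\gamma|_{[0,T]}$ to $\mathbf C$ (respectively $\mathbf E$) starting at $0$ is a length minimizing curve between its endpoints. *)

(* Defs.v *)
From HB Require Import structures.
From mathcomp Require Import all_boot all_order all_algebra.
From mathcomp Require Import all_classical all_reals all_analysis.

Set Implicit Arguments.
Unset Strict Implicit.
Unset Printing Implicit Defensive.

Import Order.TTheory GRing.Theory Num.Theory.
Import numFieldNormedType.Exports.

Local Open Scope classical_set_scope.
Local Open Scope ring_scope.

Section HorizontalCurves.
Context {R : realType}.

Local Notation mu := (@lebesgue_measure R).

(** Points of R^2, R^4 and R^5 are row vectors; indices 0, 1, 2, 3, 4 carry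
    the coordinates x, y, z, v, w. *)
Definition xc {n} (p : 'rV[R]_n.+2) : R := p 0 0.
Definition yc {n} (p : 'rV[R]_n.+2) : R := p 0 1.

(** The velocity at the point [q] for the controls [u1], [u2]. *)
Definition cartan_velocity (q : 'rV[R]_5) (u1 u2 : R) : 'rV[R]_5 :=
  \row_(i < 5) [:: u1; u2; (- u1 * yc q + u2 * xc q) / 2;
                   u2 * ((xc q ^+ 2 + yc q ^+ 2) / 2);
                   - u1 * ((xc q ^+ 2 + yc q ^+ 2) / 2)]`_i.

Definition engel_velocity (q : 'rV[R]_4) (u1 u2 : R) : 'rV[R]_4 :=
  \row_(i < 4) [:: u1; u2; (- u1 * yc q + u2 * xc q) / 2;
                   u2 * ((xc q ^+ 2 + yc q ^+ 2) / 2)]`_i.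

Definition bounded_control (T : R) (u : R -> R) : Prop :=
  measurable_fun `[0, T] u /\
  exists M : R, forall t, 0 <= t <= T -> `|u t| <= M.

(** Lipschitz solutions on [0, T] of q' = f q u1 u2, in the sense of
    Caratheodory, i.e. in integrated form. For the two systems above the
    integrands depend on [q] only through x and y, which are continuous by the
    first two equations, so all the integrals are those of bounded measurable
    functions. *)
Definition horizontal n (f : 'rV[R]_n -> R -> R -> 'rV[R]_n)
    (T : R) (q : R -> 'rV[R]_n) (u1 u2 : R -> R) : Prop :=
  [/\ bounded_control T u1, bounded_control T u2 &
      forall (t : R) (i : 'I_n), 0 <= t <= T ->
        q t 0 i = q 0 0 i
          + Rintegral mu `[0, t] (fun s => f (q s) (u1 s) (u2 s) 0 i)].

Definition curve_length (T : R) (u1 u2 : R -> R) : R :=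
  Rintegral mu `[0, T] (fun t => Num.sqrt (u1 t ^+ 2 + u2 t ^+ 2)).

Definition length_minimizing n (f : 'rV[R]_n -> R -> R -> 'rV[R]_n)
    (T : R) (q : R -> 'rV[R]_n) (u1 u2 : R -> R) : Prop :=
  horizontal f T q u1 u2 /\
  forall (S : R) (p : R -> 'rV[R]_n) (w1 w2 : R -> R),
    0 <= S -> horizontal f S p w1 w2 -> p 0 = q 0 -> p S = q T ->
    curve_length T u1 u2 <= curve_length S w1 w2.

Definition horizontal_lift n (f : 'rV[R]_n.+2 -> R -> R -> 'rV[R]_n.+2)
    (T : R) (gamma : R -> 'rV[R]_2) (q : R -> 'rV[R]_n.+2)
    (u1 u2 : R -> R) : Prop :=
  [/\ horizontal f T q u1 u2, q 0 = 0 &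
      forall t, 0 <= t <= T ->
        xc (q t) = xc (gamma t) /\ yc (q t) = yc (gamma t)].

Definition cut_time n (f : 'rV[R]_n.+2 -> R -> R -> 'rV[R]_n.+2)
    (gamma : R -> 'rV[R]_2) : \bar R :=
  ereal_sup [set T%:E | T in [set T : R | 0 < T /\
    exists (q : R -> 'rV[R]_n.+2) (u1 u2 : R -> R),
      horizontal_lift f T gamma q u1 u2 /\ length_minimizing f T q u1 u2]].

Definition cartan_cut_time := cut_time cartan_velocity.
Definition engel_cut_time := cut_time engel_velocity.

End HorizontalCurves.

Section Elasticae.
Context {R : realType}.

(** [g] is the derivative of [f] on the half-line [0, +oo), one-sided at 0;
    the values at negative times are irrelevant. *)
Definition derivative_on_halfline (f g : R -> R) : Prop :=
  forall t : R, 0 <= t ->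
    (f s - f t) / (s - t) @[s --> within [set s | 0 <= s] t^'] --> g t.

Definition elastica_eq (alpha beta : R) (gamma : R -> 'rV[R]_2) : Prop :=
  gamma 0 = 0 /\
  exists theta c : R -> R,
    [/\ derivative_on_halfline (xc \o gamma) (cos \o theta),
        derivative_on_halfline (yc \o gamma) (sin \o theta),
        derivative_on_halfline theta c &
        derivative_on_halfline c (fun t => - alpha * sin (theta t - beta))].

Definition elastica (gamma : R -> 'rV[R]_2) : Prop :=
  exists alpha beta : R, 0 <= alpha /\ elastica_eq alpha beta gamma.

(** The elasticae in the position in which they lift to extremal trajectories
    of the Engel group; the curvature then satisfies c' = a cos theta with
    a = alpha sin beta. *)
Definition engel_elastica (gamma : R -> 'rV[R]_2) : Prop :=
  exists alpha beta : R,
    [/\ 0 <= alpha, alpha * cos beta = 0 & elastica_eq alpha beta gamma].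

End Elasticae.

(* Main.v *)
(* The end point of a lift is determined by planar data: the increments of x
   and y and the moments of x dy, x^2 dy for the Engel group, together with the
   moment of y^2 dx for the Cartan group. Unless th' is constant, an elastica
   in Engel position satisfies, up to a translation and reflections,
   x' = cos th, th' = 2 C x, y' = sin th = A + C x^2 with C > 0.

   Lower bounds for the Engel cut time come from calibrations: if G is a
   quadratic polynomial with |G(x)| <= 1 along a competitor and Psi is an
   antiderivative of sqrt(1 - G^2), its length is at least the integral of
   G(x) dy plus the variation of Psi(x); G is the polynomial of an elastica
   dilated according to the range of abscissas of the competitor. This shows
   that lines and critical elasticae are always minimal, that the
   non-inflectional ones and the circles are minimal for a full turn, and the
   inflectional ones for half of the period, for the full period if the
   ordinate does not decrease over a period, and for more than half of it if
   the ordinate decreases only a little.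

   Upper bounds for the Cartan cut time come from Maxwell points: reversing an
   arc in time and turning it about the middle of its chord, or reflecting it
   in the bisector of the chord, gives a curve with the same data as soon as
   one scalar quantity, the defect, vanishes, and the new curve violates the
   Euler-Lagrange equation. The defect is explicit and changes sign within 3/2
   of the Engel bound, except for the inflectional elasticae whose ordinate
   decreases; there the two bounds differ by a factor 2, and one of them is
   improved by a definite proportion: the Engel bound if the decrease is small,
   the Cartan bound otherwise. Two loops of a circle are replaced by two shorter
   loops of different radii. *)

Require Import Defs.
From HB Require Import structures.
From mathcomp Require Import all_boot all_order all_algebra.
From mathcomp Require Import all_classical all_reals all_analysis.
From mathcomp Require Import measurable_realfun ring lra.

Set Implicit Arguments.
Unset Strict Implicit.
Unset Printing Implicit Defensive.

Import Order.TTheory GRing.Theory Num.Theory.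
Import numFieldNormedType.Exports.

Local Open Scope classical_set_scope.
Local Open Scope ring_scope.

(** * Derivatives, integrals and absolutely continuous curves *)

Section Derivatives.
Context {R : realType}.
Implicit Types (f g h : R -> R) (a b c t x l : R).

(** No cut time is computed, and elliptic functions enter only through the differential equation of
    an amplitude. The Engel bound needs a single minimal time, the Cartan bound an estimate of all
    minimal times. The first integral [sin th = A + C * X ^+ 2] is what ties both sides together: it
    makes the ordinate velocity a quadratic polynomial of the abscissa, so that the integral of such
    a polynomial against dy is a function of the Engel end point, and it gives closed primitives for
    every moment and every defect.

    A competitor may have any range of abscissas; this costs nothing, because the lower bound, as a
    function of the dilation factor, is smallest at factor 1. The obstacle is the centre [m] of the
    range. Over a full period of an inflectional elastica it contributes [C * m ^+ 2 / r ^+ 2] times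
    the total rise, which has the wrong sign when the ordinate falls; only half a period is then
    free, while the central symmetry yields a Maxwell point before a full period. The gain proved
    for the Cartan bound is proportional to the fall and disappears with it, so a small fall must be
    treated on the Engel side. Hence the threshold [b / 384] and a constant so close to 2. *)

Definition der f x l := is_derive (x : R^o) (1 : R^o) (f : R^o -> R^o) (l : R^o).

Lemma der_eq f x l l' : der f x l -> l = l' -> der f x l'.
Proof. by move=> ? <-. Qed.

Lemma derC c x : der (fun=> c) x 0.
Proof. exact: is_derive_cst. Qed.

Lemma der_id x : der (fun t => t) x 1.
Proof. exact: is_derive_id. Qed.

Lemma derD f g x l l' : der f x l -> der g x l' ->
  der (fun t => f t + g t) x (l + l').
Proof. by move=> df dg; exact: is_deriveD. Qed.

Lemma derN f x l : der f x l -> der (fun t => - f t) x (- l).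
Proof. by move=> df; exact: is_deriveN. Qed.

Lemma derB f g x l l' : der f x l -> der g x l' ->
  der (fun t => f t - g t) x (l - l').
Proof. by move=> df dg; exact: is_deriveB. Qed.

Lemma derM f g x l l' : der f x l -> der g x l' ->
  der (fun t => f t * g t) x (f x * l' + g x * l).
Proof. by move=> df dg; exact: is_deriveM. Qed.

Lemma der_comp f g x l l' : der f (g x) l -> der g x l' ->
  der (fun t => f (g t)) x (l * l').
Proof. by move=> df dg; exact: is_derive1_comp. Qed.

Lemma derX f n x l : der f x l ->
  der (fun t => f t ^+ n) x (n%:R * f x ^+ n.-1 * l).
Proof.
move=> df; suff -> : (fun t => f t ^+ n) = f ^+ n by exact: is_deriveX.
by apply/funext => t; rewrite exprfctE.
Qed.

Lemma derV f x l : f x != 0 -> der f x l ->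
  der (fun t => (f t)^-1) x (- (f x) ^- 2 * l).
Proof. by move=> f0 df; exact: is_deriveV. Qed.

Lemma der_sin f x l : der f x l -> der (fun t => sin (f t)) x (cos (f x) * l).
Proof. by move=> df; apply: (@der_comp sin) df; exact: is_derive_sin. Qed.

Lemma der_cos f x l : der f x l -> der (fun t => cos (f t)) x (- sin (f x) * l).
Proof. by move=> df; apply: (@der_comp cos) df; exact: is_derive_cos. Qed.

Lemma der_expR f x l : der f x l ->
  der (fun t => expR (f t)) x (expR (f x) * l).
Proof. by move=> df; apply: (@der_comp expR) df; exact: is_derive_expR. Qed.

Lemma der_sqrt f x l : 0 < f x -> der f x l ->
  der (fun t => Num.sqrt (f t)) x ((2 * Num.sqrt (f x))^-1 * l).
Proof.
move=> f0 df; apply: (@der_comp (@Num.sqrt R)) df.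
exact: is_derive1_sqrt.
Qed.

Lemma der_cont f x l : der f x l -> {for x, continuous f}.
Proof.
by move=> df; apply/differentiable_continuous/derivable1_diffP; case: df.
Qed.

Lemma within_cont f a b : (forall t, a <= t <= b -> {for t, continuous f}) ->
  {within `[a, b], continuous f}.
Proof.
move=> cf; apply: continuous_in_subspaceT => t.
by rewrite inE/= in_itv/=; exact: cf.
Qed.

Lemma der_within f (df : R -> R) a b :
  (forall t, a <= t <= b -> der f t (df t)) -> {within `[a, b], continuous f}.
Proof. by move=> d; apply: within_cont => t /d; exact: der_cont. Qed.

Lemma der_continuous f (df : R -> R) : (forall x : R, der f x (df x)) ->
  continuous f.
Proof. by move=> d x; exact: der_cont (d x). Qed.

Lemma der_mvt f (df : R -> R) a b : a <= b ->
  (forall t, a < t < b -> der f t (df t)) -> {within `[a, b], continuous f} ->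
  exists2 c, a <= c <= b & f b - f a = df c * (b - a).
Proof.
move=> ab d cf; have d' t : t \in `]a, b[ -> is_derive t 1 f (df t).
  by rewrite in_itv/=; exact: d.
have [c] := MVT_segment ab d' cf.
by rewrite in_itv/= => ? ?; exists c.
Qed.

Lemma der_mvt_open f (df : R -> R) a b : a < b ->
  (forall t, a < t < b -> der f t (df t)) -> {within `[a, b], continuous f} ->
  exists2 c, a < c < b & f b - f a = df c * (b - a).
Proof.
move=> ab d cf; have d' t : t \in `]a, b[ -> is_derive t 1 f (df t).
  by rewrite in_itv/=; exact: d.
have [c] := MVT ab d' cf.
by rewrite in_itv/= => ? ?; exists c.
Qed.

Lemma der_le f (df : R -> R) a b : a <= b ->
  (forall t, a <= t <= b -> der f t (df t)) ->
  (forall t, a < t < b -> 0 <= df t) -> f a <= f b.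
Proof.
rewrite le_eqVlt => /predU1P[->//|ab] d d0.
have [|c cab] := @der_mvt_open f df a b ab _ (der_within d).
  by move=> t /andP[? ?]; apply: d; rewrite !ltW.
move=> E; rewrite -subr_ge0 E mulr_ge0 ?d0// subr_ge0; exact: ltW.
Qed.

Lemma der_lt f (df : R -> R) a b : a < b ->
  (forall t, a <= t <= b -> der f t (df t)) ->
  (forall t, a < t < b -> 0 < df t) -> f a < f b.
Proof.
move=> ab d d0.
have [|c cab] := @der_mvt_open f df a b ab _ (der_within d).
  by move=> t /andP[? ?]; apply: d; rewrite !ltW.
by move=> E; rewrite -subr_gt0 E mulr_gt0 ?d0// subr_gt0.
Qed.

Lemma der_const f a b : a <= b ->
  (forall t, a <= t <= b -> der f t 0) -> f b = f a.
Proof.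
move=> ab d; apply/eqP; rewrite eq_le; apply/andP; split.
  rewrite -lerN2; apply: (@der_le (fun t => - f t) (fun=> 0)) => // t /d dt.
  by apply: der_eq (derN dt) _; rewrite oppr0.
exact: (@der_le f (fun=> 0)).
Qed.

Lemma der_eq_incr f g (df : R -> R) a b : a <= b ->
  (forall t, a <= t <= b -> der f t (df t)) ->
  (forall t, a <= t <= b -> der g t (df t)) -> f b - f a = g b - g a.
Proof.
move=> ab d d'; have := @der_const (fun t => f t - g t) a b ab _.
move=> /(_ (fun t H => der_eq (derB (d t H) (d' t H)) (subrr _))) E.
by lra.
Qed.

Lemma der_le_incr f g (df dg : R -> R) a b : a <= b ->
  (forall t, a <= t <= b -> der f t (df t)) ->
  (forall t, a <= t <= b -> der g t (dg t)) ->
  (forall t, a < t < b -> df t <= dg t) -> f b - f a <= g b - g a.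
Proof.
move=> ab d d' le.
have := @der_le (fun t => g t - f t) (fun t => dg t - df t) a b ab _ _.
move=> /(_ (fun t H => derB (d' t H) (d t H))).
by move=> /(_ (fun t H => ltac:(by rewrite subr_ge0 le))) E; lra.
Qed.

Lemma ivt f a b : a <= b -> {within `[a, b], continuous f} ->
  f a * f b <= 0 -> exists2 c, a <= c <= b & f c = 0.
Proof.
move=> ab cf s; have [|c] := IVT ab cf (v := 0); last first.
  by rewrite in_itv/= => ? ?; exists c.
rewrite ge_min le_max; have [fa|fa] := leP (f a) 0 => /=.
  have [fb|fb] := leP 0 (f b); first by rewrite orbT.
  by rewrite orbF; nra.
by rewrite (ltW fa) orTb andbT; nra.
Qed.

Lemma ivt_value f a b v : a <= b -> {within `[a, b], continuous f} ->
  f a <= v <= f b -> exists2 c, a <= c <= b & f c = v.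
Proof.
move=> ab cf /andP[av vb]; have [|c] := IVT ab cf (v := v) _.
  by rewrite ge_min le_max av vb /= orbT.
by rewrite in_itv/= => ? ?; exists c.
Qed.

End Derivatives.

(* Differentiates a closed expression, leaving the equation between the
   computed and the expected derivative and the side conditions. *)
Ltac der_rec :=
  first [match goal with H : der ?h ?x _ |- der ?h ?x _ => exact H end |
  lazymatch goal with
  | |- der (fun _ => ?c) _ _ => exact: derC
  | |- der (fun t => t) _ _ => exact: der_id
  | |- der (fun t => @?f t + - @?g t) _ _ => apply: derB; der_rec
  | |- der (fun t => @?f t + @?g t) _ _ => apply: derD; der_rec
  | |- der (fun t => - @?f t) _ _ => apply: derN; der_rec
  | |- der (fun t => @?f t * @?g t) _ _ => apply: derM; der_rec
  | |- der (fun t => @?f t ^+ _) _ _ => apply: derX; der_rec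
  | |- der (fun t => (@?f t)^-1) _ _ => apply: derV; [|der_rec]
  | |- der (fun t => sin (@?f t)) _ _ => apply: der_sin; der_rec
  | |- der (fun t => cos (@?f t)) _ _ => apply: der_cos; der_rec
  | |- der (fun t => expR (@?f t)) _ _ => apply: der_expR; der_rec
  | |- der (fun t => Num.sqrt (@?f t)) _ _ => apply: der_sqrt; [|der_rec]
  | |- der (fun t => ?h t) ?x ?l => change (der h x l); der_atom
  | |- der (fun t => ?h (@?g t)) _ _ =>
      apply: (@der_comp _ h g); [der_atom|der_rec]
  | |- der (@cos ?K) ?x ?l => change (der (fun t => cos t) x l);
      apply: der_cos; exact: der_id
  | |- der (@sin ?K) ?x ?l => change (der (fun t => sin t) x l);
      apply: der_sin; exact: der_id
  | |- der (GRing.mul ?b) ?x ?l => change (der (fun t => b * t) x l);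
      apply: derM; der_rec
  | |- der (GRing.add ?b) ?x ?l => change (der (fun t => b + t) x l);
      apply: derD; der_rec
  | |- der ?h _ _ => der_atom
  end]
with der_atom :=
  lazymatch goal with
  | |- der ?h ?x _ => match goal with
     | H : forall _, is_true _ -> der h _ _ |- _ => eapply H; cbv beta
     | H : forall _, der h _ _ |- _ => eapply H
     | H : der h x _ |- _ => exact H
     end
  end.
Ltac nz_atom := first [done | by rewrite gt_eqF | by rewrite lt_eqF |
  apply: mulf_neq0; nz_atom | rewrite oppr_eq0; nz_atom | idtac].
Ltac nz := repeat (apply/andP; split); nz_atom.
Ltac der_solve := eapply der_eq; [der_rec; try assumption|cbv beta].

Ltac ge0 := first [done | assumption | exact: sqr_ge0 | (apply: ltW; assumption) |
  apply: addr_ge0; ge0 | apply: mulr_ge0; ge0 | rewrite invr_ge0; ge0 | apply: exprn_ge0; ge0].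
Ltac order_facts := repeat match goal with
  | H := _ |- _ => clearbody H
  end; repeat match goal with
  | H : ?T |- _ => lazymatch T with
     | is_true (_ <= _) => fail
     | is_true (_ < _) => fail
     | _ = _ => fail
     | _ => clear H
     end
  end.
Ltac qlra := order_facts; lra.

Section Integrals.
Context {R : realType}.
Local Notation mu := (@lebesgue_measure R).
Implicit Types (f g w : R -> R) (a b c t : R).

Definition itg a b f : R := Rintegral mu `[a, b] f.

Definition bm a b f := measurable_fun `[a, b] f /\
  exists M : R, forall t, a <= t <= b -> `|f t| <= M.

Lemma bm_sub a b c d f : a <= c -> d <= b -> bm a b f -> bm c d f.
Proof.
move=> ac db [mf [M HM]]; split.
  apply: measurable_funS mf => // t /=; rewrite !in_itv/= => /andP[ct td].
  by rewrite (le_trans ac ct) (le_trans td db).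
by exists M => t /andP[ct td]; apply: HM; rewrite (le_trans ac ct) (le_trans td db).
Qed.

Lemma bm_ext a b f g : (forall t, a <= t <= b -> f t = g t) ->
  bm a b f -> bm a b g.
Proof.
move=> fg [mf [M HM]]; split.
  by apply: eq_measurable_fun mf => t; rewrite inE/= in_itv/=; exact: fg.
by exists M => t tab; rewrite -fg//; exact: HM.
Qed.

Lemma bm_cst a b c : bm a b (fun=> c).
Proof. by split=> //; exists `|c|. Qed.

Lemma bmD a b f g : bm a b f -> bm a b g -> bm a b (fun t => f t + g t).
Proof.
move=> [mf [M HM]] [mg [N HN]]; split; first exact: measurable_funD.
by exists (M + N) => t tab; rewrite (le_trans (ler_normD _ _))// lerD ?HM ?HN.
Qed.

Lemma bmM a b f g : bm a b f -> bm a b g -> bm a b (fun t => f t * g t).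
Proof.
move=> [mf [M HM]] [mg [N HN]]; split; first exact: measurable_funM.
by exists (M * N) => t tab; rewrite normrM ler_pM ?HM ?HN.
Qed.

Lemma bmN a b f : bm a b f -> bm a b (fun t => - f t).
Proof.
move=> bf; apply: bm_ext (bmM (bm_cst a b (-1)) bf) => t _; exact: mulN1r.
Qed.

Lemma bmB a b f g : bm a b f -> bm a b g -> bm a b (fun t => f t - g t).
Proof. by move=> bf bg; exact: bmD bf (bmN bg). Qed.

Lemma bmX a b f n : bm a b f -> bm a b (fun t => f t ^+ n).
Proof.
move=> bf; elim: n => [|n IH]; first exact: bm_cst.
by apply: bm_ext (bmM bf IH) => t _; rewrite exprS.
Qed.

Lemma bm_cont_comp a b f g : continuous g -> bm a b f -> bm a b (fun t => g (f t)).
Proof.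
move=> cg [mf [M HM]]; split.
  by apply: measurableT_comp mf; exact: continuous_measurable_fun.
have cg' : {within `[- `|M|, `|M|], continuous (fun x => `|g x|)}.
  by apply: continuous_subspaceT => x; apply: continuous_comp (cg x) (@norm_continuous _ _ _).
have [|c _ Hc] := EVT_max _ cg'; first by rewrite ge0_cp.
exists `|g c| => t tab; apply: Hc; rewrite in_itv/= -ler_norml.
by rewrite (le_trans (HM _ tab))// ler_norm.
Qed.

Lemma bm_cont a b f : (forall t, a <= t <= b -> {for t, continuous f}) ->
  bm a b f.
Proof.
move=> cf; have wf := within_cont cf; split.
  exact: subspace_continuous_measurable_fun.
have [ab|ba] := leP a b; last first.
  by exists 0 => t /andP[? ?]; lra.
have wf' : {within `[a, b], continuous (fun x => `|f x|)}.
  by apply: within_cont => t /cf ct; apply: continuous_comp ct (@norm_continuous _ _ _).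
have [c _ Hc] := EVT_max ab wf'.
by exists `|f c| => t tab; apply: Hc; rewrite in_itv.
Qed.

Lemma bm_sqrt a b f : bm a b f -> bm a b (fun t => Num.sqrt (f t)).
Proof. by apply: bm_cont_comp; exact: sqrt_continuous. Qed.

Lemma bm_integrable a b f : bm a b f -> mu.-integrable `[a, b] (EFin \o f).
Proof.
move=> [mf [M HM]]; apply: measurable_bounded_integrable => //.
  by rewrite /= lebesgue_measure_itv/=; case: ifP => //; rewrite ltry.
exists M; split; first by rewrite num_real.
move=> N MN t /=; rewrite in_itv/= => /HM /le_trans; apply; exact: ltW.
Qed.

Lemma itg_ext a b f g : (forall t, a <= t <= b -> f t = g t) ->
  itg a b f = itg a b g.
Proof.
by move=> fg; apply: eq_Rintegral => t; rewrite inE/= in_itv/=; exact: fg.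
Qed.

Lemma itgD a b f g : bm a b f -> bm a b g ->
  itg a b (fun t => f t + g t) = itg a b f + itg a b g.
Proof. by move=> /bm_integrable ? /bm_integrable ?; exact: RintegralD. Qed.

Lemma itgB a b f g : bm a b f -> bm a b g ->
  itg a b (fun t => f t - g t) = itg a b f - itg a b g.
Proof. by move=> /bm_integrable ? /bm_integrable ?; exact: RintegralB. Qed.

Lemma itgZ a b f c : bm a b f ->
  itg a b (fun t => c * f t) = c * itg a b f.
Proof. by move=> /bm_integrable ?; exact: RintegralZl. Qed.

Lemma itg_cst a b c : a <= b -> itg a b (fun=> c) = c * (b - a).
Proof.
move=> ab; rewrite /itg Rintegral_cst//= lebesgue_measure_itv/= lte_fin.
case: ltP => //= ba; rewrite (_ : b = a) ?subrr//.
by apply/eqP; rewrite eq_le ab ba.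
Qed.

Lemma itg_le a b f g : bm a b f -> bm a b g ->
  (forall t, a <= t <= b -> f t <= g t) -> itg a b f <= itg a b g.
Proof.
move=> /bm_integrable ? /bm_integrable ? fg; apply: le_Rintegral => // t /=; rewrite in_itv/=; exact: fg.
Qed.

Lemma itg_ge0 a b f : (forall t, a <= t <= b -> 0 <= f t) -> 0 <= itg a b f.
Proof. by move=> f0; apply: Rintegral_ge0 => t /=; rewrite in_itv/=; exact: f0. Qed.

Lemma itg_chasles a b c f : a <= b -> b <= c -> bm a c f ->
  itg a c f = itg a b f + itg b c f.
Proof.
move=> ab bc bf; have := Rintegral_itvB (x := b) (bm_integrable bf).
rewrite !bnd_simp => /(_ ab bc) E.
rewrite /itg -(Rintegral_itv_obnd_cbnd (r := b)).
  by rewrite -E; lra.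
apply: integrableS (bm_integrable bf) => //.
by apply: subset_itv; rewrite bnd_simp.
Qed.

Lemma itg_same a f : itg a a f = 0.
Proof. by rewrite /itg set_itv1 Rintegral_set1. Qed.

Lemma itg_bound a b f M : a <= b -> bm a b f ->
  (forall t, a <= t <= b -> `|f t| <= M) -> `|itg a b f| <= M * (b - a).
Proof.
move=> ab bf HM; rewrite ler_norml; apply/andP; split.
  rewrite -mulNr -(itg_cst _ ab); apply: itg_le => //; first exact: bm_cst.
  by move=> t /HM; rewrite ler_norml => /andP[].
rewrite -(itg_cst _ ab); apply: itg_le => //; first exact: bm_cst.
by move=> t /HM; rewrite ler_norml => /andP[].
Qed.

Lemma itg_ext_open a b f g : bm a b f -> bm a b g ->
  (forall t, a < t < b -> f t = g t) -> itg a b f = itg a b g.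
Proof.
move=> bf bg fg.
have sub h : bm a b h -> itg a b h = Rintegral mu `]a, b[ h.
  move=> bh; rewrite /itg -Rintegral_itv_bndo_bndc; last first.
    apply: integrableS (bm_integrable bh) => //.
    by apply: subset_itv; rewrite bnd_simp.
  rewrite Rintegral_itv_obnd_cbnd//.
  apply: integrableS (bm_integrable bh) => //.
  by apply: subset_itv; rewrite bnd_simp.
rewrite !sub//; apply: eq_Rintegral => t; rewrite inE/= in_itv/=; exact: fg.
Qed.

Lemma itg_FTC a b (F f : R -> R) : a <= b ->
  (forall t, a <= t <= b -> der F t (f t)) ->
  (forall t, a <= t <= b -> {for t, continuous f}) ->
  itg a b f = F b - F a.
Proof.
rewrite le_eqVlt => /predU1P[->|ab] dF cf; first by rewrite itg_same subrr.
have dF' : derivable_oo_LRcontinuous F a b.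
  split.
  - move=> t; rewrite in_itv/= => /andP[at_ tb].
    by case: (dF t); rewrite ?(ltW at_) ?(ltW tb).
  - by apply: cvg_at_right_filter; apply: der_cont (dF a _); rewrite lexx ltW.
  - by apply: cvg_at_left_filter; apply: der_cont (dF b _); rewrite lexx ltW.
rewrite /itg /Rintegral (continuous_FTC2 ab (within_cont cf) dF') -?EFinB//.
move=> t; rewrite in_itv/= => /andP[at_ tb].
by rewrite derive1E; case: (dF t) => [|_ ->//]; rewrite (ltW at_) ltW.
Qed.

(** The integral over a reversed interval is 0 here, so [itg 0 t f] is not a primitive for negative
    [t]. The two halves are pasted at 0; compared with the integral from a base point [a] below both
    -1 and [t], the pasted function differs by a constant. *)
Lemma primitive f : continuous f -> exists F : R -> R, forall t, der F t (f t).
Proof.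
move=> cf.
pose G a t := itg a t f.
have bf a b : bm a b f by apply: bm_cont => t _; exact: cf.
have dG a t : a < t -> der (G a) t (f t).
  move=> at_.
  have [|d E] := continuous_FTC1_closed (a := a) (x := t) (u := t + 1) _
     (bm_integrable (bf _ _)) at_ (cf t); first by rewrite ltrDl.
  have E' : 'D_1 (G a) t = f t by rewrite -derive1E.
  exact: DeriveDef d E'.
exists (fun t => if 0 <= t then itg (-1) t f else itg (-1) 0 f - itg t 0 f).
move=> t.
have H a : a <= -1 -> forall s, a < s ->
  (if 0 <= s then itg (-1) s f else itg (-1) 0 f - itg s 0 f) =
   itg a s f - itg a (-1) f.
  move=> a1 s as_; case: ifP => s0.
    by rewrite (@itg_chasles a (-1) s)//; [lra|move: s0; lra].
  have s0' : s <= 0 by rewrite leNgt; apply/negP => ?; move/negP: s0; apply; exact: ltW.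
  have := @itg_chasles a (-1) 0 f a1 ltac:(lra) (bf _ _).
  have := @itg_chasles a s 0 f (ltW as_) s0' (bf _ _).
  by lra.
pose a := Num.min (-1) (t - 1).
have a1 : a <= -1 by rewrite /a ge_min lexx.
have at_ : a < t by rewrite /a gt_min; apply/orP; right; lra.
have dd : der (fun s => itg a s f - itg a (-1) f) t (f t).
  by apply: der_eq (derB (dG a t at_) (derC _ _)) _; rewrite subr0.
move: dd; apply: near_eq_is_derive => //.
have : \forall s \near t, a < s by exact: lt_nbhsr.
by apply: filterS => s as_; rewrite -H.
Qed.

End Integrals.

Section Primitives.
Context {R : realType}.
Implicit Types (f g w x y : R -> R) (a b c t : R).

(** Lipschitz functions given with a bounded density. This is the form in which [horizontal]
    provides the coordinates x and y, whose controls are merely measurable. *)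
Definition prim a b (G g : R -> R) :=
  bm a b g /\ forall t, a <= t <= b -> G t = G a + itg a t g.

Lemma prim_diff a b (G g : R -> R) s t : prim a b G g -> a <= s -> s <= t ->
  t <= b -> G t - G s = itg s t g.
Proof.
move=> [bg HG] as_ st tb.
rewrite (HG s) ?as_ ?(le_trans st tb)// (HG t) ?tb ?(le_trans as_ st)//.
rewrite (@itg_chasles _ a s t)//; first by ring.
exact: bm_sub bg.
Qed.

Lemma prim_sub a b c d (G g : R -> R) : a <= c -> d <= b -> prim a b G g ->
  prim c d G g.
Proof.
move=> ac db P; split; first by apply: bm_sub P.1.
move=> t /andP[ct td]; rewrite -(prim_diff P ac ct) ?(le_trans td)//; ring.
Qed.

Lemma prim_ext a b (G G' g g' : R -> R) :
  (forall t, a <= t <= b -> G t = G' t) ->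
  bm a b g' -> (forall t, a < t < b -> g t = g' t) -> prim a b G g ->
  prim a b G' g'.
Proof.
move=> GG' bg' gg' [bg HG]; split => // t tab; have /andP[at_ tb] := tab.
have ab := le_trans at_ tb.
rewrite -!GG' ?lexx//; rewrite HG//; congr (_ + _).
apply: itg_ext_open; [exact: bm_sub bg|exact: bm_sub bg'|].
by move=> s /andP[as_ st]; apply: gg'; rewrite as_/= (lt_le_trans st).
Qed.

Lemma prim_der a b (G g : R -> R) :
  (forall t, a <= t <= b -> der G t (g t)) ->
  (forall t, a <= t <= b -> {for t, continuous g}) -> prim a b G g.
Proof.
move=> dG cg; split; first exact: bm_cont.
move=> t /andP[at_ tb]; rewrite (@itg_FTC _ a t G g at_); first by ring.
  by move=> s /andP[as_ st]; apply: dG; rewrite as_ (le_trans st).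
by move=> s /andP[as_ st]; apply: cg; rewrite as_ (le_trans st).
Qed.

Lemma prim_lip a b (G g : R -> R) : prim a b G g -> exists2 M : R, 0 <= M &
  forall s t, a <= s <= b -> a <= t <= b -> `|G t - G s| <= M * `|t - s|.
Proof.
move=> P; have [[mg [M HM]] _] := P; exists `|M| => //.
have H s t : a <= s -> s <= t -> t <= b -> `|G t - G s| <= `|M| * `|t - s|.
  move=> as_ st tb; rewrite (prim_diff P)// [X in _ * X]ger0_norm ?subr_ge0//.
  apply: itg_bound => //; first exact: bm_sub P.1.
  move=> u /andP[su ut]; apply: le_trans (HM _ _) (ler_norm _).
  by rewrite (le_trans as_ su) (le_trans ut tb).
move=> s t /andP[as_ sb] /andP[at_ tb]; have [st|ts] := leP s t; first exact: H.
by rewrite -(distrC (G s)) -(distrC s); apply: H => //; exact: ltW.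
Qed.

Lemma lip_within_cont a b (M : R) (G : R -> R) :
  (forall s t, a <= s <= b -> a <= t <= b -> `|G t - G s| <= M * `|t - s|) ->
  {within `[a, b], continuous G}.
Proof.
move=> HG; apply/subspace_continuousP => t; rewrite /= in_itv/= => tab.
apply/cvgrPdist_le => e e0; apply/nbhs_ballP.
have M1 : 0 < `|M| + 1 by rewrite ltr_wpDl.
exists (e / (`|M| + 1)) => [|s]; first by rewrite /= divr_gt0.
rewrite /ball/= => ts; rewrite in_itv/= => sab.
rewrite (le_trans (HG _ _ sab tab))// (@le_trans _ _ ((`|M| + 1) * `|t - s|))//.
  by rewrite ler_wpM2r// (le_trans (ler_norm _))// lerDl.
by rewrite mulrC -ler_pdivlMr// ltW.
Qed.

Lemma prim_within_cont a b (G g : R -> R) : prim a b G g ->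
  {within `[a, b], continuous G}.
Proof. by move=> /prim_lip[M _ H]; exact: lip_within_cont H. Qed.

Lemma bm_within_cont a b f : {within `[a, b], continuous f} -> bm a b f.
Proof.
move=> wf; split; first exact: subspace_continuous_measurable_fun.
have [ab|ba] := leP a b; last first.
  by exists 0 => t /andP[? ?]; lra.
have wf' : {within `[a, b], continuous (fun x : R => `|f x| : R)}.
  move=> t; apply: (@continuous_comp _ _ _ (f : subspace `[a, b] -> R) (@Num.norm _ R)).
    exact: wf.
  exact: norm_continuous.
have [c _ Hc] := EVT_max ab wf'.
by exists `|f c| => t tab; apply: Hc; rewrite in_itv.
Qed.

Lemma prim_bm a b (G g : R -> R) : prim a b G g -> bm a b G.
Proof. by move=> /prim_within_cont; exact: bm_within_cont. Qed.

(** Clamping the argument to [a, b] is a contraction, so the clamped function has derivative 0 on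
    the whole line, including at the end points. *)
Lemma flat_const a b (phi : R -> R) : a <= b ->
  (forall e t, 0 < e -> a <= t <= b -> exists2 d, 0 < d &
     forall s, a <= s <= b -> `|s - t| < d -> `|phi s - phi t| <= e * `|s - t|) ->
  phi b = phi a.
Proof.
move=> ab H.
pose cl t := Num.max a (Num.min b t).
have clab t : a <= cl t <= b.
  by rewrite /cl le_max lexx/= ge_max ab/= ge_min lexx.
have cll s t : `|cl s - cl t| <= `|s - t|.
  have mx (u v : R) : `|Num.max a u - Num.max a v| <= `|u - v|.
    have := ler_norm (u - v); have := ler_norm (- (u - v)); rewrite normrN.
    move: `|u - v| => w h1 h2; rewrite ler_norml.
    by have [?|?] := leP a u; have [?|?] := leP a v; apply/andP; split; lra.
  have mn (u v : R) : `|Num.min b u - Num.min b v| <= `|u - v|.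
    have := ler_norm (u - v); have := ler_norm (- (u - v)); rewrite normrN.
    move: `|u - v| => w h1 h2; rewrite ler_norml.
    by have [?|?] := leP b u; have [?|?] := leP b v; apply/andP; split; lra.
  exact: le_trans (mx _ _) (mn _ _).
have cla t : a <= t <= b -> cl t = t.
  by move=> /andP[? ?]; rewrite /cl min_r// max_r.
have d t : is_derive t 1 (fun t => phi (cl t)) 0.
  have L : h^-1 *: (phi (cl (h *: 1 + t)) - phi (cl t)) @[h --> 0^'] --> (0:R).
    apply/cvgrPdist_le => e e0.
    have [d d0 Hd] := H e (cl t) e0 (clab t).
    near=> h.
    have h0 : h != 0 by near: h; exact: nbhs_dnbhs_neq.
    have hd : `|h| < d.
      near: h; apply: dnbhs0_lt => //.
    rewrite sub0r normrN normrZ normrV ?unitfE// ler_pdivrMl ?normr_gt0//.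
    have hh : `|cl (h *: 1 + t) - cl t| <= `|h|.
      by apply: le_trans (cll _ _) _; rewrite /GRing.scale/= mulr1 addrK.
    rewrite (le_trans (Hd _ (clab _) _))//; first exact: le_lt_trans hd.
    by rewrite mulrC ler_wpM2r// ltW.
  by apply: DeriveDef; [apply/cvg_ex; exists 0|exact: cvg_lim].
have := is_derive_0_is_cst b a d.
by rewrite !cla ?lexx ?ab.
Unshelve. all: by end_near. Qed.

Lemma between_close (p q z t d : R) : `|p - t| < d -> `|q - t| < d ->
  Num.min p q <= z <= Num.max p q -> `|t - z| < d.
Proof.
rewrite !ltr_norml ge_min le_max => /andP[? ?] /andP[? ?] /andP[/orP z1 /orP z2].
by apply/andP; case: z1 => ?; case: z2 => ?; split; lra.
Qed.

(** The density [w] is only measurable, so the chain rule cannot be checked pointwise. Instead the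
    difference of the two sides is flat at every [t]: by the mean value theorem an increment of
    [Psi (x t)] is [psi z] times the integral of [w] for some intermediate [z], and [psi z] differs
    little from [psi (x u)] nearby because [x] is Lipschitz and [psi] continuous. *)
Lemma prim_comp a b x w (Psi psi : R -> R) : (forall z, der Psi z (psi z)) ->
  continuous psi -> prim a b x w ->
  prim a b (fun t => Psi (x t)) (fun t => psi (x t) * w t).
Proof.
move=> dP cpsi Px; have [bw _] := Px.
have bpw : bm a b (fun t => psi (x t) * w t).
  by apply: bmM bw; apply: bm_cont_comp => //; exact: prim_bm Px.
split => // t0 /andP[at0 t0b].
pose phi t := Psi (x t) - itg a t (fun t => psi (x t) * w t).
suff : phi t0 = phi a by rewrite /phi itg_same; lra.
apply: flat_const => // e t e0 /andP[at_ tt0].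
have tb := le_trans tt0 t0b.
have [M M0 Hlip] := prim_lip Px.
have [_ [N HN]] := bw.
have N1 : 0 < `|N| + 1 by rewrite ltr_wpDl.
have M1 : 0 < M + 1 by lra.
have /cvgrPdist_le/(_ (e / (`|N| + 1) / 2)) := cpsi (x t).
have e'0 : 0 < e / (`|N| + 1) / 2 by rewrite !divr_gt0.
move=> /(_ e'0)/nbhs_ballP[d /= d0 Hd].
exists (d / (M + 1)); first by rewrite divr_gt0.
move=> s /andP[as_ st0] sd; have sb := le_trans st0 t0b.
have psid u : a <= u <= b -> `|u - t| <= `|s - t| ->
    `|psi (x u) - psi (x t)| <= e / (`|N| + 1) / 2.
  move=> uab us; rewrite distrC; apply: Hd; rewrite /ball/=.
  rewrite distrC (le_lt_trans (Hlip _ _ _ uab))// ?at_ ?tb//.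
  rewrite (@le_lt_trans _ _ ((M + 1) * `|s - t|))//.
    by apply: ler_pM => //; lra.
  by rewrite mulrC -ltr_pdivlMr.
have main p q : a <= p -> p <= q -> q <= b -> a <= t <= b ->
   (forall u, p <= u <= q -> `|psi (x u) - psi (x t)| <= e / (`|N| + 1) / 2) ->
   (forall z, Num.min (x p) (x q) <= z <= Num.max (x p) (x q) ->
      `|psi z - psi (x t)| <= e / (`|N| + 1) / 2) ->
   `|(Psi (x q) - Psi (x p)) - itg p q (fun t => psi (x t) * w t)| <= e * (q - p).
  move=> ap pq qb tab H1 H2.
  have [z zpq Ez] : exists2 z, Num.min (x p) (x q) <= z <= Num.max (x p) (x q) &
      Psi (x q) - Psi (x p) = psi z * (x q - x p).
    have [xpq|xqp] := leP (x p) (x q).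
      have [|z ? ?] := @der_mvt _ Psi psi (x p) (x q) xpq (fun t _ => dP t).
        by apply: (@der_within _ _ psi).
      by exists z.
    have [|z ? E] := @der_mvt _ Psi psi (x q) (x p) (ltW xqp) (fun t _ => dP t).
      by apply: (@der_within _ _ psi).
    by exists z => //; lra.
  rewrite Ez (prim_diff Px)//.
  have bs1 : bm p q w by exact: bm_sub bw.
  have bs2 : bm p q (fun t => psi (x t) * w t) by exact: bm_sub bpw.
  rewrite -itgZ// -itgB//; last by apply: bmM => //; exact: bm_cst.
  apply: itg_bound => //; first by apply: bmB => //; apply: bmM => //; exact: bm_cst.
  move=> u /[dup] upq /andP[pu uq].
  rewrite -mulrBl normrM (@le_trans _ _ (e / (`|N| + 1) * (`|N| + 1)))//; last first.
    by rewrite divfK// gt_eqF.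
  apply: ler_pM => //.
    rewrite (_ : psi z - psi (x u) = (psi z - psi (x t)) - (psi (x u) - psi (x t))).
      by rewrite (le_trans (ler_normB _ _))// [leRHS](splitr) lerD ?H1 ?H2.
    by ring.
  by rewrite (le_trans (HN _ _)) ?(le_trans ap) ?(le_trans uq)// (le_trans (ler_norm _))// lerDl.
have zclose p q z : a <= p <= b -> a <= q <= b -> `|p - t| <= `|s - t| ->
    `|q - t| <= `|s - t| -> Num.min (x p) (x q) <= z <= Num.max (x p) (x q) ->
    `|psi z - psi (x t)| <= e / (`|N| + 1) / 2.
  move=> pab qab ps qs zpq; rewrite distrC; apply: Hd; rewrite /ball/=.
  have tab : a <= t <= b by rewrite at_ tb.
  have H1 := Hlip _ _ tab pab; have H2 := Hlip _ _ tab qab.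
  have D : M * `|s - t| < d.
    rewrite (@le_lt_trans _ _ ((M + 1) * `|s - t|))//.
      by apply: ler_pM => //; lra.
    by rewrite mulrC -ltr_pdivlMr.
  have H1' := le_lt_trans (le_trans H1 (ler_wpM2l M0 ps)) D.
  have H2' := le_lt_trans (le_trans H2 (ler_wpM2l M0 qs)) D.
  exact: between_close zpq.
have [ts|st] := leP t s.
  have Hm := main t s at_ ts sb ltac:(by rewrite at_ tb) _ _.
  have st' : `|s - t| = s - t by rewrite ger0_norm// subr_ge0.
  have E : phi s - phi t = (Psi (x s) - Psi (x t)) - itg t s (fun t => psi (x t) * w t).
    rewrite /phi (@itg_chasles _ a t s)//; last exact: bm_sub bpw.
    by ring.
  rewrite E st'; move: Hm; apply.
  - move=> u /andP[tu us]; apply: psid; first by rewrite (le_trans at_ tu) (le_trans us).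
    by rewrite !ger0_norm ?subr_ge0// lerB.
  - move=> z; apply: zclose; rewrite ?at_ ?tb ?as_ ?sb// subrr normr0 normr_ge0//.
have Hm := main s t as_ (ltW st) tb ltac:(by rewrite at_ tb) _ _.
have st' : `|s - t| = t - s by rewrite distrC ger0_norm// subr_ge0 ltW.
have E : phi t - phi s = (Psi (x t) - Psi (x s)) - itg s t (fun t => psi (x t) * w t).
  rewrite /phi (@itg_chasles _ a s t)//; [|exact: ltW|exact: bm_sub bpw].
  by ring.
rewrite distrC E st'; move: Hm; apply.
- move=> u /andP[su ut]; apply: psid; first by rewrite (le_trans as_ su) (le_trans ut).
  by rewrite !ler0_norm ?subr_le0 ?(ltW st)// lerN2 lerB.
- move=> z; apply: zclose; rewrite ?at_ ?tb ?as_ ?sb// subrr normr0 normr_ge0//.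
Qed.

Lemma primD a b (F f G g : R -> R) : prim a b F f -> prim a b G g ->
  prim a b (fun t => F t + G t) (fun t => f t + g t).
Proof.
move=> [bf HF] [bg HG]; split; first exact: bmD.
move=> t tab; rewrite HF// HG// itgD; first by ring.
  by move/andP: tab => [? ?]; apply: bm_sub bf.
by move/andP: tab => [? ?]; apply: bm_sub bg.
Qed.

Lemma primZ a b (F f : R -> R) c : prim a b F f ->
  prim a b (fun t => c * F t) (fun t => c * f t).
Proof.
move=> [bf HF]; split; first by apply: bmM => //; exact: bm_cst.
move=> t tab; rewrite HF// itgZ; first by ring.
by move/andP: tab => [? ?]; apply: bm_sub bf.
Qed.

Lemma prim_cst a b c : prim a b (fun=> c) (fun=> 0).
Proof.
split; first exact: bm_cst.
by move=> t /andP[? ?]; rewrite itg_cst// mul0r addr0.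
Qed.

Lemma prim_ext_eq a b (G G' g g' : R -> R) :
  (forall t, a <= t <= b -> G t = G' t) ->
  (forall t, a <= t <= b -> g t = g' t) -> prim a b G g -> prim a b G' g'.
Proof.
move=> GG' gg' P; have bg' := bm_ext gg' P.1; apply: prim_ext P => //.
by move=> t /andP[? ?]; apply: gg'; rewrite !ltW.
Qed.

(** Polarization: the product is half of [(F + G) ^+ 2 - F ^+ 2 - G ^+ 2], and squares are covered
    by [prim_comp]. *)
Lemma primM a b (F f G g : R -> R) : prim a b F f -> prim a b G g ->
  prim a b (fun t => F t * G t) (fun t => F t * g t + G t * f t).
Proof.
move=> PF PG.
have sq (z : R) : der (fun z : R => z ^+ 2) z (2 * z) by der_solve; rewrite /= expr1 mulr1.
have csq : continuous (fun z : R => 2 * z).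
  by move=> z; apply: (@der_cont _ _ _ 2); der_solve; ring.
have P1 := prim_comp sq csq PF.
have P2 := prim_comp sq csq PG.
have P3 := prim_comp sq csq (primD PF PG).
apply: prim_ext_eq (primZ (1/2) (primD P3 (primZ (-1) (primD P1 P2)))) => t _ /=; by field.
Qed.

Lemma bm_glue a b c (g g' : R -> R) : a <= b -> b <= c ->
  bm a b g -> bm b c g' -> bm a c (fun t => if t <= b then g t else g' t).
Proof.
move=> ab bc [mg [M HM]] [mg' [M' HM']]; split.
  rewrite (_ : `[a, c]%classic = `[a, b] `|` `[b, c]); last first.
    apply/seteqP; split => t /=; rewrite !in_itv/=.
      by move=> /andP[at_ tc]; have [|/ltW] := leP t b => ?; [left|right]; apply/andP.
    case => /andP[? ?]; apply/andP; split => //; first exact: le_trans bc.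
    exact: le_trans ab _.
  apply/measurable_funU => //; split.
    by apply: eq_measurable_fun mg => t; rewrite inE/= in_itv/= => /andP[_ ->].
  rewrite (_ : `[b, c]%classic = [set b] `|` `]b, c]); last first.
    by rewrite setU1itv// bnd_simp.
  apply/measurable_funU => //; split; first exact: measurable_fun_set1.
  have : measurable_fun `]b, c] g'.
    by apply: measurable_funS mg' => //; apply: subset_itv; rewrite bnd_simp.
  by apply: eq_measurable_fun => t; rewrite inE/= in_itv/= => /andP[bt _]; rewrite leNgt bt.
exists (Num.max M M') => t /andP[at_ tc]; rewrite le_max; have [tb|tb] := leP t b.
  by rewrite HM// at_.
by rewrite HM' ?orbT// tc ltW.
Qed.

Lemma itg_glue a b c (g g' : R -> R) : a <= b -> b <= c ->
  bm a b g -> bm b c g' ->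
  itg a c (fun t => if t <= b then g t else g' t) = itg a b g + itg b c g'.
Proof.
move=> ab bc bg bg'; have bgl := bm_glue ab bc bg bg'.
rewrite (itg_chasles ab bc bgl); congr (_ + _).
  by apply: itg_ext => t /andP[_ ->].
apply: itg_ext_open => //; first by apply: bm_sub bgl.
by move=> t /andP[bt _]; rewrite leNgt bt.
Qed.

Lemma prim_glue a b c (G G' g g' : R -> R) : a <= b -> b <= c ->
  prim a b G g -> prim b c G' g' -> G b = G' b ->
  prim a c (fun t => if t <= b then G t else G' t)
           (fun t => if t <= b then g t else g' t).
Proof.
move=> ab bc P P' E.
have bg := bm_glue ab bc P.1 P'.1.
split => // t /andP[at_ tc]; rewrite ab; have [tb|tb] := leP t b.
  rewrite (P.2 t) ?at_//; congr (_ + _); apply: itg_ext => s /andP[_ st].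
  by rewrite (le_trans st tb).
rewrite (@itg_chasles _ a b t)//; [|exact: ltW|exact: bm_sub bg].
rewrite (P'.2 t) ?tc ?ltW// -E (P.2 b) ?ab ?lexx// -addrA; congr (_ + (_ + _)).
  by apply: itg_ext => s /andP[_ ->].
apply: itg_ext_open.
- by apply: bm_sub P'.1.
- by apply: bm_sub bg.
- by move=> s /andP[bs _]; rewrite leNgt bs.
Qed.

End Primitives.

(** * Calibrations *)

Section Calibration.
Context {R : realType}.
Implicit Types (f g w x y : R -> R) (a b c t : R).

Definition plen a b (w1 w2 : R -> R) :=
  itg a b (fun t => Num.sqrt (w1 t ^+ 2 + w2 t ^+ 2)).

Lemma bm_speed a b w1 w2 : bm a b w1 -> bm a b w2 ->
  bm a b (fun t => Num.sqrt (w1 t ^+ 2 + w2 t ^+ 2)).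
Proof. by move=> b1 b2; apply: bm_sqrt; apply: bmD; exact: bmX. Qed.

Lemma plen_chasles a b c w1 w2 : a <= b -> b <= c -> bm a c w1 -> bm a c w2 ->
  plen a c w1 w2 = plen a b w1 w2 + plen b c w1 w2.
Proof. by move=> ab bc b1 b2; apply: itg_chasles => //; exact: bm_speed. Qed.

Lemma le_sqrt (u v : R) : u ^+ 2 <= v -> u <= Num.sqrt v.
Proof.
move=> uv; rewrite (le_trans (ler_norm u))// -sqrtr_sqr.
by rewrite ler_sqrt// (le_trans (sqr_ge0 u)).
Qed.

(** Cauchy-Schwarz for the unit covector with components [s * sqrt (1 - g ^+ 2)] and [g]. *)
Lemma calibration_cauchy (g s v1 v2 : R) : `|g| <= 1 -> s ^+ 2 = 1 ->
  g * v2 + s * Num.sqrt (1 - g ^+ 2) * v1 <= Num.sqrt (v1 ^+ 2 + v2 ^+ 2).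
Proof.
move=> g1 s1; apply: le_sqrt; rewrite -subr_ge0.
have f2 : Num.sqrt (1 - g ^+ 2) ^+ 2 = 1 - g ^+ 2.
  by rewrite sqr_sqrtr// subr_ge0 -real_normK ?num_real// exprn_ile1.
set f := Num.sqrt _ in f2 *.
rewrite (_ : _ - _ = (g * v1 - s * f * v2) ^+ 2); first exact: sqr_ge0.
have -> : v1 ^+ 2 + v2 ^+ 2 - (g * v2 + s * f * v1) ^+ 2 =
  (g * v1 - s * f * v2) ^+ 2 + (v1 ^+ 2 + v2 ^+ 2) * (1 - g ^+ 2 - s ^+ 2 * f ^+ 2).
  by ring.
by rewrite s1 mul1r f2; ring.
Qed.

Section Segment.
Variables (a b : R) (x w1 w2 : R -> R) (G Psi e : R -> R).
Hypotheses (Px : prim a b x w1) (bw2 : bm a b w2) (cG : continuous G)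
  (dPsi : forall z, der Psi z (Num.sqrt (1 - G z ^+ 2))) (be : bm a b e).
Hypothesis cal : forall t (s : R), a <= t <= b -> s ^+ 2 = 1 ->
  G (x t) * w2 t + s * Num.sqrt (1 - G (x t) ^+ 2) * w1 t + e t <=
  Num.sqrt (w1 t ^+ 2 + w2 t ^+ 2).

Let bGw : bm a b (fun t => G (x t) * w2 t).
Proof. by apply: bmM => //; apply: bm_cont_comp => //; exact: prim_bm Px. Qed.

Let cf : continuous (fun z => Num.sqrt (1 - G z ^+ 2)).
Proof.
move=> z; apply: (@continuous_comp _ _ _ (fun z => 1 - G z ^+ 2)); last exact: sqrt_continuous.
apply: continuousB; first exact: cst_continuous.
apply: (@continuous_comp _ _ _ G (fun z => z ^+ 2)); first exact: cG.
exact: exprn_continuous.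
Qed.

(** The sign in [cal] is free, hence on each segment it can be chosen as that of the increment of
    [Psi]; this is what lets absolute values add up over consecutive segments. The function [e]
    records a surplus in the calibration inequality. It is 0 in all applications but
    [infl_near_min]. *)
Lemma calibrate_segment s t : a <= s -> s <= t -> t <= b ->
  itg s t (fun t => G (x t) * w2 t) + `|Psi (x t) - Psi (x s)| + itg s t e <=
  plen s t w1 w2.
Proof.
move=> as_ st tb.
have H sg : sg ^+ 2 = 1 ->
  itg s t (fun t => G (x t) * w2 t) + sg * (Psi (x t) - Psi (x s)) + itg s t e <=
  plen s t w1 w2.
  move=> sg1.
  have PP := prim_comp dPsi cf Px.
  rewrite (prim_diff PP)//.
  have b1 : bm s t (fun t => G (x t) * w2 t) by exact: bm_sub bGw.
  have b2 : bm s t (fun t => Num.sqrt (1 - G (x t) ^+ 2) * w1 t) by exact: bm_sub PP.1.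
  have b3 : bm s t e by exact: bm_sub be.
  have b2' := bmM (bm_cst s t sg) b2.
  rewrite -itgZ// -itgD// -itgD//; last exact: bmD.
  apply: itg_le; [by apply: bmD => //; exact: bmD| |].
    by apply: bm_sub (bm_speed Px.1 bw2).
  move=> u /andP[su ut]; rewrite mulrA; apply: cal => //.
  by rewrite (le_trans as_ su) (le_trans ut).
have [p|p] := leP 0 (Psi (x t) - Psi (x s)).
  by rewrite ger0_norm//; have := H 1 (expr1n _ _); rewrite mul1r.
by rewrite ltr0_norm//; have := H (-1) ltac:(by rewrite sqrrN expr1n); rewrite mulN1r.
Qed.

Lemma calibrate_point t : a <= t -> t <= b ->
  itg a b (fun t => G (x t) * w2 t) + `|Psi (x t) - Psi (x a)| +
  `|Psi (x b) - Psi (x t)| + itg a b e <= plen a b w1 w2.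
Proof.
move=> at_ tb.
have := calibrate_segment (lexx a) at_ tb.
have := calibrate_segment at_ tb (lexx b).
rewrite (@plen_chasles a t b)//; last exact: Px.1.
rewrite (@itg_chasles _ a t b (fun t => G (x t) * w2 t))//.
rewrite (@itg_chasles _ a t b e)//.
lra.
Qed.

(** When the abscissa returns to its initial value, [Psi] runs from [x s] to [x t] and, through the
    common end value, back again, so the triangle inequality doubles its variation. *)
Lemma calibrate_range s t : a <= s <= b -> a <= t <= b -> x a = x b ->
  itg a b (fun t => G (x t) * w2 t) + 2 * (Psi (x s) - Psi (x t)) + itg a b e
  <= plen a b w1 w2.
Proof.
suff H s' t' : a <= s' -> s' <= t' -> t' <= b -> x a = x b ->
  itg a b (fun t => G (x t) * w2 t) + 2 * `|Psi (x s') - Psi (x t')| + itg a b e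
  <= plen a b w1 w2.
  move=> /andP[as_ sb] /andP[at_ tb] xab.
  have [st|ts] := leP s t.
    have := H _ _ as_ st tb xab; have := ler_norm (Psi (x s) - Psi (x t)); lra.
  have := H _ _ at_ (ltW ts) sb xab; rewrite distrC.
  have := ler_norm (Psi (x s) - Psi (x t)); lra.
move=> as_ st tb xab.
have sb := le_trans st tb; have at_ := le_trans as_ st.
have := calibrate_segment (lexx a) as_ sb.
have := calibrate_segment as_ st tb.
have := calibrate_segment at_ tb (lexx b).
rewrite (@plen_chasles a s' b)//; last exact: Px.1.
rewrite (@plen_chasles s' t' b)//; [|by apply: bm_sub Px.1|by apply: bm_sub bw2].
rewrite (@itg_chasles _ a s' b (fun t => G (x t) * w2 t))//.
rewrite (@itg_chasles _ s' t' b (fun t => G (x t) * w2 t))//; last by apply: bm_sub bGw.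
rewrite (@itg_chasles _ a s' b e)// (@itg_chasles _ s' t' b e)//; last by apply: bm_sub be.
rewrite -xab.
have := ler_distD (Psi (x a)) (Psi (x s')) (Psi (x t')).
rewrite (distrC (Psi (x t')) (Psi (x s'))).
rewrite (distrC (Psi (x a)) (Psi (x t'))).
lra.
Qed.

End Segment.

Lemma prim_argmax a b x w : a <= b -> prim a b x w ->
  exists2 t, a <= t <= b & forall s, a <= s <= b -> x s <= x t.
Proof.
move=> ab /prim_within_cont/(EVT_max ab)[t]; rewrite in_itv/= => tab H.
by exists t => // s sab; apply: H; rewrite in_itv.
Qed.

Lemma prim_argmin a b x w : a <= b -> prim a b x w ->
  exists2 t, a <= t <= b & forall s, a <= s <= b -> x t <= x s.
Proof.
move=> ab /prim_within_cont/(EVT_min ab)[t]; rewrite in_itv/= => tab H.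
by exists t => // s sab; apply: H; rewrite in_itv.
Qed.

Lemma itg_quadratic a b x w1 w2 (A B C : R) : prim a b x w1 -> bm a b w2 ->
  itg a b (fun t => (A + B * x t + C * x t ^+ 2) * w2 t) =
  A * itg a b w2 + B * itg a b (fun t => x t * w2 t) +
  C * itg a b (fun t => x t ^+ 2 * w2 t).
Proof.
move=> Px b2; have bx := prim_bm Px.
have b1 := bmM bx b2; have b3 := bmM (bmX 2 bx) b2.
have bc c := bm_cst a b c.
rewrite -!itgZ// -!itgD//; try by do ?[apply: bmM => //|apply: bmD => //].
by apply: itg_ext => t _; ring.
Qed.

(* Length minimality of [0, T] in the Engel group of a unit speed curve with
   abscissa X and ordinate velocity V, competitors being compared through the
   moments of order at most 2 of dy. *)
Definition engel_min (X V : R -> R) (T : R) : Prop :=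
  forall S x w1 w2, 0 <= S -> prim 0 S x w1 -> bm 0 S w2 ->
  x 0 = X 0 -> x S = X T -> itg 0 S w2 = itg 0 T V ->
  itg 0 S (fun t => x t * w2 t) = itg 0 T (fun t => X t * V t) ->
  itg 0 S (fun t => x t ^+ 2 * w2 t) = itg 0 T (fun t => X t ^+ 2 * V t) ->
  T <= plen 0 S w1 w2.

(** A translation or a reflection acts on the moments of order at most 2 by an invertible triangular
    substitution and preserves lengths, so a competitor of the moved curve is carried back to one of
    the original curve. *)
Lemma engel_min_affine X V T (e1 e2 h : R) : e1 ^+ 2 = 1 -> e2 ^+ 2 = 1 ->
  bm 0 T X -> bm 0 T V -> engel_min X V T ->
  engel_min (fun t => e1 * X t + h) (fun t => e2 * V t) T.
Proof.
move=> e11 e21 bX bV M S x w1 w2 S0 Px b2 x0 xS I0 I1 I2.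
have bx := prim_bm Px.
have bc c := bm_cst 0 S c.
have bc' c := bm_cst 0 T c.
have Px' := primZ e1 (primD Px (prim_cst 0 S (- h))).
have b2' := bmM (bc e2) b2.
have H := M S _ _ _ S0 Px' b2'.
rewrite (_ : plen 0 S w1 w2 = plen 0 S (fun t => e1 * (w1 t + 0)) (fun t => e2 * w2 t)); last first.
  by apply: itg_ext => t _; rewrite !exprMn e11 e21 !mul1r addr0.
have i0 : itg 0 T (fun t => e2 * V t) = e2 * itg 0 T V by rewrite itgZ.
have i1 : itg 0 T (fun t => (e1 * X t + h) * (e2 * V t)) =
   e1 * e2 * itg 0 T (fun t => X t * V t) + h * e2 * itg 0 T V.
  rewrite -itgZ; last exact: bmM.
  rewrite -itgZ// -itgD; [|by apply: bmM => //; exact: bmM|exact: bmM].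
  by apply: itg_ext => t _; ring.
have i2 : itg 0 T (fun t => (e1 * X t + h) ^+ 2 * (e2 * V t)) =
   e2 * itg 0 T (fun t => X t ^+ 2 * V t) + 2 * h * e1 * e2 * itg 0 T (fun t => X t * V t)
   + h ^+ 2 * e2 * itg 0 T V.
  rewrite -itgZ; last by apply: bmM => //; exact: bmX.
  rewrite -itgZ; last exact: bmM.
  rewrite -itgZ// -itgD; [|by apply: bmM => //; apply: bmM => //; exact: bmX|by apply: bmM => //; exact: bmM].
  rewrite -itgD; [|by apply: bmD; apply: bmM => //; apply: bmM => //; exact: bmX|exact: bmM].
  apply: itg_ext => t _.
  by rewrite (_ : _ * _ = e2 * (e1 ^+ 2 * X t ^+ 2) * V t + 2 * h * e1 * e2 * (X t * V t) + h ^+ 2 * e2 * V t);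
    [rewrite e11 mul1r; ring|ring].
have E1 u : e1 * (e1 * u) = u by rewrite mulrA -expr2 e11 mul1r.
have E2 u : e2 * (e2 * u) = u by rewrite mulrA -expr2 e21 mul1r.
apply: H.
- by rewrite x0 addrK E1.
- by rewrite xS addrK E1.
- by rewrite itgZ// I0 i0 E2.
- have -> : itg 0 S (fun t => e1 * (x t - h) * (e2 * w2 t)) =
     e1 * e2 * itg 0 S (fun t => x t * w2 t) - e1 * e2 * h * itg 0 S w2.
    rewrite -itgZ; last exact: bmM.
    rewrite -itgZ// -itgB; [|by apply: bmM => //; exact: bmM|exact: bmM].
    by apply: itg_ext => t _; ring.
  rewrite I0 I1 i0 i1 -[RHS]E1 -[in RHS](E2 (itg 0 T _)); ring.
- have -> : itg 0 S (fun t => (e1 * (x t - h)) ^+ 2 * (e2 * w2 t)) =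
     e2 * itg 0 S (fun t => x t ^+ 2 * w2 t) - 2 * h * e2 * itg 0 S (fun t => x t * w2 t)
     + h ^+ 2 * e2 * itg 0 S w2.
    rewrite -itgZ; last by apply: bmM => //; exact: bmX.
    rewrite -itgZ; last exact: bmM.
    rewrite -itgZ// -itgB; [|by apply: bmM => //; apply: bmM => //; exact: bmX|by apply: bmM => //; exact: bmM].
    rewrite -itgD; [|by apply: bmB; apply: bmM => //; apply: bmM => //; exact: bmX|exact: bmM].
    by apply: itg_ext => t _; rewrite exprMn e11 mul1r; ring.
  rewrite I0 I1 I2 i0 i1 i2 -[RHS]E2; ring.
Qed.

End Calibration.

(** * Motions with a periodic speed and the clock that measures them *)

Section Rotation.
Context {R : realType}.
Variables (W phi : R -> R) (per : R).
Hypotheses (cW : continuous W) (W_gt0 : forall p, 0 < W p)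
  (per_gt0 : 0 < per) (Wper : forall p, W (p + per) = W p)
  (dphi : forall t : R, 0 <= t -> der phi t (W (phi t))).

Lemma rotation_incr s t : 0 <= s -> s < t -> phi s < phi t.
Proof.
move=> s0 st; apply: (@der_lt _ phi (fun t => W (phi t))) => // u /andP[su _].
by apply: dphi; exact: le_trans su.
Qed.

Lemma rotation_reach (w0 p : R) : 0 < w0 -> (forall q, w0 <= W q) ->
  phi 0 <= p -> exists2 t : R, 0 <= t & phi t = p.
Proof.
move=> w0_gt0 Wge p0; set M := (p - phi 0) / w0.
have M0 : 0 <= M by rewrite divr_ge0 ?subr_ge0// ltW.
have E : p <= phi M.
  have := @der_le_incr _ (fun t => w0 * t) phi (fun=> w0) (fun t => W (phi t)) 0 M M0.
  have -> : w0 * M = p - phi 0 by rewrite /M mulrC divfK// gt_eqF.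
  rewrite mulr0 subr0 => H; rewrite -(lerD2r (- phi 0)).
  apply: H => [t _|t /andP[t0 _]|t _]; [by der_solve; ring|exact: dphi|exact: Wge].
have [||t /andP[t0 _] Et] := @ivt_value _ phi 0 M p M0.
- by apply: (@der_within _ _ (fun t => W (phi t))) => t /andP[t0 _]; exact: dphi.
- by rewrite p0.
- by exists t.
Qed.

(** The clock is a primitive of [1 / W]: the time as a function of the position. It replaces
    elliptic integrals, and the period [kap] is its increment over one period of [W]. *)
Lemma rotation_clock : exists (T0 : R -> R) (kap : R),
  [/\ 0 < kap, (forall p, der T0 p (W p)^-1), T0 0 = 0,
      (forall p, T0 (p + per) = T0 p + kap) & injective T0].
Proof.
have [|T dT] := @primitive _ (fun p => (W p)^-1).
  by move=> p; apply: continuousV; [rewrite gt_eqF|exact: cW].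
pose T0 p := T p - T 0.
have dT0 p : der T0 p (W p)^-1 by rewrite /T0; der_solve; rewrite subr0.
have inc p q : p < q -> T0 p < T0 q.
  by move=> pq; apply: (@der_lt _ T0 (fun p => (W p)^-1)) => // t _; rewrite invr_gt0.
exists T0, (T0 per); split => //.
- have <- : T0 0 = 0 by rewrite /T0 subrr.
  exact: inc.
- by rewrite /T0 subrr.
- move=> p.
  have E : forall x y : R, T0 (x + per) - T0 x = T0 (y + per) - T0 y.
    move=> x y; apply: (@is_derive_0_is_cst _ (fun x => T0 (x + per) - T0 x)) => z.
    have : der (fun x => T0 (x + per) - T0 x) z 0.
      by der_solve; rewrite Wper; ring.
    by [].
  have := E p 0; rewrite add0r /T0 subrr; lra.
- move=> p q pq; apply/eqP; case: (ltgtP p q) => // [/inc|/inc]; rewrite pq ltxx//.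
Qed.

Lemma clock_time (T0 : R -> R) : (forall p, der T0 p (W p)^-1) ->
  forall t, 0 <= t -> T0 (phi t) = T0 (phi 0) + t.
Proof.
move=> dT0 t t0.
have := @der_eq_incr _ (fun t => T0 (phi t)) (fun t => t) (fun=> 1) 0 t t0.
move=> H; suff : T0 (phi t) - T0 (phi 0) = t - 0 by lra.
apply: H => s /andP[s0 _]; last by der_solve.
have dp := dphi s0; der_solve.
by rewrite mulVf// gt_eqF.
Qed.

(** Both positions show the same time on the clock, and the clock is injective. *)
Lemma rotation_shift (T0 : R -> R) (kap : R) : 0 < kap ->
  (forall p, der T0 p (W p)^-1) ->
  (forall p, T0 (p + per) = T0 p + kap) -> injective T0 ->
  forall t, 0 <= t -> phi (t + kap) = phi t + per.
Proof.
move=> k0 dT0 T0k inj t t0; apply: inj.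
have tk : 0 <= t + kap by rewrite addr_ge0// ltW.
by rewrite T0k (clock_time dT0 t0) (clock_time dT0 tk) addrA.
Qed.

End Rotation.

Lemma unit_angle {R : realType} (u v : R) : u ^+ 2 + v ^+ 2 = 1 ->
  exists2 p : R, - pi <= p <= pi & cos p = u /\ sin p = v.
Proof.
move=> uv.
have u1 : -1 <= u <= 1.
  rewrite -ler_norml -(@ler_pXn2r _ 2)// ?nnegrE// expr1n real_normK ?num_real//.
  by have := sqr_ge0 v; lra.
have sE : Num.sqrt (1 - u ^+ 2) = `|v| by rewrite -uv addrC addKr sqrtr_sqr.
have a0 : 0 <= acos u by apply: acos_ge0.
have api : acos u <= pi by apply: acos_lepi.
have [v0|v0] := leP 0 v.
  exists (acos u); first by apply/andP; split => //; have := pi_ge0 R; lra.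
  by rewrite ?acosK ?sin_acos ?sE ?ger0_norm// in_itv.
exists (- acos u); first by apply/andP; split; have := pi_ge0 R; lra.
by rewrite ?cosN ?sinN ?acosK ?sin_acos ?sE ?ltr0_norm ?opprK// in_itv.
Qed.

(* The normal form of the elasticae with c' = a cos th and a nonzero, up to a
   translation and reflections. *)
Record normal {R : realType} (C A : R) (X th y : R -> R) : Prop := Normal {
  nC : 0 < C;
  nX : forall t, 0 <= t -> der X t (cos (th t));
  ny : forall t, 0 <= t -> der y t (sin (th t));
  nth' : forall t, 0 <= t -> der th t (2 * C * X t);
  nF : forall t, 0 <= t -> sin (th t) = A + C * X t ^+ 2 }.

Section Normal.
Context {R : realType}.
Variables (C A : R) (X th y : R -> R).
Hypothesis N : normal C A X th y.
Let C0 := nC N.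
Let dX := nX N.
Let dy := ny N.
Let dth := nth' N.
Let F := nF N.
Let U t := cos (th t).

Lemma normal_unit t : 0 <= t -> U t ^+ 2 + (A + C * X t ^+ 2) ^+ 2 = 1.
Proof. by move=> t0; rewrite -F// cos2Dsin2. Qed.

Lemma normal_dU t : 0 <= t -> der U t (- (A + C * X t ^+ 2) * (2 * C * X t)).
Proof. by move=> t0; rewrite /U -F//; der_solve. Qed.
Let dU := normal_dU.

Lemma normal_dy t : 0 <= t -> der y t (A + C * X t ^+ 2).
Proof. by move=> t0; rewrite -F//; exact: dy. Qed.
Let dy' := normal_dy.

Lemma normal_Xcont t : 0 <= t -> {for t, continuous X}.
Proof. by move=> /dX; exact: der_cont. Qed.

Lemma normal_sin_cont t : 0 <= t -> {for t, continuous (fun t => sin (th t))}.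
Proof. by move=> t0; apply: (@der_cont _ _ _ (cos (th t) * (2 * C * X t))); der_solve. Qed.

Lemma normal_cos_cont t : 0 <= t -> {for t, continuous (fun t => cos (th t))}.
Proof. by move=> /dU; exact: der_cont. Qed.

Lemma normal_moment0 a b : 0 <= a -> a <= b ->
  itg a b (fun t => sin (th t)) = y b - y a.
Proof.
move=> a0 ab; apply: itg_FTC => // t /andP[at_ _].
  by apply: dy; exact: le_trans at_.
by apply: normal_sin_cont; exact: le_trans at_.
Qed.

Lemma normal_moment1 a b : 0 <= a -> a <= b ->
  itg a b (fun t => X t * sin (th t)) = - (U b - U a) / (2 * C).
Proof.
move=> a0 ab; rewrite (@itg_FTC _ a b (fun t => - U t / (2 * C)) _ ab).
- by field; rewrite gt_eqF.
- move=> t /andP[at_ _]; have t0 := le_trans a0 at_.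
  have d := dU t0; der_solve; rewrite F//; field; by rewrite gt_eqF.
- move=> t /andP[at_ _]; have t0 := le_trans a0 at_.
  by apply: continuousM; [exact: normal_Xcont|exact: normal_sin_cont].
Qed.

(** Since [cos (th t) ^+ 2 = 1 - sin (th t) * (A + C * X t ^+ 2)], the derivative of [X * U] is
    [1 - A * sin th - 3 * C * X ^+ 2 * sin th]. Solving for the last term gives the primitive. *)
Lemma normal_moment2 a b : 0 <= a -> a <= b ->
  itg a b (fun t => X t ^+ 2 * sin (th t)) =
  (b - a - A * (y b - y a) - (X b * U b - X a * U a)) / (3 * C).
Proof.
move=> a0 ab.
rewrite (@itg_FTC _ a b (fun t => (t - A * y t - X t * U t) / (3 * C)) _ ab).
- by field; rewrite gt_eqF.
- move=> t /andP[at_ _]; have t0 := le_trans a0 at_.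
  have d := dU t0; have dx := dX t0; have d3 := dy' t0.
  have u := normal_unit t0; der_solve; rewrite F//.
  have E : cos (th t) * cos (th t) = 1 - (A + C * X t ^+ 2) ^+ 2.
    by rewrite -expr2 -/(U t); lra.
  rewrite -/(U t) in E *; rewrite mulrDl; field: E; by rewrite gt_eqF.
- move=> t /andP[at_ _]; have t0 := le_trans a0 at_.
  apply: continuousM; last exact: normal_sin_cont.
  by apply: (@der_cont _ _ _ (2 * X t * cos (th t))); der_solve; rewrite /= expr1.
Qed.

(** The integral of [U ^+ 2] dt is that of [U] dx, hence the variation of the primitive of
    [sqrt (1 - G ^+ 2)] wherever [U] keeps its sign. This makes the hill of a calibration comparable
    with the length and the rise of the elastica. *)
Lemma normal_dJ t : 0 <= t ->
  der (fun t => (2 * (t - A * y t) + X t * U t) / 3) t (U t ^+ 2).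
Proof.
move=> t0; have d := dU t0; have dx := dX t0; have d3 := dy' t0.
have u := normal_unit t0; der_solve.
rewrite -/(U t) /=; move: u; move: (U t) (X t) => u v E.
have -> : u ^+ 2 = u ^+ 2 + (u ^+ 2 + (A + C * v ^+ 2) ^+ 2 - 1) * (-2/3).
  by rewrite E subrr mul0r addr0.
by field.
Qed.

Lemma engel_min_normal T : 0 <= T ->
  (forall S x w1 w2, 0 <= S -> prim 0 S x w1 -> bm 0 S w2 ->
    x 0 = X 0 -> x S = X T -> itg 0 S w2 = y T - y 0 ->
    itg 0 S (fun t => x t * w2 t) = - (U T - U 0) / (2 * C) ->
    itg 0 S (fun t => x t ^+ 2 * w2 t) =
     (T - A * (y T - y 0) - (X T * U T - X 0 * U 0)) / (3 * C) ->
    T <= plen 0 S w1 w2) ->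
  engel_min X (fun t => sin (th t)) T.
Proof.
move=> T0 H S x w1 w2 S0 Px b2 x0 xS I0 I1 I2; apply: H x0 xS _ _ _ => //.
- by rewrite I0 normal_moment0.
- by rewrite I1 normal_moment1.
- by rewrite I2 normal_moment2// subr0.
Qed.

End Normal.

Section QuadraticCalibration.
Context {R : realType}.
Implicit Types (A B C : R).

Lemma quadratic_cont A B C : continuous (fun z : R => A + B * z + C * z ^+ 2).
Proof.
apply: (@der_continuous _ _ (fun z => B + C * (2 * z))) => z; der_solve.
by rewrite /= expr1; ring.
Qed.

Lemma cal_primitive A C : exists Psi : R -> R, Psi 0 = 0 /\
  forall z, der Psi z (Num.sqrt (1 - (A + C * z ^+ 2) ^+ 2)).
Proof.
have [|P dP] := @primitive _ (fun z : R => Num.sqrt (1 - (A + C * z ^+ 2) ^+ 2)).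
  have c : continuous (fun z : R => 1 - (A + C * z ^+ 2) ^+ 2).
    apply: (@der_continuous _ _ (fun z => - (2 * (A + C * z ^+ 2) * (C * (2 * z))))) => z.
    by der_solve; rewrite /= !expr1; ring.
  by move=> z; apply: continuous_comp (c z) _; exact: sqrt_continuous.
exists (fun z => P z - P 0); split; first by rewrite subrr.
by move=> z; der_solve; rewrite subr0.
Qed.

Lemma cal_odd A C (Psi : R -> R) : Psi 0 = 0 ->
  (forall z, der Psi z (Num.sqrt (1 - (A + C * z ^+ 2) ^+ 2))) ->
  forall z, Psi (- z) = - Psi z.
Proof.
move=> P0 dP z.
have := @is_derive_0_is_cst _ (fun z => Psi (- z) + Psi z) z 0.
rewrite oppr0 P0 addr0 => H; suff : Psi (- z) + Psi z = 0 by lra.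
apply: H => u; suff : der (fun z => Psi (- z) + Psi z) u 0 by [].
by der_solve; rewrite sqrrN; ring.
Qed.

Lemma cal_mono A C (Psi : R -> R) :
  (forall z, der Psi z (Num.sqrt (1 - (A + C * z ^+ 2) ^+ 2))) ->
  forall u v, u <= v -> Psi u <= Psi v.
Proof.
by move=> dP u v uv; apply: (@der_le _ Psi _ _ _ uv (fun t _ => dP t)) => t _; exact: sqrtr_ge0.
Qed.

(** The parabola centred at [m] and dilated by [r], expanded in powers of [z] because the moments of
    a competitor enter through the three coefficients. *)
Lemma scaled_calibration A C (Psi : R -> R) m r : r != 0 ->
  (forall z, der Psi z (Num.sqrt (1 - (A + C * z ^+ 2) ^+ 2))) ->
  forall z, der (fun z => r * Psi ((z - m) / r)) z
    (Num.sqrt (1 - (A + C * m ^+ 2 / r ^+ 2 + (- 2 * C * m / r ^+ 2) * z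
                  + C / r ^+ 2 * z ^+ 2) ^+ 2)).
Proof.
move=> r0 dP z.
have -> : A + C * m ^+ 2 / r ^+ 2 + (- 2 * C * m / r ^+ 2) * z + C / r ^+ 2 * z ^+ 2 =
  A + C * ((z - m) / r) ^+ 2 by field.
by der_solve; field.
Qed.

Variables (A B C : R) (Psi : R -> R) (S : R) (x w1 w2 : R -> R).
Hypotheses (dPsi : forall z, der Psi z (Num.sqrt (1 - (A + B * z + C * z ^+ 2) ^+ 2)))
  (S0 : 0 <= S) (Px : prim 0 S x w1) (b2 : bm 0 S w2).
Hypothesis hill : forall t, 0 <= t <= S -> `|A + B * x t + C * x t ^+ 2| <= 1.

Let bound := A * itg 0 S w2 + B * itg 0 S (fun t => x t * w2 t) +
  C * itg 0 S (fun t => x t ^+ 2 * w2 t).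

Let cau t (s : R) : 0 <= t <= S -> s ^+ 2 = 1 ->
  (A + B * x t + C * x t ^+ 2) * w2 t + s * Num.sqrt (1 - (A + B * x t + C * x t ^+ 2) ^+ 2) * w1 t + 0 <=
  Num.sqrt (w1 t ^+ 2 + w2 t ^+ 2).
Proof. by move=> tS s1; rewrite addr0; apply: calibration_cauchy => //; exact: hill. Qed.

Lemma quadratic_point t : 0 <= t <= S ->
  bound + `|Psi (x t) - Psi (x 0)| + `|Psi (x S) - Psi (x t)| <= plen 0 S w1 w2.
Proof.
move=> /andP[t0 tS].
have := calibrate_point Px b2 (@quadratic_cont A B C) dPsi (bm_cst 0 S 0) cau t0 tS.
by rewrite itg_cst// mul0r addr0 (itg_quadratic _ _ _ Px b2).
Qed.

Lemma quadratic_range s t : 0 <= s <= S -> 0 <= t <= S -> x 0 = x S ->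
  bound + 2 * (Psi (x s) - Psi (x t)) <= plen 0 S w1 w2.
Proof.
move=> sS tS xS.
have := calibrate_range Px b2 (@quadratic_cont A B C) dPsi (bm_cst 0 S 0) cau sS tS xS.
by rewrite itg_cst// mul0r addr0 (itg_quadratic _ _ _ Px b2).
Qed.

End QuadraticCalibration.

(** The speed of the Jacobi amplitude. When [C * b ^+ 2 = 1 - A] the radicand is
    [2 * C * (1 - k2 * sin p ^+ 2)] with [k2 = (1 - A) / 2]. *)
Definition infl_speed {R : realType} (C A b p : R) : R :=
  Num.sqrt (C * (1 + A + C * b ^+ 2 * cos p ^+ 2)).

(** * Lower bounds in the Engel group *)

(* [phi] is the amplitude, [T0] the time as a function of the amplitude and
   [kap] half of the period. *)
Record inflectional {R : realType} (C A : R) (X th y : R -> R)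
    (b : R) (phi T0 : R -> R) (kap : R) : Prop := Inflectional {
  iN : normal C A X th y;
  iA : -1 < A < 1;
  ib : 0 < b;
  ibE : C * b ^+ 2 = 1 - A;
  iphi : forall t : R, 0 <= t -> der phi t (infl_speed C A b (phi t));
  iX : forall t : R, 0 <= t -> X t = b * cos (phi t);
  iU : forall t : R, 0 <= t ->
    cos (th t) = - (b * sin (phi t) * infl_speed C A b (phi t));
  iphi0 : - pi <= phi 0 <= pi;
  ikap : 0 < kap;
  iT0 : forall p, der T0 p (infl_speed C A b p)^-1;
  iT00 : T0 0 = 0;
  iT0p : forall p, T0 (p + pi) = T0 p + kap;
  iT0i : injective T0 }.

Ltac infl_facts I :=
  have N := iN I; have C0 := nC N; have b0 := ib I; have bE := ibE I;
  have k0 := ikap I; have /andP[A_gt A_lt] := iA I.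

Generalizable All Variables.

Lemma inflectional_exists {R : realType} (C A : R) (X th y : R -> R)
  (b := Num.sqrt ((1 - A) / C)) : normal C A X th y -> -1 < A < 1 ->
  exists phi T0 kap, inflectional C A X th y b phi T0 kap.
Proof.
move=> N A1; have C0 := nC N; have /andP[A_gt A_lt] := A1.
have b0 : 0 < b by rewrite sqrtr_gt0 divr_gt0// subr_gt0.
have bE : C * b ^+ 2 = 1 - A.
  rewrite sqr_sqrtr; first by rewrite mulrC divfK// gt_eqF.
  by rewrite divr_ge0// ltW// subr_gt0.
pose om t := Num.sqrt (C * (1 + A + C * X t ^+ 2)).
have om_arg t : 0 < C * (1 + A + C * X t ^+ 2).
  have : 0 <= C * X t ^+ 2 by rewrite mulr_ge0 ?sqr_ge0// ltW.
  by move=> ?; rewrite mulr_gt0//; lra.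
have om_gt0 t : 0 < om t by rewrite sqrtr_gt0.
have omE t : om t ^+ 2 = C * (1 + A + C * X t ^+ 2) by rewrite sqr_sqrtr// ltW.
pose zeta t := - cos (th t) / (b * om t).
have dzeta (t : R) : 0 <= t -> der zeta t (X t / b * om t).
  move=> t0; have dX := nX N t0; have dU := normal_dU N t0.
  rewrite /zeta /om; der_solve.
  - by apply: mulf_neq0; rewrite gt_eqF//; exact: om_gt0.
  - exact: om_arg.
  - have := normal_unit N t0; have := omE t; have := om_gt0 t; have := om_arg t.
    rewrite -/(om t) /= !expr1.
    move: (om t) (X t) (cos (th t)) => o x u oa o0 oE uE.
    have on : o != 0 by rewrite gt_eqF.
    have bn : b != 0 by rewrite gt_eqF.
    have uE' : u ^+ 2 = 1 - (A + C * x ^+ 2) ^+ 2 by lra.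
    have Cn : C != 0 by rewrite gt_eqF.
    have wn : 1 + A + C * x ^+ 2 != 0 by move: oa; rewrite pmulr_rgt0// => /gt_eqF ->.
    transitivity (C * x * (2 * (A + C * x ^+ 2) * o ^+ 2 + C * u ^+ 2) / (b * o ^+ 3)).
      by field; rewrite on bn.
    rewrite uE' (_ : o ^+ 3 = o ^+ 2 * o); last by ring.
    have -> : x / b * o = x * o ^+ 2 / (b * o) by field; rewrite on bn.
    by rewrite oE; field; rewrite wn Cn on bn.
(* The elastica is known for nonnegative times only; the speed is frozen before 0 in order to have a
   primitive on the line. *)
pose om' t := om (Num.max 0 t).
have com' : continuous om'.
  have cX : continuous (fun t : R => X (Num.max 0 t)).
    move=> t; apply: (@continuous_comp _ _ _ (fun t : R => Num.max 0 t) X).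
      by apply: continuous_max; [exact: cst_continuous|exact: cvg_id].
    by apply: (normal_Xcont N); rewrite le_max lexx.
  have c2 : continuous (fun z : R => C * (1 + A + C * z ^+ 2)).
    by apply: (@der_continuous _ _ (fun z => C * (C * (2 * z)))) => z; der_solve; rewrite /= expr1; ring.
  move=> t; apply: continuous_comp (continuous_comp (cX t) (c2 _)) _.
  exact: sqrt_continuous.
have [Om dOm] := primitive com'.
have [p0 p0pi [cp0 sp0]] : exists2 p0 : R, -pi <= p0 <= pi & cos p0 = X 0 / b /\ sin p0 = zeta 0.
  apply: unit_angle.
  have u := normal_unit N (lexx 0); have := om_gt0 0; have := omE 0.
  rewrite /zeta; move: u; move: (X 0) (cos (th 0)) (om 0) => x u o uE oE o0.
  have uE' : u ^+ 2 = (1 - (A + C * x ^+ 2)) * (1 + (A + C * x ^+ 2)).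
    by rewrite (_ : u ^+ 2 = 1 - (A + C * x ^+ 2) ^+ 2); [ring|lra].
  have bn : b != 0 by rewrite gt_eqF.
  have on : o != 0 by rewrite gt_eqF.
  have C_n : C != 0 by rewrite gt_eqF.
  have b2 : b ^+ 2 = (1 - A) / C by rewrite -bE mulrC mulKf.
  have An : 1 - A != 0 by rewrite gt_eqF// subr_gt0; case/andP: A1.
  rewrite !expr_div_n exprMn sqrrN uE' oE b2; field.
  rewrite An C_n/= andbT.
  have : C * (1 + A + C * x ^+ 2) != 0 by rewrite -oE expf_eq0 negb_and on orbT.
  by rewrite mulf_eq0 negb_or => /andP[_].
pose phi t := p0 + (Om t - Om 0).
have dphi0 (t : R) : 0 <= t -> der phi t (om t).
  by move=> t0; rewrite /phi; der_solve; rewrite /om' max_r//; ring.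
have E (t : R) : 0 <= t -> X t / b = cos (phi t) /\ zeta t = sin (phi t).
  move=> t0.
  (* Two points turning with the same speed keep their distance, which is 0 initially. *)
  pose e t := (X t / b - cos (phi t)) ^+ 2 + (zeta t - sin (phi t)) ^+ 2.
  have : e t = e 0.
    apply: der_const => // s /andP[s0 _].
    have dX := nX N s0; have dz := dzeta _ s0; have dp := dphi0 _ s0.
    rewrite /e; der_solve.
    rewrite /= !expr1 (_ : cos (th s) = - (zeta s * (b * om s))); last first.
      by rewrite /zeta; field; rewrite !gt_eqF.
    by field; rewrite gt_eqF.
  rewrite {2}/e /phi subrr addr0 cp0 sp0 !subrr expr0n addr0 /e.
  move=> /eqP; rewrite paddr_eq0 ?sqr_ge0// !sqrf_eq0 !subr_eq0.
  by move=> /andP[/eqP -> /eqP ->].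
have EX (t : R) : 0 <= t -> X t = b * cos (phi t).
  by move=> /E[<- _]; rewrite mulrC divfK// gt_eqF.
have Eom (t : R) : 0 <= t -> infl_speed C A b (phi t) = om t.
  by move=> t0; rewrite /infl_speed /om EX//; congr (Num.sqrt _); ring.
have dphi (t : R) : 0 <= t -> der phi t (infl_speed C A b (phi t)).
  by move=> t0; rewrite Eom//; exact: dphi0.
have cW : continuous (infl_speed C A b).
  have c : continuous (fun z : R => C * (1 + A + C * b ^+ 2 * cos z ^+ 2)).
    apply: (@der_continuous _ _ (fun z => - (C * (C * b ^+ 2 * (2 * cos z * sin z))))) => z.
    by der_solve; rewrite /= expr1; ring.
  by move=> z; apply: continuous_comp (c z) _; exact: sqrt_continuous.
have /andP[A1' _] := A1.
have w0 : 0 < Num.sqrt (C * (1 + A)) by rewrite sqrtr_gt0 mulr_gt0//; lra.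
have Wge p : Num.sqrt (C * (1 + A)) <= infl_speed C A b p.
  have : 0 <= C * b ^+ 2 * cos p ^+ 2 by rewrite bE mulr_ge0 ?sqr_ge0//; lra.
  by move=> ?; rewrite ler_wsqrtr// ler_pM2l//; lra.
have Wper p : infl_speed C A b (p + pi) = infl_speed C A b p.
  by rewrite /infl_speed cosDpi sqrrN.
have [T0 [kap [k0 dT0 T00 T0p T0i]]] := rotation_clock cW (fun p => lt_le_trans w0 (Wge p)) (pi_gt0 R) Wper.
exists phi, T0, kap; split => //.
  move=> t t0; have [_ zE] := E t t0.
  rewrite Eom// -zE /zeta; field; by rewrite !gt_eqF.
by rewrite /phi subrr addr0.
Qed.

Lemma infl_speed_gt0 {R : realType} `(I : @inflectional R C A X th y b phi T0 kap) p : 0 < infl_speed C A b p.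
Proof.
infl_facts I.
rewrite sqrtr_gt0 mulr_gt0// ltr_pwDl//; first by qlra.
by rewrite bE mulr_ge0 ?sqr_ge0//; qlra.
Qed.

Lemma infl_phi_shift {R : realType} `(I : @inflectional R C A X th y b phi T0 kap) {t : R} : 0 <= t -> phi (t + kap) = phi t + pi.
Proof.
infl_facts I.
exact: (rotation_shift (infl_speed_gt0 I) (iphi I) k0 (iT0 I) (iT0p I) (iT0i I)).
Qed.

Lemma infl_Xshift {R : realType} `(I : @inflectional R C A X th y b phi T0 kap) {t : R} : 0 <= t -> X (t + kap) = - X t.
Proof.
infl_facts I.
move=> t0; rewrite !(iX I)//; last by rewrite addr_ge0// ltW.
by rewrite (infl_phi_shift I)// cosDpi mulrN.
Qed.

Lemma infl_Ushift {R : realType} `(I : @inflectional R C A X th y b phi T0 kap) {t : R} : 0 <= t -> cos (th (t + kap)) = - cos (th t).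
Proof.
infl_facts I.
move=> t0; rewrite !(iU I)//; last by rewrite addr_ge0// ltW.
by rewrite (infl_phi_shift I)// sinDpi /infl_speed cosDpi sqrrN; ring.
Qed.

Lemma infl_yshift {R : realType} `(I : @inflectional R C A X th y b phi T0 kap) {t : R} : 0 <= t -> y (t + kap) = y t + (y kap - y 0).
Proof.
infl_facts I.
move=> t0.
have : y (t + kap) - y t = y (0 + kap) - y 0.
  apply: (@der_const _ (fun t => y (t + kap) - y t)) => // s /andP[s0 _].
  have sk : 0 <= s + kap by rewrite addr_ge0// ltW.
  have d1 := normal_dy N s0; have d2 := normal_dy N sk.
  by der_solve; rewrite (infl_Xshift I)// sqrrN; ring.
by rewrite add0r; qlra.
Qed.

Lemma infl_Xbound {R : realType} `(I : @inflectional R C A X th y b phi T0 kap) {t : R} : 0 <= t -> `|X t| <= b.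
Proof.
infl_facts I.
move=> t0; have c1 : `|cos (phi t)| <= 1 by rewrite ler_norml cos_geN1 cos_le1.
by rewrite (iX I)// normrM (gtr0_norm b0) -[leRHS]mulr1 ler_pM2l.
Qed.

Lemma infl_top {R : realType} `(I : @inflectional R C A X th y b phi T0 kap) : exists2 t : R, 0 <= t & X t = b /\
  forall s, t <= s <= t + kap -> cos (th s) <= 0.
Proof.
infl_facts I.
have /andP[_ p1] := iphi0 I.
(* The initial amplitude is at most [pi], so the vertex of amplitude [2 * pi] is still ahead; from
   there the sine is nonnegative for half a turn. *)
have [||| t t0 Et] := rotation_reach (iphi I) (w0 := Num.sqrt (C * (1 + A))) (p := pi *+ 2).
- by rewrite sqrtr_gt0 mulr_gt0//; qlra.
- move=> p; rewrite ler_wsqrtr// ler_pM2l// lerDl bE mulr_ge0 ?sqr_ge0//; qlra.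
- by rewrite (le_trans p1)// mulr2n lerDl pi_ge0.
exists t => //; split; first by rewrite (iX I)// Et cos2pi mulr1.
move=> s /andP[ts sk]; have s0 := le_trans t0 ts.
rewrite (iU I)// oppr_le0 mulr_ge0//; last exact/ltW/(infl_speed_gt0 I).
rewrite mulr_ge0//; first exact: ltW.
have inc := rotation_incr (infl_speed_gt0 I) (iphi I).
have le p q : 0 <= p -> p <= q -> phi p <= phi q.
  by move=> p0; rewrite le_eqVlt => /predU1P[->//|pq]; exact/ltW/inc.
have l1 : pi *+ 2 <= phi s by rewrite -Et le.
have l2 : phi s <= pi *+ 2 + pi by rewrite -Et -(infl_phi_shift I)// le.
rewrite -(subrK (pi *+ 2) (phi s)) sinD sin2pi cos2pi mulr0 addr0 mulr1.
by apply: sin_ge0_pi; apply/andP; split; qlra.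
Qed.

(** In the half period that starts at a vertex the abscissa descends through the whole hill from [b]
    to [- b] and [sqrt (1 - G ^+ 2)] equals [- cos th], so the variation of [Psi] is the integral of
    [cos th ^+ 2], known from [normal_dJ]. *)
Lemma infl_Psi {R : realType} `(I : @inflectional R C A X th y b phi T0 kap) {Psi : R -> R} :
  (forall z, der Psi z (Num.sqrt (1 - (A + C * z ^+ 2) ^+ 2))) ->
  Psi b - Psi (- b) = 2 / 3 * (kap - A * (y kap - y 0)).
Proof.
infl_facts I.
move=> dPsi; have [t t0 [Xt Us]] := (infl_top I).
pose Q s := Psi (X s) + (2 * (s - A * y s) + X s * cos (th s)) / 3.
have : Q (t + kap) = Q t.
  apply: der_const; first by rewrite lerDl ltW.
  move=> s /[dup] ss /andP[ts sk]; have s0 := le_trans t0 ts.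
  have dX := nX N s0; have dJ := normal_dJ N s0.
  apply: der_eq (derD (der_comp (dPsi (X s)) dX) dJ) _.
  have -> : Num.sqrt (1 - (A + C * X s ^+ 2) ^+ 2) = - cos (th s).
    rewrite -(normal_unit N s0) addrK sqrtr_sqr ler0_norm//; exact: Us.
  by ring.
by rewrite /Q (infl_Xshift I)// (infl_Ushift I)// (infl_yshift I)// Xt; qlra.
Qed.

Lemma infl_h_bound {R : realType} `(I : @inflectional R C A X th y b phi T0 kap) : `|y kap - y 0| <= kap.
Proof.
infl_facts I.
have E := normal_moment0 N (lexx 0) (ltW k0).
rewrite -E (le_trans (@itg_bound _ 0 kap _ 1 (ltW k0) _ _))//.
- by apply: bm_cont => t /andP[t0 _]; exact: (normal_sin_cont N).
- by move=> t _; rewrite ler_norml sin_geN1 sin_le1.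
- by rewrite subr0 mul1r.
Qed.

Lemma infl_J_gt0 {R : realType} `(I : @inflectional R C A X th y b phi T0 kap) : 0 < kap - A * (y kap - y 0).
Proof.
infl_facts I.
have /(ler_wpM2l (normr_ge0 A)) := (infl_h_bound I); rewrite -normrM.
have := ler_norm (A * (y kap - y 0)).
have : `|A| * kap < 1 * kap by rewrite ltr_pM2r// ltr_norml A_gt.
qlra.
Qed.

Lemma infl_hill {R : realType} `(I : @inflectional R C A X th y b phi T0 kap) {z : R} : `|z| <= b -> `|A + C * z ^+ 2| <= 1.
Proof.
infl_facts I.
move=> zb; have z2 : z ^+ 2 <= b ^+ 2 by rewrite -real_normK ?num_real// lerXn2r// nnegrE// ltW.
have : C * z ^+ 2 <= C * b ^+ 2 by rewrite ler_pM2l.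
have : 0 <= C * z ^+ 2 by rewrite mulr_ge0 ?sqr_ge0// ltW.
by rewrite ler_norml bE => ? ?; apply/andP; split; qlra.
Qed.

(** In the lower bound for the length, a dilation by [r] multiplies the hill by [r] and the
    quadratic coefficient by [1 / r ^+ 2]. The minimum at [r = 1] expresses that the elastica wins
    against competitors of every width. *)
Lemma cube_amgm {R : realType} (r : R) : 0 < r -> 3 / 2 <= r + (2 * r ^+ 2)^-1.
Proof.
move=> r0; rewrite -subr_ge0.
have -> : r + (2 * r ^+ 2)^-1 - 3 / 2 = (r - 1) ^+ 2 * (2 * r + 1) / (2 * r ^+ 2).
  by field; rewrite gt_eqF.
apply: divr_ge0; first by apply: mulr_ge0; [exact: sqr_ge0|qlra].
by apply: mulr_ge0 => //; exact: sqr_ge0.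
Qed.

(* The calibration is the parabola dilated about its axis so that its hill is
   exactly reached by the competitor. *)
Lemma infl_half_min {R : realType} `(I : @inflectional R C A X th y b phi T0 kap) : engel_min X (fun t => sin (th t)) kap.
Proof.
infl_facts I.
apply: (engel_min_normal N (ltW k0)) => S x w1 w2 S0 Px b2 x0 xS I0 I1 I2.
have Xk := infl_Xshift I (t := 0) (lexx 0); have Uk := infl_Ushift I (t := 0) (lexx 0).
rewrite add0r in Xk Uk.
have UX0 : X kap * cos (th kap) - X 0 * cos (th 0) = 0 by rewrite Xk Uk; ring.
have J0 := (infl_J_gt0 I).
have [t tS Ht] : exists2 t, 0 <= t <= S & forall s, 0 <= s <= S -> `|x s| <= `|x t|.
  have [t1 t1S H1] := prim_argmax S0 Px; have [t2 t2S H2] := prim_argmin S0 Px.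
  have [le|lt] := leP `|x t2| `|x t1|; [exists t1 => //|exists t2 => //] => s sS.
    rewrite ler_norml; have := H1 _ sS; have := H2 _ sS.
    move: le; rewrite ler_norml => /andP[]; have := ler_norm (x t1).
    have := ler_norm (- x t2); rewrite normrN.
    move: `|x t1| `|x t2| => a1 a2 *; apply/andP; split; qlra.
  rewrite ler_norml; have := H1 _ sS; have := H2 _ sS.
  move: lt; rewrite ltr_norml => /andP[].
  have := ler_norm (- x t2); rewrite normrN.
  move: `|x t2| => a2 *; apply/andP; split; qlra.
(* A competitor on the axis has second moment 0, while that of the half period is a positive
   multiple of [kap - A * (y kap - y 0)]. *)
have xt0 : 0 < `|x t|.
  rewrite lt_def normr_ge0 andbT; apply/negP => /eqP xt0.
  have z s : 0 <= s <= S -> x s = 0.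
    by move=> /Ht; rewrite xt0 normr_le0 => /eqP.
  have : itg 0 S (fun t => x t ^+ 2 * w2 t) = 0.
    rewrite (@itg_ext _ 0 S _ (fun=> 0)) ?itg_cst ?mul0r// => s sS.
    by rewrite z// expr0n mul0r.
  rewrite I2 UX0 subr0 => /eqP; rewrite mulf_eq0 invr_eq0 (gt_eqF J0)/= mulf_eq0.
  by rewrite (gt_eqF C0) pnatr_eq0.
have [Psi [P0 dPsi]] := cal_primitive A C.
have Podd := cal_odd P0 dPsi.
pose r := `|x t| / b.
have r0 : 0 < r by rewrite divr_gt0.
have rn : r != 0 by rewrite gt_eqF.
have dQ := scaled_calibration 0 rn dPsi.
have hill s : 0 <= s <= S -> `|A + C * 0 ^+ 2 / r ^+ 2 + (- 2 * C * 0 / r ^+ 2) * x s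
                  + C / r ^+ 2 * x s ^+ 2| <= 1.
  move=> sS; rewrite (_ : _ + _ = A + C * (x s / r) ^+ 2); last by field.
  apply: (infl_hill I); rewrite normrM normfV (gtr0_norm r0) ler_pdivrMr//.
  by rewrite /r mulrC divfK ?gt_eqF//; exact: Ht.
have main := quadratic_point dQ S0 Px b2 hill tS.
rewrite I0 I1 I2 x0 xS Xk !subr0 in main.
(* The abscissa goes from [X 0] to [- X 0] and touches an edge of the hill on the way. As [Psi] is
   odd, the two end contributions cancel, whichever edge it is. *)
have Pt : 2 * r * Psi b <= `|r * Psi (x t / r) - r * Psi (X 0 / r)| +
    `|r * Psi (- X 0 / r) - r * Psi (x t / r)|.
  rewrite mulNr Podd; have [xp|xn] := leP 0 (x t).
    have xtp : 0 < x t by move: xt0; rewrite (ger0_norm xp).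
    have -> : x t / r = b by rewrite /r ger0_norm//; field; nz.
    have := ler_norm (r * Psi b - r * Psi (X 0 / r)).
    have := ler_norm (- (r * - Psi (X 0 / r) - r * Psi b)); rewrite normrN.
    qlra.
  have -> : x t / r = - b.
    rewrite /r ltr0_norm//; field; nz.
  rewrite Podd.
  have := ler_norm (- (r * - Psi b - r * Psi (X 0 / r))); rewrite normrN.
  have := ler_norm (r * - Psi (X 0 / r) - r * - Psi b).
  qlra.
have PJ := (infl_Psi I) dPsi; rewrite Podd in PJ.
have am := ler_wpM2l (ltW J0) (cube_amgm r0).
have E : (A + C * 0 ^+ 2 / r ^+ 2) * (y kap - y 0) +
  - 2 * C * 0 / r ^+ 2 * (- (cos (th kap) - cos (th 0)) / (2 * C)) +
  C / r ^+ 2 * ((kap - A * (y kap - y 0) - (- X 0 * cos (th kap) - X 0 * cos (th 0))) / (3 * C)) =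
  A * (y kap - y 0) + (kap - A * (y kap - y 0)) * (2 * r ^+ 2)^-1 * (2 / 3).
  by rewrite Uk; field; nz.
rewrite E -addrA in main; apply: le_trans main.
move: Pt am PJ.
set J := kap - _; rewrite mulrDr.
move: (`|_| + `|_|) => a; move: (Psi b) (J * (2 * r ^+ 2)^-1) => P v Pt am PJ.
have PE : P = J / 3 by qlra.
have : 2 * r * P = J * r * (2 / 3) by rewrite PE; field.
rewrite /J in am PE *; qlra.
Qed.

Lemma normal_Xlip `{N : @normal R C A X th y} (s t : R) : 0 <= s -> s <= t ->
  `|X t - X s| <= t - s.
Proof.
move=> s0 st; have P : prim s t X (fun t => cos (th t)).
  apply: prim_der => u /andP[su _]; have u0 := le_trans s0 su; first exact: nX N _ u0.
  exact: (normal_cos_cont N).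
rewrite (prim_diff P)// -[leRHS]mul1r; apply: itg_bound => //; first exact: P.1.
by move=> u _; rewrite ler_norml cos_geN1 cos_le1.
Qed.

Lemma infl_full `(I : @inflectional R C A X th y b phi T0 kap) :
  [/\ X (2 * kap) = X 0, cos (th (2 * kap)) = cos (th 0) &
     y (2 * kap) - y 0 = 2 * (y kap - y 0)].
Proof.
infl_facts I.
have Xk := infl_Xshift I (t := 0) (lexx 0); have Uk := infl_Ushift I (t := 0) (lexx 0).
rewrite add0r in Xk Uk.
have k0' := ltW k0.
rewrite (_ : 2 * kap = kap + kap); last by ring.
by rewrite (infl_Xshift I)// (infl_Ushift I)// (infl_yshift I)// Xk Uk !opprK; split => //; ring.
Qed.

(** Over a full period the abscissa returns and the first moment is 0, so the calibration may be
    centred at the middle [m] of the range of the competitor. The displacement adds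
    [2 * (C * m ^+ 2 / r ^+ 2 * h)] to the bound, and the hypothesis on the rise makes it
    nonnegative. *)
Lemma infl_full_min `(I : @inflectional R C A X th y b phi T0 kap) :
  0 <= y kap - y 0 -> engel_min X (fun t => sin (th t)) (2 * kap).
Proof.
infl_facts I => h0.
have [X2 U2 y2] := infl_full I.
have k20 : 0 <= 2 * kap by rewrite mulr_ge0// ltW.
apply: (engel_min_normal N k20) => S x w1 w2 S0 Px b2 x0 xS I0 I1 I2.
have J0 := infl_J_gt0 I.
rewrite X2 U2 y2 ?subrr ?oppr0 ?mul0r ?subr0 ?addr0 in xS I0 I1 I2.
set h := y kap - y 0 in h0 I0 I2 J0.
have [tM tMS HM] := prim_argmax S0 Px; have [tm tmS Hm] := prim_argmin S0 Px.
(* With a constant abscissa the second moment would be a multiple of the first, which is 0; for the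
   elastica it is positive. *)
have lohi : x tm < x tM.
  rewrite lt_neqAle Hm// andbT; apply/negP => /eqP E.
  have xc s : 0 <= s <= S -> x s = X 0.
    move=> sS; have E0 : x 0 = x tM.
      by apply/eqP; rewrite eq_le HM ?lexx ?S0//= -E Hm// lexx S0.
    rewrite -x0 E0; apply/eqP; rewrite eq_le HM//= -E Hm//.
  have E1 : itg 0 S (fun t => x t * w2 t) = X 0 * itg 0 S w2.
    by rewrite -itgZ//; apply: itg_ext => t /xc ->.
  have E2 : itg 0 S (fun t => x t ^+ 2 * w2 t) = X 0 ^+ 2 * itg 0 S w2.
    by rewrite -itgZ//; apply: itg_ext => t /xc ->.
  have : itg 0 S (fun t => x t ^+ 2 * w2 t) = 0 by rewrite E2 expr2 -mulrA -E1 I1 mulr0.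
  rewrite I2 => /eqP; rewrite mulf_eq0 invr_eq0 mulf_eq0 (gt_eqF C0) pnatr_eq0/= orbF.
  by rewrite (_ : _ - _ = 2 * (kap - A * h)); [rewrite mulf_eq0 (gt_eqF J0) pnatr_eq0|ring].
pose r := (x tM - x tm) / (2 * b); pose m := (x tM + x tm) / 2.
have r0 : 0 < r by rewrite divr_gt0 ?subr_gt0// mulr_gt0.
have rn : r != 0 by rewrite gt_eqF.
have rbE : r * b = (x tM - x tm) / 2 by rewrite /r; field; nz.
have [Psi [P0 dPsi]] := cal_primitive A C.
have dQ := scaled_calibration m rn dPsi.
have hill s : 0 <= s <= S -> `|A + C * m ^+ 2 / r ^+ 2 + (- 2 * C * m / r ^+ 2) * x s
                  + C / r ^+ 2 * x s ^+ 2| <= 1.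
  move=> sS; rewrite (_ : _ + _ = A + C * ((x s - m) / r) ^+ 2); last by field.
  apply: (infl_hill I); rewrite normrM normfV (gtr0_norm r0) ler_pdivrMr// mulrC rbE.
  by rewrite ler_norml /m; have := HM _ sS; have := Hm _ sS; move=> ? ?; apply/andP; split; qlra.
have main := quadratic_range dQ S0 Px b2 hill tMS tmS (etrans x0 (esym xS)).
have Eb : (x tM - m) / r = b by rewrite (_ : x tM - m = r * b); [field|rewrite rbE /m; field].
have Eb' : (x tm - m) / r = - b by rewrite (_ : x tm - m = - (r * b)); [field|rewrite rbE /m; field].
rewrite Eb Eb' I0 I1 I2 in main; apply: le_trans main.
have PJ := infl_Psi I dPsi; rewrite -/h in PJ.
have am := ler_wpM2l (ltW J0) (cube_amgm r0).
have hm : 0 <= C * m ^+ 2 / r ^+ 2 * h.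
  by rewrite mulr_ge0// divr_ge0 ?sqr_ge0// mulr_ge0 ?sqr_ge0// ltW.
rewrite mulr0 addr0 -mulrBr PJ.
have -> : (A + C * m ^+ 2 / r ^+ 2) * (2 * h) +
  C / r ^+ 2 * ((2 * kap - A * (2 * h)) / (3 * C)) +
  2 * (r * (2 / 3 * (kap - A * h))) =
  2 * A * h + 2 * (C * m ^+ 2 / r ^+ 2 * h) + (kap - A * h) * (r + (2 * r ^+ 2)^-1) * (4 / 3).
  by field; nz.
move: hm am; set u := _ * h; set v := _ * (_ + _); qlra.
Qed.

(** * Beyond half a period when the ordinate falls only a little *)

(** The right-hand side is the integral of [(al + be * z + ga * z ^+ 2) ^+ 2] over [u, v]. In the
    Legendre basis about the midpoint it is a sum of three squares; the one of degree 1 is kept. *)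
Lemma quadratic_square_gain {R : realType} (al be ga u v : R) : u <= v ->
  (v - u) ^+ 3 / 12 * (be + ga * (u + v)) ^+ 2 <=
  (al ^+ 2 * v + al * be * v ^+ 2 + (be ^+ 2 + 2 * al * ga) * v ^+ 3 / 3
     + be * ga * v ^+ 4 / 2 + ga ^+ 2 * v ^+ 5 / 5)
  - (al ^+ 2 * u + al * be * u ^+ 2 + (be ^+ 2 + 2 * al * ga) * u ^+ 3 / 3
     + be * ga * u ^+ 4 / 2 + ga ^+ 2 * u ^+ 5 / 5).
Proof.
move=> uv; rewrite -subr_ge0.
set c := (u + v) / 2; set l := v - u.
have uE : u = c - l / 2 by rewrite /c /l; field.
have vE : v = c + l / 2 by rewrite /c /l; field.
have l0 : 0 <= l by rewrite subr_ge0.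
clearbody c l; rewrite {}uE {}vE.
set w := (X in 0 <= X).
have -> : w = l * (al + be * c + ga * c ^+ 2 + ga * l ^+ 2 / 12) ^+ 2 +
   ga ^+ 2 * l ^+ 5 / 180 by rewrite /w; field.
apply: addr_ge0; first by rewrite mulr_ge0 ?sqr_ge0.
by rewrite divr_ge0// mulr_ge0 ?sqr_ge0 ?exprn_ge0.
Qed.

(** Since the abscissa has speed at most 1, the integral in time dominates the integral over the
    abscissas swept, up to sign. *)
Lemma normal_square_gain `{N : @normal R C A X th y} (al be ga s t : R) :
  0 <= s -> s <= t ->
  `|X t - X s| ^+ 3 / 12 * (be + ga * (X s + X t)) ^+ 2 <=
  itg s t (fun u => (al + be * X u + ga * X u ^+ 2) ^+ 2).
Proof.
move=> s0 st.
pose Q (z : R) := al ^+ 2 * z + al * be * z ^+ 2 + (be ^+ 2 + 2 * al * ga) * z ^+ 3 / 3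
     + be * ga * z ^+ 4 / 2 + ga ^+ 2 * z ^+ 5 / 5.
have dQ u : 0 <= u -> der (fun u => Q (X u)) u ((al + be * X u + ga * X u ^+ 2) ^+ 2 * cos (th u)).
  move=> u0; have dX := nX N u0; rewrite /Q; der_solve; rewrite /=; by field.
have cq u : 0 <= u -> {for u, continuous (fun u => (al + be * X u + ga * X u ^+ 2) ^+ 2)}.
  move=> u0; have dX := nX N u0.
  apply: (@der_cont _ _ _ (2 * (al + be * X u + ga * X u ^+ 2) * (be * cos (th u) + ga * (2 * X u * cos (th u))))).
  by der_solve; rewrite /= !expr1; ring.
have bq : bm s t (fun u => (al + be * X u + ga * X u ^+ 2) ^+ 2).
  by apply: bm_cont => u /andP[su _]; apply: cq; exact: le_trans su.
have EQ : Q (X t) - Q (X s) = itg s t (fun u => (al + be * X u + ga * X u ^+ 2) ^+ 2 * cos (th u)).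
  rewrite (@itg_FTC _ s t (fun u => Q (X u)) _ st); first by [].
    by move=> u /andP[su _]; apply: dQ; exact: le_trans su.
  move=> u /andP[su _]; have u0 := le_trans s0 su.
  by apply: continuousM; [exact: cq|exact: (normal_cos_cont N)].
have bc : bm s t (fun u => cos (th u)).
  by apply: bm_cont => u /andP[su _]; apply: (normal_cos_cont N); exact: le_trans su.
have H (e : R) : e ^+ 2 = 1 -> e * (Q (X t) - Q (X s)) <=
   itg s t (fun u => (al + be * X u + ga * X u ^+ 2) ^+ 2).
  move=> e1; rewrite EQ -itgZ; last exact: bmM.
  apply: itg_le => //; first by apply: bmM; [exact: bm_cst|exact: bmM].
  move=> u _; rewrite mulrCA ler_piMr ?sqr_ge0//.
  rewrite (le_trans (ler_norm _))// normrM.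
  have -> : `|e| = 1 by apply/eqP; rewrite -sqrp_eq1// real_normK ?num_real// e1.
  by rewrite mul1r ler_norml cos_geN1 cos_le1.
have [le|/ltW le] := leP (X s) (X t).
  rewrite ger0_norm ?subr_ge0//; apply: le_trans (H 1 (expr1n _ _)).
  by rewrite mul1r; exact: quadratic_square_gain.
rewrite distrC ger0_norm ?subr_ge0// (addrC (X s) (X t)).
apply: le_trans (H (-1) _); last by rewrite sqrrN expr1n.
by rewrite mulN1r opprB; exact: quadratic_square_gain.
Qed.

(** The right-hand side is [3 * Psi b]. Put [u = C * z ^+ 2 * (1 - A - C * z ^+ 2)]: for nonpositive
    [A] one has [u <= 1 - (A + C * z ^+ 2) ^+ 2 <= 1], so the integrand of [Psi] is at least [u],
    whose integral up to [b] is [2 / 15 * C ^+ 2 * b ^+ 5]. *)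
Lemma infl_J_ge `(I : @inflectional R C A X th y b phi T0 kap) : A <= 0 ->
  2 / 5 * (C * b ^+ 3) <= kap - A * (y kap - y 0).
Proof.
infl_facts I => A0.
have [Psi [P0 dPsi]] := cal_primitive A C.
have := infl_Psi I dPsi; rewrite (cal_odd P0 dPsi) => PJ.
pose L (z : R) := C ^+ 2 * (b ^+ 2 * z ^+ 3 / 3 - z ^+ 5 / 5).
have := @der_le_incr _ L Psi (fun z => C ^+ 2 * (b ^+ 2 * z ^+ 2 - z ^+ 4)) _ 0 b (ltW b0) _ (fun z _ => dPsi z).
have L0 : L 0 = 0 by rewrite /L; ring.
rewrite P0 L0 !subr0 => H.
have {H} : L b <= Psi b.
  apply: H => [z _|z /andP[z0 zb]]; first by rewrite /L; der_solve; rewrite /=; by field.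
  have z2 : z ^+ 2 <= b ^+ 2 by rewrite lerXn2r// ?nnegrE; exact: ltW.
  have Cz : C * z ^+ 2 <= C * b ^+ 2 by rewrite ler_pM2l.
  have Cz0 : 0 <= C * z ^+ 2 by rewrite mulr_ge0 ?sqr_ge0// ltW.
  apply: le_sqrt; set u := C ^+ 2 * _.
  have u0 : 0 <= u.
    rewrite /u (_ : _ - _ = z ^+ 2 * (b ^+ 2 - z ^+ 2)); last by ring.
    by rewrite mulr_ge0 ?sqr_ge0// mulr_ge0 ?sqr_ge0// subr_ge0.
  have uF : u <= 1 - (A + C * z ^+ 2) ^+ 2.
    have -> : u = (C * z ^+ 2) * (1 - A - C * z ^+ 2) by rewrite -bE /u; ring.
    have -> : 1 - (A + C * z ^+ 2) ^+ 2 = (1 + A + C * z ^+ 2) * (1 - A - C * z ^+ 2) by ring.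
    by rewrite ler_wpM2r//; qlra.
  have u1 : u <= 1 by rewrite (le_trans uF)// lerBlDr lerDl sqr_ge0.
  by rewrite (le_trans _ uF)// expr2 ler_piMl.
have -> : L b = 2 / 15 * (C * b ^+ 2) * (C * b ^+ 3) by rewrite /L; field.
rewrite bE => H.
have Cb : 0 <= C * b ^+ 3 by rewrite mulr_ge0 ?exprn_ge0// ltW.
have : C * b ^+ 3 <= (1 - A) * (C * b ^+ 3) by rewrite ler_peMl//; qlra.
qlra.
Qed.

Lemma infl_A_neg `(I : @inflectional R C A X th y b phi T0 kap) :
  y kap - y 0 < 0 -> A < 0.
Proof.
infl_facts I => h0; rewrite ltNge; apply/negP => A0.
have := @der_le _ y (fun t => A + C * X t ^+ 2) 0 kap (ltW k0) _ _.
suff H : y 0 <= y kap by move: h0; rewrite subr_lt0 ltNge H.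
apply: (@der_le _ y (fun t => A + C * X t ^+ 2) 0 kap (ltW k0)) => t /andP[t0 _].
  exact: (normal_dy N).
by rewrite addr_ge0// mulr_ge0 ?sqr_ge0// ltW.
Qed.

(** With [w = 1 + sin th], between 0 and 2, [w ^+ 2 <= 2 * w] bounds [w] by [3 / 2 * b] times the
    speed of the amplitude, which advances by [pi < 4] in half a period. A negative rise thus
    controls the half period: [kap] is at most [6 * b] plus the fall. *)
Lemma infl_kap_upper `(I : @inflectional R C A X th y b phi T0 kap) : A <= 0 ->
  kap + (y kap - y 0) <= 6 * b.
Proof.
infl_facts I => A0.
have Cb : 1 <= C * b ^+ 2 by rewrite bE; qlra.
have H := @der_le_incr _ (fun t => t + y t) (fun t => 3 / 2 * b * phi t)
   (fun t => 1 + (A + C * X t ^+ 2)) (fun t => 3 / 2 * b * infl_speed C A b (phi t)) 0 kap (ltW k0).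
have {H} : kap + y kap - (0 + y 0) <= 3 / 2 * b * phi kap - 3 / 2 * b * phi 0.
  apply: H => t /andP[t0 _].
  - by have d := normal_dy N t0; der_solve.
  - by have d := iphi I t0; der_solve; ring.
  - set w := 1 + _; have t0' := ltW t0.
    have w2 : w <= 2.
      have := infl_hill I (infl_Xbound I t0'); rewrite ler_norml => /andP[_]; rewrite /w; qlra.
    have w0 : 0 <= w.
      have := infl_hill I (infl_Xbound I t0'); rewrite ler_norml => /andP[+ _]; rewrite /w; qlra.
    have -> : infl_speed C A b (phi t) = Num.sqrt (C * w).
      by rewrite /infl_speed /w (iX I)//; congr Num.sqrt; ring.
    have b0' := ltW b0.
    rewrite -(ler_pXn2r (n := 2))// ?nnegrE ?mulr_ge0 ?sqrtr_ge0//.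
    rewrite exprMn sqr_sqrtr; last by rewrite mulr_ge0// ltW.
    rewrite (_ : (3 / 2 * b) ^+ 2 * (C * w) = 9 / 4 * (C * b ^+ 2) * w); last by field.
    by rewrite expr2 ler_wpM2r//; qlra.
rewrite -[in phi kap](add0r kap) (infl_phi_shift I)// => H.
have : pi < 4 :> R by have := pihalf_lt2 R; qlra.
have b0' := b0; nra.
Qed.

Lemma itg_shift {R : realType} (F f : R -> R) (S T r : R) : 0 <= T -> 0 <= r ->
  (forall t, 0 <= t -> der F t (f t)) -> (forall t, 0 <= t -> {for t, continuous f}) ->
  itg S (S + r) (fun t => f (t - S + T)) = itg T (T + r) f.
Proof.
move=> T0 r0 dF cf.
rewrite (@itg_FTC _ T (T + r) F); last 3 first.
- by rewrite lerDl.
- by move=> t /andP[Tt _]; apply: dF; exact: le_trans Tt.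
- by move=> t /andP[Tt _]; apply: cf; exact: le_trans Tt.
rewrite (@itg_FTC _ S (S + r) (fun t => F (t - S + T))); last 3 first.
- by rewrite lerDl.
- move=> t /andP[St _]; have t0 : 0 <= t - S + T by rewrite addr_ge0// subr_ge0.
  by have d := dF _ t0; der_solve; ring.
- move=> t /andP[St _]; have t0 : 0 <= t - S + T by rewrite addr_ge0// subr_ge0.
  apply: (@continuous_comp _ _ _ (fun t => t - S + T) f); last exact: cf.
  by apply: (@der_cont _ _ _ 1); der_solve; ring.
by rewrite subrr add0r (_ : S + r - S + T = T + r)//; ring.
Qed.

(** In the second half period an edge [b] or [- b] is reached, and one of the opposite end values
    [X kap], [X (2 * kap)] is at distance at least [b] from it. Moving the start by [b / 2] loses at
    most [b / 2], as the speed is at most 1. *)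
Lemma infl_rest_spread `(I : @inflectional R C A X th y b phi T0 kap) :
  exists s t, [/\ kap + b / 2 <= s, s <= t, t <= 2 * kap & b / 2 <= `|X t - X s|].
Proof.
infl_facts I.
have k0' := ltW k0.
have kk : 0 <= kap + kap by rewrite addr_ge0.
have cU t : kap <= t <= 2 * kap -> {for t, continuous (fun t => cos (th t))}.
  by move=> /andP[kt _]; apply: (normal_cos_cont N); exact: le_trans kt.
have k2k : kap <= 2 * kap by qlra.
have [|t /andP[kt t2k] Ut] := ivt k2k (within_cont cU).
  rewrite (_ : 2 * kap = kap + kap); last by ring.
  by rewrite (infl_Ushift I)// mulrN oppr_le0 -expr2 sqr_ge0.
have t0 := le_trans k0' kt.
have X2k : X (2 * kap) = - X kap.
  by rewrite (_ : 2 * kap = kap + kap); [rewrite (infl_Xshift I)|ring].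
have Xt : `|X t| = b.
  have := normal_unit N t0; rewrite Ut expr0n add0r => /eqP.
  rewrite sqrf_eq1 => /orP[] /eqP E; last first.
    have : 0 <= C * X t ^+ 2 by rewrite mulr_ge0 ?sqr_ge0// ltW.
    by move: E => /eqP; rewrite (_ : (_ == _) = (A + C * X t ^+ 2 + 1 == 0)); [move=> /eqP; qlra|rewrite -subr_eq0 opprK].
  have E' : C * X t ^+ 2 = C * b ^+ 2 by rewrite bE; qlra.
  have E2 : X t ^+ 2 = b ^+ 2 by apply: (mulfI _ E'); rewrite gt_eqF.
  by apply/eqP; rewrite -(eqrXn2 (n := 2))// ?ltW// real_normK ?num_real// E2.
have lip s u : kap <= s -> s <= u -> `|X u - X s| <= u - s.
  by move=> ks su; apply: (normal_Xlip (N := N)) => //; exact: le_trans ks.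
have kb : 2 * b <= kap.
  have [t1 t10 [Xt1 _]] := infl_top I.
  have := normal_Xlip (N := N) t10 (_ : t1 <= t1 + kap).
  rewrite lerDl => /(_ k0'); rewrite (infl_Xshift I)// Xt1.
  rewrite -opprD normrN ger0_norm; last by rewrite addr_ge0// ltW.
  qlra.
have far : b <= `|X (2 * kap) - X t| \/ b <= `|X t - X kap|.
  rewrite X2k; have [Xp|Xn] := leP 0 (X t); [rewrite ger0_norm// in Xt|rewrite ltr0_norm// in Xt];
  rewrite !ler_normr; have [?|?] := leP 0 (X kap).
  - by left; apply/orP; right; qlra.
  - by right; apply/orP; left; qlra.
  - by right; apply/orP; right; qlra.
  - by left; apply/orP; left; qlra.
have [Tt|tT] := leP (kap + b / 2) t.
  case: far => far; first by exists t, (2 * kap); split => //; qlra.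
  exists (kap + b / 2), t; split => //.
  have := lip kap (kap + b / 2) (lexx _) _.
  rewrite lerDl => /(_ ltac:(qlra)) h1.
  have := ler_distD (X (kap + b / 2)) (X t) (X kap); qlra.
case: far => far.
  exists (kap + b / 2), (2 * kap); split => //; first by qlra.
  have := lip t (kap + b / 2) kt (ltW tT).
  have := ler_distD (X (kap + b / 2)) (X (2 * kap)) (X t); qlra.
have := lip kap t (lexx _) kt; qlra.
Qed.

(** The displacement cost on the left is paid by the dilation defect and by the misfit on the added
    arc. For [r > 2] the dilation defect suffices, [m] being at most [b * (1 + r)]. Otherwise [m] is
    split into [d] and [(1 - r ^+ 2) * c]: the misfit pays for the square of [d], the dilation for
    the rest. The constant is [384 = 2 * 6 * 4 * 8], from [r ^+ 2 <= 4] and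
    [(b / 2) ^+ 3 = b ^+ 3 / 8]. *)
Lemma near_gain_arith {R : realFieldType} (C b J H r m c l : R) :
  0 < C -> 0 < b -> 1 <= C * b ^+ 2 -> 2 / 5 * (C * b ^+ 3) <= J ->
  0 <= H -> H <= b / 384 -> 0 < r -> `|m| <= b * (1 + r) -> `|c| <= b -> b / 2 <= l ->
  C * m ^+ 2 * H <= 2 / 3 * J * (r - 1) ^+ 2 * (2 * r + 1) +
    C ^+ 2 * l ^+ 3 / (6 * r ^+ 2) * (m - (1 - r ^+ 2) * c) ^+ 2.
Proof.
move=> C0 b0 Cb J0 H0 Hb r0 mb cb lb.
have l0 : 0 < l by qlra.
have g0 : 0 <= C ^+ 2 * l ^+ 3 / (6 * r ^+ 2) * (m - (1 - r ^+ 2) * c) ^+ 2.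
  by rewrite mulr_ge0 ?sqr_ge0// divr_ge0 ?mulr_ge0 ?sqr_ge0 ?exprn_ge0 ?ltW.
have Cb3 : 0 < C * b ^+ 3 by rewrite mulr_gt0// exprn_gt0.
have [r2|r2] := leP r 2; last first.
  have m2 : m ^+ 2 <= b ^+ 2 * (1 + r) ^+ 2.
    rewrite -exprMn -real_normK ?num_real// lerXn2r// ?nnegrE// mulr_ge0 ?ltW//; qlra.
  have s1 : C * m ^+ 2 * H <= C * (b ^+ 2 * (1 + r) ^+ 2) * (b / 384).
    apply: ler_pM => //; first by rewrite mulr_ge0 ?sqr_ge0// ltW.
    by rewrite ler_pM2l.
  have s2 : 2 / 3 * (2 / 5 * (C * b ^+ 3)) * (r - 1) ^+ 2 * 5 <= 2 / 3 * J * (r - 1) ^+ 2 * (2 * r + 1).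
    apply: ler_pM; [|qlra| |qlra].
      by rewrite mulr_ge0 ?sqr_ge0//; qlra.
    by rewrite ler_wpM2r ?sqr_ge0//; qlra.
  have s3 : (1 + r) ^+ 2 <= 9 * (r - 1) ^+ 2.
    rewrite -subr_ge0 (_ : _ - _ = 4 * (r - 2) * (2 * r - 1)); last by ring.
    by rewrite !mulr_ge0//; qlra.
  have s4 : C * b ^+ 3 * (1 + r) ^+ 2 <= C * b ^+ 3 * (9 * (r - 1) ^+ 2) by rewrite ler_pM2l.
  have e1 : C * (b ^+ 2 * (1 + r) ^+ 2) * (b / 384) = (C * b ^+ 3 * (1 + r) ^+ 2) / 384 by field.
  have e2 : 2 / 3 * (2 / 5 * (C * b ^+ 3)) * (r - 1) ^+ 2 * 5 = 4 / 27 * (C * b ^+ 3 * (9 * (r - 1) ^+ 2)) by field.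
  have p : 0 <= C * b ^+ 3 * (9 * (r - 1) ^+ 2) by rewrite mulr_ge0 ?(ltW Cb3)// mulr_ge0 ?sqr_ge0.
  rewrite e1 in s1; rewrite e2 in s2; move: s1 s2 s4 p g0.
  by move: (C * b ^+ 3 * _) (C * b ^+ 3 * _) => u v; qlra.
set d := m - (1 - r ^+ 2) * c in g0 *.
have mE : m = d + (1 - r ^+ 2) * c by rewrite /d; ring.
have m2 : m ^+ 2 <= 2 * d ^+ 2 + 2 * ((1 - r ^+ 2) * c) ^+ 2.
  rewrite mE -subr_ge0 (_ : _ - _ = (d - (1 - r ^+ 2) * c) ^+ 2) ?sqr_ge0//; ring.
have CH0 : 0 <= C * H by rewrite mulr_ge0// ltW.
have l3 : b ^+ 3 / 8 <= l ^+ 3.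
  rewrite (_ : b ^+ 3 / 8 = (b / 2) ^+ 3); last by field.
  by rewrite lerXn2r// ?nnegrE; qlra.
have s1 : 2 * (C * H) * d ^+ 2 <= C ^+ 2 * l ^+ 3 / (6 * r ^+ 2) * d ^+ 2.
  apply: ler_wpM2r; first exact: sqr_ge0.
  rewrite ler_pdivlMr; last by rewrite mulr_gt0// exprn_gt0.
  have r4 : r ^+ 2 <= 4 by rewrite -subr_ge0 (_ : _ - _ = (2 - r) * (2 + r)); [rewrite mulr_ge0; qlra|ring].
  have t1 : 2 * (C * H) * (6 * r ^+ 2) <= 2 * (C * H) * (6 * 4).
    by apply: ler_wpM2l; [qlra|rewrite ler_pM2l].
  have t2 : C * H <= C * (b / 384) by rewrite ler_pM2l.
  have t3 : C * (b / 8) <= C ^+ 2 * (b ^+ 3 / 8).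
    rewrite (_ : C ^+ 2 * (b ^+ 3 / 8) = (C * (b / 8)) * (C * b ^+ 2)); last by field.
    by rewrite ler_peMr// mulr_ge0 ?ltW//; qlra.
  have t4 : C ^+ 2 * (b ^+ 3 / 8) <= C ^+ 2 * l ^+ 3 by rewrite ler_pM2l// exprn_gt0.
  move: t1 t2 t3 t4; rewrite !(mulrA C b) mulrA; move: (C * H) (C * b) (C ^+ 2 * _) (C ^+ 2 * _) => ? ? ? ?; qlra.
have s2 : 2 * (C * H) * ((1 - r ^+ 2) * c) ^+ 2 <= 2 / 3 * J * (r - 1) ^+ 2 * (2 * r + 1).
  have c2 : c ^+ 2 <= b ^+ 2 by rewrite -real_normK ?num_real// lerXn2r// nnegrE// ltW.
  have -> : 2 * (C * H) * ((1 - r ^+ 2) * c) ^+ 2 = 2 * (C * H) * (c ^+ 2 * (1 + r) ^+ 2) * (r - 1) ^+ 2 by ring.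
  have -> : 2 / 3 * J * (r - 1) ^+ 2 * (2 * r + 1) = 2 / 3 * J * (2 * r + 1) * (r - 1) ^+ 2 by ring.
  apply: ler_wpM2r; first exact: sqr_ge0.
  have t1 : c ^+ 2 * (1 + r) ^+ 2 <= b ^+ 2 * 9.
    apply: ler_pM; rewrite ?sqr_ge0//.
    by rewrite -subr_ge0 (_ : _ - _ = (2 - r) * (4 + r)); [rewrite mulr_ge0; qlra|ring].
  have t2 : C * H <= C * (b / 384) by rewrite ler_pM2l.
  have t3 : 2 * (C * H) * (c ^+ 2 * (1 + r) ^+ 2) <= 2 * (C * (b / 384)) * (b ^+ 2 * 9).
    apply: ler_pM => //; [qlra|by rewrite mulr_ge0 ?sqr_ge0|qlra].
  have t4 : 2 / 3 * (2 / 5 * (C * b ^+ 3)) <= 2 / 3 * J * (2 * r + 1).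
    rewrite -[leLHS]mulr1; apply: ler_pM; qlra.
  have e : 2 * (C * (b / 384)) * (b ^+ 2 * 9) = 3 / 64 * (C * b ^+ 3) by field.
  qlra.
have : C * H * m ^+ 2 <= C * H * (2 * d ^+ 2 + 2 * ((1 - r ^+ 2) * c) ^+ 2) by rewrite ler_wpM2l.
rewrite (_ : C * m ^+ 2 * H = C * H * m ^+ 2); last by ring.
move: s1 s2; set u := ((1 - _) * c) ^+ 2; set v := d ^+ 2.
rewrite (_ : C * H * (2 * v + 2 * u) = 2 * (C * H) * v + 2 * (C * H) * u); last by ring.
by move: (_ * v) (_ * u) => ? ?; qlra.
Qed.

(** For unit vectors, 1 minus the inner product is half the squared distance; the second component
    of the distance is the surplus. *)
Lemma square_gain_cal {R : realFieldType} (sg f g c s : R) : sg ^+ 2 = 1 ->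
  f ^+ 2 = 1 - g ^+ 2 -> c ^+ 2 + s ^+ 2 = 1 ->
  g * s + sg * f * c + 1 / 2 * (g - s) ^+ 2 <= 1.
Proof.
move=> sg2 f2 cs; rewrite -subr_ge0 (_ : _ - _ = (sg * f - c) ^+ 2 / 2).
  by rewrite divr_ge0 ?sqr_ge0.
have E2 : (sg * f) ^+ 2 = 1 - g ^+ 2 by rewrite exprMn sg2 mul1r.
have -> : (sg * f - c) ^+ 2 = (sg * f) ^+ 2 - 2 * sg * f * c + c ^+ 2 by ring.
rewrite E2; have s2 : s ^+ 2 = 1 - c ^+ 2 by lra.
have -> : 1 / 2 * (g - s) ^+ 2 = (g ^+ 2 - 2 * g * s + s ^+ 2) / 2 by field.
by rewrite s2; field.
Qed.

(** Here [P] is the length of the competitor, so [P + (2 * kap - T)] is that of its completion, and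
    [Q] is the integral of the squared misfit. Divided by [r ^+ 2], the estimate of
    [near_gain_arith] is exactly what the calibration of the completion needs to give [T <= P]. *)
Lemma near_final {R : realFieldType} (A C kap h r m c l T P Q be ga p q : R) :
  r != 0 -> 0 < r -> C != 0 ->
  C * m ^+ 2 * - (2 * h) <= 2 / 3 * (kap - A * h) * (r - 1) ^+ 2 * (2 * r + 1) +
    C ^+ 2 * l ^+ 3 / (6 * r ^+ 2) * (m - (1 - r ^+ 2) * c) ^+ 2 ->
  l ^+ 3 / 12 * (be + ga * (2 * c)) ^+ 2 <= Q ->
  be = - 2 * C * m / r ^+ 2 -> ga = C / r ^+ 2 - C -> p - q = 2 / 3 * (kap - A * h) ->
  (A + C * m ^+ 2 / r ^+ 2) * (2 * h) + be * 0 +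
  C / r ^+ 2 * ((2 * kap - A * (2 * h)) / (3 * C)) +
  2 * (r * p - r * q) + 1 / 2 * Q <= P + (2 * kap - T) -> T <= P.
Proof.
move=> rn r0 Cn near + bE; rewrite bE => gain ga_ pq main.
rewrite {}ga_ (_ : _ + _ = - (2 * C * (m - (1 - r ^+ 2) * c)) / r ^+ 2) in gain; last by field.
rewrite -(ler_pM2r (_ : 0 < (r ^+ 2)^-1)) in near; last by rewrite invr_gt0 exprn_gt0.
move: main; rewrite mulr0 addr0 -mulrBr pq => main.
have e1 : (- (2 * C * (m - (1 - r ^+ 2) * c)) / r ^+ 2) ^+ 2 * (l ^+ 3 / 12) =
  2 * (C ^+ 2 * l ^+ 3 / (6 * r ^+ 2) * (m - (1 - r ^+ 2) * c) ^+ 2 * (r ^+ 2)^-1) by field.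
rewrite mulrC e1 in gain.
have e2 : (A + C * m ^+ 2 / r ^+ 2) * (2 * h) + C / r ^+ 2 * ((2 * kap - A * (2 * h)) / (3 * C))
   + 2 * (r * (2 / 3 * (kap - A * h))) =
   2 * kap - C * m ^+ 2 * - (2 * h) / r ^+ 2 +
   2 / 3 * (kap - A * h) * (r - 1) ^+ 2 * (2 * r + 1) / r ^+ 2 by field; rewrite rn Cn.
rewrite mulrDl in near.
move: near gain main; rewrite e2; lra.
Qed.

(* The competitor is completed by the rest of the elastica to a full period,
   and the calibration is not sharp on that rest. *)
Lemma infl_near_min {R : realType} `(I : @inflectional R C A X th y b phi T0 kap) :
  y kap - y 0 < 0 -> - (2 * (y kap - y 0)) <= b / 384 ->
  engel_min X (fun t => sin (th t)) (kap + b / 2).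
Proof.
infl_facts I => hneg hb.
have A0 := ltW (infl_A_neg I hneg).
have [s1 [s2 [Ts1 s12 s2k spread]]] := infl_rest_spread I.
have [X2 U2 y2] := infl_full I.
set T := kap + b / 2 in Ts1 *.
have T0' : 0 <= T by rewrite addr_ge0 ?divr_ge0// ltW.
have s10 := le_trans T0' Ts1.
have T2k : T <= 2 * kap := le_trans Ts1 (le_trans s12 s2k).
apply: (engel_min_normal N T0') => S x w1 w2 S0 Px b2 x0 xS I0 I1 I2.
have J0 := infl_J_gt0 I; have Jge := infl_J_ge I A0.
set h := y kap - y 0 in hneg hb J0 Jge y2.
pose r0 := 2 * kap - T.
have r0_ge0 : 0 <= r0 by rewrite subr_ge0.
have SS : S <= S + r0 by rewrite lerDl.
have S'0 : 0 <= S + r0 by rewrite addr_ge0.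
pose sh t := t - S + T.
have sh0 (t : R) : S <= t -> 0 <= sh t by move=> St; rewrite addr_ge0// subr_ge0.
have csh (t : R) : {for t, continuous sh} by apply: (@der_cont _ _ _ 1); rewrite /sh; der_solve; ring.
have csh_comp (g : R -> R) : (forall t : R, 0 <= t -> {for t, continuous g}) ->
   forall t : R, S <= t <= S + r0 -> {for t, continuous (fun t => g (sh t))}.
  by move=> cg t /andP[St _]; apply: continuous_comp (csh t) (cg _ (sh0 _ St)).
(* Completion of the competitor by the elastica on [T, 2 * kap], run at shifted times: the moments
   become those of a full period. *)
pose x' t := if t <= S then x t else X (sh t).
pose w1' t := if t <= S then w1 t else cos (th (sh t)).
pose w2' t := if t <= S then w2 t else sin (th (sh t)).
have bX2 : bm S (S + r0) (fun t => X (sh t)).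
  by apply: bm_cont; exact: csh_comp (normal_Xcont N).
have bs2 : bm S (S + r0) (fun t => sin (th (sh t))).
  by apply: bm_cont; exact: csh_comp (normal_sin_cont N).
have bc2 : bm S (S + r0) (fun t => cos (th (sh t))).
  by apply: bm_cont; exact: csh_comp (normal_cos_cont N).
have Px' : prim 0 (S + r0) x' w1'.
  apply: prim_glue => //; last by rewrite xS /sh subrr add0r.
  apply: prim_der; last exact: csh_comp (normal_cos_cont N).
  move=> t /andP[St _]; have d := nX N (sh0 _ St).
  rewrite /sh in d *; der_solve; ring.
have b2' : bm 0 (S + r0) w2' by exact: bm_glue.
have bx := prim_bm Px.
have split2 : S + r0 - S + T = 2 * kap by rewrite /r0; ring.
have shiftE (F f : R -> R) : (forall t : R, 0 <= t -> der F t (f t)) ->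
    (forall t : R, 0 <= t -> {for t, continuous f}) ->
    itg S (S + r0) (fun t => f (sh t)) = itg T (2 * kap) f.
  move=> dF cf; rewrite (_ : 2 * kap = T + r0); last by rewrite /r0; ring.
  exact: (itg_shift S T0' r0_ge0 dF cf).
have m0 : itg 0 (S + r0) w2' = 2 * h.
  rewrite itg_glue// I0 (shiftE y (fun t => sin (th t)) (ny N) (normal_sin_cont N)).
  by rewrite (normal_moment0 N T0' T2k) -y2; ring.
have m1 : itg 0 (S + r0) (fun t => x' t * w2' t) = 0.
  rewrite (@itg_ext _ _ _ _ (fun t => if t <= S then x t * w2 t else X (sh t) * sin (th (sh t)))); last first.
    by move=> t _; rewrite /x' /w2'; case: ifP.
  rewrite itg_glue//; [|exact: bmM|exact: bmM].
  rewrite I1 (shiftE (fun t => - cos (th t) / (2 * C)) (fun t => X t * sin (th t))).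
  - by rewrite (normal_moment1 N T0' T2k) U2; field; nz.
  - by move=> t t0; have d := normal_dU N t0; der_solve; rewrite (nF N)//; field; nz.
  - by move=> t t0; apply: continuousM; [exact: (normal_Xcont N)|exact: (normal_sin_cont N)].
have m2 : itg 0 (S + r0) (fun t => x' t ^+ 2 * w2' t) = (2 * kap - A * (2 * h)) / (3 * C).
  rewrite (@itg_ext _ _ _ _ (fun t => if t <= S then x t ^+ 2 * w2 t else X (sh t) ^+ 2 * sin (th (sh t)))); last first.
    by move=> t _; rewrite /x' /w2'; case: ifP.
  rewrite itg_glue//; [|by apply: bmM => //; exact: bmX|by apply: bmM => //; exact: bmX].
  rewrite I2 (shiftE (fun t => (t - A * y t - X t * cos (th t)) / (3 * C)) (fun t => X t ^+ 2 * sin (th t))).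
  - by rewrite (normal_moment2 N T0' T2k) X2 U2 -y2; field; nz.
  - move=> t t0; have d := normal_dU N t0; have dx := nX N t0; have d3 := normal_dy N t0.
    have u := normal_unit N t0; der_solve; rewrite (nF N)//.
    have E : cos (th t) * cos (th t) = 1 - (A + C * X t ^+ 2) ^+ 2 by rewrite -expr2; qlra.
    by rewrite mulrDl; field: E; nz.
  - move=> t t0; apply: continuousM; last exact: (normal_sin_cont N).
    by have dx := nX N t0; apply: (@der_cont _ _ _ (2 * X t * cos (th t))); der_solve; rewrite /= expr1.
have [tM tMS HM] := prim_argmax S'0 Px'; have [tm tmS Hm] := prim_argmin S'0 Px'.
have inrange (u : R) : T <= u -> u <= 2 * kap -> x' tm <= X u <= x' tM.
  move=> Tu u2.
  have E : X u = X (sh (u - T + S)) by rewrite /sh; congr X; ring.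
  have uS : 0 <= u - T + S <= S + r0 by rewrite /r0; apply/andP; split; qlra.
  have E' : X u = x' (u - T + S).
    rewrite /x'; have [le|_] := leP (u - T + S) S; last exact: E.
    have uT : u = T by qlra.
    by rewrite uT subrr add0r xS.
  by rewrite E' HM// Hm.
have spr : b / 2 <= x' tM - x' tm.
  have /andP[a1 a2] := inrange s1 Ts1 (le_trans s12 s2k).
  have /andP[a3 a4] := inrange s2 (le_trans Ts1 s12) s2k.
  by apply: le_trans spread _; rewrite ler_norml; apply/andP; split; qlra.
pose r := (x' tM - x' tm) / (2 * b); pose m := (x' tM + x' tm) / 2.
have r0' : 0 < r by rewrite divr_gt0 ?mulr_gt0//; qlra.
have rn : r != 0 by rewrite gt_eqF.
have rbE : r * b = (x' tM - x' tm) / 2 by rewrite /r; field; nz.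
have [Psi [P0 dPsi]] := cal_primitive A C.
have dQ := scaled_calibration m rn dPsi.
pose G (z : R) := A + C * m ^+ 2 / r ^+ 2 + (- 2 * C * m / r ^+ 2) * z + C / r ^+ 2 * z ^+ 2.
have hill (s : R) : 0 <= s <= S + r0 -> `|G (x' s)| <= 1.
  move=> sS; rewrite /G (_ : _ + _ = A + C * ((x' s - m) / r) ^+ 2); last by field.
  apply: (infl_hill I); rewrite normrM normfV (gtr0_norm r0') ler_pdivrMr// mulrC rbE.
  by rewrite ler_norml /m; have := HM _ sS; have := Hm _ sS; move=> ? ?; apply/andP; split; qlra.
(* Coefficients of the misfit [G (X t) - sin (th t)] in powers of [X t]. On the added arc half its
   square is the surplus of the calibration. *)
pose al := C * m ^+ 2 / r ^+ 2; pose be := - 2 * C * m / r ^+ 2; pose ga := C / r ^+ 2 - C.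
pose q t := (al + be * X t + ga * X t ^+ 2) ^+ 2.
have GE (t : R) : 0 <= t -> (G (X t) - sin (th t)) ^+ 2 = q t.
  by move=> t0; rewrite (nF N)// /G /q /al /be /ga; congr (_ ^+ 2); ring.
pose e t := if t <= S then 0 else (1 / 2) * q (sh t).
have dq (t : R) : 0 <= t -> der (fun t => al + be * X t + ga * X t ^+ 2) t (be * cos (th t) + ga * (2 * X t * cos (th t))).
  by move=> t0; have dx := nX N t0; der_solve; rewrite /= expr1; ring.
have cq (t : R) : 0 <= t -> {for t, continuous q}.
  move=> t0; apply: (@der_cont _ _ _ (2 * (al + be * X t + ga * X t ^+ 2) * (be * cos (th t) + ga * (2 * X t * cos (th t))))).
  by have d := dq _ t0; rewrite /q; der_solve; rewrite /= expr1; ring.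
have bq2 : bm S (S + r0) (fun t => 1 / 2 * q (sh t)).
  by apply: bmM; [exact: bm_cst|apply: bm_cont; exact: csh_comp cq].
have bq : bm T (2 * kap) q.
  by apply: bm_cont => t /andP[Tt _]; apply: cq; exact: le_trans Tt.
have be_ : bm 0 (S + r0) e by apply: bm_glue => //; exact: bm_cst.
have cal (t s : R) : 0 <= t <= S + r0 -> s ^+ 2 = 1 ->
    G (x' t) * w2' t + s * Num.sqrt (1 - G (x' t) ^+ 2) * w1' t + e t <=
    Num.sqrt (w1' t ^+ 2 + w2' t ^+ 2).
  move=> tS ss; have Gt := hill _ tS; move: Gt.
  rewrite /x' /w2' /w1' /e; have [tS'|St] := leP t S => Gt.
    by rewrite addr0; exact: calibration_cauchy.
  have t0 := sh0 _ (ltW St).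
  rewrite -GE// cos2Dsin2 sqrtr1.
  have f2 : Num.sqrt (1 - G (X (sh t)) ^+ 2) ^+ 2 = 1 - G (X (sh t)) ^+ 2.
    by rewrite sqr_sqrtr// subr_ge0 -real_normK ?num_real// exprn_ile1.
  exact: (square_gain_cal ss f2 (cos2Dsin2 (th (sh t)))).
have main := calibrate_range Px' b2' (@quadratic_cont _ _ _ _) dQ be_ cal tMS tmS _.
have x0' : x' 0 = X 0 by rewrite /x' S0.
have xS' : x' (S + r0) = X 0.
  rewrite /x'; have [le|_] := leP (S + r0) S; last by rewrite /sh split2.
  have r00 : r0 = 0 by apply/eqP; rewrite eq_le r0_ge0 andbT -(lerD2l S) addr0.
  by rewrite r00 addr0 xS -X2; congr X; apply/esym/eqP; rewrite -subr_eq0; exact/eqP.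
have {main} := main (etrans x0' (esym xS')).
have Eb : (x' tM - m) / r = b by rewrite (_ : x' tM - m = r * b); [field|rewrite rbE /m; field].
have Eb' : (x' tm - m) / r = - b by rewrite (_ : x' tm - m = - (r * b)); [field|rewrite rbE /m; field].
rewrite Eb Eb' (itg_quadratic _ _ _ Px' b2') m0 m1 m2.
have PJ := infl_Psi I dPsi; rewrite -/h in PJ.
have len : plen 0 (S + r0) w1' w2' = plen 0 S w1 w2 + r0.
  rewrite /plen (@itg_ext _ _ _ _ (fun t => if t <= S then Num.sqrt (w1 t ^+ 2 + w2 t ^+ 2) else
     Num.sqrt (cos (th (sh t)) ^+ 2 + sin (th (sh t)) ^+ 2))); last first.
    by move=> t _; rewrite /w1' /w2'; case: ifP.
  rewrite itg_glue//; [|exact: bm_speed Px.1 b2|exact: bm_speed].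
  congr (_ + _); rewrite (@itg_ext _ _ _ _ (fun=> 1)); last by move=> t _; rewrite cos2Dsin2 sqrtr1.
  by rewrite itg_cst//; ring.
have Qd : exists F : R -> R, forall t : R, 0 <= t -> der F t (q t).
  pose qq (t : R) := q (Num.max 0 t).
  have [|F dF] := @primitive _ qq.
    move=> t; apply: (@continuous_comp _ _ _ (fun t : R => Num.max 0 t) q).
      by apply: continuous_max; [exact: cst_continuous|exact: cvg_id].
    by apply: cq; rewrite le_max lexx.
  by exists F => t t0; apply: der_eq (dF t) _; rewrite /qq max_r.
have gain : itg 0 (S + r0) e = 1 / 2 * itg T (2 * kap) q.
  rewrite itg_glue//; last exact: bm_cst.
  rewrite itg_cst// mul0r add0r itgZ; last by apply: bm_cont; exact: csh_comp cq.
  by have [F dF] := Qd; rewrite (shiftE F q dF cq).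
have gain2 : `|X s2 - X s1| ^+ 3 / 12 * (be + ga * (X s1 + X s2)) ^+ 2 <= itg T (2 * kap) q.
  apply: (le_trans (normal_square_gain (N := N) al be ga s10 s12)).
  have g1 : 0 <= itg T s1 q by apply: itg_ge0 => t _; exact: sqr_ge0.
  have g2 : 0 <= itg s2 (2 * kap) q by apply: itg_ge0 => t _; exact: sqr_ge0.
  have c1 := itg_chasles Ts1 (le_trans s12 s2k) bq.
  have c2 := itg_chasles s12 s2k (bm_sub Ts1 (lexx _) bq).
  change (itg s1 s2 q <= itg T (2 * kap) q); qlra.
have Cb : 1 <= C * b ^+ 2 by rewrite bE; qlra.
have X0r : x' tm <= X 0 <= x' tM by rewrite -x0' HM ?Hm// lexx.
have Xb0 := infl_Xbound I (lexx 0).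
have mb : `|m| <= b * (1 + r).
  rewrite mulrDr mulr1 (mulrC b r) rbE /m; move: X0r Xb0; rewrite !ler_norml.
  by move=> /andP[? ?] /andP[? ?]; apply/andP; split; qlra.
have cb : `|(X s1 + X s2) / 2| <= b.
  have := infl_Xbound I s10; have := infl_Xbound I (le_trans s10 s12).
  by rewrite !ler_norml => /andP[? ?] /andP[? ?]; apply/andP; split; qlra.
have H0 : 0 <= - (2 * h) by qlra.
have := near_gain_arith C0 b0 Cb Jge H0 hb r0' mb cb spread.
rewrite len gain => near main.
have c2 : X s1 + X s2 = 2 * ((X s1 + X s2) / 2) by field.
rewrite c2 in gain2; apply: (near_final rn r0' _ near gain2 (erefl _) (erefl _) PJ).
  by rewrite gt_eqF.
rewrite mulr0 in main *; exact: main.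
Qed.

(** * Non-inflectional elasticae: minimality for a full turn *)

Lemma contB {R : realType} (f g : R -> R) : continuous f -> continuous g ->
  continuous (fun t => f t - g t).
Proof. by move=> cf cg t; exact: continuousB (cf t) (cg t). Qed.

Lemma contM {R : realType} (f g : R -> R) : continuous f -> continuous g ->
  continuous (fun t => f t * g t).
Proof. by move=> cf cg t; exact: continuousM (cf t) (cg t). Qed.

Lemma cont_comp {R : realType} (f g : R -> R) : continuous f -> continuous g ->
  continuous (fun t => f (g t)).
Proof. by move=> cf cg t; exact: continuous_comp (cg t) (cf _). Qed.

(* The abscissa as a function of the angle. *)
Definition rev_abs {R : realType} (C A p : R) : R := Num.sqrt ((sin p - A) / C).

(* [T0] and [Y] are the time and the ordinate as functions of the angle. *)
Record revolving {R : realType} (C A : R) (X th y T0 Y : R -> R) (P : R) : Prop :=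
  Revolving {
  vN : normal C A X th y;
  vA : A < -1;
  vX : forall t : R, 0 <= t -> X t = rev_abs C A (th t);
  vP : 0 < P;
  vT0 : forall p, der T0 p (2 * C * rev_abs C A p)^-1;
  vY : forall p, der Y p (sin p / (2 * C * rev_abs C A p));
  vT0p : forall p, T0 (p + 2 * pi) = T0 p + P;
  vT0i : injective T0 }.

Lemma rev_arg_gt0 {R : realType} (C A p : R) : 0 < C -> A < -1 -> 0 < (sin p - A) / C.
Proof. by move=> C0 A1; rewrite divr_gt0//; have := sin_geN1 p; lra. Qed.

Lemma rev_abs_gt0 {R : realType} (C A p : R) : 0 < C -> A < -1 -> 0 < rev_abs C A p.
Proof. by move=> C0 A1; rewrite sqrtr_gt0 rev_arg_gt0. Qed.

Lemma rev_abs_sqr {R : realType} (C A p : R) : 0 < C -> A < -1 ->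
  C * rev_abs C A p ^+ 2 = sin p - A.
Proof.
by move=> C0 A1; rewrite sqr_sqrtr ?ltW ?rev_arg_gt0// mulrC divfK// gt_eqF.
Qed.

Lemma rev_abs_der {R : realType} (C A p : R) : 0 < C -> A < -1 ->
  der (rev_abs C A) p (cos p / (2 * C * rev_abs C A p)).
Proof.
move=> C0 A1; have x0 := rev_abs_gt0 p C0 A1; have a0 := rev_arg_gt0 p C0 A1.
have d := is_derive_sin p; move: x0; rewrite /rev_abs => x0; der_solve.
by move: x0; move: (Num.sqrt _) => r r0; field; nz.
Qed.

Lemma revolving_exists {R : realType} (C A : R) (X th y : R -> R) : normal C A X th y ->
  A < -1 -> 0 < X 0 -> exists T0 Y P, revolving C A X th y T0 Y P.
Proof.
move=> N A1 X0; have C0 := nC N.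
have XE (t : R) : 0 <= t -> X t ^+ 2 = rev_abs C A (th t) ^+ 2.
  move=> t0; apply: (mulfI (_ : C != 0)); first by rewrite gt_eqF.
  by rewrite rev_abs_sqr// (nF N)//; ring.
have Xn (t : R) : 0 <= t -> X t != 0.
  by move=> t0; rewrite -sqrf_eq0 XE// sqrf_eq0 gt_eqF// rev_abs_gt0.
have Xp (t : R) : 0 <= t -> 0 < X t.
  move=> t0; rewrite lt_def Xn//= leNgt; apply/negP => Xt.
  have [||u /andP[u0 _] Eu] := @ivt _ X 0 t t0.
  - by apply: within_cont => u /andP[u0 _]; exact: (normal_Xcont N).
  - by rewrite mulr_ge0_le0// ltW.
  - by have := Xn _ u0; rewrite Eu eqxx.
pose W p := 2 * C * rev_abs C A p.
have cW : continuous W.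
  apply: (@der_continuous _ _ (fun p => 2 * C * (cos p / (2 * C * rev_abs C A p)))) => p.
  by have d := rev_abs_der p C0 A1; rewrite /W; der_solve; ring.
have W0 p : 0 < W p by rewrite !mulr_gt0// rev_abs_gt0.
have pi20 : (0 : R) < 2 * pi by rewrite mulr_gt0// pi_gt0.
have Wp p : W (p + 2 * pi) = W p.
  by rewrite /W /rev_abs (_ : 2 * pi = pi *+ 2) ?sinD2pi// mulr_natl.
have [T0 [P [P0 dT0 T00 T0p T0i]]] := rotation_clock cW W0 pi20 Wp.
have [|Y dY] := @primitive _ (fun p => sin p / W p).
  move=> p; apply: (@continuousM _ _ sin (fun p => (W p)^-1)); first exact: continuous_sin.
  by apply: continuousV; [rewrite gt_eqF|exact: cW].
exists T0, Y, P; split => // t t0.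
by apply/eqP; rewrite -(eqrXn2 (n := 2))// ?ltW ?rev_abs_gt0 ?Xp// XE.
Qed.

Ltac rev_facts I :=
  have N := vN I; have C0 := nC N; have A1 := vA I; have P0 := vP I.

Lemma rev_th_shift {R : realType} `(I : @revolving R C A X th y T0 Y P) (t : R) :
  0 <= t -> th (t + P) = th t + 2 * pi.
Proof.
rev_facts I => t0.
have dth (s : R) : 0 <= s -> der th s (2 * C * rev_abs C A (th s)).
  by move=> s0; rewrite -(vX I)//; exact: nth' N _ s0.
have W0 p : 0 < 2 * C * rev_abs C A p by rewrite !mulr_gt0// rev_abs_gt0.
exact: (rotation_shift W0 dth P0 (vT0 I) (vT0p I) (vT0i I)).
Qed.

Lemma sinDtwopi {R : realType} (p : R) : sin (p + 2 * pi) = sin p.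
Proof. by rewrite (_ : 2 * pi = pi *+ 2) ?sinD2pi// mulr_natl. Qed.

Lemma cosDtwopi {R : realType} (p : R) : cos (p + 2 * pi) = cos p.
Proof. by rewrite (_ : 2 * pi = pi *+ 2) ?cosD2pi// mulr_natl. Qed.

Lemma rev_Xshift {R : realType} `(I : @revolving R C A X th y T0 Y P) (t : R) :
  0 <= t -> X (t + P) = X t.
Proof.
rev_facts I => t0; rewrite !(vX I)//; last by rewrite addr_ge0// ltW.
by rewrite (rev_th_shift I)// /rev_abs sinDtwopi.
Qed.

Lemma rev_yE {R : realType} `(I : @revolving R C A X th y T0 Y P) (s t : R) :
  0 <= s -> s <= t -> y t - y s = Y (th t) - Y (th s).
Proof.
rev_facts I => s0 st.
apply: (@der_eq_incr _ y (fun t => Y (th t)) (fun t => sin (th t)) _ _ st) => u /andP[su _].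
  by have u0 := le_trans s0 su; exact: ny N _ u0.
have u0 := le_trans s0 su; have d := nth' N u0; have d' := vY I (th u).
der_solve; rewrite (vX I)//; have := rev_abs_gt0 (th u) C0 A1 => x0; field; nz.
Qed.

Lemma rev_tE {R : realType} `(I : @revolving R C A X th y T0 Y P) (s t : R) :
  0 <= s -> s <= t -> t - s = T0 (th t) - T0 (th s).
Proof.
rev_facts I => s0 st.
apply: (@der_eq_incr _ (fun t => t) (fun t => T0 (th t)) (fun => 1) _ _ st) => u /andP[su _].
  by der_solve.
have u0 := le_trans s0 su; have d := nth' N u0; have d' := vT0 I (th u).
der_solve; rewrite (vX I)//; have := rev_abs_gt0 (th u) C0 A1 => x0; field; nz.
Qed.

Lemma rev_absN {R : realType} (C A p : R) : rev_abs C A (pi - p) = rev_abs C A p.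
Proof. by rewrite /rev_abs sinB sinpi cospi; congr (Num.sqrt ((_ - _) / _)); ring. Qed.

(** The abscissa is invariant under the reflection [p] to [pi - p] of the angle, so the turn
    consists of two equal halves between the angles [- (pi / 2)] and [pi / 2]. *)
Lemma rev_halves {R : realType} `(I : @revolving R C A X th y T0 Y P) :
  P = 2 * (T0 (pi / 2) - T0 (- (pi / 2))) /\
  y P - y 0 = 2 * (Y (pi / 2) - Y (- (pi / 2))).
Proof.
rev_facts I.
have sym (F f : R -> R) : (forall p, der F p (f p)) -> (forall p, f (pi - p) = f p) ->
    (forall p, f (p + 2 * pi) = f p) ->
    forall p, F (p + 2 * pi) - F p = 2 * (F (pi / 2) - F (- (pi / 2))).
  move=> dF fs fp p.
  have c1 : F (p + 2 * pi) - F p = F (- (pi / 2) + 2 * pi) - F (- (pi / 2)).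
    apply: (@is_derive_0_is_cst _ (fun p => F (p + 2 * pi) - F p)) => z.
    suff : der (fun p => F (p + 2 * pi) - F p) z 0 by [].
    by der_solve; rewrite fp; ring.
  have c2 : F (pi - - (pi / 2)) + F (- (pi / 2)) = F (pi - pi / 2) + F (pi / 2).
    apply: (@is_derive_0_is_cst _ (fun p => F (pi - p) + F p)) => z.
    suff : der (fun p => F (pi - p) + F p) z 0 by [].
    by der_solve; rewrite fs; ring.
  rewrite c1; have e1 : - (pi / 2) + 2 * pi = pi - - (pi / 2) :> R by field.
  have e2 : pi - pi / 2 = pi / 2 :> R by field.
  by rewrite e1; rewrite e2 in c2; lra.
split.
  rewrite -(sym T0 (fun p => (2 * C * rev_abs C A p)^-1) _ _ _ 0).
  - by rewrite (vT0p I); ring.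
  - exact: vT0 I.
  - by move=> p; rewrite rev_absN.
  - by move=> p; rewrite /rev_abs sinDtwopi.
rewrite (rev_yE I (lexx 0) (ltW P0)) -[in th P](add0r P) (rev_th_shift I)//.
apply: (sym Y (fun p => sin p / (2 * C * rev_abs C A p))).
- exact: vY I.
- by move=> p; rewrite rev_absN sinB sinpi cospi; congr (_ / _); ring.
- by move=> p; rewrite /rev_abs sinDtwopi.
Qed.

(** The left-hand side is the first order expansion at [(C, e)] of [sqrt ((e1 + s) / C1) - sqrt ((e1
    - s) / C1)] as a function of [(C1, e1)]: the graph lies above its tangent plane. In the sums and
    differences of the roots the gap is a sum of three nonnegative fractions. *)
Lemma revolving_tangent {R : realFieldType} (C C1 e e1 s p q p1 q1 : R) :
  0 < C -> 0 < C1 -> 0 < s -> 0 < p -> 0 < q -> 0 <= p1 -> 0 <= q1 ->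
  C * p ^+ 2 = e + s -> C * q ^+ 2 = e - s ->
  C1 * p1 ^+ 2 = e1 + s -> C1 * q1 ^+ 2 = e1 - s ->
  (3 - C1 / C) * (p - q) / 2 + (e1 - e) / (2 * C) * (p^-1 - q^-1) <= p1 - q1.
Proof.
move=> C0 C10 s0 p0 q0 p10 q10 Ep Eq Ep1 Eq1.
have D0 : 0 < (p - q) * (p + q).
  by rewrite -subr_sqr -(pmulr_rgt0 _ C0) mulrBr Ep Eq; lra.
have d0 : 0 < (p1 - q1) * (p1 + q1).
  by rewrite -subr_sqr -(pmulr_rgt0 _ C10) mulrBr Ep1 Eq1; lra.
have S0 : 0 < p + q by rewrite addr_gt0.
rewrite pmulr_lgt0// in D0.
have t0 : 0 < p1 + q1.
  by rewrite lt_def addr_ge0// andbT; apply/negP => /eqP E; move: d0; rewrite E mulr0 ltxx.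
rewrite pmulr_lgt0// in d0.
have eE : e = C * (p ^+ 2 + q ^+ 2) / 2 by rewrite mulrDr Ep Eq; field.
have C1E : C1 = C * ((p - q) * (p + q)) / ((p1 - q1) * (p1 + q1)).
  have : C1 * ((p1 - q1) * (p1 + q1)) = C * ((p - q) * (p + q)).
    by rewrite -!subr_sqr !mulrBr Ep Eq Ep1 Eq1; ring.
  by move=> <-; field; nz.
have e1E : e1 = C * ((p - q) * (p + q)) / ((p1 - q1) * (p1 + q1)) * (p1 ^+ 2 + q1 ^+ 2) / 2.
  by rewrite -C1E mulrDr Ep1 Eq1; field.
rewrite -subr_ge0 {}eE {}e1E {}C1E.
clear -C0 p0 q0 S0 D0 t0 d0.
set D := p - q in D0 *; set S := p + q in S0 *; set d := p1 - q1 in d0 *; set t := p1 + q1 in t0 *.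
have pE : p = (S + D) / 2 by rewrite /S /D; field.
have qE : q = (S - D) / 2 by rewrite /S /D; field.
have p1E : p1 = (t + d) / 2 by rewrite /t /d; field.
have q1E : q1 = (t - d) / 2 by rewrite /t /d; field.
rewrite pE in p0; rewrite qE in q0.
clearbody D S d t; rewrite {}pE {}qE {}p1E {}q1E.
have SD : 0 < S + D by lra.
have SD' : 0 < S - D by lra.
have -> : d - ((3 - C * (D * S) / (d * t) / C) * D / 2 +
    (C * (D * S) / (d * t) * (((t + d) / 2) ^+ 2 + ((t - d) / 2) ^+ 2) / 2 -
     C * (((S + D) / 2) ^+ 2 + ((S - D) / 2) ^+ 2) / 2) / (2 * C) *
     (((S + D) / 2)^-1 - ((S - D) / 2)^-1)) =
  (d - D) ^+ 2 / d + (t - S) ^+ 2 * D ^+ 2 / (2 * S * d * t)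
  + D ^+ 2 * (t * D - d * S) ^+ 2 / (2 * ((S + D) * (S - D)) * S * d * t).
  by field; nz.
by ge0.
Qed.

(** Needed for primitives with square roots that vanish, and are not differentiable, at an end of
    the interval. *)
Lemma der_le_incr_open {R : realType} (f g df dg : R -> R) (a b : R) : a <= b ->
  {within `[a, b], continuous f} -> {within `[a, b], continuous g} ->
  (forall t, a < t < b -> der f t (df t)) -> (forall t, a < t < b -> der g t (dg t)) ->
  (forall t, a < t < b -> df t <= dg t) -> f b - f a <= g b - g a.
Proof.
move=> ab cf cg dF dG le.
have cB : {within `[a, b], continuous (fun t => g t - f t)}.
  by move=> x; apply: continuousB; [exact: cg|exact: cf].
have [c /andP[ac cb] E] : exists2 c, a <= c <= b & exists2 D, 0 <= D & g b - f b - (g a - f a) = D * (b - a).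
  move: ab; rewrite le_eqVlt => /predU1P[<-|ab]; first by exists a; rewrite ?lexx//; exists 0 => //; ring.
  have [|c /andP[ac cb] ->] := @der_mvt_open _ (fun t => g t - f t) (fun t => dg t - df t) a b ab _ cB.
    by move=> t tab; apply: derB; [exact: dG|exact: dF].
  by exists c; rewrite ?ltW//; exists (dg c - df c) => //; rewrite subr_ge0 le// ac.
case: E => D D0 E; have : 0 <= D * (b - a) by rewrite mulr_ge0// subr_ge0.
by rewrite -E; lra.
Qed.

Lemma sqrt_comp_cont {R : realType} (f : R -> R) : continuous f ->
  continuous (fun t => Num.sqrt (f t)).
Proof. by move=> cf t; apply: continuous_comp (cf t) _; exact: sqrt_continuous. Qed.

(* Pairing the angles [p] and [- p] and integrating by parts, the hill of the
   parabola of parameters [- e, c] is compared with the one of the elastica. *)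
Lemma rev_hill {R : realType} `(I : @revolving R C A X th y T0 Y P) (c e : R) (Psi : R -> R) :
  0 < c -> 1 <= e ->
  (forall z, der Psi z (Num.sqrt (1 - (- e + c * z ^+ 2) ^+ 2))) ->
  P + e * (y P - y 0) - c * (P - A * (y P - y 0)) / (3 * C) <=
  2 * (Psi (Num.sqrt ((e + 1) / c)) - Psi (Num.sqrt ((e - 1) / c))).
Proof.
rev_facts I => c0 e1 dPsi.
have [PE hE] := rev_halves I; set h := y P - y 0 in hE *.
pose Xt (s : R) p := Num.sqrt ((e + s * sin p) / c).
(* The boundary term of the integration by parts is subtracted: along its own hill
   [sqrt (1 - G ^+ 2)] is [cos p], so the derivative of [K] is [sin p] times a difference of
   abscissas. At [pi / 2] the boundary term vanishes. *)
pose K p := Psi (Xt 1 p) - Psi (Xt (-1) p) - cos p * (Xt 1 p - Xt (-1) p).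
pose Xa := rev_abs C A.
pose tau p := T0 p - T0 (- p); pose ups p := Y p - Y (- p).
pose rho p := tau p - A * ups p - cos p * (Xa p - Xa (- p)).
(* Its derivative is [sin p] times the tangent plane of [revolving_tangent] at [(c, e)], taken from
   the elastica, where [e] is [- A]. At [pi / 2] it is linear in the length and the fall of the
   turn. *)
pose L p := (3 - c / C) * rho p / 3 + (e + A) * ups p.
have pi2 : (0 : R) < pi / 2 by rewrite divr_gt0// pi_gt0.
have cXt s : continuous (Xt s).
  apply: sqrt_comp_cont; apply: (@der_continuous _ _ (fun p => s * cos p / c)) => p.
  have d := is_derive_sin p; der_solve; ring.
have cPsi : continuous Psi by move=> z; exact: der_cont (dPsi z).
have cK : continuous K.
  apply: contB; last by apply: contM; [exact: continuous_cos|apply: contB; exact: cXt].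
  by apply: contB; apply: cont_comp => //; exact: cXt.
have Xa0 p : 0 < Xa p by exact: rev_abs_gt0.
have dL p : der L p (sin p * ((3 - c / C) * (Xa p - Xa (- p)) / 2 +
     (e + A) / (2 * C) * ((Xa p)^-1 - (Xa (- p))^-1))).
  have d1 := vT0 I p; have d2 := vT0 I (- p); have d3 := vY I p; have d4 := vY I (- p).
  have d5 := rev_abs_der p C0 A1; have d6 := rev_abs_der (- p) C0 A1.
  rewrite /L /rho /tau /ups /Xa; der_solve.
  have := Xa0 p; have := Xa0 (- p).
  have := rev_abs_sqr p C0 A1; have := rev_abs_sqr (- p) C0 A1.
  have := cos2Dsin2 p; rewrite /Xa sinN cosN /=.
  move: (rev_abs C A p) (rev_abs C A (- p)) (sin p) (cos p) => u v s k sk Ev Eu v0 u0.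
  have AE : A = s - C * u ^+ 2 by lra.
  rewrite AE in Ev *.
  have k2 : k * k = 1 - s ^+ 2 by rewrite -expr2; lra.
  have sE : s = C * (u ^+ 2 - v ^+ 2) / 2 by rewrite mulrBr Ev; field.
  field: k2 Ev; nz.
have rho0 : L 0 = 0 by rewrite /L /rho /tau /ups oppr0; ring.
have cL : continuous L by move=> p; exact: der_cont (dL p).
have in_pi2 (p : R) : 0 < p < pi / 2 -> 0 < sin p /\ 0 < cos p.
  move=> /andP[p0 p2]; split; first by rewrite sin_gt0_pi// p0/=; lra.
  by rewrite cos_gt0_pihalf// p2 andbT; lra.
have dK (p : R) : 0 < p < pi / 2 -> der K p (sin p * (Xt 1 p - Xt (-1) p)).
  move=> /in_pi2[s0 k0].
  have arg k : k ^+ 2 = 1 -> 0 < (e + k * sin p) / c.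
    move=> k2; rewrite divr_gt0//; have /andP[] : -1 < k * sin p < 1; last by lra.
    rewrite -ltr_norml -(@ltr_pXn2r _ 2)// ?nnegrE// expr1n real_normK ?num_real//.
    rewrite exprMn k2 mul1r; have := cos2Dsin2 p; have : 0 < cos p ^+ 2 by rewrite exprn_gt0.
    lra.
  have a1 := arg 1 (expr1n _ _); have a2 := arg (-1) ltac:(by rewrite sqrrN expr1n).
  have sq k : 0 < (e + k * sin p) / c -> k ^+ 2 = 1 ->
      Num.sqrt (1 - (- e + c * Xt k p ^+ 2) ^+ 2) = cos p.
    move=> a k2; rewrite sqr_sqrtr; last exact: ltW.
    have -> : 1 - (- e + c * ((e + k * sin p) / c)) ^+ 2 = cos p ^+ 2.
      have -> : - e + c * ((e + k * sin p) / c) = k * sin p by field; nz.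
      by rewrite exprMn k2 mul1r -(cos2Dsin2 p); ring.
    by rewrite sqrtr_sqr gtr0_norm.
  have d1 := dPsi (Xt 1 p); have d2 := dPsi (Xt (-1) p).
  rewrite (sq 1 a1 (expr1n _ _)) in d1.
  rewrite (sq (-1) a2 ltac:(by rewrite sqrrN expr1n)) in d2.
  have x1 : 0 < Xt 1 p by rewrite sqrtr_gt0.
  have x2 : 0 < Xt (-1) p by rewrite sqrtr_gt0.
  have d3 : der (Xt 1) p (cos p / (2 * c * Xt 1 p)).
    move: x1; rewrite /Xt => x1; der_solve.
    by move: x1; move: (Num.sqrt _) => r r0; field; nz.
  have d4 : der (Xt (-1)) p (- cos p / (2 * c * Xt (-1) p)).
    move: x2; rewrite /Xt => x2; der_solve.
    by move: x2; move: (Num.sqrt _) => r r0; field; nz.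
  clear dPsi; rewrite /K; der_solve; field; nz.
have main : L (pi / 2) - L 0 <= K (pi / 2) - K 0.
  apply: (der_le_incr_open (ltW pi2) _ _ (fun p _ => dL p) dK).
  - by apply: within_cont => p _; exact: cL.
  - by apply: within_cont => p _; exact: cK.
  move=> p /in_pi2[s0 k0]; rewrite ler_pM2l//.
  have -> : e + A = e - - A by rewrite opprK.
  apply: (revolving_tangent (s := sin p)) => //.
  all: try exact: sqrtr_ge0.
  - by rewrite rev_abs_sqr//; ring.
  - by rewrite rev_abs_sqr// sinN; ring.
  - rewrite sqr_sqrtr; last by rewrite divr_ge0 ?(ltW c0)//; have := sin_geN1 p; lra.
    by field; nz.
  - rewrite sqr_sqrtr; last by rewrite divr_ge0 ?(ltW c0)//; have := sin_le1 p; lra.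
    by field; nz.
have K0 : K 0 = 0.
  have E : Xt (-1) 0 = Xt 1 0 by rewrite /Xt sin0 !mulr0.
  by rewrite /K E; ring.
have Kp : K (pi / 2) = Psi (Num.sqrt ((e + 1) / c)) - Psi (Num.sqrt ((e - 1) / c)).
  by rewrite /K cos_pihalf mul0r subr0 /Xt sin_pihalf !mulr1.
rewrite rho0 K0 !subr0 Kp in main.
move: main; rewrite /L /rho /tau /ups cos_pihalf mul0r subr0.
have -> : T0 (pi / 2) - T0 (- (pi / 2)) = P / 2 by lra.
have -> : Y (pi / 2) - Y (- (pi / 2)) = h / 2 by lra.
have -> : (3 - c / C) * (P / 2 - A * (h / 2)) / 3 + (e + A) * (h / 2) =
   (P + e * h - c * (P - A * h) / (3 * C)) / 2 by field; nz.
lra.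
Qed.

(** The angles [p] and [- p] have opposite slopes, and the larger abscissa belongs to the rising
    one, which the angle therefore passes faster. *)
Lemma rev_drop {R : realType} `(I : @revolving R C A X th y T0 Y P) : y P - y 0 < 0.
Proof.
rev_facts I; have [_ ->] := rev_halves I.
rewrite pmulr_rlt0//.
have pi2 : (0 : R) < pi / 2 by rewrite divr_gt0// pi_gt0.
have : - (Y 0 - Y (- 0)) < - (Y (pi / 2) - Y (- (pi / 2))); last by rewrite oppr0; lra.
apply: (@der_lt _ (fun p => - (Y p - Y (- p))) (fun p => sin p / (2 * C) * ((rev_abs C A (- p))^-1 - (rev_abs C A p)^-1)) _ _ pi2).
  move=> p _; have d3 := vY I p; have d4 := vY I (- p); der_solve.
  have u := rev_abs_gt0 p C0 A1; have v := rev_abs_gt0 (- p) C0 A1.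
  by rewrite sinN; field; nz.
move=> p /andP[p0 p2]; have s0 : 0 < sin p by rewrite sin_gt0_pi// p0/=; lra.
have u := rev_abs_gt0 p C0 A1; have v := rev_abs_gt0 (- p) C0 A1.
rewrite mulr_gt0//; first by rewrite divr_gt0// mulr_gt0.
rewrite subr_gt0 ltf_pV2//; rewrite ltr_sqrt; last exact: rev_arg_gt0.
by rewrite ltr_pM2r ?invr_gt0// sinN; lra.
Qed.

(** The inequality [rev_hill] holds for every parabola with admissible [c] and [e], so it remains to
    choose one whose hill is the range of the competitor. *)
Lemma rev_min {R : realType} `(I : @revolving R C A X th y T0 Y P) :
  engel_min X (fun t => sin (th t)) P.
Proof.
rev_facts I; have h0 := rev_drop I.
have XP : X P = X 0 by rewrite -(rev_Xshift I (lexx 0)) add0r.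
have thP : th P = th 0 + 2 * pi by rewrite -(rev_th_shift I (lexx 0)) add0r.
apply: (engel_min_normal N (ltW P0)) => S x w1 w2 S0 Px b2 x0 xS I0 I1 I2.
rewrite XP thP cosDtwopi ?subrr ?oppr0 ?mul0r ?subr0 in xS I1 I2.
have X0 : 0 < X 0 by rewrite (vX I)// rev_abs_gt0.
set h := y P - y 0 in h0 I0 I2.
have [tM tMS HM] := prim_argmax S0 Px; have [tm tmS Hm] := prim_argmin S0 Px.
have final (c e : R) : 0 < c -> 1 <= e ->
   (forall s, 0 <= s <= S -> `|- e + 0 * x s + c * x s ^+ 2| <= 1) ->
   (forall Psi : R -> R, Psi 0 = 0 -> (forall z, der Psi z (Num.sqrt (1 - (- e + c * z ^+ 2) ^+ 2))) ->
     Psi (Num.sqrt ((e + 1) / c)) - Psi (Num.sqrt ((e - 1) / c)) <= Psi (x tM) - Psi (x tm)) ->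
   P <= plen 0 S w1 w2.
  move=> c0 e1 hill ends.
  have [Psi [Psi0 dPsi]] := cal_primitive (- e) c.
  have dQ z : der Psi z (Num.sqrt (1 - (- e + 0 * z + c * z ^+ 2) ^+ 2)).
    by rewrite mul0r addr0.
  have main := quadratic_range dQ S0 Px b2 hill tMS tmS (etrans x0 (esym xS)).
  have := rev_hill I c0 e1 dPsi; have := ends _ Psi0 dPsi.
  rewrite I0 I1 I2 ?addr0 in main.
  have e2 : c * ((P - A * h) / (3 * C)) = c * (P - A * h) / (3 * C) by rewrite mulrA.
  rewrite -/h e2 in main *; move: main; move: (c * _ / _) => u.
  rewrite -/h mulNr ?mulr0 ?addr0; move: (e * h) => v; lra.
have [lo0|lo0] := ltP 0 (x tm).
  have lohi : x tm < x tM.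
    rewrite lt_neqAle Hm// andbT; apply/negP => /eqP E.
    have xc s : 0 <= s <= S -> x s = x tm.
      by move=> sS; apply/eqP; rewrite eq_le Hm// andbT E HM.
    have : itg 0 S (fun t => x t * w2 t) = x tm * itg 0 S w2.
      by rewrite -itgZ//; apply: itg_ext => t /xc ->.
    by rewrite I1 I0 => /esym/eqP; rewrite mulf_eq0 (gt_eqF lo0) (lt_eqF h0).
  have sq : x tm ^+ 2 < x tM ^+ 2 by rewrite ltrXn2r// ?nnegrE// ltW// (lt_trans lo0).
  (* The parabola with values -1 and 1 at the two ends of a positive range. *)
  pose c := 2 / (x tM ^+ 2 - x tm ^+ 2).
  have dn : x tM ^+ 2 - x tm ^+ 2 != 0 by rewrite gt_eqF// subr_gt0.
  have c0 : 0 < c by rewrite divr_gt0// subr_gt0.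
  have E1 : (c * x tm ^+ 2 + 1 + 1) / c = x tM ^+ 2 by rewrite /c; field.
  have E2 : (c * x tm ^+ 2 + 1 - 1) / c = x tm ^+ 2 by rewrite /c; field.
  apply: (final c (c * x tm ^+ 2 + 1)) => //.
  - by rewrite lerDr mulr_ge0 ?sqr_ge0// ltW.
  - move=> s sS; have xs0 : 0 < x s by apply: lt_le_trans lo0 _; exact: Hm.
    have l1 : c * x tm ^+ 2 <= c * x s ^+ 2.
      by rewrite ler_pM2l// lerXn2r// ?nnegrE ?Hm// ltW.
    have l2 : c * x s ^+ 2 <= c * x tM ^+ 2.
      by rewrite ler_pM2l// lerXn2r// ?nnegrE ?HM// ltW// (lt_trans lo0).
    have l3 : c * x tM ^+ 2 = c * x tm ^+ 2 + 2 by rewrite /c; field.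
    by rewrite mul0r addr0 ler_norml; apply/andP; split; lra.
  - by move=> Psi _ _; rewrite E1 E2 !sqrtr_sqr (gtr0_norm lo0) (gtr0_norm (lt_trans lo0 lohi)) lexx.
have xM0 : 0 < x tM by apply: lt_le_trans X0 _; rewrite -x0 HM// lexx.
(* If the range reaches the axis, the parabola has its minimum -1 there and rises to 1 at the
   farthest abscissa; both sides of the axis lie in the hill. *)
pose M := Num.max (- x tm) (x tM).
have M0 : 0 < M by rewrite lt_max xM0 orbT.
have E1 : (1 + 1) / (2 / M ^+ 2) = M ^+ 2 by field; nz.
apply: (final (2 / M ^+ 2) 1) => //.
- by rewrite divr_gt0// exprn_gt0.
- move=> s sS.
  have xsM : x s ^+ 2 <= M ^+ 2.
    rewrite -real_normK ?num_real// lerXn2r// ?nnegrE ?(ltW M0)// ler_norml; apply/andP; split.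
      by rewrite lerNl le_max lerN2 Hm.
    by rewrite le_max HM ?orbT.
  have l2 : 2 / M ^+ 2 * x s ^+ 2 <= 2 / M ^+ 2 * M ^+ 2.
    by rewrite ler_pM2l// divr_gt0// exprn_gt0.
  have l1 : 0 <= 2 / M ^+ 2 * x s ^+ 2 by rewrite mulr_ge0 ?sqr_ge0// divr_ge0// sqr_ge0.
  have l3 : 2 / M ^+ 2 * M ^+ 2 = 2 by field; nz.
  by rewrite mul0r addr0 ler_norml; apply/andP; split; lra.
- move=> Psi Psi0 dPsi; rewrite subrr mul0r sqrtr0 E1 sqrtr_sqr gtr0_norm// Psi0 subr0.
  have mono := cal_mono dPsi; have odd := cal_odd Psi0 dPsi.
  have := mono _ _ lo0; have := mono _ _ (ltW xM0); rewrite Psi0 => p1 p2.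
  rewrite /M; case: (leP (- x tm) (x tM)) => le; first by lra.
  by rewrite odd; lra.
Qed.

(** * Lines and circles *)

(** The calibration is constant, its covector being the direction of the line. *)
Lemma line_min {R : realType} (X th : R -> R) (T : R) : 0 <= T ->
  (forall t : R, 0 <= t -> der X t (cos (th t))) -> (forall t : R, 0 <= t -> th t = th 0) ->
  engel_min X (fun t => sin (th t)) T.
Proof.
move=> T0 dX cth S x w1 w2 S0 Px b2 x0 xS I0 _ _.
pose f := Num.sqrt (1 - (sin (th 0) + 0 * 0 + 0 * 0 ^+ 2) ^+ 2) : R.
have dQ z : der (fun z : R => f * z) z (Num.sqrt (1 - (sin (th 0) + 0 * z + 0 * z ^+ 2) ^+ 2)).
  by der_solve; rewrite /f !mul0r; ring.
have := quadratic_point dQ S0 Px b2 _ (t := 0); rewrite lexx S0 => main.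
have {main} := main _ isT; have E : sin (th 0) + 0 * 0 + 0 * 0 ^+ 2 = sin (th 0) by rewrite !mul0r !addr0.
rewrite /f E; have -> : Num.sqrt (1 - sin (th 0) ^+ 2) = `|cos (th 0)|.
  by rewrite -sqrtr_sqr -(cos2Dsin2 (th 0)); congr Num.sqrt; ring.
have XT : X T - X 0 = cos (th 0) * T.
  have := @der_eq_incr _ X (fun t => cos (th 0) * t) (fun=> cos (th 0)) 0 T T0.
  rewrite mulr0 subr0; apply => t /andP[t0 _]; last by der_solve; ring.
  by rewrite -(cth t t0); exact: dX.
have V : itg 0 T (fun t => sin (th t)) = sin (th 0) * T.
  rewrite (@itg_ext _ _ _ _ (fun=> sin (th 0))) ?itg_cst ?subr0// => t /andP[t0 _].
  by rewrite cth.
rewrite I0 V x0 xS subrr normr0 addr0 !mul0r !addr0 -mulrBr XT.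
have -> : `| `|cos (th 0)| * (cos (th 0) * T)| = cos (th 0) ^+ 2 * T.
  by rewrite !normrM normr_id (ger0_norm T0) mulrA -normrM -expr2 ger0_norm ?sqr_ge0.
have -> : sin (th 0) * (sin (th 0) * T) = sin (th 0) ^+ 2 * T by ring.
rewrite -mulrDl addrC cos2Dsin2 mul1r; apply => t _.
by rewrite !mul0r !addr0 ler_norml sin_geN1 sin_le1.
Qed.

(** The variation is the area of half a unit disk; the substitution by the sine gives it. *)
Lemma disk_primitive {R : realType} : exists Psi : R -> R,
  (forall z, der Psi z (Num.sqrt (1 - z ^+ 2))) /\ Psi 1 - Psi (-1) = pi / 2.
Proof.
have [|P dP] := @primitive R (fun z => Num.sqrt (1 - z ^+ 2)).
  apply: sqrt_comp_cont; apply: (@der_continuous _ _ (fun z => - (2 * z))) => z.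
  by der_solve; rewrite /= expr1; ring.
exists P; split => //.
have pi2 : (0 : R) < pi / 2 by rewrite divr_gt0// pi_gt0.
have := @der_eq_incr _ (fun p => P (sin p)) (fun p => (p + sin p * cos p) / 2)
   (fun p => cos p ^+ 2) (- (pi / 2)) (pi / 2) _.
rewrite sinN cosN sin_pihalf cos_pihalf !mulr0 !addr0 => H.
rewrite H; first by field.
- by lra.
- move=> p /andP[p1 p2]; have d := dP (sin p); der_solve.
  have c0 : 0 <= cos p by apply: cos_ge0_pihalf; rewrite p1.
  have -> : 1 - sin p ^+ 2 = cos p ^+ 2 by rewrite -(cos2Dsin2 p) addrK.
  by rewrite sqrtr_sqr ger0_norm// mulr1 expr2.
- move=> p _; der_solve; have := cos2Dsin2 p; move: (sin p) (cos p) => s c E.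
  have s2 : s * s = 1 - c ^+ 2 by rewrite -expr2; lra.
  by field: s2.
Qed.

(* The affine calibration is the one of the circle with the same range of
   abscissas as the competitor. *)
Lemma circle_min {R : realType} (X th : R -> R) (c : R) : 0 < c ->
  (forall t : R, 0 <= t -> der X t (cos (th t))) -> (forall t : R, 0 <= t -> der th t c) ->
  engel_min X (fun t => sin (th t)) (2 * pi / c).
Proof.
move=> c0 dX dth.
have T0 : 0 <= 2 * pi / c by rewrite divr_ge0 ?mulr_ge0 ?pi_ge0// ltW.
have thT : th (2 * pi / c) = th 0 + 2 * pi.
  have := @der_eq_incr _ th (fun t => c * t) (fun=> c) _ _ T0.
  rewrite mulr0 subr0 => H; rewrite -(subrK (th 0) (th _)) H.
  - by field; nz.
  - by move=> t /andP[t0 _]; exact: dth.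
  - by move=> t _; der_solve; ring.
have XT : X (2 * pi / c) = X 0.
  have := @der_eq_incr _ X (fun t => sin (th t) / c) (fun t => cos (th t)) _ _ T0.
  rewrite thT sinDtwopi subrr => H; apply/eqP; rewrite -subr_eq0 H//.
  - by move=> t /andP[t0 _]; exact: dX.
  - by move=> t /andP[t0 _]; have d := dth t t0; der_solve; field; nz.
have csin (t : R) : 0 <= t -> {for t, continuous (fun t => sin (th t))}.
  move=> t0; apply: (@der_cont _ _ _ (cos (th t) * c)); by have d := dth t t0; der_solve.
have V0 : itg 0 (2 * pi / c) (fun t => sin (th t)) = 0.
  rewrite (@itg_FTC _ _ _ (fun t => - cos (th t) / c)) ?thT ?cosDtwopi ?subrr// => t /andP[t0 _].
    by have d := dth t t0; der_solve; field; nz.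
  exact: csin.
have V1 : itg 0 (2 * pi / c) (fun t => X t * sin (th t)) = pi / c ^+ 2.
  rewrite (@itg_FTC _ _ _ (fun t => - X t * cos (th t) / c + (th t + sin (th t) * cos (th t)) / (2 * c ^+ 2)))//.
  - by rewrite thT cosDtwopi sinDtwopi XT; field; nz.
  - move=> t /andP[t0 _]; have d := dth t t0; have d' := dX t t0; der_solve.
    have := cos2Dsin2 (th t); move: (sin (th t)) (cos (th t)) => s k E.
    have s2 : s * s = 1 - k ^+ 2 by rewrite -expr2; lra.
    by field: s2; nz.
  - move=> t /andP[t0 _]; apply: continuousM; last exact: csin.
    exact: der_cont (dX t t0).
move=> S x w1 w2 S0 Px b2 x0 xS I0 I1 _; rewrite XT V0 V1 in xS I0 I1.
have [tM tMS HM] := prim_argmax S0 Px; have [tm tmS Hm] := prim_argmin S0 Px.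
have lohi : x tm < x tM.
  rewrite lt_neqAle Hm// andbT; apply/negP => /eqP E.
  have xc s : 0 <= s <= S -> x s = x tm.
    by move=> sS; apply/eqP; rewrite eq_le Hm// andbT E HM.
  have : itg 0 S (fun t => x t * w2 t) = x tm * itg 0 S w2.
    by rewrite -itgZ//; apply: itg_ext => t /xc ->.
  rewrite I1 I0 mulr0 => /eqP; rewrite mulf_eq0 invr_eq0 expf_eq0/= (gt_eqF c0) orbF.
  by rewrite gt_eqF// pi_gt0.
pose h := (x tM - x tm) / 2; pose m := (x tM + x tm) / 2.
have h0 : 0 < h by rewrite divr_gt0// subr_gt0.
have [Psi [dPsi Psi1]] := @disk_primitive R.
have dQ z : der (fun z => h * Psi ((z - m) / h)) z
    (Num.sqrt (1 - (- m / h + h^-1 * z + 0 * z ^+ 2) ^+ 2)).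
  have d := dPsi ((z - m) / h); der_solve.
  have -> : - m / h + h^-1 * z + 0 * z ^+ 2 = (z - m) / h by field; nz.
  by field; nz.
have := quadratic_range dQ S0 Px b2 _ tMS tmS (etrans x0 (esym xS)).
have -> : (x tM - m) / h = 1 by rewrite (_ : x tM - m = h); [rewrite divff// gt_eqF|rewrite /m /h; field].
have -> : (x tm - m) / h = -1 by rewrite (_ : x tm - m = - h); [rewrite mulNr divff// gt_eqF|rewrite /m /h; field].
rewrite I0 I1 mulr0 mul0r addr0 add0r -mulrBr Psi1 => main; apply: le_trans (main _).
  rewrite -subr_ge0.
  (* Half of the range is [h]; the bound is least when [h] is the radius [1 / c]. *)
  have -> : h^-1 * (pi / c ^+ 2) + 2 * (h * (pi / 2)) - 2 * pi / c = pi * (h - c^-1) ^+ 2 / h.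
    by field; nz.
  by have p0 := pi_ge0 R; ge0.
move=> s sS; rewrite mul0r addr0 (_ : _ + _ = (x s - m) / h); last by field; nz.
rewrite normrM normfV (gtr0_norm h0) ler_pdivrMr// mul1r ler_norml.
by have := HM _ sS; have := Hm _ sS; rewrite /h /m => ? ?; apply/andP; split; lra.
Qed.

(** * The critical elastica *)

(** Since [(ta - nu) * (ta + nu) = (1 - mu) * (1 + mu)], for nonnegative [ta] the claim amounts to
    comparing [(1 + 2 * mu) / (1 + mu) ^+ 2] with [(ta + 2 * nu) / (ta + nu) ^+ 2]; [a1] and [a2]
    insert [(1 + 2 * nu) / (1 + nu) ^+ 2] between them. A negative [ta] has the larger right-hand
    side of the two signs. *)
Lemma soliton_gap {R : realFieldType} (mu nu ta : R) : 0 < mu -> 0 <= nu -> -1 <= ta <= 1 ->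
  mu ^+ 2 - nu ^+ 2 = 1 - ta ^+ 2 -> 0 <= ta \/ 1 <= mu ->
  (1 - mu) ^+ 2 * (1 + 2 * mu) <= (ta - nu) ^+ 2 * (ta + 2 * nu).
Proof.
move=> mu0 nu0.
wlog t0 : ta / 0 <= ta.
  move=> W /andP[t1 t1'] E H; have [t0|t0] := leP 0 ta; first by apply: W => //; rewrite t1.
  have m1 : 1 <= mu by case: H => //; rewrite leNgt t0.
  have m1' : 1 <= mu ^+ 2 by rewrite expr_ge1// ltW.
  have tn : (- ta) ^+ 2 <= nu ^+ 2 by rewrite sqrrN; lra.
  have tn' : - ta <= nu by rewrite -(ler_pXn2r (n := 2))// nnegrE; lra.
  apply: (le_trans (W (- ta) _ _ _ _)).
  - lra.
  - by apply/andP; split; lra.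
  - by rewrite sqrrN.
  - by right.
  rewrite -subr_ge0.
  have -> : (ta - nu) ^+ 2 * (ta + 2 * nu) - (- ta - nu) ^+ 2 * (- ta + 2 * nu) =
     2 * - ta * (3 * nu ^+ 2 - (- ta) ^+ 2) by ring.
  by apply: mulr_ge0; [lra|have := sqr_ge0 nu; lra].
move=> /andP[_ t1] E _.
have t2 : ta ^+ 2 <= 1 by rewrite expr_le1.
have nm : nu <= mu by rewrite -(ler_pXn2r (n := 2))// ?nnegrE ?(ltW mu0)//; lra.
have [z|nz0] := eqVneq (ta + nu) 0.
  have ta0 : ta = 0 by lra.
  have n0 : nu = 0 by lra.
  have : mu ^+ 2 = 1 by rewrite ta0 n0 in E; rewrite !expr0n/= in E; lra.
  move=> /eqP; rewrite sqrf_eq1 => /orP[/eqP ->|/eqP m1]; last by lra.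
  by rewrite ta0 n0 subrr expr0n mul0r mulr0 addr0 mulr0.
have tn0 : 0 < ta + nu by rewrite lt_def nz0 addr_ge0.
have a1 : (1 + 2 * nu) * (ta + nu) ^+ 2 <= (ta + 2 * nu) * (1 + nu) ^+ 2.
  rewrite -subr_ge0 (_ : _ - _ = (1 - ta) * ((1 + 2 * nu) * ta + nu * (2 + 3 * nu))); last by ring.
  by apply: mulr_ge0; [lra|ge0].
have a2 : (1 + 2 * mu) * (1 + nu) ^+ 2 <= (1 + 2 * nu) * (1 + mu) ^+ 2.
  rewrite -subr_ge0 (_ : _ - _ = (mu - nu) * (mu + nu + 2 * mu * nu)); last by ring.
  by apply: mulr_ge0; [lra|ge0].
have a3 : (1 + 2 * mu) * (ta + nu) ^+ 2 <= (ta + 2 * nu) * (1 + mu) ^+ 2.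
  rewrite -(ler_pM2r (_ : 0 < (1 + nu) ^+ 2)); last by rewrite exprn_gt0// ltr_wpDr.
  have b1 := ler_wpM2r (sqr_ge0 (ta + nu)) a2.
  have b2 := ler_wpM2r (sqr_ge0 (1 + mu)) a1.
  lra.
have D : (ta - nu) * (ta + nu) = (1 - mu) * (1 + mu) by rewrite -!subr_sqr; lra.
have m1 : 0 < 1 + mu by lra.
rewrite -(ler_pM2r (_ : 0 < (ta + nu) ^+ 2 * (1 + mu) ^+ 2)); last by rewrite mulr_gt0// exprn_gt0.
have -> : (ta - nu) ^+ 2 * (ta + 2 * nu) * ((ta + nu) ^+ 2 * (1 + mu) ^+ 2) =
  ((ta - nu) * (ta + nu)) ^+ 2 * ((ta + 2 * nu) * (1 + mu) ^+ 2) by ring.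
rewrite D (_ : (1 - mu) ^+ 2 * (1 + 2 * mu) * _ = ((1 - mu) * (1 + mu)) ^+ 2 * ((1 + 2 * mu) * (ta + nu) ^+ 2)); last by ring.
by rewrite ler_wpM2l ?sqr_ge0.
Qed.

(** For the parabola with minimum -1 on the axis the integrand is
    [2 / M ^+ 2 * z * sqrt (M ^+ 2 - z ^+ 2)], which has an elementary primitive. *)
Lemma cal_soliton {R : realType} (M : R) (Psi : R -> R) : 0 < M -> Psi 0 = 0 ->
  (forall z, der Psi z (Num.sqrt (1 - (-1 + 2 / M ^+ 2 * z ^+ 2) ^+ 2))) ->
  forall z, 0 <= z <= M -> Psi z = 2 / (3 * M ^+ 2) * (M ^+ 3 - Num.sqrt (M ^+ 2 - z ^+ 2) ^+ 3).
Proof.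
move=> M0 Psi0 dPsi z /andP[z0 zM].
pose Q (z : R) := - (2 / (3 * M ^+ 2) * Num.sqrt (M ^+ 2 - z ^+ 2) ^+ 3).
pose f (z : R) := Num.sqrt (1 - (-1 + 2 / M ^+ 2 * z ^+ 2) ^+ 2).
have cQ : continuous Q.
  have c2 : continuous (fun z : R => M ^+ 2 - z ^+ 2).
    by apply: (@der_continuous _ _ (fun z => - (2 * z))) => u; der_solve; rewrite /= expr1; ring.
  have c3 : continuous (fun z : R => - (2 / (3 * M ^+ 2) * z ^+ 3)).
    by apply: (@der_continuous _ _ (fun z => - (2 / (3 * M ^+ 2) * (3 * z ^+ 2)))) => u; der_solve; rewrite /=; ring.
  exact: (cont_comp c3 (sqrt_comp_cont c2)).
have dQ u : 0 < u < z -> der Q u (f u).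
  move=> /andP[u0 uz]; have uM : u < M := lt_le_trans uz zM.
  have a0 : 0 < M ^+ 2 - u ^+ 2 by rewrite subr_gt0 ltrXn2r// ltW.
  have -> : f u = 2 / M ^+ 2 * u * Num.sqrt (M ^+ 2 - u ^+ 2).
    rewrite /f -[RHS]gtr0_norm; last by rewrite mulr_gt0 ?sqrtr_gt0// mulr_gt0// divr_gt0// exprn_gt0.
    rewrite -sqrtr_sqr exprMn sqr_sqrtr; last exact: ltW.
    by congr Num.sqrt; field; nz.
  have r0 : 0 < Num.sqrt (M ^+ 2 - u ^+ 2) by rewrite sqrtr_gt0.
  rewrite /Q; der_solve; move: r0; rewrite /=; move: (Num.sqrt _) => r r0; field; nz.
have cP : continuous Psi by move=> u; exact: der_cont (dPsi u).
have E : Psi z - Psi 0 = Q z - Q 0.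
  apply/eqP; rewrite eq_le; apply/andP; split.
    apply: (der_le_incr_open z0 _ _ (fun u _ => dPsi u) dQ) => //.
      by apply: within_cont => u _; exact: cP.
    by apply: within_cont => u _; exact: cQ.
  apply: (der_le_incr_open z0 _ _ dQ (fun u _ => dPsi u)) => //.
    by apply: within_cont => u _; exact: cQ.
  by apply: within_cont => u _; exact: cP.
have Q0 : Q 0 = - (2 / (3 * M ^+ 2) * M ^+ 3) by rewrite /Q expr0n subr0 sqrtr_sqr gtr0_norm.
by rewrite -[LHS]subr0 -Psi0 E Q0 /Q; ring.
Qed.

(** The lower bound for the length separates into one contribution for each end of the arc. This is
    the contribution of one end, with abscissa [x] and rescaled time [artanh ta], minimized by the
    vertex alone; after division by powers of [b] it is [soliton_gap]. *)
Lemma soliton_end {R : realType} (b M x ta : R) : 0 < b -> 0 < M -> 0 <= x <= M ->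
  -1 <= ta <= 1 -> x ^+ 2 = b ^+ 2 * (1 - ta ^+ 2) -> 0 <= ta \/ b <= M ->
  - b + b ^+ 3 / (3 * M ^+ 2) <= - (b * ta) + b ^+ 3 / (3 * M ^+ 2) * (3 * ta - 2 * ta ^+ 3)
    - 2 / (3 * M ^+ 2) * (M ^+ 3 - Num.sqrt (M ^+ 2 - x ^+ 2) ^+ 3).
Proof.
move=> b0 M0 /andP[x0 xM] t1 xE H.
set n := Num.sqrt _.
have n2 : n ^+ 2 = M ^+ 2 - x ^+ 2 by rewrite sqr_sqrtr// subr_ge0 lerXn2r// nnegrE ltW.
have n0 : 0 <= n by exact: sqrtr_ge0.
have gap := @soliton_gap _ (M / b) (n / b) ta (divr_gt0 M0 b0) (divr_ge0 n0 (ltW b0)) t1 _ _.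
rewrite -subr_ge0.
have -> : - (b * ta) + b ^+ 3 / (3 * M ^+ 2) * (3 * ta - 2 * ta ^+ 3)
    - 2 / (3 * M ^+ 2) * (M ^+ 3 - n ^+ 3) - (- b + b ^+ 3 / (3 * M ^+ 2)) =
   b ^+ 3 / (3 * M ^+ 2) * ((ta - n / b) ^+ 2 * (ta + 2 * (n / b)) - (1 - M / b) ^+ 2 * (1 + 2 * (M / b))).
  have -> : (ta - n / b) ^+ 2 * (ta + 2 * (n / b)) =
     ta ^+ 3 - 3 * ta * n ^+ 2 / b ^+ 2 + 2 * n ^+ 3 / b ^+ 3 by field; nz.
  by rewrite n2 xE; field; nz.
rewrite mulr_ge0// ?subr_ge0; first by ge0.
apply: gap; first by rewrite !expr_div_n -mulrBl n2 xE; field; nz.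
by case: H; [left|right; rewrite ler_pdivlMr// mul1r].
Qed.

Section Soliton.
Context {R : realType}.

(** The axis is an equilibrium that is not reached in finite time:
    [|X * cos th| <= sqrt (2 * C) * X ^+ 2], so [X ^+ 2] decays at most exponentially. *)
Lemma soliton_pos (C : R) (X th y : R -> R) : normal C (-1) X th y -> X 0 != 0 ->
  forall t, 0 <= t -> X t != 0.
Proof.
move=> N X0 t t0; have C0 := nC N.
pose om := Num.sqrt (2 * C).
have om0 : 0 < om by rewrite sqrtr_gt0 mulr_gt0.
have om2 : om ^+ 2 = 2 * C by rewrite sqr_sqrtr// mulr_ge0// ltW.
have H : X 0 ^+ 2 * expR (2 * om * 0) <= X t ^+ 2 * expR (2 * om * t).
  apply: (@der_le _ (fun t => X t ^+ 2 * expR (2 * om * t))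
     (fun t => 2 * (X t * cos (th t) + om * X t ^+ 2) * expR (2 * om * t)) _ _ t0) => s /andP[s0 _].
    have d := nX N s0; der_solve; rewrite /= expr1; ring.
  have u := normal_unit N (ltW s0).
  apply: mulr_ge0; last exact: expR_ge0; apply: mulr_ge0 => //.
  suff : `|X s * cos (th s)| <= om * X s ^+ 2 by rewrite ler_norml => /andP[]; lra.
  rewrite -(ler_pXn2r (n := 2))// ?nnegrE//; last by rewrite mulr_ge0 ?sqr_ge0// ltW.
  rewrite real_normK ?num_real// !exprMn om2.
  have -> : cos (th s) ^+ 2 = 1 - (-1 + C * X s ^+ 2) ^+ 2 by lra.
  rewrite -subr_ge0 (_ : _ - _ = C ^+ 2 * X s ^+ 6); last by ring.
  by rewrite (_ : X s ^+ 6 = (X s ^+ 3) ^+ 2); [rewrite mulr_ge0 ?sqr_ge0|ring].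
rewrite mulr0 expR0 mulr1 in H; apply/negP => /eqP E.
move: H; rewrite E expr0n mul0r => H.
have : 0 < X 0 ^+ 2 by rewrite lt_def sqr_ge0 sqrf_eq0 X0.
by rewrite ltNge H.
Qed.

Lemma soliton_min (C : R) (X th y : R -> R) (T : R) : normal C (-1) X th y -> 0 < X 0 ->
  0 <= T -> engel_min X (fun t => sin (th t)) T.
Proof.
move=> N X0 T0; have C0 := nC N.
have Xn := soliton_pos N (lt0r_neq0 X0).
have Xp (t : R) : 0 <= t -> 0 < X t.
  move=> t0; rewrite lt_def Xn//= leNgt; apply/negP => Xt.
  have [||u /andP[u0 _] Eu] := @ivt _ X 0 t t0.
  - by apply: within_cont => u /andP[u0 _]; exact: (normal_Xcont N).
  - by rewrite mulr_ge0_le0// ltW.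
  - by have := Xn _ u0; rewrite Eu eqxx.
pose b := Num.sqrt (2 / C).
have b0 : 0 < b by rewrite sqrtr_gt0 divr_gt0.
have b2 : b ^+ 2 = 2 / C by rewrite sqr_sqrtr// divr_ge0// ltW.
have CE : C = 2 / b ^+ 2 by rewrite b2; field; nz.
clearbody b.
(* The hyperbolic tangent of the rescaled time: [X ^+ 2 = b ^+ 2 * (1 - ta ^+ 2)] and
   [b * ta' = C * X ^+ 2]. *)
pose ta t := - (b * cos (th t)) / (2 * X t).
have taU (t : R) : 0 <= t -> cos (th t) = - (2 * X t * ta t) / b.
  by move=> t0; have x0 := Xp t t0; rewrite /ta; field; nz.
have taX (t : R) : 0 <= t -> X t ^+ 2 = b ^+ 2 * (1 - ta t ^+ 2).
  move=> t0; have x0 := Xp t t0; have := normal_unit N t0; rewrite CE => u.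
  have u2 : cos (th t) ^+ 2 = 1 - (-1 + 2 / b ^+ 2 * X t ^+ 2) ^+ 2 by qlra.
  by rewrite /ta expr_div_n sqrrN exprMn u2; field; nz.
have ta1 (t : R) : 0 <= t -> -1 <= ta t <= 1.
  move=> t0; rewrite -ler_norml -(ler_pXn2r (n := 2))// ?nnegrE// expr1n real_normK ?num_real//.
  have := sqr_ge0 (X t); rewrite taX// pmulr_rge0 ?exprn_gt0//; qlra.
have dta (t : R) : 0 <= t -> der (fun t => b * ta t) t (1 + (-1 + C * X t ^+ 2)).
  move=> t0; have x0 := Xp t t0; have dX := nX N t0; have dU := normal_dU N t0.
  have xn : 2 * X t != 0 by rewrite mulf_neq0// gt_eqF.
  rewrite /ta; der_solve; rewrite /= ?expr1.
  have u := normal_unit N t0.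
  have u2 : cos (th t) * cos (th t) = 1 - (-1 + C * X t ^+ 2) ^+ 2 by rewrite -expr2; qlra.
  transitivity (b ^+ 2 * (cos (th t) * cos (th t) + 2 * C * X t ^+ 2 * (-1 + C * X t ^+ 2)) / (2 * X t ^+ 2)).
    by field; nz.
  by rewrite u2 CE; field; nz.
have hE : T + (y T - y 0) = b * (ta T - ta 0).
  have := @der_eq_incr _ (fun t => t + y t) (fun t => b * ta t) (fun t => 1 + (-1 + C * X t ^+ 2)) 0 T T0.
  rewrite mulrBr => <-; first by ring.
    by move=> t /andP[t0 _]; have d := normal_dy N t0; der_solve.
  by move=> t /andP[t0 _]; exact: dta.
apply: (engel_min_normal N T0) => S x w1 w2 S0 Px bw x0 xS I0 I1 I2.
have [t tS Ht] : exists2 t, 0 <= t <= S & forall s, 0 <= s <= S -> `|x s| <= `|x t|.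
  have [t1 t1S H1] := prim_argmax S0 Px; have [t2 t2S H2] := prim_argmin S0 Px.
  have [le|lt] := leP `|x t2| `|x t1|; [exists t1 => //|exists t2 => //] => s sS.
    rewrite ler_norml; have := H1 _ sS; have := H2 _ sS.
    move: le; rewrite ler_norml => /andP[]; have := ler_norm (x t1).
    have := ler_norm (- x t2); rewrite normrN.
    move: `|x t1| `|x t2| => a1 a2 *; apply/andP; split; qlra.
  rewrite ler_norml; have := H1 _ sS; have := H2 _ sS.
  move: lt; rewrite ltr_norml => /andP[].
  have := ler_norm (- x t2); rewrite normrN.
  move: `|x t2| => a2 *; apply/andP; split; qlra.
pose M := `|x t|.
have X0M : X 0 <= M by rewrite -x0 (le_trans (ler_norm _))// Ht// lexx.
have XTM : X T <= M by rewrite -xS (le_trans (ler_norm _))// Ht// lexx S0.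
have M0 : 0 < M by apply: lt_le_trans X0M.
have XT0 := Xp T T0.
(* If the competitor goes as far as the vertex, or the arc contains the vertex, the parabola is
   dilated to the largest abscissa [M] of the competitor. Otherwise the abscissa is monotone on the
   arc and the competitor stays inside the hill of the elastica, whose own parabola is then
   sharp. *)
have [ends|[Mb sgn]] : (b <= M \/ (ta 0 <= 0 /\ 0 <= ta T)) \/ (M <= b /\ (0 < ta 0 \/ ta T < 0)).
  have [bM|Mb] := leP b M; first by left; left.
  have [a|a] := leP (ta 0) 0; last by right; split; [exact: ltW|left].
  have [c|c] := leP 0 (ta T); first by left; right.
  by right; split; [exact: ltW|right].
- have [Psi [Psi0 dPsi]] := cal_primitive (-1) (2 / M ^+ 2).
  have PsiE := cal_soliton M0 Psi0 dPsi.
  have dQ z : der Psi z (Num.sqrt (1 - (-1 + 0 * z + 2 / M ^+ 2 * z ^+ 2) ^+ 2)).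
    by rewrite mul0r addr0.
  have hill (s : R) : 0 <= s <= S -> `|-1 + 0 * x s + 2 / M ^+ 2 * x s ^+ 2| <= 1.
    move=> sS; have xs : x s ^+ 2 <= M ^+ 2.
      by rewrite -real_normK ?num_real// lerXn2r// ?nnegrE ?(ltW M0)//; exact: Ht.
    have l2 : 2 / M ^+ 2 * x s ^+ 2 <= 2 / M ^+ 2 * M ^+ 2.
      by rewrite ler_pM2l// divr_gt0// exprn_gt0.
    have l1 : 0 <= 2 / M ^+ 2 * x s ^+ 2 by rewrite mulr_ge0 ?sqr_ge0// divr_ge0// sqr_ge0.
    have l3 : 2 / M ^+ 2 * M ^+ 2 = 2 by field; nz.
    by rewrite mul0r addr0 ler_norml; apply/andP; split; qlra.
  have main := quadratic_point dQ S0 Px bw hill tS.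
  have mono := cal_mono dPsi; have odd := cal_odd Psi0 dPsi.
  have PM : Psi M = 2 / 3 * M.
    by rewrite PsiE ?lexx ?(ltW M0)// subrr sqrtr0 expr0n subr0; field; nz.
  have P1 := mono _ _ X0M; have P2 := mono _ _ XTM.
  have P3 := mono _ _ (ltW X0); rewrite Psi0 in P3.
  have P4 := mono _ _ (ltW XT0); rewrite Psi0 in P4.
  have jump : 2 * Psi M - Psi (X 0) - Psi (X T) <=
     `|Psi (x t) - Psi (x 0)| + `|Psi (x S) - Psi (x t)|.
    rewrite x0 xS; have [xp|xn] := leP 0 (x t).
      have -> : x t = M by rewrite /M ger0_norm.
      have := ler_norm (Psi M - Psi (X 0)); have := ler_norm (Psi M - Psi (X T)).
      by rewrite (distrC (Psi (X T))); qlra.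
    have -> : x t = - M by rewrite /M ltr0_norm// opprK.
    rewrite odd; have := ler_norm (- (- Psi M - Psi (X 0))); have := ler_norm (Psi (X T) - - Psi M).
    by rewrite normrN; qlra.
  have e1 : 0 <= ta T \/ b <= M by case: ends => [|[]]; [right|left].
  have e0 : 0 <= - ta 0 \/ b <= M by case: ends => [|[]]; [right|left; rewrite oppr_ge0].
  have E1 := soliton_end b0 M0 (_ : 0 <= X T <= M) (ta1 T T0) (taX T T0) e1.
  have {}E1 := E1 ltac:(by rewrite (ltW XT0)).
  have E0 := soliton_end b0 M0 (_ : 0 <= X 0 <= M) (_ : -1 <= - ta 0 <= 1) _ e0.
  have {}E0 := E0 ltac:(by rewrite (ltW X0)) ltac:(by have := ta1 0 (lexx 0); rewrite lerNl lerNr opprK andbC) ltac:(by rewrite sqrrN taX).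
  rewrite -PsiE ?(ltW XT0)// in E1; rewrite -PsiE ?(ltW X0)// in E0.
  have am : 2 * b <= 2 / 3 * b ^+ 3 / M ^+ 2 + 4 / 3 * M.
    rewrite -subr_ge0 (_ : _ - _ = 2 / 3 * (M - b) ^+ 2 * (2 * M + b) / M ^+ 2); last by field; nz.
    by ge0.
  rewrite I0 I1 I2 in main.
  have I2E : 2 / M ^+ 2 * ((T - -1 * (y T - y 0) - (X T * cos (th T) - X 0 * cos (th 0))) / (3 * C)) =
     b ^+ 3 / (3 * M ^+ 2) * (3 * ta T - 2 * ta T ^+ 3 + (3 * - ta 0 - 2 * (- ta 0) ^+ 3)).
    rewrite !mulN1r opprK hE (taU T T0) (taU 0 (lexx 0)).
    have -> : X T * (- (2 * X T * ta T) / b) = - (2 * X T ^+ 2 * ta T) / b by field; nz.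
    have -> : X 0 * (- (2 * X 0 * ta 0) / b) = - (2 * X 0 ^+ 2 * ta 0) / b by field; nz.
    by rewrite !taX// CE; field; nz.
  rewrite I2E mul0r addr0 mulN1r in main.
  have hE' : - (y T - y 0) = T - b * (ta T - ta 0) by rewrite -hE; ring.
  rewrite hE' in main; rewrite PM in jump.
  move: main jump E1 E0 am P1 P2.
  have -> : 2 / 3 * b ^+ 3 / M ^+ 2 = 2 * (b ^+ 3 / (3 * M ^+ 2)) by field; nz.
  clear; move: (b ^+ 3 / _) (ta T) (ta 0) (Psi (X 0)) (Psi (X T)) => u v w p q.
  move: `|_| `|_| (plen _ _ _ _) => j1 j2 len *; lra.
have [Psi [Psi0 dPsi]] := cal_primitive (-1) C.
have dQ z : der Psi z (Num.sqrt (1 - (-1 + 0 * z + C * z ^+ 2) ^+ 2)).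
  by rewrite mul0r addr0.
have hill (s : R) : 0 <= s <= S -> `|-1 + 0 * x s + C * x s ^+ 2| <= 1.
  move=> sS; have xs : x s ^+ 2 <= b ^+ 2.
    by rewrite -real_normK ?num_real// lerXn2r// ?nnegrE ?(ltW b0)// (le_trans (Ht _ sS)).
  have l2 : C * x s ^+ 2 <= C * b ^+ 2 by rewrite ler_pM2l.
  have l1 : 0 <= C * x s ^+ 2 by rewrite mulr_ge0 ?sqr_ge0// ltW.
  have l3 : C * b ^+ 2 = 2 by rewrite CE; field; nz.
  by rewrite mul0r addr0 ler_norml; apply/andP; split; qlra.
have main := quadratic_point dQ S0 Px bw hill (t := S).
rewrite S0 lexx subrr normr0 addr0 x0 xS I0 I1 I2 in main; have {main} := main isT.
pose J (t : R) := (2 * (t - -1 * y t) + X t * cos (th t)) / 3.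
have mono_ta (u v : R) : 0 <= u -> u <= v -> ta u <= ta v.
  move=> u0 uv; rewrite -(ler_pM2l b0).
  apply: (@der_le _ (fun t => b * ta t) (fun t => 1 + (-1 + C * X t ^+ 2)) _ _ uv) => r /andP[ur _].
    by apply: dta; exact: le_trans ur.
  by rewrite addrA subrr add0r mulr_ge0 ?sqr_ge0// ltW.
have [e [e1 eU]] : exists e : R, e ^+ 2 = 1 /\ forall t, 0 <= t <= T -> `|cos (th t)| = e * cos (th t).
  case: sgn => sg.
    exists (-1); rewrite sqrrN expr1n; split => // r /andP[r0 _].
    have tr : 0 <= ta r by apply: le_trans (ltW sg) _; exact: mono_ta.
    rewrite mulN1r ler0_norm// taU// mulNr oppr_le0 divr_ge0 ?(ltW b0)//.
    exact: mulr_ge0 (mulr_ge0 (ler0n _ 2) (ltW (Xp r r0))) tr.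
  exists 1; rewrite expr1n; split => // r /andP[r0 rT].
  have tr : 0 <= - ta r by rewrite oppr_ge0; apply: le_trans _ (ltW sg); exact: mono_ta.
  rewrite mul1r ger0_norm// taU// -mulrN divr_ge0 ?(ltW b0)//.
  exact: mulr_ge0 (mulr_ge0 (ler0n _ 2) (ltW (Xp r r0))) tr.
have PJ : Psi (X T) - Psi (X 0) = e * J T - e * J 0.
  apply: (@der_eq_incr _ (fun t => Psi (X t)) (fun t => e * J t) (fun t => e * cos (th t) ^+ 2) _ _ T0) => r /andP[r0 rT].
    have d := nX N r0; have d' := dPsi (X r); clear dPsi dQ; der_solve.
    have -> : 1 - (-1 + C * X r ^+ 2) ^+ 2 = cos (th r) ^+ 2 by have u := normal_unit N r0; move: u; clear; lra.
    by rewrite sqrtr_sqr eU ?r0//; ring.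
  by have d := normal_dJ N r0; rewrite /J; der_solve; ring.
have JJ : J T - J 0 <= `|Psi (X T) - Psi (X 0)|.
  rewrite PJ -mulrBr normrM.
  have -> : `|e| = 1 by apply/eqP; rewrite -sqrp_eq1// real_normK ?num_real// e1.
  by rewrite mul1r ler_norm.
have -> : C * ((T - -1 * (y T - y 0) - (X T * cos (th T) - X 0 * cos (th 0))) / (3 * C)) =
  (T - -1 * (y T - y 0) - (X T * cos (th T) - X 0 * cos (th 0))) / 3 by field; nz.
move: JJ; rewrite /J; qlra.
Qed.

End Soliton.

(** * Maxwell points in the Cartan group *)

Section EulerLagrange.
Context {R : realType}.
Implicit Types (f g e p q w x y v : R -> R) (a b c t : R).

(** Linear span of a list, indexed by the list so that inversion produces the coefficients. *)
Inductive lspan : seq (R -> R) -> (R -> R) -> Prop :=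
| lspan0 : lspan [::] (fun=> 0)
| lspan_cons c e es p : lspan es p -> lspan (e :: es) (fun t => c * e t + p t).

Definition bms a b es := forall e, List.In e es -> bm a b e.

Lemma lspan_bm a b es p : bms a b es -> lspan es p -> bm a b p.
Proof.
move=> + L; elim: L => [_|c e es' q _ IH B]; first exact: bm_cst.
apply: bmD; last by apply: IH => e' ?; apply: B; right.
by apply: bmM; [exact: bm_cst|apply: B; left].
Qed.

Lemma lspan_ortho a b es p f : bms a b es -> bm a b f -> lspan es p ->
  (forall e, List.In e es -> itg a b (fun t => f t * e t) = 0) ->
  itg a b (fun t => f t * p t) = 0.
Proof.
move=> + bf L; elim: L => [_ _|c e es' q L IH B H].
  rewrite (@itg_ext _ _ _ _ (fun t => 0 * f t)); last by move=> t _; ring.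
  by rewrite itgZ// mul0r.
have be : bm a b e by apply: B; left.
have B' : bms a b es' by move=> e' ?; apply: B; right.
have bq := lspan_bm B' L.
rewrite (@itg_ext _ _ _ _ (fun t => c * (f t * e t) + f t * q t)); last by move=> t _; ring.
have bfe := bmM bf be.
rewrite itgD ?itgZ//; [|by apply: bmM => //; exact: bm_cst|exact: bmM].
by rewrite H ?mulr0 ?add0r; [apply: IH => // e' ?; apply: H; right|left].
Qed.

Lemma lspanD es p q c : lspan es p -> lspan es q ->
  exists2 r, lspan es r & forall t, r t = p t + c * q t.
Proof.
move=> L; elim: L q => [q L|k e es' p' L' IH q Lq].
  by inversion L; exists (fun=> 0); [exact: lspan0|move=> t; ring].
inversion Lq as [|k' e' es2 q' Lq']; subst.
have [r Lr Er] := IH _ Lq'.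
exists (fun t => (k + c * k') * e t + r t); first exact: lspan_cons.
by move=> t; rewrite Er; ring.
Qed.

(** The degenerate case of Cauchy-Schwarz: the integral of [(g + k * f) ^+ 2] is affine in [k] and
    nonnegative. *)
Lemma itg_sqr_eq0 a b f g : a <= b -> bm a b f -> bm a b g ->
  itg a b (fun t => f t ^+ 2) = 0 -> itg a b (fun t => g t * f t) = 0.
Proof.
move=> ab bf bg f0.
have bgf := bmM bg bf; have bg2 := bmX 2 bg; have bf2 := bmX 2 bf.
set s := itg a b (fun t => g t * f t); set n := itg a b (fun t => g t ^+ 2).
have key k : 0 <= n + 2 * k * s.
  have -> : n + 2 * k * s = itg a b (fun t => (g t + k * f t) ^+ 2).
    rewrite (@itg_ext _ _ _ (fun t => (g t + k * f t) ^+ 2)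
       (fun t => g t ^+ 2 + (2 * k * (g t * f t) + k ^+ 2 * f t ^+ 2))); last by move=> t _; ring.
    have bc k' := bm_cst a b k'.
    have b1 := bmM (bc (2 * k)) bgf; have b3 := bmM (bc (k ^+ 2)) bf2.
    by rewrite itgD//; [rewrite itgD// !itgZ// f0 mulr0 addr0|exact: bmD].
  by apply: itg_ge0 => t _; exact: sqr_ge0.
have n0 : 0 <= n by apply: itg_ge0 => t _; exact: sqr_ge0.
apply/eqP/negP => /negP s0.
have := key (- (n + 1) / (2 * s)).
rewrite (_ : n + _ = -1); last by field.
by rewrite oppr_ge0 ler10.
Qed.

Lemma itg_project a b es f : a <= b -> bms a b es -> bm a b f ->
  exists2 p, lspan es p &
    forall e, List.In e es -> itg a b (fun t => (f t - p t) * e t) = 0.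
Proof.
move=> ab; elim: es f => [f _ _|e es IH f B bf]; first by exists (fun=> 0); [exact: lspan0|].
have be : bm a b e by apply: B; left.
have B' : bms a b es by move=> e' ?; apply: B; right.
have [q Lq Hq] := IH e B' be; have [p Lp Hp] := IH f B' bf.
have bq := lspan_bm B' Lq; have bp := lspan_bm B' Lp.
have be' := bmB be bq; have bf' := bmB bf bp; have bfe := bmM bf' be'.
have bee := bmM be' be'.
pose n := itg a b (fun t => (e t - q t) ^+ 2).
pose c := itg a b (fun t => (f t - p t) * (e t - q t)) / n.
have [r Lr Er] := lspanD (- c) Lp Lq.
exists (fun t => c * e t + r t); first exact: lspan_cons.
have bf'' : bm a b (fun t => f t - (c * e t + r t)).
  by apply: bmB => //; apply: bmD; [apply: bmM => //; exact: bm_cst|exact: lspan_bm Lr].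
have Ht t : f t - (c * e t + r t) = f t - p t - c * (e t - q t) by rewrite Er; ring.
have H' e' : List.In e' es -> itg a b (fun t => (f t - (c * e t + r t)) * e' t) = 0.
  move=> i; have be1 : bm a b e' by exact: B'.
  rewrite (@itg_ext _ _ _ _ (fun t => (f t - p t) * e' t - c * ((e t - q t) * e' t))); last first.
    by move=> t _; rewrite Ht; ring.
  have b1 := bmM bf' be1; have b2 := bmM be' be1.
  by rewrite itgB//; [rewrite itgZ// Hp// Hq//; ring|apply: bmM => //; exact: bm_cst].
move=> e1 [<-|]; last exact: H'.
have oq := lspan_ortho B' bf'' Lq H'.
rewrite (@itg_ext _ _ _ _ (fun t => (f t - p t) * (e t - q t) - c * ((e t - q t) * (e t - q t)) +
   (f t - (c * e t + r t)) * q t)); last by move=> t _; rewrite !Ht; ring.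
have b3 := bmM (bm_cst a b c) bee.
rewrite itgD; [|exact: bmB|exact: bmM].
rewrite oq addr0 itgB// itgZ//.
have -> : itg a b (fun t => (e t - q t) * (e t - q t)) = n.
  by apply: itg_ext => t _; rewrite expr2.
(* Gram-Schmidt for a family that may be dependent: a new function of residual norm 0 is orthogonal
   to everything. *)
have [n0|n0] := eqVneq n 0; last by rewrite /c divfK// subrr.
by rewrite n0 mulr0 subr0; exact: itg_sqr_eq0.
Qed.

(** The quadratic equation is the preservation of the moment of y^2 dx under the variation of
    [euler_lagrange], the inequality its effect on the length. A correction [de] of order [ep ^+ 2]
    solves the equation, so for small [ep] the linear term [- ep * ga] prevails. *)
Lemma EL_arith (ga et a b c k : R) : 0 < ga -> 0 < et -> exists ep de : R,
  - 2 * de * et + ep ^+ 2 * a - 2 * ep * de * b + de ^+ 2 * c = 0 /\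
  - ep * ga + de * k + (ep ^+ 2 * ga + de ^+ 2 * et) / 2 < 0.
Proof.
move=> ga0 et0.
(* With this [K] the term linear in [de] dominates [a] at [de = K * ep ^+ 2] and at its opposite,
   where the quadratic expression takes opposite signs. The number [L] below collects all smallness
   conditions on [ep = 1 / L]. *)
pose K := (`|a| + 1) / et.
have K0 : 0 < K by rewrite divr_gt0// ltr_wpDl.
have Ket : K * et = `|a| + 1 by rewrite /K divfK// gt_eqF.
clearbody K.
pose Z := (K * `|k| + ga / 2 + K ^+ 2 * et / 2) / ga.
pose L := 1 + 2 * `|b| * K + `|c| * K ^+ 2 + Z.
have t1 : 0 <= 2 * `|b| * K by rewrite mulr_ge0 ?(ltW K0)// mulr_ge0.
have t2 : 0 <= `|c| * K ^+ 2 by rewrite mulr_ge0// exprn_ge0// ltW.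
have t3 : 0 <= Z.
  by have nk := normr_ge0 k; ge0.
have LE : L = 1 + 2 * `|b| * K + `|c| * K ^+ 2 + Z by [].
have ZE : K * `|k| + ga / 2 + K ^+ 2 * et / 2 = Z * ga by rewrite /Z divfK// gt_eqF.
clearbody Z L.
have L1 : 1 <= L by rewrite LE; lra.
have L0 : 0 < L by lra.
pose ep := L^-1.
have ep0 : 0 < ep by rewrite invr_gt0.
have ep1 : ep <= 1 by rewrite invf_le1.
have epL : ep * L = 1 by rewrite mulVf// gt_eqF.
pose q de := - 2 * de * et + ep ^+ 2 * a - 2 * ep * de * b + de ^+ 2 * c.
have small : ep * (2 * `|b| * K + `|c| * K ^+ 2) < 1.
  have : ep * (2 * `|b| * K + `|c| * K ^+ 2) < ep * L by rewrite ltr_pM2l// LE; lra.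
  by rewrite epL.
have D0 : 0 < K * ep ^+ 2 by rewrite mulr_gt0// exprn_gt0.
have cc : ep ^+ 2 * (K ^+ 2 * c) <= ep * (`|c| * K ^+ 2) /\ - (ep * (`|c| * K ^+ 2)) <= ep ^+ 2 * (K ^+ 2 * c).
  have : `|ep ^+ 2 * (K ^+ 2 * c)| <= ep * (`|c| * K ^+ 2).
    rewrite normrM (normrM (K ^+ 2)) (ger0_norm (sqr_ge0 ep)) (ger0_norm (sqr_ge0 K)) (mulrC (K ^+ 2)).
    apply: ler_wpM2r; first by rewrite mulr_ge0 ?sqr_ge0.
    by rewrite expr2 ler_piMr// ltW.
  by rewrite ler_norml => /andP[].
have bb s : s ^+ 2 = 1 -> s * (ep * K * b) <= ep * (`|b| * K).
  move=> s2; apply: le_trans (ler_norm _) _.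
  have s1 : `|s| = 1 by apply/eqP; rewrite -sqrp_eq1// real_normK ?num_real// s2.
  by rewrite !normrM s1 mul1r (gtr0_norm ep0) (gtr0_norm K0) -mulrA (mulrC K).
have q1 : q (K * ep ^+ 2) <= 0.
  rewrite /q (_ : _ + _ = ep ^+ 2 * (- 2 * (K * et) + a - 2 * (ep * K * b) + ep ^+ 2 * (K ^+ 2 * c))); last by ring.
  rewrite mulr_ge0_le0 ?sqr_ge0// Ket.
  have [c1 _] := cc; have := bb (-1) ltac:(by rewrite sqrrN expr1n); have := ler_norm a.
  have na := normr_ge0 a; move: small c1 na; rewrite mulrDr -!mulrA; lra.
have q2 : 0 <= q (- (K * ep ^+ 2)).
  rewrite /q (_ : _ + _ = ep ^+ 2 * (2 * (K * et) + a + 2 * (ep * K * b) + ep ^+ 2 * (K ^+ 2 * c))); last by ring.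
  rewrite mulr_ge0 ?sqr_ge0// Ket.
  have [_ c1] := cc; have := bb (-1) ltac:(by rewrite sqrrN expr1n); have := ler_norm (- a).
  rewrite normrN; have na := normr_ge0 a; move: small c1 na; rewrite mulrDr -!mulrA; lra.
have DD : - (K * ep ^+ 2) <= K * ep ^+ 2 by lra.
have cq : {within `[- (K * ep ^+ 2), K * ep ^+ 2], continuous q}.
  apply: (@der_within _ _ (fun de => - 2 * et - 2 * ep * b + 2 * de * c)) => de _.
  by rewrite /q; der_solve; rewrite /= expr1; ring.
have [|de /andP[de1 de2] Ede] := ivt DD cq; first by rewrite mulr_ge0_le0.
exists ep, de; split; first exact: Ede.
have ade : `|de| <= K * ep ^+ 2 by rewrite ler_norml de1.
have s1 : de * k <= K * ep ^+ 2 * `|k|.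
  by rewrite (le_trans (ler_norm _))// normrM ler_wpM2r.
have s2 : de ^+ 2 <= K ^+ 2 * ep ^+ 2.
  rewrite -(real_normK (num_real de)).
  apply: (@le_trans _ _ ((K * ep ^+ 2) ^+ 2)); first by rewrite lerXn2r// ?nnegrE ltW.
  rewrite exprMn ler_wpM2l ?sqr_ge0// -exprM (_ : (2 * 2 = 2 + 2)%N)// exprD ler_piMr ?sqr_ge0//.
  by rewrite expr_le1// ltW.
have s3 : de ^+ 2 * et <= K ^+ 2 * ep ^+ 2 * et by rewrite ler_wpM2r// ltW.
have s4 : ep * (K * `|k| + ga / 2 + K ^+ 2 * et / 2) < ga.
  have : ep * (Z * ga) < ep * (L * ga) by rewrite ltr_pM2l// ltr_pM2r// LE; lra.
  by rewrite ZE (mulrA ep L) epL mul1r.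
have s5 : ep * (ep * (K * `|k| + ga / 2 + K ^+ 2 * et / 2)) < ep * ga by rewrite ltr_pM2l.
move: s1 s3 s5.
have -> : K * ep ^+ 2 * `|k| = ep * (ep * (K * `|k|)) by ring.
have -> : K ^+ 2 * ep ^+ 2 * et = ep * (ep * (K ^+ 2 * et)) by ring.
have -> : ep ^+ 2 * ga = ep * (ep * ga) by ring.
lra.
Qed.

(* Length minimality in the Cartan group of a unit speed curve, through the
   five planar quantities determined by the end point of the lift. *)
Definition cartan_min (T : R) x y w1 w2 : Prop :=
  forall S x' y' v1 v2, 0 <= S -> prim 0 S x' v1 -> prim 0 S y' v2 ->
  x' 0 = x 0 -> y' 0 = y 0 -> x' S = x T -> y' S = y T ->
  itg 0 S (fun t => x' t * v2 t) = itg 0 T (fun t => x t * w2 t) ->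
  itg 0 S (fun t => x' t ^+ 2 * v2 t) = itg 0 T (fun t => x t ^+ 2 * w2 t) ->
  itg 0 S (fun t => y' t ^+ 2 * v1 t) = itg 0 T (fun t => y t ^+ 2 * w1 t) ->
  T <= plen 0 S v1 v2.

(** Only the ordinate is varied, by a primitive of [v] orthogonal to 1, x and x^2, which keeps the
    end point and the moments of x dy and x^2 dy. The moment of y^2 dx changes by [- 2] times the
    integral of [Om * v] plus a quadratic term. If the residual [g] of [w2] and the residual [h] of
    [Om] are both nonzero, [g] shortens the curve to first order and [h] restores that moment to
    second order. The second alternative is the degenerate one, where [Om] has no residual. *)
Lemma euler_lagrange (T : R) x y w1 w2 Om : 0 <= T -> prim 0 T x w1 -> prim 0 T y w2 ->
  prim 0 T Om (fun t => y t * w1 t) -> Om 0 = 0 ->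
  (forall t, 0 <= t <= T -> w1 t ^+ 2 + w2 t ^+ 2 = 1) -> cartan_min T x y w1 w2 ->
  (exists a0 a1 a2 a3 : R, itg 0 T (fun t => (w2 t - (a0 + a1 * x t + a2 * x t ^+ 2 + a3 * Om t)) ^+ 2) = 0)
  \/ (exists b0 b1 b2 : R, itg 0 T (fun t => (Om t - (b0 + b1 * x t + b2 * x t ^+ 2)) ^+ 2) = 0).
Proof.
move=> T0 Px Py POm Om0 unit min.
have bw1 := Px.1; have bw2 := Py.1; have bx := prim_bm Px; have bO := prim_bm POm.
have by_ := prim_bm Py.
have bc c := bm_cst 0 T c; have bx2 := bmX 2 bx.
pose es := [:: (fun=> 1); x; (fun t => x t ^+ 2)] : seq (R -> R).
have B3 : bms 0 T es by move=> e /= [<-|[<-|[<-|//]]].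
have B4 : bms 0 T (Om :: es) by move=> e /= [<-|/B3].
have [ph Lh Hh] := itg_project T0 B3 bO.
have [pg Lg Hg] := itg_project T0 B4 bw2.
have bph := lspan_bm B3 Lh; have bpg := lspan_bm B4 Lg.
pose h t := Om t - ph t; pose g t := w2 t - pg t.
have bh : bm 0 T h by exact: bmB.
have bg : bm 0 T g by exact: bmB.
have inv3 p : lspan es p -> exists b0 b1 b2 : R, forall t, p t = b0 + b1 * x t + b2 * x t ^+ 2.
  move=> L; inversion L as [|b0 ? ? p1 L1]; subst.
  inversion L1 as [|b1 ? ? p2 L2]; subst.
  inversion L2 as [|b2 ? ? p3 L3]; subst.
  inversion L3; subst.
  by exists b0, b1, b2 => t; ring.
pose ga := itg 0 T (fun t => g t ^+ 2); pose et := itg 0 T (fun t => h t ^+ 2).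
have [ga0|ga0] := eqVneq ga 0.
  left; inversion Lg as [|a3 ? ? p L]; subst.
  have [b0 [b1 [b2 E]]] := inv3 _ L; exists b0, b1, b2, a3.
  rewrite -[RHS]ga0; apply: itg_ext => t _; rewrite /g E; congr (_ ^+ 2); ring.
have [et0|et0] := eqVneq et 0.
  right; have [b0 [b1 [b2 E]]] := inv3 _ Lh; exists b0, b1, b2.
  by rewrite -[RHS]et0; apply: itg_ext => t _; rewrite /h E.
exfalso.
have gap : 0 < ga by rewrite lt_def ga0 itg_ge0// => t _; exact: sqr_ge0.
have etp : 0 < et by rewrite lt_def et0 itg_ge0// => t _; exact: sqr_ge0.
have pG : prim 0 T (fun t => itg 0 t g) g by split => // t _; rewrite itg_same add0r.
have pH : prim 0 T (fun t => itg 0 t h) h by split => // t _; rewrite itg_same add0r.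
pose G t := itg 0 t g; pose H t := itg 0 t h.
pose a := itg 0 T (fun t => G t ^+ 2 * w1 t).
pose b := itg 0 T (fun t => G t * H t * w1 t).
pose c := itg 0 T (fun t => H t ^+ 2 * w1 t).
pose k := itg 0 T (fun t => w2 t * h t).
have [ep [de [E1 E2]]] := EL_arith a b c k gap etp.
(* The residual [g] is also orthogonal to [Om], so that only [de] acts on the third moment to first
   order. *)
pose v t := - ep * g t + de * h t.
have bv : bm 0 T v by apply: bmD; exact: bmM.
pose V t := - ep * G t + de * H t.
have pV : prim 0 T V v by exact: (primD (primZ _ pG) (primZ _ pH)).
have bG := prim_bm pG; have bH := prim_bm pH.
have itgv f : bm 0 T f -> itg 0 T (fun t => v t * f t) =
   - ep * itg 0 T (fun t => g t * f t) + de * itg 0 T (fun t => h t * f t).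
  move=> bf; have b1 := bmM bg bf; have b2 := bmM bh bf.
  rewrite -!itgZ// -itgD; [|exact: bmM|exact: bmM].
  by apply: itg_ext => t _; rewrite /v; ring.
have ov e : List.In e es -> itg 0 T (fun t => v t * e t) = 0.
  move=> i; rewrite itgv ?Hh// ?Hg//; [ring|by right|exact: B3].
have o1 : itg 0 T v = 0.
  by apply: etrans (ov (fun=> 1) _); [apply: itg_ext => t _; rewrite mulr1|left].
have VT : V T = 0 by rewrite (pV.2 T) ?T0 ?lexx// o1 /V /G /H !itg_same; ring.
have V0 : V 0 = 0 by rewrite /V /G /H !itg_same; ring.
have gh : itg 0 T (fun t => g t * h t) = 0.
  rewrite (@itg_ext _ _ _ _ (fun t => g t * Om t - g t * ph t)); last by move=> t _; rewrite /h; ring.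
  rewrite itgB; [|exact: bmM|exact: bmM].
  rewrite Hg; last by left.
  by rewrite (lspan_ortho B3 bg Lh) ?subrr// => e i; apply: Hg; right.
have hO : itg 0 T (fun t => h t * Om t) = et.
  rewrite (@itg_ext _ _ _ _ (fun t => h t ^+ 2 + h t * ph t)); last by move=> t _; rewrite /h; ring.
  rewrite itgD; [|exact: bmX|exact: bmM].
  by rewrite (lspan_ortho B3 bh Lh) ?addr0// => e i; apply: Hh.
have gw : itg 0 T (fun t => g t * w2 t) = ga.
  rewrite (@itg_ext _ _ _ _ (fun t => g t ^+ 2 + g t * pg t)); last by move=> t _; rewrite /g; ring.
  rewrite itgD; [|exact: bmX|exact: bmM].
  by rewrite (lspan_ortho B4 bg Lg) ?addr0.
have Py' : prim 0 T (fun t => y t + V t) (fun t => w2 t + v t) := primD Py pV.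
have := min T x (fun t => y t + V t) w1 (fun t => w2 t + v t) T0 Px Py' erefl _ erefl.
rewrite V0 VT !addr0 => /(_ erefl erefl).
have add e : List.In e es -> itg 0 T (fun t => e t * (w2 t + v t)) = itg 0 T (fun t => e t * w2 t).
  move=> i; have be := B3 _ i.
  rewrite (@itg_ext _ _ _ _ (fun t => e t * w2 t + v t * e t)); last by move=> t _; ring.
  by rewrite itgD ?ov ?addr0//; exact: bmM.
rewrite (add x) ?(add (fun t => x t ^+ 2)); [|by right; right; left|by right; left].
move=> /(_ erefl erefl).
have yV : itg 0 T (fun t => Om t * v t + V t * (y t * w1 t)) = 0.
  have P := primM POm pV; have := P.2 T; rewrite T0 lexx => /(_ isT).
  by rewrite VT Om0 mulr0 mul0r add0r => <-.
have bOv := bmM bO bv; have bV := prim_bm pV.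
have byw := bmM by_ bw1; have bVyw := bmM bV byw.
rewrite itgD// in yV.
have vO : itg 0 T (fun t => Om t * v t) = de * et.
  rewrite (@itg_ext _ _ _ _ (fun t => v t * Om t)); last by move=> t _; ring.
  by rewrite itgv// hO Hg; [ring|left].
have -> : itg 0 T (fun t => (y t + V t) ^+ 2 * w1 t) = itg 0 T (fun t => y t ^+ 2 * w1 t).
  have bGG := bmM (bmX 2 bG) bw1; have bHH := bmM (bmX 2 bH) bw1.
  have bGH := bmM (bmM bG bH) bw1; have byy := bmM (bmX 2 by_) bw1.
  rewrite (@itg_ext _ _ _ (fun t => (y t + V t) ^+ 2 * w1 t) (fun t => y t ^+ 2 * w1 t + (2 * (V t * (y t * w1 t)) + (ep ^+ 2 * (G t ^+ 2 * w1 t)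
    + ((- 2 * ep * de) * (G t * H t * w1 t) + de ^+ 2 * (H t ^+ 2 * w1 t)))))); last first.
    by move=> t _; rewrite /V; ring.
  have b1 := bmM (bc 2) bVyw; have b2 := bmM (bc (ep ^+ 2)) bGG.
  have b3 := bmM (bc (- 2 * ep * de)) bGH; have b4 := bmM (bc (de ^+ 2)) bHH.
  have b34 := bmD b3 b4; have b234 := bmD b2 b34; have b1234 := bmD b1 b234.
  rewrite (itgD byy b1234) (itgD b1 b234) (itgD b2 b34) (itgD b3 b4) !itgZ//.
  by move: E1 yV; rewrite vO -/a -/b -/c; lra.
move=> /(_ erefl); apply/negP; rewrite -ltNge.
have bwv := bmM bw2 bv; have bv2 := bmX 2 bv.
have bL : bm 0 T (fun t => 1 + (w2 t * v t + 1 / 2 * v t ^+ 2)).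
  by apply: bmD => //; apply: bmD => //; exact: bmM.
apply: (@le_lt_trans _ _ (itg 0 T (fun t => 1 + (w2 t * v t + 1 / 2 * v t ^+ 2)))).
  apply: itg_le => //; first by apply: bm_speed => //; exact: bmD.
  move=> t tT; have u := unit _ tT.
  have -> : w1 t ^+ 2 + (w2 t + v t) ^+ 2 = 1 + 2 * (w2 t * v t + 1 / 2 * v t ^+ 2).
    have -> : w1 t ^+ 2 = 1 - w2 t ^+ 2 by lra.
    by field.
  have : 0 <= w1 t ^+ 2 + (w2 t + v t) ^+ 2 by rewrite addr_ge0 ?sqr_ge0.
  have -> : w1 t ^+ 2 + (w2 t + v t) ^+ 2 = 1 + 2 * (w2 t * v t + 1 / 2 * v t ^+ 2).
    have -> : w1 t ^+ 2 = 1 - w2 t ^+ 2 by lra.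
    by field.
  move: (w2 t * v t + _) => z z0.
  rewrite -[leRHS]ger0_norm; last by lra.
  rewrite -sqrtr_sqr ler_sqrt ?sqr_ge0// -subr_ge0 (_ : _ - _ = z ^+ 2) ?sqr_ge0//; ring.
have b5 := bmM (bc (1 / 2)) bv2.
rewrite (itgD (bc 1) (bmD bwv b5)) (itgD bwv b5) itgZ// itg_cst// mul1r subr0.
have -> : itg 0 T (fun t => w2 t * v t) = - ep * ga + de * k.
  rewrite (@itg_ext _ _ _ _ (fun t => v t * w2 t)); last by move=> t _; ring.
  rewrite itgv// gw; congr (_ + _ * _); apply: itg_ext => t _; ring.
have -> : itg 0 T (fun t => v t ^+ 2) = ep ^+ 2 * ga + de ^+ 2 * et.
  rewrite (@itg_ext _ _ _ _ (fun t => v t * v t)); last by move=> t _; rewrite expr2.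
  have hg : itg 0 T (fun t => h t * g t) = 0.
    by apply: etrans gh; apply: itg_ext => t _; ring.
  rewrite itgv// (@itg_ext _ _ _ (fun t => g t * v t) (fun t => v t * g t)); last by move=> t _; ring.
  rewrite (@itg_ext _ _ _ (fun t => h t * v t) (fun t => v t * h t)); last by move=> t _; ring.
  rewrite !itgv// gh hg /ga /et.
  rewrite (@itg_ext _ _ _ (fun t => g t * g t) (fun t => g t ^+ 2)); last by move=> t _; rewrite expr2.
  rewrite (@itg_ext _ _ _ (fun t => h t * h t) (fun t => h t ^+ 2)); last by move=> t _; rewrite expr2.
  ring.
by move: E2; lra.
Qed.

End EulerLagrange.

(** * Replacing an arc of a minimal curve *)

Section Maxwell.
Context {R : realType}.
Implicit Types (f g x y w : R -> R) (a b c t T : R).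

Definition patch a b f g : R -> R :=
  fun t => if t <= a then f t else if t <= b then g t else f t.

Lemma patchE a b f g t : a < t <= b -> patch a b f g t = g t.
Proof. by move=> /andP[at_ tb]; rewrite /patch leNgt at_/= tb. Qed.

Lemma patch_out a b f g t : t <= a \/ b < t -> patch a b f g t = f t.
Proof. by rewrite /patch; case: leP => // _ [//|]; case: leP. Qed.

Lemma itg_patch a b T f g : 0 <= a -> a <= b -> b <= T -> bm 0 T f -> bm a b g ->
  itg 0 T (patch a b f g) = itg 0 T f - itg a b f + itg a b g.
Proof.
move=> a0 ab bT bf bg.
have bf1 : bm b T f by apply: bm_sub bf => //; exact: le_trans ab.
have bf2 : bm 0 a f by apply: bm_sub bf => //; exact: le_trans bT.
have bf3 : bm a T f by exact: bm_sub bf.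
rewrite (itg_glue a0 (le_trans ab bT) bf2); last exact: bm_glue.
rewrite (itg_glue ab bT bg bf1) (itg_chasles a0 (le_trans ab bT) bf) (itg_chasles ab bT bf3); ring.
Qed.

Lemma prim_patch a b T F f G g : 0 <= a -> a <= b -> b <= T ->
  prim 0 T F f -> prim a b G g -> G a = F a -> G b = F b ->
  prim 0 T (patch a b F G) (patch a b f g).
Proof.
move=> a0 ab bT PF PG Ga Gb.
apply: (prim_glue a0 (le_trans ab bT)); first by apply: prim_sub PF => //; exact: le_trans bT.
- by apply: (prim_glue ab bT PG) => //; apply: prim_sub PF => //; exact: le_trans ab.
- by rewrite ab.
Qed.

Lemma replace_arc a b T x y w1 w2 x' y' v1 v2 : 0 <= a -> a <= b -> b <= T ->
  prim 0 T x w1 -> prim 0 T y w2 -> prim a b x' v1 -> prim a b y' v2 ->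
  x' a = x a -> x' b = x b -> y' a = y a -> y' b = y b ->
  itg a b (fun t => x' t * v2 t) = itg a b (fun t => x t * w2 t) ->
  itg a b (fun t => x' t ^+ 2 * v2 t) = itg a b (fun t => x t ^+ 2 * w2 t) ->
  itg a b (fun t => y' t ^+ 2 * v1 t) = itg a b (fun t => y t ^+ 2 * w1 t) ->
  cartan_min T x y w1 w2 ->
  cartan_min T (patch a b x x') (patch a b y y') (patch a b w1 v1) (patch a b w2 v2).
Proof.
move=> a0 ab bT Px Py Px' Py' xa xb ya yb I1 I2 I3 M S z1 z2 u1 u2 S0 P1 P2.
have end0 f g : f a = g a -> patch a b f g 0 = f 0 by move=> _; rewrite /patch a0.
have endT f g : g a = f a -> g b = f b -> patch a b f g T = f T.
  move=> ea eb; rewrite /patch; case: leP => // aT; case: leP => // Tb.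
  by have -> : T = b by apply/eqP; rewrite eq_le Tb.
rewrite !end0 ?endT// => x0 y0 xT yT J1 J2 J3.
have bx := prim_bm Px; have by_ := prim_bm Py; have bx' := prim_bm Px'; have by' := prim_bm Py'.
have mom (h : R -> R -> R) x1 w x1' v : bm 0 T (fun t => h (x1 t) (w t)) -> bm a b (fun t => h (x1' t) (v t)) ->
   itg a b (fun t => h (x1' t) (v t)) = itg a b (fun t => h (x1 t) (w t)) ->
   itg 0 T (fun t => h (patch a b x1 x1' t) (patch a b w v t)) = itg 0 T (fun t => h (x1 t) (w t)).
  move=> b1 b2 E; rewrite (@itg_ext _ _ _ _ (patch a b (fun t => h (x1 t) (w t)) (fun t => h (x1' t) (v t)))).
    by rewrite itg_patch// E; ring.
  by move=> t _; rewrite /patch; case: ifP => //; case: ifP.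
apply: M S0 P1 P2 x0 y0 xT yT _ _ _.
- rewrite J1; apply: (mom (fun p q => p * q)) => //; apply: bmM => //; [exact: Py.1|exact: Py'.1].
- rewrite J2; apply: (mom (fun p q => p ^+ 2 * q)) => //; apply: bmM; [exact: bmX|exact: Py.1|exact: bmX|exact: Py'.1].
- rewrite J3; apply: (mom (fun p q => p ^+ 2 * q)) => //; apply: bmM; [exact: bmX|exact: Px.1|exact: bmX|exact: Px'.1].
Qed.

Lemma itg_sqr_zero a b f t : (forall s, a < s < b -> {for s, continuous f}) ->
  bm a b f -> itg a b (fun s => f s ^+ 2) = 0 -> a < t < b -> f t = 0.
Proof.
move=> cf bf f0 tab; have /andP[at_ tb] := tab; apply/eqP/negP => /negP ft.
have e0 : 0 < `|f t| / 2 by rewrite divr_gt0// normr_gt0.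
have /cvgrPdist_lt/(_ _ e0)/nbhs_ballP[d /= d0 H] := cf _ tab.
pose r := Num.min (d / 2) (Num.min ((t - a) / 2) ((b - t) / 2)).
have r0 : 0 < r by rewrite !lt_min !divr_gt0 ?subr_gt0.
have rd : r < d by apply: le_lt_trans (_ : d / 2 < d); [rewrite ge_min lexx|lra].
have ra : a <= t - r.
  have : r <= (t - a) / 2 by rewrite !ge_min lexx orbT.
  lra.
have rb : t + r <= b.
  have : r <= (b - t) / 2 by rewrite !ge_min lexx !orbT.
  lra.
have low s : t - r <= s <= t + r -> (`|f t| / 2) ^+ 2 <= f s ^+ 2.
  move=> /andP[s1 s2]; have st : ball t d s.
    by rewrite /ball /= ltr_norml; apply/andP; split; lra.
  have := H _ st => /= Hs.
  rewrite -(real_normK (num_real (f s))) lerXn2r// ?nnegrE ?(ltW e0)//.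
  have := ler_distD (f s) (f t) 0; rewrite !subr0.
  move: (ltW Hs); lra.
have b2 := bmX 2 bf.
have tr : t - r <= t + r by lra.
have : 0 < itg a b (fun s => f s ^+ 2); last by rewrite f0 ltxx.
have c1 := itg_chasles ra (le_trans tr rb) b2.
have b3 : bm (t - r) b (fun s => f s ^+ 2) by apply: bm_sub b2.
have c2 := itg_chasles tr rb b3.
have b4 : bm (t - r) (t + r) (fun s => f s ^+ 2) by apply: bm_sub b2.
have p1 : 0 <= itg a (t - r) (fun s => f s ^+ 2) by apply: itg_ge0 => s _; exact: sqr_ge0.
have p2 : 0 <= itg (t + r) b (fun s => f s ^+ 2) by apply: itg_ge0 => s _; exact: sqr_ge0.
have := itg_le (bm_cst _ _ _) b4 low; rewrite itg_cst//.
have : 0 < (`|f t| / 2) ^+ 2 * (t + r - (t - r)) by rewrite mulr_gt0 ?exprn_gt0//; lra.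
lra.
Qed.

Lemma der_near a b f g t l : (forall s, a < s < b -> f s = g s) -> a < t < b ->
  der f t l -> der g t l.
Proof.
move=> fg /andP[at_ tb]; apply: near_eq_is_derive.
near=> s; apply: fg; apply/andP; split; near: s; [exact: lt_nbhsr|exact: lt_nbhsl].
Unshelve. all: by end_near. Qed.

Lemma der_unique f t l l' : der f t l -> der f t l' -> l = l'.
Proof.
by move=> d d'; rewrite -(@derive_val _ _ _ _ _ _ _ d) (@derive_val _ _ _ _ _ _ _ d').
Qed.

Lemma der_zero a b f t l : (forall s, a < s < b -> f s = 0) -> a < t < b -> der f t l -> l = 0.
Proof.
move=> f0 tab d; apply: (der_unique d); apply: der_near tab (derC 0 t) => s /f0 //.
Qed.

Lemma nonzero_nbhd a b f t : a < t < b -> {for t, continuous f} -> f t != 0 ->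
  exists c d, [/\ a <= c, c < t, t < d, d <= b & forall s, c < s < d -> f s != 0].
Proof.
move=> /andP[at_ tb] cf ft.
have e0 : 0 < `|f t| by rewrite normr_gt0.
have /cvgrPdist_lt/(_ _ e0)/nbhs_ballP[d /= d0 H] := cf.
exists (Num.max a (t - d)), (Num.min b (t + d)).
split; [by rewrite le_max lexx|by rewrite gt_max at_/=; lra|by rewrite lt_min tb/=; lra|by rewrite ge_min lexx|].
move=> s; rewrite gt_max lt_min => /andP[/andP[as_ s1] /andP[sb s2]].
have st : ball t d s by rewrite /ball /= ltr_norml; apply/andP; split; lra.
by apply/negP => /eqP fs; have /= := H _ st; rewrite fs subr0 ltxx.
Qed.

Variables (C A : R) (X th y : R -> R).

(** Differentiating the relation gives [X] times the relation turned by a right angle; at a point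
    with [X] nonzero both hold and [p ^+ 2 + q ^+ 2 = 0]. If [X] vanished on the interval, so would
    [cos th], and then [A ^+ 2 = 1]. *)
Lemma normal_indep2 c d p q : normal C A X th y -> A ^+ 2 != 1 -> 0 <= c -> c < d ->
  (forall t, c < t < d -> p * cos (th t) + q * sin (th t) = 0) -> p = 0 /\ q = 0.
Proof.
move=> N A1 c0 cd H; have C0 := nC N.
have t0 t : c < t < d -> 0 <= t by move=> /andP[ct _]; exact: le_trans (ltW ct).
have H2 t : c < t < d -> X t * (q * cos (th t) - p * sin (th t)) = 0.
  move=> tcd; have tt := t0 t tcd; have d1 := nth' N tt.
  have D : der (fun t => p * cos (th t) + q * sin (th t)) t
     (2 * C * (X t * (q * cos (th t) - p * sin (th t)))) by der_solve; ring.
  have /eqP := der_zero H tcd D.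
  by rewrite mulf_eq0 mulf_eq0 pnatr_eq0 (gt_eqF C0)/= => /eqP.
have [[t tcd Xt]|none] := pselect (exists2 t, c < t < d & X t != 0).
  have h1 := H t tcd; have := H2 t tcd => /eqP; rewrite mulf_eq0 (negPf Xt)/= => /eqP h2.
  have : p ^+ 2 + q ^+ 2 = 0.
    rewrite -[LHS]mulr1 -(cos2Dsin2 (th t)).
    rewrite (_ : _ * _ = (p * cos (th t) + q * sin (th t)) ^+ 2 + (q * cos (th t) - p * sin (th t)) ^+ 2); last by ring.
    by rewrite h1 h2 expr0n addr0.
  by move=> /eqP; rewrite paddr_eq0 ?sqr_ge0// !sqrf_eq0 => /andP[/eqP -> /eqP ->].
have X0 t : c < t < d -> X t = 0.
  by move=> tcd; apply/eqP/negP => /negP Xt; apply: none; exists t.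
pose m := (c + d) / 2; have mcd : c < m < d by rewrite /m; apply/andP; split; lra.
have m0 := t0 m mcd.
have U0 := der_zero X0 mcd (nX N m0).
have := normal_unit N m0; rewrite U0 (X0 m mcd) !expr0n mulr0 addr0 add0r => A2.
by rewrite A2 eqxx in A1.
Qed.

(** The four functions are those of the Euler-Lagrange equation, the last one being a primitive of y
    dx. One differentiation brings out the factor [cos th], a second one leads to
    [normal_indep2]. *)
Lemma normal_indep4 c d k0 k1 k2 k3 : normal C A X th y -> A ^+ 2 != 1 -> 0 <= c -> c < d ->
  (forall t, c < t < d -> k0 + k1 * X t + k2 * X t ^+ 2 +
      k3 * (y t * X t + cos (th t) / (2 * C)) = 0) ->
  [/\ k0 = 0, k1 = 0, k2 = 0 & k3 = 0].
Proof.
move=> N A1 c0 cd H; have C0 := nC N.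
have t0 t : c < t < d -> 0 <= t by move=> /andP[ct _]; exact: le_trans (ltW ct).
have H1 t : c < t < d -> cos (th t) * (k1 + 2 * k2 * X t + k3 * y t) = 0.
  move=> tcd; have tt := t0 t tcd; have d1 := nX N tt; have d2 := ny N tt; have d3 := nth' N tt.
  have D : der (fun t => k0 + k1 * X t + k2 * X t ^+ 2 + k3 * (y t * X t + cos (th t) / (2 * C))) t
     (cos (th t) * (k1 + 2 * k2 * X t + k3 * y t)) by der_solve; rewrite /= expr1; field; nz.
  exact: der_zero H tcd D.
have [t tcd Ut] : exists2 t, c < t < d & cos (th t) != 0.
  apply: contrapT => none.
  have [] := normal_indep2 (p := 1) (q := 0) N A1 c0 cd; last by move=> /eqP; rewrite oner_eq0.
  move=> t tcd; rewrite mul1r mul0r addr0; apply/eqP/negP => /negP Ut.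
  by apply: none; exists t.
have [a [b [ca at_ tb bd nz_]]] := nonzero_nbhd tcd (normal_cos_cont N (t0 t tcd)) Ut.
have sub s : a < s < b -> c < s < d.
  by move=> /andP[as_ sb]; rewrite (le_lt_trans ca as_) (lt_le_trans sb bd).
have H2 s : a < s < b -> k1 + 2 * k2 * X s + k3 * y s = 0.
  move=> sab; have := H1 s (sub s sab) => /eqP.
  by rewrite mulf_eq0 (negPf (nz_ s sab))/= => /eqP.
have [k20 k30] : 2 * k2 = 0 /\ k3 = 0.
  apply: (normal_indep2 N A1 (le_trans c0 ca) (lt_trans at_ tb)) => s sab.
  have tt := t0 s (sub s sab); have d1 := nX N tt; have d2 := ny N tt.
  have D : der (fun t => k1 + 2 * k2 * X t + k3 * y t) s (2 * k2 * cos (th s) + k3 * sin (th s)).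
    by der_solve; ring.
  exact: der_zero H2 sab D.
have k2z : k2 = 0 by move: k20 => /eqP; rewrite mulf_eq0 pnatr_eq0 => /eqP.
have tab : a < t < b by rewrite at_.
have k1z : k1 = 0 by have := H2 t tab; rewrite k2z k30 !(mulr0, mul0r) !addr0.
by split=> //; have := H t tcd; rewrite k2z k30 k1z !mul0r !addr0.
Qed.

(* A minimal curve obtained from an elastica by replacing an arc satisfies the
   Euler-Lagrange equation of the remaining part of the elastica. *)
Lemma maxwell_rigid a b T x' y' v1 v2 : normal C A X th y -> A ^+ 2 != 1 ->
  0 <= a -> a <= b -> b < T ->
  prim a b x' v1 -> prim a b y' v2 -> (forall t, a <= t <= b -> v1 t ^+ 2 + v2 t ^+ 2 = 1) ->
  (forall t, a <= t <= b -> {for t, continuous x'}) ->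
  (forall t, a <= t <= b -> {for t, continuous v2}) ->
  x' a = X a -> x' b = X b -> y' a = y a -> y' b = y b ->
  itg a b (fun t => x' t * v2 t) = itg a b (fun t => X t * sin (th t)) ->
  itg a b (fun t => x' t ^+ 2 * v2 t) = itg a b (fun t => X t ^+ 2 * sin (th t)) ->
  itg a b (fun t => y' t ^+ 2 * v1 t) = itg a b (fun t => y t ^+ 2 * cos (th t)) ->
  cartan_min T X y (fun t => cos (th t)) (fun t => sin (th t)) ->
  forall t, a < t < b -> v2 t = A + C * x' t ^+ 2.
Proof.
move=> N A1 a0 ab bT Px' Py' u1 cx cv xa xb ya yb I1 I2 I3 M; have C0 := nC N.
have T0 : 0 <= T by rewrite (le_trans a0)// (le_trans ab)// ltW.
have b0 := le_trans a0 ab; have bT' := ltW bT.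
have Px : prim 0 T X (fun t => cos (th t)).
  apply: prim_der => t /andP[t0 _]; [exact: nX N _ t0|exact: (normal_cos_cont N)].
have Py : prim 0 T y (fun t => sin (th t)).
  apply: prim_der => t /andP[t0 _]; [exact: ny N _ t0|exact: (normal_sin_cont N)].
have Mp := replace_arc a0 ab bT' Px Py Px' Py' xa xb ya yb I1 I2 I3 M.
have Pxp := prim_patch a0 ab bT' Px Px' xa xb.
have Pyp := prim_patch a0 ab bT' Py Py' ya yb.
set xp := patch a b X x' in Mp Pxp; set yp := patch a b y y' in Mp Pyp.
set w1 := patch a b _ v1 in Mp Pxp; set w2 := patch a b _ v2 in Mp Pyp.
have bO : bm 0 T (fun t => yp t * w1 t) by apply: bmM Pxp.1; exact: prim_bm Pyp.
pose Om t := itg 0 t (fun t => yp t * w1 t).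
have POm : prim 0 T Om (fun t => yp t * w1 t) by split => // t _; rewrite /Om itg_same add0r.
have unit t : 0 <= t <= T -> w1 t ^+ 2 + w2 t ^+ 2 = 1.
  move=> tT; rewrite /w1 /w2 /patch; case: (leP t a) => ta; first by rewrite cos2Dsin2.
  by case: (leP t b) => tb; [apply: u1; rewrite (ltW ta)|rewrite cos2Dsin2].
pose O2 t := y t * X t + cos (th t) / (2 * C).
(* After the replaced arc the primitive of y dx is known up to a constant, so the Euler-Lagrange
   relation can be read on (b, T), which is nonempty. *)
have Om2 t : b < t -> t <= T -> Om t = Om b - O2 b + O2 t.
  move=> bt tT.
  have := prim_diff POm b0 (ltW bt) tT.
  rewrite (@itg_ext_open _ b t _ (fun t => y t * cos (th t))).
  - rewrite (@itg_FTC _ b t O2 _ (ltW bt)); first by move=> E; rewrite -(subrK (Om b) (Om t)) E; ring.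
      move=> s /andP[bs _]; have s0 := le_trans b0 bs.
      have d1 := nX N s0; have d2 := ny N s0; have d3 := nth' N s0; rewrite /O2; der_solve; field; nz.
    move=> s /andP[bs _]; have s0 := le_trans b0 bs.
    by apply: continuousM; [exact: der_cont (ny N s0)|exact: (normal_cos_cont N)].
  - by apply: bm_sub bO.
  - apply: bm_cont => s /andP[bs _]; have s0 := le_trans b0 bs.
    by apply: continuousM; [exact: der_cont (ny N s0)|exact: (normal_cos_cont N)].
  - by move=> s /andP[bs _]; rewrite /yp /w1 !patch_out//; right.
have part p q f : 0 <= p -> p <= q -> q <= T -> bm 0 T f -> itg 0 T (fun t => f t ^+ 2) = 0 ->
   itg p q (fun t => f t ^+ 2) = 0.
  move=> p0 pq qT bf f0; have b2 := bmX 2 bf.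
  have pos r s : 0 <= itg r s (fun t => f t ^+ 2) by apply: itg_ge0 => t _; exact: sqr_ge0.
  have c1 := itg_chasles p0 (le_trans pq qT) b2.
  have c2 := itg_chasles pq qT (bm_sub p0 (lexx T) b2).
  by have := pos 0 p; have := pos p q; have := pos q T; lra.
have bxp := prim_bm Pxp; have bOm := prim_bm POm; have bc c := bm_cst 0 T c.
have cO2 t : 0 <= t -> der O2 t (y t * cos (th t)).
  move=> t0; have d1 := nX N t0; have d2 := ny N t0; have d3 := nth' N t0.
  rewrite /O2; der_solve; rewrite (nF N)//; field; nz.
pose k := Om b - O2 b.
(* a function of the patched curve vanishes on the untouched part *)
have outer (f g : R -> R) : bm 0 T f -> itg 0 T (fun t => f t ^+ 2) = 0 ->
    (forall t, b <= t -> {for t, continuous g}) -> (forall t, b < t < T -> f t = g t) ->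
    forall t, b < t < T -> g t = 0.
  move=> bf f0 cg fg t tT.
  have bg : bm b T g by apply: bm_cont => s /andP[bs _]; exact: cg.
  apply: (itg_sqr_zero (a := b) (b := T) _ bg _ tT) => [s /andP[/ltW bs _]|]; first exact: cg.
  rewrite -(part b T f b0 bT' (lexx T) bf f0); apply: itg_ext_open.
  - exact: bmX.
  - by apply: bmX; apply: bm_sub bf.
  - by move=> s sT; rewrite fg.
have [[a0' [a1' [a2' [a3' E]]]]|[b0' [b1' [b2' E]]]] :=
  euler_lagrange T0 Pxp Pyp POm (itg_same _ _) unit Mp.
  have bp : bm 0 T (fun t => a0' + a1' * xp t + a2' * xp t ^+ 2 + a3' * Om t).
    by do ?apply: bmD => //; apply: bmM => //; exact: bmX.
  have bf := bmB Pyp.1 bp.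
  (* Independence on (b, T) identifies the multipliers with those of the elastica; the same relation
     on (a, b) is the claim. *)
  have [z0 z1 z2 z3] : [/\ A - a0' - a3' * k = 0, - a1' = 0, C - a2' = 0 & - a3' = 0].
    apply: (normal_indep4 N A1 b0 bT).
    apply: outer bf E _ _ => t.
      move=> bt; have t0 := le_trans b0 bt; have d1 := nX N t0; have d2 := ny N t0; have d3 := nth' N t0.
      by eapply der_cont; der_rec.
    move=> /andP[bt tT]; have t0 := le_trans b0 (ltW bt).
    rewrite /w2 /xp !patch_out; [|by right|by right].
    by rewrite Om2// ?(ltW tT)// (nF N)// /k /O2; ring.
  have a3z : a3' = 0 by lra.
  have a1z : a1' = 0 by lra.
  have a2z : a2' = C by lra.
  have a0z : a0' = A by move: z0; rewrite a3z mul0r; lra.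
  move=> t tab; apply/eqP; rewrite -subr_eq0; apply/eqP.
  have cg s : a <= s <= b -> {for s, continuous (fun t => v2 t - (A + C * x' t ^+ 2))}.
    move=> sab; apply: continuousB; first exact: cv.
    apply: (@continuous_comp _ _ _ x' (fun z => A + C * z ^+ 2)); first exact: cx.
    have d : der (fun z => A + C * z ^+ 2) (x' s) (C * (2 * x' s)) by der_solve; rewrite /= expr1; ring.
    exact: der_cont d.
  have bg : bm a b (fun t => v2 t - (A + C * x' t ^+ 2)) by exact: bm_cont.
  apply: (@itg_sqr_zero a b (fun t => v2 t - (A + C * x' t ^+ 2)) t _ bg _ tab).
    by move=> s /andP[? ?]; apply: cg; rewrite !ltW.
  rewrite -(part a b _ a0 ab bT' bf E); apply: itg_ext_open.
  - exact: bmX.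
  - by apply: bmX; apply: bm_sub bf.
  - move=> s /andP[as_ sb]; rewrite /w2 /xp !patchE ?as_ ?ltW// a0z a1z a2z a3z.
    by congr (_ ^+ 2); ring.
(* In the degenerate alternative the primitive of y dx would be a quadratic polynomial of the
   abscissa on (b, T), against [normal_indep4]. *)
exfalso.
have bp : bm 0 T (fun t => b0' + b1' * xp t + b2' * xp t ^+ 2).
  by do ?apply: bmD => //; apply: bmM => //; exact: bmX.
have bf := bmB bOm bp.
have [_ _ _ /eqP] : [/\ k - b0' = 0, - b1' = 0, - b2' = 0 & 1 = 0 :> R].
  apply: (normal_indep4 N A1 b0 bT).
  apply: outer bf E _ _ => t.
    move=> bt; have t0 := le_trans b0 bt; have d1 := nX N t0; have d2 := ny N t0; have d3 := nth' N t0.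
    by eapply der_cont; der_rec.
  move=> /andP[bt tT]; rewrite /xp !patch_out; last by right.
  by rewrite Om2// ?(ltW tT)// /k /O2; ring.
by rewrite oner_eq0.
Qed.

Lemma normal_primitives t : normal C A X th y -> 0 <= t ->
  der (fun t => (t - A * y t - X t * cos (th t)) / (3 * C)) t (X t ^+ 2 * sin (th t)) /\
  der (fun t => y t ^+ 2 * X t + (y t * cos (th t) - A * X t - C * X t ^+ 3 / 3) / C) t
    (y t ^+ 2 * cos (th t)).
Proof.
move=> N t0; have C0 := nC N.
have d := normal_dU N t0; have dx := nX N t0; have d3 := normal_dy N t0.
have u := normal_unit N t0; split; der_solve; rewrite ?(nF N)//=.
  have E : cos (th t) * cos (th t) = 1 - (A + C * X t ^+ 2) ^+ 2 by rewrite -expr2; lra.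
  by rewrite mulrDl; field: E; nz.
by field; nz.
Qed.

Lemma itg_rev a b s (Q q f : R -> R) : 0 <= a -> a <= b -> 2 * s = a + b ->
  (forall t, 0 <= t -> der Q t (q t)) -> (forall t, a <= t <= b -> f t = q (2 * s - t)) ->
  (forall t, a <= t <= b -> {for t, continuous f}) -> itg a b f = Q b - Q a.
Proof.
move=> a0 ab sE dQ fE cf; rewrite (@itg_FTC _ a b (fun t => - Q (2 * s - t)) f ab)//.
  have -> : 2 * s - b = a by rewrite sE addrK.
  have -> : 2 * s - a = b by rewrite sE addrC addKr.
  by rewrite opprK addrC.
move=> t tab; have t0 : 0 <= 2 * s - t by case/andP: tab => ? ?; rewrite sE; lra.
by have d := dQ _ t0; clear dQ; der_solve; rewrite fE//; ring.
Qed.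

(* The time reversed arc is turned by half a turn about the middle of its end
   points. *)
Lemma maxwell_Z s p T : normal C A X th y -> A ^+ 2 != 1 -> 0 <= s - p -> 0 < p -> s + p < T ->
  X (s - p) + X (s + p) != 0 ->
  - (cos (th (s + p)) - cos (th (s - p))) / (2 * C) =
    (X (s - p) + X (s + p)) * (y (s + p) - y (s - p)) / 2 ->
  cartan_min T X y (fun t => cos (th t)) (fun t => sin (th t)) -> False.
Proof.
move=> N A1 a0 p0 bT Sn Z M; have C0 := nC N.
pose a := s - p; pose b := s + p; pose Sg := X a + X b; pose Sy := y a + y b.
have ab : a < b by rewrite /a /b; lra.
have ab' := ltW ab.
have sE : 2 * s = a + b by rewrite /a /b; ring.
have rE t : a <= t <= b -> a <= 2 * s - t <= b by rewrite /a /b => /andP[? ?]; apply/andP; split; lra.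
have r0 t : a <= t <= b -> 0 <= 2 * s - t by move=> /rE/andP[+ _]; exact: le_trans.
have ra : 2 * s - a = b by rewrite /a /b; ring.
have rb : 2 * s - b = a by rewrite /a /b; ring.
pose x' t := Sg - X (2 * s - t); pose y' t := Sy - y (2 * s - t).
pose v1 t := cos (th (2 * s - t)); pose v2 t := sin (th (2 * s - t)).
have dx' t : a <= t <= b -> der x' t (v1 t).
  by move=> /r0 t0; have d := nX N t0; rewrite /x'; der_solve; rewrite /v1; ring.
have dy' t : a <= t <= b -> der y' t (v2 t).
  by move=> /r0 t0; have d := ny N t0; rewrite /y'; der_solve; rewrite /v2; ring.
have cv1 t : a <= t <= b -> {for t, continuous v1}.
  by move=> /r0 t0; have d := nth' N t0; rewrite /v1; eapply der_cont; der_rec.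
have cv2 t : a <= t <= b -> {for t, continuous v2}.
  by move=> /r0 t0; have d := nth' N t0; rewrite /v2; eapply der_cont; der_rec.
have cx t : a <= t <= b -> {for t, continuous x'} by move=> /dx'; exact: der_cont.
have abt t : a <= t <= b -> 0 <= t by move=> /andP[+ _]; exact: le_trans.
have [P2 [P3 dP]] : exists P2 P3 : R -> R, forall t, 0 <= t ->
    der P2 t (X t ^+ 2 * sin (th t)) /\ der P3 t (y t ^+ 2 * cos (th t)).
  by do 2 eexists; move=> t t0; exact: normal_primitives N t0.
pose P1 t := - cos (th t) / (2 * C).
have dP1 t : 0 <= t -> der P1 t (X t * sin (th t)).
  by move=> t0; have d := nth' N t0; rewrite /P1; der_solve; field; nz.
have Z' : P1 b - P1 a = Sg * (y b - y a) / 2 by rewrite -Z /P1 -/a -/b; field; nz.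
have m2 : itg a b (fun t => X t ^+ 2 * sin (th t)) = P2 b - P2 a.
  apply: itg_FTC ab' _ _ => t /abt t0; first by case: (dP t t0).
  by have d := nX N t0; have d' := nth' N t0; eapply der_cont; der_rec.
have m3 : itg a b (fun t => y t ^+ 2 * cos (th t)) = P3 b - P3 a.
  apply: itg_FTC ab' _ _ => t /abt t0; first by case: (dP t t0).
  by have d := ny N t0; have d' := nth' N t0; eapply der_cont; der_rec.
have rev : forall t, a < t < b -> v2 t = A + C * x' t ^+ 2.
  have Px' : prim a b x' v1 by exact: prim_der.
  have Py' : prim a b y' v2 by exact: prim_der.
  apply: (maxwell_rigid N A1 a0 ab' bT Px' Py' _ cx cv2 _ _ _ _ _ _ _ M).
  - by move=> t _; rewrite cos2Dsin2.
  - by rewrite /x' ra /Sg; ring.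
  - by rewrite /x' rb /Sg; ring.
  - by rewrite /y' ra /Sy; ring.
  - by rewrite /y' rb /Sy; ring.
  - rewrite (normal_moment1 N a0 ab').
    rewrite (itg_rev (Q := fun t => Sg * y t - P1 t) (q := fun t => (Sg - X t) * sin (th t)) a0 ab' sE).
    - have -> : - (cos (th b) - cos (th a)) / (2 * C) = P1 b - P1 a by rewrite /P1; field; nz.
      by move: Z'; move: (P1 a) (P1 b) => *; lra.
    - by move=> t t0; have d := ny N t0; have d' := dP1 t t0; clear dP1; der_solve; ring.
    - by [].
    - by move=> t tab; apply: continuousM; [exact: cx|exact: cv2].
  - rewrite m2 (itg_rev (Q := fun t => Sg ^+ 2 * y t - 2 * Sg * P1 t + P2 t) (q := fun t => (Sg - X t) ^+ 2 * sin (th t)) a0 ab' sE).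
    (* The changes of the two remaining moments are multiples of the change of the first one, so the
       single condition [Z] suffices. *)
    - have E : Sg * (P1 b - P1 a) = Sg * (Sg * (y b - y a) / 2) by rewrite Z'.
      by move: E; move: (P1 a) (P1 b) => *; lra.
    - by move=> t t0; have d := ny N t0; have d' := dP1 t t0; have [d2 _] := dP t t0; clear dP1; der_solve; ring.
    - by [].
    - move=> t tab; apply: continuousM; last exact: cv2.
      by have d := dx' t tab; clear dx'; eapply der_cont; der_rec.
  - rewrite m3 (itg_rev (Q := fun t => Sy ^+ 2 * X t - 2 * Sy * (X t * y t - P1 t) + P3 t) (q := fun t => (Sy - y t) ^+ 2 * cos (th t)) a0 ab' sE).
    - have E : Sy * (P1 b - P1 a) = Sy * (Sg * (y b - y a) / 2) by rewrite Z'.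
      by move: E; rewrite /Sy /Sg; move: (P1 a) (P1 b) => *; lra.
    - by move=> t t0; have d := nX N t0; have d1 := ny N t0; have d' := dP1 t t0; have [_ d2] := dP t t0; clear dP1; der_solve; ring.
    - by [].
    - move=> t tab; apply: continuousM; last exact: cv1.
      by have d := dy' t tab; clear dy'; eapply der_cont; der_rec.
(* The arc and its image satisfy the same equation, so [X ^+ 2 = (Sg - X) ^+ 2]; as [Sg] is not 0
   the abscissa would be constant. *)
have Xc t : a < t < b -> X t - Sg / 2 = 0.
  move=> /andP[at_ tb]; have tab : a < 2 * s - t < b by rewrite -ra -{2}rb; apply/andP; split; lra.
  have t0 : 0 <= t by apply: abt; rewrite !ltW.
  have := rev _ tab; rewrite /v2 /x' (_ : 2 * s - (2 * s - t) = t); last by ring.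
  rewrite (nF N)// => E.
  have : C * Sg * (X t - Sg / 2) = 0 by lra.
  by move=> /eqP; rewrite !mulf_eq0 (gt_eqF C0) (negPf Sn)/= => /eqP.
have [/eqP] : 1 = 0 :> R /\ 0 = 0 :> R; last by rewrite oner_eq0.
apply: (normal_indep2 N A1 a0 ab) => t tab.
have t0 : 0 <= t by apply: abt; case/andP: tab => ? ?; rewrite !ltW.
have dX := nX N t0.
apply: (der_zero Xc tab); der_solve; ring.
Qed.

(* [V] vanishes if and only if the reversed and reflected arc (with respect to
   the bisector of its chord) has the same moments. *)
Lemma maxwell_V s p T (P2 P3 : R -> R) (D := X (s + p) - X (s - p)) (Y := y (s + p) - y (s - p))
  (xm := (X (s - p) + X (s + p)) / 2) (ym := (y (s - p) + y (s + p)) / 2)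
  (M1 := - (cos (th (s + p)) - cos (th (s - p))) / (2 * C)) :
  normal C A X th y -> A ^+ 2 != 1 -> 0 <= s - p -> 0 < p -> s + p < T ->
  (forall t, 0 <= t -> der P2 t (X t ^+ 2 * sin (th t)) /\ der P3 t (y t ^+ 2 * cos (th t))) ->
  D != 0 ->
  D * (P2 (s + p) - P2 (s - p) - 2 * xm * M1 + xm ^+ 2 * Y)
   - Y * (P3 (s + p) - P3 (s - p) -
       2 * ym * (X (s + p) * y (s + p) - X (s - p) * y (s - p) - M1) + ym ^+ 2 * D)
   + D * Y * (Y ^+ 2 - D ^+ 2) / 12 = 0 ->
  cartan_min T X y (fun t => cos (th t)) (fun t => sin (th t)) -> False.
Proof.
move=> N A1 a0 p0 bT dP Dn Z M; have C0 := nC N.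
pose a := s - p; pose b := s + p.
have ab : a < b by rewrite /a /b; lra.
have rE t : a <= t <= b -> a <= 2 * s - t <= b by rewrite /a /b => /andP[? ?]; apply/andP; split; lra.
have r0 t : a <= t <= b -> 0 <= 2 * s - t by move=> /rE/andP[+ _]; exact: le_trans.
have ra : 2 * s - a = b by rewrite /a /b; ring.
have rb : 2 * s - b = a by rewrite /a /b; ring.
have L0 : D ^+ 2 + Y ^+ 2 != 0 by rewrite paddr_eq0 ?sqr_ge0// !sqrf_eq0 negb_and Dn.
(* Cosine and sine of twice the angle of the chord: the reflection in the bisector of the chord,
   followed by time reversal. *)
pose c := (D ^+ 2 - Y ^+ 2) / (D ^+ 2 + Y ^+ 2); pose sn := 2 * D * Y / (D ^+ 2 + Y ^+ 2).
have csn : c ^+ 2 + sn ^+ 2 = 1 by rewrite /c /sn; field.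
pose x' t := xm - c * (X (2 * s - t) - xm) - sn * (y (2 * s - t) - ym).
pose y' t := ym - sn * (X (2 * s - t) - xm) + c * (y (2 * s - t) - ym).
pose v1 t := c * cos (th (2 * s - t)) + sn * sin (th (2 * s - t)).
pose v2 t := sn * cos (th (2 * s - t)) - c * sin (th (2 * s - t)).
have b0 : 0 <= b := le_trans a0 (ltW ab).
have dx' t : a <= t <= b -> der x' t (v1 t).
  move=> /r0 t0; have d := nX N t0; have d' := ny N t0; rewrite /x'; der_solve; rewrite /v1; ring.
have dy' t : a <= t <= b -> der y' t (v2 t).
  move=> /r0 t0; have d := nX N t0; have d' := ny N t0; rewrite /y'; der_solve; rewrite /v2; ring.
have cv1 t : a <= t <= b -> {for t, continuous v1}.
  by move=> /r0 t0; have d := nth' N t0; rewrite /v1; eapply der_cont; der_rec.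
have cv2 t : a <= t <= b -> {for t, continuous v2}.
  by move=> /r0 t0; have d := nth' N t0; rewrite /v2; eapply der_cont; der_rec.
have cx t : a <= t <= b -> {for t, continuous x'} by move=> /dx'; exact: der_cont.
have cy t : a <= t <= b -> {for t, continuous y'} by move=> /dy'; exact: der_cont.
have abt t : a <= t <= b -> 0 <= t by move=> /andP[+ _]; exact: le_trans.
have cP2 t : 0 <= t -> {for t, continuous (fun t => X t ^+ 2 * sin (th t))}.
  by move=> t0; have d := nX N t0; have d' := nth' N t0; eapply der_cont; der_rec.
have cP3 t : 0 <= t -> {for t, continuous (fun t => y t ^+ 2 * cos (th t))}.
  by move=> t0; have d := ny N t0; have d' := nth' N t0; eapply der_cont; der_rec.
have m2 : itg a b (fun t => X t ^+ 2 * sin (th t)) = P2 b - P2 a.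
  by apply: itg_FTC (ltW ab) _ _ => t /abt t0; [case: (dP t t0)|exact: cP2].
have m3 : itg a b (fun t => y t ^+ 2 * cos (th t)) = P3 b - P3 a.
  by apply: itg_FTC (ltW ab) _ _ => t /abt t0; [case: (dP t t0)|exact: cP3].
have Xa : X a = xm - D / 2 by rewrite /xm /D /a; field.
have Xb : X b = xm + D / 2 by rewrite /xm /D /b; field.
have ya : y a = ym - Y / 2 by rewrite /ym /Y /a; field.
have yb : y b = ym + Y / 2 by rewrite /ym /Y /b; field.
pose P1 t := - cos (th t) / (2 * C).
have dP1 t : 0 <= t -> der P1 t (X t * sin (th t)).
  by move=> t0; have d := nth' N t0; rewrite /P1; der_solve; field; nz.
have M1E : M1 = P1 b - P1 a by rewrite /M1 /P1 -/a -/b; field; nz.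
rewrite -/a -/b M1E in Z.
pose e1 := xm + c * xm + sn * ym; pose e2 := ym + sn * xm - c * ym.
have sE : 2 * s = a + b by rewrite /a /b; ring.
have rev_itg (Q q f : R -> R) := @itg_rev a b s Q q f a0 (ltW ab) sE.
(* [Q1], [Q2] and [Q3] are primitives, in the time of the original arc, of the three moments of its
   image. *)
pose Q1 t := e1 * (sn * X t - c * y t) - c * sn * X t ^+ 2 / 2 + c ^+ 2 * P1 t
   - sn ^+ 2 * (X t * y t - P1 t) + c * sn * y t ^+ 2 / 2.
pose Q2 t := e1 ^+ 2 * (sn * X t - c * y t)
   - 2 * e1 * (c * sn * X t ^+ 2 / 2 - c ^+ 2 * P1 t + sn ^+ 2 * (X t * y t - P1 t) - c * sn * y t ^+ 2 / 2)
   + sn * c ^+ 2 * X t ^+ 3 / 3 - c ^+ 3 * P2 t + c * sn ^+ 2 * (X t ^+ 2 * y t - P2 t)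
   - c ^+ 2 * sn * (X t * y t ^+ 2 - P3 t) + sn ^+ 3 * P3 t - c * sn ^+ 2 * y t ^+ 3 / 3.
pose Q3 t := e2 ^+ 2 * (c * X t + sn * y t)
   + 2 * e2 * (- (sn * c) * X t ^+ 2 / 2 - sn ^+ 2 * P1 t + c ^+ 2 * (X t * y t - P1 t) + c * sn * y t ^+ 2 / 2)
   + sn ^+ 2 * c * X t ^+ 3 / 3 + sn ^+ 3 * P2 t - sn * c ^+ 2 * (X t ^+ 2 * y t - P2 t)
   - sn ^+ 2 * c * (X t * y t ^+ 2 - P3 t) + c ^+ 3 * P3 t + c ^+ 2 * sn * y t ^+ 3 / 3.
have dQ1 t : 0 <= t -> der Q1 t ((e1 - c * X t - sn * y t) * (sn * cos (th t) - c * sin (th t))).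
  move=> t0; have d1 := nX N t0; have d2 := ny N t0; have d3 := dP1 t t0.
  by rewrite /Q1; clear dP1; der_solve; rewrite /=; field.
have dQ2 t : 0 <= t -> der Q2 t ((e1 - c * X t - sn * y t) ^+ 2 * (sn * cos (th t) - c * sin (th t))).
  move=> t0; have d1 := nX N t0; have d2 := ny N t0; have d3 := dP1 t t0; have [d4 d5] := dP t t0.
  by rewrite /Q2; clear dP1; der_solve; rewrite /=; field.
have dQ3 t : 0 <= t -> der Q3 t ((e2 - sn * X t + c * y t) ^+ 2 * (c * cos (th t) + sn * sin (th t))).
  move=> t0; have d1 := nX N t0; have d2 := ny N t0; have d3 := dP1 t t0; have [d4 d5] := dP t t0.
  by rewrite /Q3; clear dP1; der_solve; rewrite /=; field.
have rev : forall t, a < t < b -> v2 t = A + C * x' t ^+ 2.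
  have Px' : prim a b x' v1 by exact: prim_der.
  have Py' : prim a b y' v2 by exact: prim_der.
  apply: (maxwell_rigid N A1 a0 (ltW ab) bT Px' Py' _ cx cv2 _ _ _ _ _ _ _ M).
  - by move=> t _; rewrite /v1 /v2; have := cos2Dsin2 (th (2 * s - t)) => u;
       rewrite (_ : _ + _ = (c ^+ 2 + sn ^+ 2) * (cos (th (2 * s - t)) ^+ 2 + sin (th (2 * s - t)) ^+ 2)); [rewrite u csn mulr1|ring].
  - by rewrite /x' ra Xa Xb yb /c /sn; field.
  - by rewrite /x' rb Xa Xb ya /c /sn; field.
  - by rewrite /y' ra Xb ya yb /c /sn; field.
  - by rewrite /y' rb Xa ya yb /c /sn; field.
  - rewrite (normal_moment1 N a0 (ltW ab)) -/M1 M1E.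
    rewrite (rev_itg Q1 (fun t => (e1 - c * X t - sn * y t) * (sn * cos (th t) - c * sin (th t)))) ?dQ1//.
    - by rewrite /Q1 Xa Xb ya yb /e1 /c /sn; move: (P1 a) (P1 b) => u v; field.
    - by move=> t tab; rewrite /x' /v2 /e1; ring.
    - by move=> t tab; apply: continuousM; [exact: cx|exact: cv2].
  - rewrite m2 (rev_itg Q2 (fun t => (e1 - c * X t - sn * y t) ^+ 2 * (sn * cos (th t) - c * sin (th t)))) ?dQ2//.
    (* The first moment is preserved identically. The second and the third change by multiples of
       the same defect, with factors proportional to [D] and [Y]. *)
    - rewrite -[RHS]subr0 -(mulr0 (2 * D / (D ^+ 2 + Y ^+ 2))) -Z /Q2 Xa Xb ya yb /e1 /c /sn.
      by move: (P1 a) (P1 b) (P2 a) (P2 b) (P3 a) (P3 b) => *; field.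
    - by move=> t tab; rewrite /x' /v2 /e1; ring.
    - move=> t tab; apply: continuousM; last exact: cv2.
      by have d := dx' t tab; eapply der_cont; der_rec.
  - rewrite m3 (rev_itg Q3 (fun t => (e2 - sn * X t + c * y t) ^+ 2 * (c * cos (th t) + sn * sin (th t)))) ?dQ3//.
    - rewrite -[RHS]addr0 -(mulr0 (2 * Y / (D ^+ 2 + Y ^+ 2))) -Z /Q3 Xa Xb ya yb /e2 /c /sn.
      by move: (P1 a) (P1 b) (P2 a) (P2 b) (P3 a) (P3 b) => *; field.
    - by move=> t tab; rewrite /y' /v1 /e2; ring.
    - move=> t tab; apply: continuousM; last exact: cv1.
      by have d := dy' t tab; eapply der_cont; der_rec.
(* differentiating the equation twice shows that the chord would be zero *)
have rev' t : a < t < b -> sn * cos (th t) - c * sin (th t) = A + C * (e1 - c * X t - sn * y t) ^+ 2.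
  move=> /andP[at_ tb]; have tab : a < 2 * s - t < b by rewrite -ra -{2}rb; apply/andP; split; lra.
  have := rev _ tab; rewrite /v2 /x' /e1 (_ : 2 * s - (2 * s - t) = t); last by ring.
  by move=> ->; ring.
have d1 t : a < t < b -> (X t - (e1 - c * X t - sn * y t)) * (c * cos (th t) + sn * sin (th t)) = 0.
  move=> tab; have t0 : 0 <= t by apply: abt; case/andP: tab => ? ?; rewrite !ltW.
  have f0 r : a < r < b -> sn * cos (th r) - c * sin (th r) - (A + C * (e1 - c * X r - sn * y r) ^+ 2) = 0.
    by move=> rab; rewrite rev'// subrr.
  have dX := nX N t0; have dY := ny N t0; have dT := nth' N t0.
  have D0 : der (fun r => sn * cos (th r) - c * sin (th r) - (A + C * (e1 - c * X r - sn * y r) ^+ 2)) t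
     (- (2 * C) * ((X t - (e1 - c * X t - sn * y t)) * (c * cos (th t) + sn * sin (th t)))).
    by der_solve; rewrite /= expr1; ring.
  have /eqP := der_zero f0 tab D0.
  by rewrite mulf_eq0 oppr_eq0 mulf_eq0 pnatr_eq0 (gt_eqF C0)/= => /eqP.
have [t tab tn] : exists2 t, a < t < b & c * cos (th t) + sn * sin (th t) != 0.
  apply: contrapT => none.
  have [c0 s0] : c = 0 /\ sn = 0.
    apply: (normal_indep2 N A1 a0 ab) => t tab; apply/eqP/negP => /negP Ut.
    by apply: none; exists t.
  by move: csn; rewrite c0 s0 !expr0n addr0 => /eqP; rewrite eq_sym oner_eq0.
have t0 : 0 <= t by apply: abt; case/andP: tab => ? ?; rewrite !ltW.
have cn : {for t, continuous (fun t => c * cos (th t) + sn * sin (th t))}.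
  by have d := nth' N t0; eapply der_cont; der_rec.
have [a' [b' [aa a't tb' bb nz_]]] := nonzero_nbhd tab cn tn.
have sub r : a' < r < b' -> a < r < b.
  by move=> /andP[ar rb']; rewrite (le_lt_trans aa ar) (lt_le_trans rb' bb).
have eqX r : a' < r < b' -> X r - (e1 - c * X r - sn * y r) = 0.
  move=> rab; have := d1 r (sub r rab) => /eqP.
  by rewrite mulf_eq0 (negPf (nz_ r rab)) orbF => /eqP.
have [c1 _] : 1 + c = 0 /\ sn = 0.
  apply: (normal_indep2 N A1 (le_trans a0 aa) (lt_trans a't tb')) => r rab.
  have rr : 0 <= r by apply: abt; case/andP: (sub r rab) => ? ?; rewrite !ltW.
  have dX := nX N rr; have dY := ny N rr.
  apply: (der_zero eqX rab); der_solve; ring.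
move: c1; rewrite /c => c1.
have : 2 * D ^+ 2 / (D ^+ 2 + Y ^+ 2) = 0 by rewrite -[RHS]c1; field.
by move=> /eqP; rewrite !mulf_eq0 invr_eq0 pnatr_eq0 (negPf L0) (negPf Dn).
Qed.

End Maxwell.

(** * Inflectional elasticae: zeros of the defect of the central symmetry *)

(** The position as a function of time on the whole line: the clock is onto, because it gains a
    fixed amount in each period. *)
Lemma clock_inverse {R : realType} (W T0 : R -> R) (per kap : R) : 0 < per -> 0 < kap ->
  (forall p, 0 < W p) -> (forall p, der T0 p (W p)^-1) ->
  (forall p, T0 (p + per) = T0 p + kap) -> injective T0 ->
  exists am : R -> R, [/\ forall u, T0 (am u) = u, forall p, am (T0 p) = p &
    forall u, der am u (W (am u))].
Proof.
move=> per0 k0 W0 dT0 T0p T0i.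
have cT : continuous T0 by exact: der_continuous dT0.
have up (n : nat) p : T0 (p + n%:R * per) = T0 p + n%:R * kap.
  elim: n => [|n IH]; first by rewrite !mul0r !addr0.
  by rewrite -natr1 mulrDl mul1r addrA T0p IH; ring.
have surj u : exists p, T0 p = u.
  pose n := Num.bound (`|u - T0 0| / kap).
  have nP : `|u - T0 0| <= n%:R * kap.
    rewrite -ler_pdivrMr//; apply/ltW/archi_boundP; exact: divr_ge0 (ltW k0).
  have np : 0 <= n%:R * per by rewrite mulr_ge0// ltW.
  have lo : T0 (- (n%:R * per)) = T0 0 - n%:R * kap.
    have := up n (- (n%:R * per)); rewrite addNr => ->; ring.
  have hi : T0 (n%:R * per) = T0 0 + n%:R * kap by have := up n 0; rewrite add0r.
  have np' : - (n%:R * per) <= n%:R * per by lra.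
  have [|p _ <-] := ivt_value np' (within_cont (fun p _ => cT p)) (v := u); last by exists p.
  by rewrite lo hi; move: nP; rewrite ler_norml => /andP[? ?]; apply/andP; split; lra.
have [am amP] := choice surj.
have amK p : am (T0 p) = p by apply: T0i; rewrite amP.
exists am; split => // u.
have Wn : (W (am u))^-1 != 0 by rewrite invr_eq0 gt_eqF.
have := @is_derive_inverse R T0 am (W (am u))^-1 (am u) _ _ (dT0 (am u)) Wn.
rewrite amP invrK; apply.
- by near=> p; exact: amK.
- by near=> p; exact: cT.
Unshelve. all: by end_near. Qed.

(* The maximal inflectional elastica, centred at a vertex; U and Y stand for
   cos th and for the ordinate. *)
Record hill {R : realType} (C A b kap : R) (X U Y : R -> R) : Prop := Hill {
  hC : 0 < C;
  hA : -1 < A < 1;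
  hb : 0 < b;
  hbE : C * b ^+ 2 = 1 - A;
  hk : 0 < kap;
  hX : forall u, der X u (U u);
  hU : forall u, der U u (- (2 * C * X u * (A + C * X u ^+ 2)));
  hY : forall u, der Y u (A + C * X u ^+ 2);
  hunit : forall u, U u ^+ 2 + (A + C * X u ^+ 2) ^+ 2 = 1;
  hXe : forall u, X (- u) = X u;
  hUo : forall u, U (- u) = - U u;
  hYo : forall u, Y (- u) = - Y u;
  hXs : forall u, X (u + kap) = - X u;
  hUs : forall u, U (u + kap) = - U u;
  hYs : forall u, Y (u + kap) = Y u + Y kap;
  hX0 : X 0 = b;
  hXpos : forall u, - (kap / 2) < u < kap / 2 -> 0 < X u;
  hUneg : forall u, 0 < u < kap -> U u < 0 }.

Lemma der_swap {R : realType} (f g df dg : R -> R) : (forall t : R, der f t (df t)) ->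
  (forall t : R, der g t (dg t)) -> (forall t, df t = dg t) -> f 0 = g 0 -> forall t, f t = g t.
Proof.
move=> dF dG E E0 t; apply/eqP; rewrite -subr_eq0; apply/eqP.
have -> : 0 = f 0 - g 0 by rewrite E0 subrr.
apply: (@is_derive_0_is_cst _ (fun t => f t - g t)) => s.
suff : der (fun t => f t - g t) s 0 by [].
by apply: der_eq (derB (dF s) (dG s)) _; rewrite E subrr.
Qed.

(** Arcs have to be compared with translates of themselves, which may leave the half-line on which
    the elastica is given. The inverse clock extends it. The speed is even, hence the clock and its
    inverse are odd, whence the parities about the vertex. *)
Lemma hill_exists {R : realType} `(I : @inflectional R C A X th y b phi T0 kap) :
  exists (Xg Ug Yg : R -> R) (t0 : R), hill C A b kap Xg Ug Yg /\
    forall t : R, 0 <= t -> [/\ X t = Xg (t + t0), cos (th t) = Ug (t + t0) &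
      forall s : R, 0 <= s -> y t - y s = Yg (t + t0) - Yg (s + t0)].
Proof.
infl_facts I.
pose W := infl_speed C A b.
have W0 p : 0 < W p by exact: infl_speed_gt0 I p.
have arg p : 0 < C * (1 + A + C * b ^+ 2 * cos p ^+ 2).
  by rewrite mulr_gt0// ltr_pwDl//; [lra|rewrite bE mulr_ge0 ?sqr_ge0//; lra].
have Wev p : W (- p) = W p by rewrite /W /infl_speed cosN.
have W2 p : W p ^+ 2 = C * (1 + A + C * b ^+ 2 * cos p ^+ 2) by rewrite sqr_sqrtr// ltW.
have [am [amP amK dam]] := clock_inverse (pi_gt0 R) k0 W0 (iT0 I) (iT0p I) (iT0i I).
have T0odd p : T0 (- p) = - T0 p.
  apply: (@der_swap _ (fun p => T0 (- p)) (fun p => - T0 p) (fun p => - (W p)^-1) (fun p => - (W p)^-1)) => //.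
  - move=> t; have d := iT0 I (- t); der_solve; rewrite -/(W (- t)) Wev; ring.
  - by move=> t; have d := iT0 I t; der_solve.
  - by rewrite !oppr0 (iT00 I) oppr0.
have amo u : am (- u) = - am u by apply: (iT0i I); rewrite amP T0odd amP.
have ams u : am (u + kap) = am u + pi by apply: (iT0i I); rewrite amP (iT0p I) amP.
have am0 : am 0 = 0 by apply: (iT0i I); rewrite amP (iT00 I).
have amk : am kap = pi by have := ams 0; rewrite add0r am0 add0r.
have amh : am (kap / 2) = pi / 2.
  have := ams (- (kap / 2)); rewrite amo (_ : - (kap / 2) + kap = kap / 2); last by field.
  lra.
have inc u v : u < v -> am u < am v.
  move=> uv; apply: (@der_lt _ am (fun u => W (am u)) _ _ uv) => t _; [exact: dam|exact: W0].
pose Xg u := b * cos (am u); pose Ug u := - (b * sin (am u) * W (am u)).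
have [|Y dY] := @primitive _ (fun u => A + C * Xg u ^+ 2).
  apply: (@der_continuous _ _ (fun u => C * (2 * Xg u * (- (b * (sin (am u) * W (am u))))))) => u.
  by have d := dam u; rewrite /Xg; der_solve; rewrite /= expr1; ring.
pose Yg u := Y u - Y 0.
have dYg u : der Yg u (A + C * Xg u ^+ 2) by have d := dY u; rewrite /Yg; der_solve; ring.
have Yodd u : Yg (- u) = - Yg u.
  apply: (@der_swap _ (fun u => Yg (- u)) (fun u => - Yg u) (fun u => - (A + C * Xg u ^+ 2)) (fun u => - (A + C * Xg u ^+ 2))) => //.
  - by move=> t; have d := dYg (- t); clear dYg; der_solve; rewrite /Xg amo cosN; ring.
  - by move=> t; have d := dYg t; der_solve.
  - by rewrite /Yg oppr0 subrr oppr0.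
exists Xg, Ug, Yg, (T0 (phi 0)); split; last first.
  have phE (t : R) : 0 <= t -> phi t = am (t + T0 (phi 0)).
    by move=> t0; apply: (iT0i I); rewrite amP (clock_time W0 (iphi I) (iT0 I) t0) addrC.
  move=> t t0; split; first by rewrite (iX I)// phE.
    by rewrite (iU I)// phE.
  have E (r : R) : 0 <= r -> y r - y 0 = Yg (r + T0 (phi 0)) - Yg (0 + T0 (phi 0)).
    move=> r0; apply: (@der_eq_incr _ y (fun r => Yg (r + T0 (phi 0))) (fun r => A + C * X r ^+ 2) 0 r r0) => q /andP[q0 _].
      exact: (normal_dy N).
    by have d := dYg (q + T0 (phi 0)); clear dYg; der_solve; rewrite (iX I)// (phE q)// /Xg; ring.
  by move=> s s0; have := E s s0; have := E t t0; lra.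
split => //; first exact: iA I.
- by move=> u; have d := dam u; rewrite /Xg /Ug; der_solve; ring.
- move=> u; have d := dam u; have dW : der W (am u) (- (C * (C * b ^+ 2 * (2 * cos (am u) * sin (am u)))) / (2 * W (am u))).
    have w0 := W0 (am u); have a0 := arg (am u).
    move: w0; rewrite /W /infl_speed => w0; der_solve; rewrite /= expr1.
    by move: w0; move: (Num.sqrt _) => r r0; field; nz.
  rewrite /Ug; der_solve; rewrite /Xg.
  have := W2 (am u); have := W0 (am u); have := cos2Dsin2 (am u).
  move: (W _) (cos _) (sin _) => w c s cs w0 w2.
  have s2 : s * s = 1 - c ^+ 2 by rewrite -expr2; lra.
  have AE : A = 1 - C * b ^+ 2 by lra.
  transitivity (- (b * c * (w ^+ 2 - C ^+ 2 * b ^+ 2 * (s * s)))); first by field; nz.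
  by rewrite w2 s2 AE; ring.
- move=> u; have := W2 (am u); have := cos2Dsin2 (am u); rewrite /Ug /Xg.
  move: (W _) (cos _) (sin _) => w c s cs w2.
  rewrite sqrrN exprMn w2 exprMn; have -> : s ^+ 2 = 1 - c ^+ 2 by lra.
  have AE : A = 1 - C * b ^+ 2 by lra.
  by rewrite AE; ring.
- by move=> u; rewrite /Xg amo cosN.
- by move=> u; rewrite /Ug amo sinN Wev; ring.
- by move=> u; rewrite /Xg ams cosDpi; ring.
- move=> u; rewrite /Ug ams sinDpi /W /infl_speed cosDpi sqrrN; ring.
- apply: (@der_swap _ (fun u => Yg (u + kap)) (fun u => Yg u + Yg kap) (fun u => A + C * Xg u ^+ 2) (fun u => A + C * Xg u ^+ 2)) => //.
  + move=> t; have d := dYg (t + kap); clear dYg; der_solve; rewrite /Xg ams cosDpi; ring.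
  + by move=> t; have d := dYg t; clear dYg; der_solve; ring.
  + by rewrite add0r /Yg subrr add0r.
- by rewrite /Xg am0 cos0 mulr1.
- move=> u /andP[u1 u2]; rewrite /Xg mulr_gt0// cos_gt0_pihalf//.
  by rewrite -amh -amo !inc.
- move=> u /andP[u1 u2]; rewrite /Ug oppr_lt0 mulr_gt0// mulr_gt0// sin_gt0_pi//.
  by rewrite -{1}am0 -amk !inc.
Qed.

Lemma der_ln {R : realType} (f : R -> R) x l : 0 < f x -> der f x l ->
  der (fun t => ln (f t)) x ((f x)^-1 * l).
Proof. by move=> f0 df; apply: (@der_comp _ (@ln R)) df; exact: is_derive1_ln. Qed.

Section Hill.
Context {R : realType}.
Variables (C A b kap : R) (X U Y : R -> R).

(* Half of the moment defect of the central symmetry of the arc [v-p, v+p], as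
   in maxwell_Z. *)
Definition defect (v p : R) : R := - (U (v + p) - U (v - p)) / (2 * C)
  - (X (v + p) + X (v - p)) * (Y (v + p) - Y (v - p)) / 2.

Lemma hill_Xbound (H : hill C A b kap X U Y) u : `|X u| <= b.
Proof.
have C0 := hC H; have bE := hbE H.
have := hunit H u; have U2 := sqr_ge0 (U u) => un.
rewrite -(ler_pXn2r (n := 2))// ?nnegrE ?(ltW (hb H))// real_normK ?num_real//.
rewrite -(ler_pM2l C0) bE.
have : (A + C * X u ^+ 2) ^+ 2 <= 1 by lra.
move=> F2; have : `|A + C * X u ^+ 2| <= 1.
  by rewrite -(ler_pXn2r (n := 2))// ?nnegrE// expr1n real_normK ?num_real.
by rewrite ler_norml => /andP[_]; lra.
Qed.

(** The function [f] and its derivative [g] solve a linear system with bounded coefficients, so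
    vanishing at [p] they vanish at 0, where [f] is [2 * X v]. *)
Lemma hill_unique (H : hill C A b kap X U Y) v p : 0 <= p -> X (v + p) = - X (v - p) ->
  U (v + p) = U (v - p) -> X v = 0.
Proof.
move=> p0 EX EU; have C0 := hC H; have b0 := hb H.
pose f t := X (v + t) + X (v - t); pose g t := U (v + t) - U (v - t).
pose Q t := f t ^+ 2 + g t ^+ 2.
pose L := 1 + 2 * C * (1 + 3 * C * b ^+ 2).
have df t : der f t (g t).
  have dX := hX H; rewrite /f; der_solve.
  rewrite /g; ring.
pose k t := - (2 * C * (A + C * (X (v + t) ^+ 2 - X (v + t) * X (v - t) + X (v - t) ^+ 2))).
have dg t : der g t (f t * k t).
  by have dU := hU H; rewrite /g; der_solve; rewrite /f /k; ring.
have A1 : `|A| <= 1 by rewrite ler_norml; have /andP[? ?] := hA H; rewrite !ltW.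
have kL t : `|1 + k t| <= L.
  rewrite (le_trans (ler_normD _ _))// normr1 lerD2l normrN !normrM (gtr0_norm C0) ger0_norm//.
  rewrite ler_pM2l ?mulr_gt0// (le_trans (ler_normD _ _))// lerD//.
  rewrite normrM (gtr0_norm C0) -mulrA mulrCA ler_pM2l//.
  have h1 := hill_Xbound H (v + t); have h2 := hill_Xbound H (v - t).
  rewrite (le_trans (ler_normD _ _))// (le_trans (lerD (ler_normB _ _) (lexx _)))// !normrX normrM.
  have b2 : 3 * b ^+ 2 = b ^+ 2 + b * b + b ^+ 2 by ring.
  by rewrite b2 !lerD ?ler_pM ?lerXn2r ?nnegrE ?(ltW b0).
have mono : Q 0 * expR (L * 0) <= Q p * expR (L * p).
  apply: (@der_le _ (fun t => Q t * expR (L * t))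
    (fun t => (2 * f t * g t * (1 + k t) + L * Q t) * expR (L * t)) _ _ p0) => t _.
    by have d1 := df t; have d2 := dg t; rewrite /Q; der_solve; rewrite /= !expr1; ring.
  apply: mulr_ge0; last exact: expR_ge0.
  have fg : `|2 * f t * g t| <= Q t.
    rewrite /Q ler_norml; apply/andP; split; rewrite -subr_ge0.
      by rewrite (_ : _ - _ = (f t + g t) ^+ 2) ?sqr_ge0//; ring.
    by rewrite (_ : _ - _ = (f t - g t) ^+ 2) ?sqr_ge0//; ring.
  have := ler_pM (normr_ge0 _) (normr_ge0 _) fg (kL t); rewrite -normrM ler_norml => /andP[+ _].
  by lra.
have Qp : Q p = 0 by rewrite /Q /f /g EX EU addNr subrr expr0n addr0.
move: mono; rewrite Qp mul0r mulr0 expR0 mulr1 /Q /f /g addr0 subr0 subrr expr0n addr0 => q0.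
have : (X v + X v) ^+ 2 = 0 by apply/eqP; rewrite eq_le q0 sqr_ge0.
by move=> /eqP; rewrite sqrf_eq0 => /eqP; lra.
Qed.

Lemma defect_cont (H : hill C A b kap X U Y) v : continuous (defect v).
Proof.
move=> p; have d1 := hU H (v + p); have d2 := hU H (v - p).
have d3 := hX H (v + p); have d4 := hX H (v - p); have d5 := hY H (v + p); have d6 := hY H (v - p).
by rewrite /defect; eapply der_cont; der_rec.
Qed.

(** A zero of the defect with [X (v + r) + X (v - r) = 0] would have equal [U] at both ends, which
    [hill_unique] excludes. The nonzero sum is what [maxwell_Z] requires. *)
Lemma defect_root (H : hill C A b kap X U Y) v p q : 0 <= p -> p <= q -> X v != 0 ->
  defect v p * defect v q <= 0 -> exists2 r, p <= r <= q &
  defect v r = 0 /\ X (v + r) + X (v - r) != 0.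
Proof.
move=> p0 pq Xv sgn; have [r prq r0] := ivt pq (within_cont (fun t _ => @defect_cont H v t)) sgn.
exists r => //; split => //; apply/negP => /eqP S0.
have C0 := hC H; have rr : 0 <= r by case/andP: prq => + _; exact: le_trans.
move: Xv; rewrite (hill_unique H rr) ?eqxx//; first by lra.
move: r0; rewrite /defect S0 mul0r mul0r subr0 => /eqP.
by rewrite mulf_eq0 oppr_eq0 invr_eq0 mulf_eq0 pnatr_eq0 (gt_eqF C0)/= orbF subr_eq0 => /eqP.
Qed.

Lemma hill_neg (H : hill C A b kap X U Y) u : [/\ X (u - kap) = - X u, U (u - kap) = - U u &
  Y (u - kap) = Y u - Y kap].
Proof.
have := hXs H (u - kap); have := hUs H (u - kap); have := hYs H (u - kap); rewrite subrK.
by split; lra.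
Qed.

Lemma defect_quarter (H : hill C A b kap X U Y) v : defect v (kap / 2) = - U (v + kap / 2) / C.
Proof.
have C0 := hC H; have [x1 u1 _] := hill_neg H (v + kap / 2).
rewrite (_ : v + kap / 2 - kap = v - kap / 2) in x1 u1; last by field.
by rewrite /defect x1 u1; field; nz.
Qed.

(** Opposite to the value of [defect_quarter], so the defect has a zero of half-width between
    [kap / 2] and [3 * (kap / 2)] for every centre. *)
Lemma defect_3quarter (H : hill C A b kap X U Y) v : defect v (3 * (kap / 2)) = U (v + kap / 2) / C.
Proof.
have C0 := hC H; have [x1 u1 _] := hill_neg H (v + kap / 2).
have [x2 u2 _] := hill_neg H (v + kap / 2 - kap).
rewrite /defect (_ : v + 3 * (kap / 2) = v + kap / 2 + kap); last by field.
rewrite (_ : v - 3 * (kap / 2) = v + kap / 2 - kap - kap); last by field.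
by rewrite (hXs H) (hUs H) x2 u2 x1 u1; field; nz.
Qed.

Lemma hill_reduce (H : hill C A b kap X U Y) v : exists v1 e, [/\ `|v1| <= kap / 2, e ^+ 2 = 1 &
  forall u, [/\ X (v + u) = e * X (v1 + u), U (v + u) = e * U (v1 + u) &
    forall u', Y (v + u) - Y (v + u') = Y (v1 + u) - Y (v1 + u')]].
Proof.
have k0 := hk H.
have [n] : exists n : nat, `|v| <= kap / 2 + n%:R * kap.
  exists (Num.bound (`|v| / kap)).
  have : `|v| / kap < (Num.bound (`|v| / kap))%:R by apply: archi_boundP; exact: divr_ge0 (ltW k0).
  by rewrite ltr_pdivrMr// => ?; have := ltW k0; lra.
elim: n v => [v|n IH v vn].
  rewrite mul0r addr0 => vk; exists v, 1; split => //; first by rewrite expr1n.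
  by move=> u; rewrite !mul1r; split.
have [/IH//|big] := leP `|v| (kap / 2 + n%:R * kap).
have [v0|v0] := leP 0 v.
  have [|v1 [e [v1k e2 E]]] := IH (v - kap).
    move: vn big; rewrite (ger0_norm v0) -[n.+1%:R]natr1 (mulrDl _ 1) mul1r ler_norml.
    have : 0 <= n%:R * kap by rewrite mulr_ge0// ltW.
    by move=> ? ? ?; apply/andP; split; lra.
  exists v1, (- e); rewrite sqrrN; split => // u; have [E1 E2 E3] := E u.
  have [x1 u1 y1] := hill_neg H (v + u).
  rewrite (_ : v - kap + u = v + u - kap) in E1 E2 *; last by ring.
  split; [by rewrite -[LHS]opprK -x1 E1 mulNr|by rewrite -[LHS]opprK -u1 E2 mulNr|].
  move=> u'; rewrite -E3; have [_ _ y2] := hill_neg H (v + u').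
  rewrite (_ : v - kap + u = v + u - kap); last by ring.
  rewrite (_ : v - kap + u' = v + u' - kap); last by ring.
  by rewrite y1 y2; ring.
have [|v1 [e [v1k e2 E]]] := IH (v + kap).
  move: vn big; rewrite (ltr0_norm v0) -[n.+1%:R]natr1 (mulrDl _ 1) mul1r ler_norml.
  have : 0 <= n%:R * kap by rewrite mulr_ge0// ltW.
  by move=> ? ? ?; apply/andP; split; lra.
exists v1, (- e); rewrite sqrrN; split => // u; have [E1 E2 E3] := E u.
rewrite (_ : v + kap + u = v + u + kap) in E1 E2; last by ring.
rewrite (hXs H) in E1; rewrite (hUs H) in E2.
split; [by rewrite mulNr -E1 opprK|by rewrite mulNr -E2 opprK|].
move=> u'; rewrite -E3.
rewrite (_ : v + kap + u = v + u + kap); last by ring.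
rewrite (_ : v + kap + u' = v + u' + kap); last by ring.
by rewrite !(hYs H); ring.
Qed.

Lemma hill_decr (H : hill C A b kap X U Y) u v : 0 <= u -> u < v -> v <= kap -> X v < X u.
Proof.
move=> u0 uv vk; rewrite -ltrN2.
apply: (@der_lt _ (fun u => - X u) (fun u => - U u) _ _ uv) => t /andP[ut tv].
  by have dX := hX H; der_solve.
by rewrite oppr_gt0 (hUneg H)// (le_lt_trans u0 ut) (lt_le_trans tv vk).
Qed.

Lemma hill_sum_pos (H : hill C A b kap X U Y) v q : `|v| < kap / 2 -> 0 <= q -> q < kap / 2 ->
  0 < X (v + q) + X (v - q).
Proof.
wlog v0 : v / 0 <= v.
  move=> W vk q0 qk; have [v0|v0] := leP 0 v; first exact: W.
  have := W (- v) _ _ q0 qk; rewrite oppr_ge0 normrN => /(_ (ltW v0) vk).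
  rewrite -(hXe H) -[X (- v - q)](hXe H) addrC.
  rewrite (_ : - (- v - q) = v + q); last by ring.
  by rewrite (_ : - (- v + q) = v - q); last by ring.
rewrite ger0_norm// => vk q0 qk.
have E : X (v + q) = - X (kap - v - q).
  have := hXs H (v + q - kap); rewrite subrK => ->.
  by rewrite -(hXe H) (_ : - (v + q - kap) = kap - v - q); last by ring.
rewrite E addrC subr_gt0.
have [vq|qv] := leP q v.
  apply: (hill_decr H); lra.
rewrite -(hXe H (v - q)) opprB.
by apply: (hill_decr H); lra.
Qed.

(** Twice [defect v q] divided by the sum of the end abscissas; in this normalization the defect
    does not depend on the centre of the arc. *)
Definition reduced (v q : R) : R :=
  - (U (v + q) - U (v - q)) / (C * (X (v + q) + X (v - q))) - (Y (v + q) - Y (v - q)).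

(** Replacing the half-width [q] by [kap - q] moves the ends of the arc to the opposite ones shifted
    by half a period; only the rise is affected, by [2 * Y kap]. *)
Lemma defect_reduced (H : hill C A b kap X U Y) v q : X (v + q) + X (v - q) != 0 ->
  defect v (kap - q) = (X (v + q) + X (v - q)) * (reduced v q + 2 * Y kap) / 2.
Proof.
move=> S0; have C0 := hC H; have [x1 u1 y1] := hill_neg H (v + q).
rewrite /defect /reduced (_ : v + (kap - q) = v - q + kap); last by ring.
rewrite (_ : v - (kap - q) = v + q - kap); last by ring.
rewrite (hXs H) (hUs H) (hYs H) x1 u1 y1; field.
by rewrite S0 gt_eqF.
Qed.

Lemma reduced_const (H : hill C A b kap X U Y) v q : `|v| < kap / 2 -> 0 <= q -> q < kap / 2 ->
  reduced v q = reduced 0 q.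
Proof.
move=> vk q0 qk; have C0 := hC H.
have d w : `|w| < kap / 2 -> der (fun v => reduced v q) w 0.
  move=> wk; have S0 := hill_sum_pos H wk q0 qk.
  have Sn : C * (X (w + q) + X (w - q)) != 0 by rewrite mulf_neq0// gt_eqF.
  have dX := hX H; have dU := hU H; have dY := hY H.
  rewrite /reduced; der_solve => //.
  have := hunit H (w + q); have := hunit H (w - q); move: S0 Sn.
  move: (X (w + q)) (X (w - q)) (U (w + q)) (U (w - q)) => x x' u u' S0 Sn E' E.
  have u2 : u * u = 1 - (A + C * x ^+ 2) ^+ 2 by rewrite -expr2; lra.
  have u2' : u' * u' = 1 - (A + C * x' ^+ 2) ^+ 2 by rewrite -expr2; lra.
  by field: u2 u2'; nz.
have [v0|v0] := leP 0 v.
  apply: (@der_const _ (fun v => reduced v q) 0 v v0) => w /andP[w0 wv]; apply: d.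
  by rewrite ger0_norm//; move: vk; rewrite ger0_norm//; exact: le_lt_trans.
apply/esym/(@der_const _ (fun v => reduced v q) v 0 (ltW v0)) => w /andP[vw w0]; apply: d.
rewrite ler0_norm//; move: vk; rewrite ltr0_norm//; apply: le_lt_trans; lra.
Qed.

Lemma reduced0 (H : hill C A b kap X U Y) q : 0 <= q -> q < kap / 2 ->
  reduced 0 q = - U q / (C * X q) - 2 * Y q.
Proof.
move=> q0 qk; have C0 := hC H; have k0 := hk H.
have Xq : 0 < X q by apply: (hXpos H); apply/andP; split; lra.
rewrite /reduced !add0r (hXe H) (hUo H) (hYo H).
by rewrite (_ : X q + X q = 2 * X q); [field; nz|ring].
Qed.

(* Half of the way from the vertex to the inflection point, on the logarithmic
   scale of X + sqrt (X^2 + e^2), takes a definite part of the time. *)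
Lemma hill_wait (H : hill C A b kap X U Y) : A <= 0 -> exists m : R, [/\ 0 < m,
  (1 + A) * b ^+ 2 <= 10 * C * b ^+ 2 * m ^+ 2 &
  forall u, 0 <= u -> u <= 2 / 5 * (kap / 2) -> m <= X u].
Proof.
move=> A0; have C0 := hC H; have b0 := hb H; have bE := hbE H; have k0 := hk H.
have /andP[A1 _] := hA H.
(* The scale of the inflection: [U ^+ 2 = C ^+ 2 * (b ^+ 2 - X ^+ 2) * (X ^+ 2 + e ^+ 2)]. *)
pose e := Num.sqrt ((1 + A) / C).
have e0 : 0 < e by rewrite sqrtr_gt0 divr_gt0//; qlra.
have e2 : C * e ^+ 2 = 1 + A by rewrite sqr_sqrtr; [rewrite mulrC divfK// gt_eqF|rewrite divr_ge0 ?ltW//; qlra].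
clearbody e.
have eb : e <= b.
  by rewrite -(ler_pXn2r (n := 2)) ?nnegrE ?(ltW e0) ?(ltW b0)// -(ler_pM2l C0) e2 bE; qlra.
pose B := b + Num.sqrt (b ^+ 2 + e ^+ 2).
have be2 : 0 < b ^+ 2 + e ^+ 2 by rewrite addr_gt0 ?exprn_gt0.
have sE : Num.sqrt (b ^+ 2 + e ^+ 2) ^+ 2 = b ^+ 2 + e ^+ 2 by rewrite sqr_sqrtr// ltW.
have s0 := sqrtr_ge0 (b ^+ 2 + e ^+ 2).
have se : e <= Num.sqrt (b ^+ 2 + e ^+ 2).
  by rewrite -(ler_pXn2r (n := 2))// ?nnegrE ?(ltW e0)// sE lerDr sqr_ge0.
have sb : Num.sqrt (b ^+ 2 + e ^+ 2) <= 3 / 2 * b.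
  rewrite -(ler_pXn2r (n := 2))// ?nnegrE ?mulr_ge0 ?(ltW b0)// sE exprMn.
  have : e ^+ 2 <= b ^+ 2 by rewrite lerXn2r ?nnegrE ?(ltW e0) ?(ltW b0).
  by have := sqr_ge0 b; qlra.
have sbe : Num.sqrt (b ^+ 2 + e ^+ 2) <= b + e.
  rewrite -(ler_pXn2r (n := 2))// ?nnegrE ?addr_ge0 ?(ltW b0) ?(ltW e0)// sE.
  rewrite -subr_ge0 (_ : _ - _ = 2 * b * e); last by ring.
  by rewrite mulr_ge0 ?(ltW e0)// mulr_ge0 ?(ltW b0).
have B0 : 0 < B by rewrite ltr_pwDl.
(* [B] and [e] are the values of [X + sqrt (X ^+ 2 + e ^+ 2)] at the vertex and at the inflection
   point; [g] is their geometric mean, and [m] below is the abscissa where it is attained. *)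
pose g := Num.sqrt (e * B).
have g0 : 0 < g by rewrite sqrtr_gt0 mulr_gt0.
have g2 : g ^+ 2 = e * B by rewrite sqr_sqrtr//; ge0.
clearbody g.
pose m := (g ^+ 2 - e ^+ 2) / (2 * g).
have eB : 2 * e <= B by rewrite /B; qlra.
have mn : 0 < g ^+ 2 - e ^+ 2.
  rewrite g2 (_ : _ - _ = e * (B - e)); last by ring.
  by rewrite mulr_gt0// subr_gt0; qlra.
have m0 : 0 < m by rewrite divr_gt0// mulr_gt0.
have m2 : m ^+ 2 = e * (B - e) ^+ 2 / (4 * B).
  rewrite /m expr_div_n exprMn !g2; field; nz.
have Gm : m + Num.sqrt (m ^+ 2 + e ^+ 2) = g.
  have -> : m ^+ 2 + e ^+ 2 = ((g ^+ 2 + e ^+ 2) / (2 * g)) ^+ 2 by rewrite /m; field; nz.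
  rewrite sqrtr_sqr ger0_norm; last by ge0.
  by rewrite /m; field; nz.
have mup : m ^+ 2 <= b ^+ 2 / 2.
  have h1 : (B - e) ^+ 2 <= (2 * b) ^+ 2.
    by rewrite lerXn2r// ?nnegrE; rewrite /B; qlra.
  rewrite m2 ler_pdivrMr ?mulr_gt0//.
  have h2 : e * (B - e) ^+ 2 <= e * (2 * b) ^+ 2 by rewrite ler_pM2l.
  have h3 : 2 * e * b ^+ 2 <= B * b ^+ 2 by rewrite ler_pM2r// exprn_gt0.
  by move: h2; rewrite exprMn; move: h3; qlra.
have mlow : e * b ^+ 2 / (4 * B) <= m ^+ 2.
  rewrite m2 ler_pM2r ?invr_gt0 ?mulr_gt0// ler_pM2l// lerXn2r// ?nnegrE ?(ltW b0)//; rewrite /B; qlra.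
exists m; split => //.
  have h : 4 * B <= 10 * b by rewrite /B; qlra.
  rewrite -e2.
  have h1 : C * e ^+ 2 * b ^+ 2 = C * (e * b ^+ 2 / (4 * B)) * (e * (4 * B)) by field; nz.
  have h2 : e * (4 * B) <= b * (10 * b) by apply: ler_pM => //; ge0.
  rewrite h1 (_ : 10 * C * b ^+ 2 * m ^+ 2 = C * m ^+ 2 * (b * (10 * b))); last by ring.
  apply: ler_pM => //; rewrite ?ler_pM2l//.
  - by ge0.
  - by ge0.
move=> u u0 uk; rewrite leNgt; apply/negP => Xum.
have mb : m <= b.
  rewrite -(ler_pXn2r (n := 2)) ?nnegrE ?(ltW m0) ?(ltW b0)//; apply: le_trans mup _.
  by have := sqr_ge0 b; qlra.
have [||u1 /andP[u10 u1u] Xu1] := @ivt _ (fun u => X u - m) 0 u u0.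
- by apply: within_cont => t _; apply: (@der_cont _ _ _ (U t)); have d := hX H t; der_solve; ring.
- by rewrite (hX0 H) mulr_ge0_le0 ?subr_ge0 ?subr_le0// ltW.
have {}Xu1 : X u1 = m by qlra.
pose L t := ln (X t + Num.sqrt (X t ^+ 2 + e ^+ 2)).
have arg t : 0 < X t ^+ 2 + e ^+ 2 by rewrite ltr_wpDl ?sqr_ge0 ?exprn_gt0.
have argp t : 0 < X t + Num.sqrt (X t ^+ 2 + e ^+ 2).
  rewrite -ltrBlDl add0r; apply: le_lt_trans (_ : `|X t| < _); first by rewrite -normrN ler_norm.
  by rewrite -sqrtr_sqr ltr_sqrt// ltrDl exprn_gt0.
have bX t : 0 <= b ^+ 2 - X t ^+ 2.
  by rewrite subr_ge0 -(real_normK (num_real (X t))) lerXn2r// ?nnegrE ?(ltW b0)// (hill_Xbound H).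
have UE t : 0 < t < kap -> - U t = C * Num.sqrt (b ^+ 2 - X t ^+ 2) * Num.sqrt (X t ^+ 2 + e ^+ 2).
  move=> tk; have Un := hUneg H tk.
  apply/eqP; rewrite -(eqrXn2 (n := 2))//; last 2 first.
  - by rewrite oppr_ge0 ltW.
  - by rewrite !mulr_ge0 ?sqrtr_ge0// ltW.
  rewrite sqrrN !exprMn sqr_sqrtr// sqr_sqrtr; last exact: ltW.
  have := hunit H t => un; apply/eqP.
  have -> : U t ^+ 2 = (1 - A - C * X t ^+ 2) * (1 + A + C * X t ^+ 2).
    by have -> : U t ^+ 2 = 1 - (A + C * X t ^+ 2) ^+ 2 by [qlra]; ring.
  by rewrite -bE -e2; ring.
have dL t : der L t (U t / Num.sqrt (X t ^+ 2 + e ^+ 2)).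
  have dX := hX H t; have a1 := arg t; have a2 := argp t.
  have r0 : 0 < Num.sqrt (X t ^+ 2 + e ^+ 2) by rewrite sqrtr_gt0.
  have dG : der (fun t => X t + Num.sqrt (X t ^+ 2 + e ^+ 2)) t (U t + X t * U t / Num.sqrt (X t ^+ 2 + e ^+ 2)).
    by der_solve; rewrite /= expr1; move: r0; move: (Num.sqrt _) => r r0; field; nz.
  apply: (der_eq (@der_ln _ (fun t => X t + Num.sqrt (X t ^+ 2 + e ^+ 2)) t _ a2 dG)).
  by move: a2 r0; move: (Num.sqrt _) => r a2 r0; field; nz.
have bXs t : 0 <= Num.sqrt (b ^+ 2 - X t ^+ 2) by exact: sqrtr_ge0.
have dLE t : 0 < t < kap -> U t / Num.sqrt (X t ^+ 2 + e ^+ 2) = - (C * Num.sqrt (b ^+ 2 - X t ^+ 2)).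
  move=> tk; rewrite -[U t]opprK UE// mulNr mulfK// gt_eqF// sqrtr_gt0//.
have u1k : u1 < kap / 2 by qlra.
(* The logarithm [L] falls at the rate [C * sqrt (b ^+ 2 - X ^+ 2)], at most [C * b] before the
   level [m] is reached. *)
have fast : - (C * b) * u1 <= L u1 - L 0.
  have := @der_le_incr _ (fun t => - (C * b) * t) L (fun=> - (C * b)) (fun t => U t / Num.sqrt (X t ^+ 2 + e ^+ 2)) 0 u1 u10.
  rewrite mulr0 subr0; apply => t.
  - by move=> _; der_solve; ring.
  - by move=> _; exact: dL.
  move=> /andP[t0 tu]; rewrite dLE; last by rewrite t0/=; qlra.
  rewrite lerN2 ler_pM2l// -[leRHS](gtr0_norm b0) -sqrtr_sqr ler_wsqrtr// gerBl sqr_ge0//.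
(* Beyond that level [X ^+ 2 <= b ^+ 2 / 2], and the rate is at least [7 / 10 * (C * b)]. *)
have slow : L (kap / 2) - L u1 <= - (C * (7 / 10 * b)) * (kap / 2) - - (C * (7 / 10 * b)) * u1.
  apply: (@der_le_incr _ L (fun t => - (C * (7 / 10 * b)) * t) (fun t => U t / Num.sqrt (X t ^+ 2 + e ^+ 2)) (fun=> - (C * (7 / 10 * b))) _ _ (ltW u1k)) => t.
  - by move=> _; exact: dL.
  - by move=> _; der_solve; ring.
  move=> /andP[t0 tu]; have tk : 0 < t < kap by rewrite (le_lt_trans u10 t0)/=; qlra.
  rewrite dLE// lerN2 ler_pM2l//; apply: le_sqrt.
  have Xt : X t ^+ 2 <= m ^+ 2.
    rewrite lerXn2r ?nnegrE ?(ltW m0)//; first by apply/ltW/(hXpos H); apply/andP; split; qlra.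
    by rewrite -Xu1; apply/ltW/(hill_decr H); qlra.
  rewrite exprMn; have := sqr_ge0 b; move: mup Xt; qlra.
have Xk : X (kap / 2) = 0.
  have := hXs H (- (kap / 2)); rewrite (hXe H) (_ : - (kap / 2) + kap = kap / 2); [qlra|by field].
have L0 : L 0 = ln B by rewrite /L (hX0 H).
have L1 : L u1 = ln g by rewrite /L Xu1 Gm.
have L2 : L (kap / 2) = ln e by rewrite /L Xk expr0n add0r add0r sqrtr_sqr gtr0_norm.
have lng : 2 * ln g = ln e + ln B.
  by rewrite -lnM ?posrE// -g2 lnXn// mulr_natl.
rewrite L0 L1 in fast; rewrite L1 L2 in slow.
(* Both stages lower [L] by the same amount, so [u1] is at least [7 / 17] of the quarter period,
   more than [2 / 5]. *)
have : C * b * (7 / 10 * (kap / 2 - u1)) <= C * b * u1 by qlra.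
rewrite ler_pM2l ?mulr_gt0//; qlra.
Qed.

(** The derivative of the reduced defect in [q] is [U ^+ 2 / (C * X ^+ 2)]. It would blow up at the
    inflection point; the level [m] of [hill_wait] keeps it bounded. *)
Lemma reduced_bound (H : hill C A b kap X U Y) q : A <= 0 -> 0 <= q -> q <= 2 / 5 * (kap / 2) ->
  reduced 0 q <= 22 * q.
Proof.
move=> A0 q0 qk; have C0 := hC H; have b0 := hb H; have bE := hbE H; have k0 := hk H.
have [m [m0 mb mX]] := hill_wait H A0.
rewrite reduced0//; last by lra.
have Xp t : 0 <= t <= q -> m <= X t.
  by move=> /andP[t0 tq]; apply: mX => //; exact: le_trans qk.
have := @der_le_incr _ (fun t => - U t / (C * X t) - 2 * Y t) (fun t => 22 * t)
  (fun t => U t ^+ 2 / (C * X t ^+ 2)) (fun=> 22) 0 q q0.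
have U0 : U 0 = 0 by have := hUo H 0; rewrite oppr0; lra.
have Y0 : Y 0 = 0 by have := hYo H 0; rewrite oppr0; lra.
rewrite U0 Y0 oppr0 mul0r !mulr0 !subr0; apply => t tq.
- have dX := hX H; have dU := hU H; have dY := hY H.
  have x0 : 0 < X t := lt_le_trans m0 (Xp t tq).
  have xn : C * X t != 0 by rewrite mulf_neq0// gt_eqF.
  by der_solve => //; field; nz.
- by der_solve; ring.
have tq' : 0 <= t <= q by case/andP: tq => ? ?; rewrite !ltW.
have x0 : 0 < X t := lt_le_trans m0 (Xp t tq').
rewrite ler_pdivrMr; last by rewrite mulr_gt0// exprn_gt0.
have m2 : m ^+ 2 <= X t ^+ 2 by rewrite lerXn2r ?nnegrE ?(ltW m0) ?(ltW x0)// Xp.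
have U2 : U t ^+ 2 = (1 - A - C * X t ^+ 2) * (1 + A + C * X t ^+ 2).
  by have := hunit H t => un; have -> : U t ^+ 2 = 1 - (A + C * X t ^+ 2) ^+ 2 by [lra]; ring.
have Cx : 0 <= C * X t ^+ 2 by rewrite mulr_ge0 ?sqr_ge0// ltW.
have Cb2 : C * b ^+ 2 <= 2 by rewrite bE; have /andP[? _] := hA H; lra.
have h0 : 0 <= 1 + A + C * X t ^+ 2 by have /andP[? _] := hA H; lra.
have h1 : U t ^+ 2 <= C * b ^+ 2 * (1 + A + C * X t ^+ 2) by rewrite U2 ler_wpM2r// bE; lra.
(* The constant 22 is 20 from this estimate plus 2 from [h3], both using [C * b ^+ 2 <= 2]. *)
have h2 : (1 + A) * (C * b ^+ 2) <= 20 * (C * X t ^+ 2).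
  have : 10 * C * b ^+ 2 * m ^+ 2 <= 10 * C * b ^+ 2 * X t ^+ 2 by rewrite ler_pM2l ?mulr_gt0 ?exprn_gt0.
  move=> h; have := le_trans mb h; rewrite -(ler_pM2l C0) => h3.
  have : C * b ^+ 2 * (10 * (C * X t ^+ 2)) <= 2 * (10 * (C * X t ^+ 2)) by rewrite ler_wpM2r// mulr_ge0.
  by lra.
have h3 : C * b ^+ 2 * (C * X t ^+ 2) <= 2 * (C * X t ^+ 2) by rewrite ler_wpM2r.
lra.
Qed.

End Hill.

(** * Upper bounds for the inflectional elasticae *)

Section InflectionalUpper.
Context {R : realType}.
Variables (C A : R) (X th y : R -> R) (b : R) (phi T0 : R -> R) (kap : R).
Let V t := sin (th t).
Let U t := cos (th t).

Lemma infl_generic (I : inflectional C A X th y b phi T0 kap) c d : 0 <= c -> c < d ->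
  exists2 t, c < t < d & X t != 0.
Proof.
infl_facts I => c0 cd; apply: contrapT => none.
have X0 t : c < t < d -> X t = 0.
  by move=> tcd; apply/eqP/negP => /negP Xt; apply: none; exists t.
pose m := (c + d) / 2; have mcd : c < m < d by rewrite /m; apply/andP; split; lra.
have m0 : 0 <= m by case/andP: mcd => + _; move/ltW; exact: le_trans.
have U0 := der_zero X0 mcd (nX N m0).
have := normal_unit N m0; rewrite U0 (X0 m mcd) !expr0n mulr0 addr0 add0r => /eqP.
by rewrite sqrf_eq1 => /orP[] /eqP E; move: A_gt A_lt; rewrite E ltxx.
Qed.

(* A zero of the defect of an arc with middle [s] is a Maxwell point. *)
Lemma infl_maxwell (I : inflectional C A X th y b phi T0 kap) Xg Ug Yg t0 s p q T :
  hill C A b kap Xg Ug Yg ->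
  (forall t : R, 0 <= t -> [/\ X t = Xg (t + t0), cos (th t) = Ug (t + t0) &
      forall s : R, 0 <= s -> y t - y s = Yg (t + t0) - Yg (s + t0)]) ->
  0 < p -> p <= q -> q <= s -> s + q < T -> X s != 0 ->
  defect C Xg Ug Yg (s + t0) p * defect C Xg Ug Yg (s + t0) q <= 0 ->
  cartan_min T X y U V -> False.
Proof.
infl_facts I => H G p0 pq qs sT Xs sgn M.
have s0 : 0 <= s by rewrite (le_trans (ltW p0))// (le_trans pq).
have [Xs' _ _] := G s s0; rewrite Xs' in Xs.
have [r /andP[pr rq] [r0 Sr]] := defect_root H (ltW p0) pq Xs sgn.
have a0 : 0 <= s - r by rewrite subr_ge0 (le_trans rq).
have b0' : 0 <= s + r by rewrite addr_ge0// (le_trans (ltW p0)).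
have [X1 U1 _] := G _ a0; have [X2 U2 Y2] := G _ b0'.
have e1 : s - r + t0 = s + t0 - r by ring.
have e2 : s + r + t0 = s + t0 + r by ring.
apply: (@maxwell_Z _ C A X th y s r T N _ a0 (lt_le_trans p0 pr) _ _ _ M).
- by rewrite sqrf_eq1 negb_or (lt_eqF A_lt) (gt_eqF A_gt).
- by apply: le_lt_trans sT; rewrite lerD2l.
- by rewrite X1 X2 e1 e2 addrC.
- rewrite U1 U2 X1 X2 Y2// e1 e2; move: r0; rewrite /defect (addrC (Xg _)).
  by move/eqP; rewrite subr_eq0 => /eqP.
Qed.

(** The defect changes sign between the half-widths [kap / 2] and [3 * (kap / 2)]; a longer minimal
    curve leaves room for such an arc, centred off the axis, with a rest after it. *)
Lemma infl_cartan_3 (I : inflectional C A X th y b phi T0 kap) T :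
  cartan_min T X y U V -> T <= 3 * kap.
Proof.
infl_facts I => M; rewrite leNgt; apply/negP => kT.
have [s /andP[s1 s2] Xs] := infl_generic I (c := 3 * (kap / 2)) (d := T / 2) ltac:(lra) ltac:(lra).
have [Xg [Ug [Yg [t0 [H G]]]]] := hill_exists I.
apply: (infl_maxwell I H G (p := kap / 2) (q := 3 * (kap / 2)) _ _ _ _ Xs _ M); try lra.
rewrite (defect_quarter H) (defect_3quarter H) mulNr mulNr oppr_le0.
by rewrite -expr2 sqr_ge0.
Qed.

(** A fall makes the sign change earlier: at half-width [kap - q] the sign of the defect is decided
    by the reduced defect, at most [22 * q], plus twice the rise of a half period. The admissible
    [q] is the gain over a full period. *)
Lemma infl_cartan_neg (I : inflectional C A X th y b phi T0 kap) T q : y kap - y 0 < 0 ->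
  0 <= q -> q <= 2 / 5 * (kap / 2) -> 22 * q <= - (2 * (y kap - y 0)) ->
  cartan_min T X y U V -> T <= 2 * (kap - q).
Proof.
infl_facts I => h0 q0 qk qh M; rewrite leNgt; apply/negP => kT.
have [Xg [Ug [Yg [t0 [H G]]]]] := hill_exists I.
have [s /andP[s1 s2] Xs] := infl_generic I (c := kap - q) (d := T / 2) ltac:(lra) ltac:(lra).
have hE : Yg kap = y kap - y 0.
  have [_ _ E] := G _ (ltW k0); rewrite E// (addrC kap) (hYs H) add0r; ring.
have s0 : 0 <= s by lra.
have [Xs' _ _] := G s s0.
apply: (infl_maxwell I H G (p := kap / 2) (q := kap - q) _ _ _ _ Xs _ M); try lra.
have [v1 [e [v1k e2 E]]] := hill_reduce H (s + t0).
have [E0 _ _] := E 0; rewrite !addr0 in E0.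
have v1k' : `|v1| < kap / 2.
  rewrite lt_neqAle v1k andbT; apply/negP => /eqP vE.
  have Xk : Xg (kap / 2) = 0.
    have := hXs H (- (kap / 2)); rewrite (hXe H) (_ : - (kap / 2) + kap = kap / 2); [lra|by field].
  move: Xs; rewrite Xs' E0 mulf_eq0 negb_or => /andP[_].
  have [v0|v0] := leP 0 v1; [rewrite ger0_norm// in vE|rewrite ltr0_norm// in vE].
    by rewrite vE Xk eqxx.
  by rewrite -(hXe H) vE Xk eqxx.
have qk2 : q < kap / 2 by lra.
have Sp := hill_sum_pos H v1k' q0 qk2.
have [Ep1 _ Yp] := E q; have [Em1 _ _] := E (- q); have [_ Eu _] := E (kap / 2).
rewrite (defect_quarter H) Eu.
have Un : Ug (v1 + kap / 2) < 0.
  by apply: (hUneg H); move: v1k'; rewrite ltr_norml => /andP[? ?]; apply/andP; split; lra.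
have SE : Xg (s + t0 + q) + Xg (s + t0 - q) = e * (Xg (v1 + q) + Xg (v1 - q)).
  by rewrite Ep1 Em1 mulrDr.
have en : e != 0 by apply/negP => /eqP e0; move: e2; rewrite e0 expr0n => /eqP; rewrite eq_sym oner_eq0.
rewrite (defect_reduced H); last by rewrite SE mulf_neq0// gt_eqF.
have redE : reduced C Xg Ug Yg (s + t0) q = reduced C Xg Ug Yg v1 q.
  have [_ Eu1 _] := E q; have [_ Eu2 _] := E (- q).
  rewrite /reduced SE Yp Eu1 Eu2; congr (_ - _).
  by rewrite -mulrBr (mulrCA C) -mulrN invfM mulrACA divff// mul1r.
rewrite redE (reduced_const H)// SE.
have A0 := ltW (infl_A_neg I h0).
have := reduced_bound H A0 q0 qk; rewrite -hE in qh; rewrite -hE in h0.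
move: (reduced _ _ _ _ 0 q) => r rb.
have -> : - (e * Ug (v1 + kap / 2)) / C * (e * (Xg (v1 + q) + Xg (v1 - q)) * (r + 2 * Yg kap) / 2) =
  e ^+ 2 * (- Ug (v1 + kap / 2) * (Xg (v1 + q) + Xg (v1 - q)) / (2 * C)) * (r + 2 * Yg kap).
  by field; nz.
rewrite e2 mul1r mulr_ge0_le0//; last by lra.
by rewrite divr_ge0 ?mulr_ge0 ?oppr_ge0// ltW// mulr_gt0.
Qed.

End InflectionalUpper.

(* The maximal non-inflectional elastica, centred at a point of maximal
   abscissa; U and Y stand for cos th and for the ordinate. *)
Record wave {R : realType} (C A P : R) (X U Y : R -> R) : Prop := Wave {
  wC : 0 < C;
  wP : 0 < P;
  wX : forall u, der X u (U u);
  wU : forall u, der U u (- (2 * C * X u * (A + C * X u ^+ 2)));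
  wY : forall u, der Y u (A + C * X u ^+ 2);
  wunit : forall u, U u ^+ 2 + (A + C * X u ^+ 2) ^+ 2 = 1;
  wXe : forall u, X (- u) = X u;
  wUo : forall u, U (- u) = - U u;
  wYo : forall u, Y (- u) = - Y u;
  wXs : forall u, X (u + P) = X u;
  wUs : forall u, U (u + P) = U u;
  wYs : forall u, Y (u + P) = Y u + Y P;
  wYP : Y P < 0;
  wUneg : forall u, 0 < u < P / 2 -> U u < 0 }.

(** The abscissa is maximal at the angle [pi / 2]; the reflection [p] to [pi - p] about it becomes
    the time reversal of the curve centred there. *)
Lemma wave_exists {R : realType} `(I : @revolving R C A X th y T0 Y P) :
  exists (Xg Ug Yg : R -> R) (t0 : R), wave C A P Xg Ug Yg /\
    forall t : R, 0 <= t -> [/\ X t = Xg (t + t0), cos (th t) = Ug (t + t0) &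
      forall s : R, 0 <= s -> y t - y s = Yg (t + t0) - Yg (s + t0)].
Proof.
rev_facts I.
pose Xa := rev_abs C A; pose W p := 2 * C * Xa p.
have Xa0 p : 0 < Xa p by exact: rev_abs_gt0.
have W0 p : 0 < W p by rewrite !mulr_gt0.
have pi20 : (0 : R) < 2 * pi by rewrite mulr_gt0// pi_gt0.
have [am [amP amK dam]] := clock_inverse pi20 P0 W0 (vT0 I) (vT0p I) (vT0i I).
have WN p : W (pi - p) = W p by rewrite /W /Xa rev_absN.
have T0N p : T0 (pi - p) = 2 * T0 (pi / 2) - T0 p.
  have E : T0 (pi - p) + T0 p = T0 (pi - pi / 2) + T0 (pi / 2).
    apply: (@is_derive_0_is_cst _ (fun p => T0 (pi - p) + T0 p)) => z.
    suff : der (fun p => T0 (pi - p) + T0 p) z 0 by [].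
    have dT : forall p, der T0 p (W p)^-1 := vT0 I.
    by der_solve; rewrite WN; ring.
  by move: E; rewrite (_ : pi - pi / 2 = pi / 2); [lra|by field].
pose u0 := T0 (pi / 2).
pose g u := am (u0 + u).
have dg u : der g u (W (g u)) by have d := dam (u0 + u); rewrite /g; der_solve; ring.
have gN u : g (- u) = pi - g u.
  by apply: (vT0i I); rewrite /g amP T0N amP /u0; ring.
have gs u : g (u + P) = g u + 2 * pi.
  by apply: (vT0i I); rewrite /g amP (vT0p I) amP; ring.
have g0 : g 0 = pi / 2 by apply: (vT0i I); rewrite /g amP addr0.
have gh : g (P / 2) = 3 * (pi / 2).
  have := gs (- (P / 2)); rewrite gN (_ : - (P / 2) + P = P / 2); [lra|by field].
have inc u v : u < v -> g u < g v.
  by move=> uv; apply: (@der_lt _ g (fun u => W (g u)) _ _ uv) => t _; [exact: dg|exact: W0].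
pose Xg u := Xa (g u); pose Ug u := cos (g u).
have sq p : C * Xa p ^+ 2 = sin p - A by exact: rev_abs_sqr.
have sE u : A + C * Xg u ^+ 2 = sin (g u) by rewrite sq; ring.
have [|Y1 dY1] := @primitive _ (fun u => sin (g u)).
  by apply: (@der_continuous _ _ (fun u => cos (g u) * W (g u))) => u; der_solve.
pose Yg u := Y1 u - Y1 0.
have dYg u : der Yg u (A + C * Xg u ^+ 2) by rewrite sE /Yg; der_solve; ring.
have phE (t : R) : 0 <= t -> th t = g (t + (T0 (th 0) - u0)).
  move=> t0; apply: (vT0i I); rewrite /g amP.
  by have := rev_tE I (lexx 0) t0; lra.
have G (t : R) : 0 <= t -> X t = Xg (t + (T0 (th 0) - u0)) by move=> t0; rewrite (vX I)// {1}phE.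
have Yodd u : Yg (- u) = - Yg u.
  apply: (@der_swap _ (fun u => Yg (- u)) (fun u => - Yg u) (fun u => - (A + C * Xg u ^+ 2)) (fun u => - (A + C * Xg u ^+ 2))) => //.
  - move=> t; have d := dYg (- t); clear dYg; der_solve.
    by rewrite !sE gN sinB sinpi cospi; ring.
  - by move=> t; have d := dYg t; der_solve.
  - by rewrite /Yg oppr0 subrr oppr0.
have yE (t : R) : 0 <= t -> y t - y 0 = Yg (t + (T0 (th 0) - u0)) - Yg (0 + (T0 (th 0) - u0)).
  move=> r0; apply: (@der_eq_incr _ y (fun r => Yg (r + (T0 (th 0) - u0))) (fun r => A + C * X r ^+ 2) 0 t r0) => q /andP[q0 _].
    exact: (normal_dy N).
  by have d := dYg (q + (T0 (th 0) - u0)); clear dYg; der_solve; rewrite (G q)//; ring.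
have Ys u : Yg (u + P) = Yg u + Yg P.
  apply: (@der_swap _ (fun u => Yg (u + P)) (fun u => Yg u + Yg P) (fun u => A + C * Xg u ^+ 2) (fun u => A + C * Xg u ^+ 2)) => //.
  + by move=> t; have d := dYg (t + P); clear dYg; der_solve; rewrite !sE gs sinDtwopi; ring.
  + by move=> t; have d := dYg t; clear dYg; der_solve; ring.
  + by rewrite add0r /Yg subrr add0r.
exists Xg, Ug, Yg, (T0 (th 0) - u0); split; last first.
  move=> t t0; split; [exact: G|by rewrite {1}phE|].
  by move=> s s0; have := yE s s0; have := yE t t0; lra.
split => //.
- by move=> u; have d := dg u; have dXa : forall p, der Xa p (cos p / (2 * C * Xa p)) := fun p => rev_abs_der p C0 A1; rewrite /Xg; der_solve;
    rewrite /Ug /W; have := Xa0 (g u) => x0; field; nz.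
- by move=> u; have d := dg u; rewrite /Ug; der_solve; rewrite sE /W /Xg; ring.
- by move=> u; rewrite sE cos2Dsin2.
- by move=> u; rewrite /Xg gN /Xa rev_absN.
- by move=> u; rewrite /Ug gN cosB cospi sinpi; ring.
- by move=> u; rewrite /Xg gs /Xa /rev_abs sinDtwopi.
- by move=> u; rewrite /Ug gs cosDtwopi.
- have := rev_drop I; rewrite yE ?(ltW P0)// (addrC P) Ys add0r; lra.
- move=> u /andP[u1 u2]; rewrite /Ug.
  have l1 : pi / 2 < g u by rewrite -g0 inc.
  have l2 : g u < 3 * (pi / 2) by rewrite -gh inc.
  rewrite -(subrK pi (g u)) cosDpi oppr_lt0 cos_gt0_pihalf//.
  by apply/andP; split; lra.
Qed.

Lemma der_pos_right {R : realType} (f : R -> R) x l : der f x l -> 0 < l ->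
  exists2 d, 0 < d & forall h, 0 < h -> h < d -> f x < f (x + h).
Proof.
move=> [df] <- l0.
have /cvgr_gt/(_ _ l0)/nbhs_ballP[d /= d0 Hd] : (h^-1 *: ((f \o shift x) (h *: (1 : R^o)) - f x)) @[h --> 0^'] --> 'D_(1 : R^o) (f : R^o -> R^o) (x : R^o).
  exact: df.
exists d => // h h0 hd.
have := Hd h; rewrite /ball /= sub0r normrN gtr0_norm// => /(_ hd).
rewrite gt_eqF// => /(_ isT); rewrite /shift /= [_ *: 1]mulr1 /GRing.scale /= pmulr_rgt0 ?invr_gt0//.
by rewrite subr_gt0 addrC.
Qed.

(** * Non-inflectional elasticae: zeros of the defect of the reflection *)

Section Wave.
Context {R : realType}.
Variables (C A P : R) (X U Y : R -> R).

Definition chord (v p : R) : R := X (v + p) - X (v - p).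
Definition rise (v p : R) : R := Y (v + p) - Y (v - p).
Definition drift (v p : R) : R := U (v + p) + U (v - p).
Definition bend (v p : R) : R := U (v + p) - U (v - p).
Definition mid (v p : R) : R := (X (v + p) + X (v - p)) / 2.

(* Half of the moment defect of maxwell_V for the arc [v-p, v+p]. *)
Definition vdefect (v p : R) : R :=
  chord v p * (p / (3 * C) + A * rise v p / (3 * C) + mid v p * bend v p / (3 * C)
    + mid v p ^+ 2 * rise v p - chord v p * drift v p / (12 * C))
  - rise v p ^+ 3 * chord v p / 12 - rise v p ^+ 2 * drift v p / (4 * C).

(** The quotient by the chord is to the reflection what [reduced] is to the central symmetry. Its
    derivative is a sum of squares, whence monotonicity in the half-width. *)
Lemma vdefect_dp (H : wave C A P X U Y) (v p : R) : chord v p != 0 ->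
  der (fun p => vdefect v p / chord v p) p
   (((C * (2 * mid v p) * chord v p * rise v p + chord v p * bend v p) ^+ 2 +
    (drift v p * rise v p - chord v p *
      (A + C * X (v + p) ^+ 2 + (A + C * X (v - p) ^+ 2))) ^+ 2) / (4 * C * chord v p ^+ 2)).
Proof.
move=> D0; have C0 := wC H; have dX := wX H; have dU := wU H; have dY := wY H.
rewrite /vdefect /chord /rise /drift /bend /mid in D0 *; der_solve => //.
have := wunit H (v + p); have := wunit H (v - p); move: D0; rewrite /=.
move: (X (v + p)) (X (v - p)) (U (v + p)) (U (v - p)) (Y (v + p)) (Y (v - p)) => x x' u u' z z' D0 E' E.
have u2 : u * u = 1 - (A + C * x ^+ 2) ^+ 2 by rewrite -expr2; lra.
have u2' : u' * u' = 1 - (A + C * x' ^+ 2) ^+ 2 by rewrite -expr2; lra.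
by field: u2 u2'; nz.
Qed.

(** Independence of the centre, which allows the sign to be computed for an arc with both ends at
    vertices. *)
Lemma vdefect_ds (H : wave C A P X U Y) (v p : R) : chord v p != 0 ->
  der (fun v => vdefect v p / chord v p) v 0.
Proof.
move=> D0; have C0 := wC H; have dX := wX H; have dU := wU H; have dY := wY H.
rewrite /vdefect /chord /rise /drift /bend /mid in D0 *; der_solve => //.
have := wunit H (v + p); have := wunit H (v - p); move: D0; rewrite /=.
move: (X (v + p)) (X (v - p)) (U (v + p)) (U (v - p)) (Y (v + p)) (Y (v - p)) => x x' u u' z z' D0 E' E.
have u2 : u * u = 1 - (A + C * x ^+ 2) ^+ 2 by rewrite -expr2; lra.
have u2' : u' * u' = 1 - (A + C * x' ^+ 2) ^+ 2 by rewrite -expr2; lra.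
by field: u2 u2'; nz.
Qed.

Lemma wave_decr (H : wave C A P X U Y) (u v : R) : 0 <= u -> u < v -> v <= P / 2 -> X v < X u.
Proof.
move=> u0 uv vk; rewrite -ltrN2.
apply: (@der_lt _ (fun u => - X u) (fun u => - U u) _ _ uv) => t /andP[ut tv].
  by have dX := wX H; der_solve.
by rewrite oppr_gt0 (wUneg H)// (le_lt_trans u0 ut) (lt_le_trans tv vk).
Qed.

Lemma wave_even_decr (H : wave C A P X U Y) (u v : R) : `|u| < `|v| -> `|v| <= P / 2 -> X v < X u.
Proof.
move=> uv vP; have abs w : X `|w| = X w.
  by have [w0|w0] := leP 0 w; [rewrite ger0_norm|rewrite ltr0_norm ?(wXe H)].
by rewrite -(abs u) -(abs v); apply: (wave_decr H).
Qed.

Lemma wave_turn (H : wave C A P X U Y) u : X (P - u) = X u.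
Proof. by rewrite addrC (wXs H) (wXe H). Qed.

(** The abscissa is even and decreases on half a period: the chord is positive because the later end
    is closer to a maximum of the abscissa, namely 0, or [- P] for the earlier end if that one lies
    more than half a period back. *)
Lemma chord_gt0 (H : wave C A P X U Y) (v p : R) : - (P / 2) < v < 0 -> 0 < p < P / 2 ->
  0 < chord v p.
Proof.
move=> /andP[v1 v2] /andP[p0 p2]; have P0 := wP H.
have vp : `|v - p| = p - v by rewrite ltr0_norm; [ring|lra].
rewrite subr_gt0; have [le|lt] := leP (p - v) (P / 2).
  apply: (wave_even_decr H); rewrite vp// ltr_norml; apply/andP; split; lra.
have e : X (v - p) = X (P - (p - v)) by rewrite (wave_turn H) -(wXe H); congr X; ring.
have E : `|P - (p - v)| = P - (p - v) by rewrite ger0_norm; lra.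
rewrite e; apply: (wave_even_decr H); rewrite E; [rewrite ltr_norml; apply/andP; split|]; lra.
Qed.

Lemma chord_half (H : wave C A P X U Y) (v r : R) : chord v (P / 2 + r) = chord (v + P / 2) r.
Proof.
rewrite /chord; have e1 : v + (P / 2 + r) = v + P / 2 + r by ring.
have e2 : v - (P / 2 + r) + P = v + P / 2 - r by field.
by rewrite e1 -(wXs H (v - _)) e2.
Qed.

Lemma chordN (H : wave C A P X U Y) (v p : R) : chord (- v) p = - chord v p.
Proof.
rewrite /chord -(wXe H (- v + p)) -(wXe H (- v - p)).
have -> : - (- v + p) = v - p by ring.
have -> : - (- v - p) = v + p by ring.
by ring.
Qed.

Lemma vdefectN (H : wave C A P X U Y) (v p : R) : vdefect (- v) p = - vdefect v p.
Proof.
have x1 : X (- v + p) = X (v - p) by rewrite -(wXe H); congr X; ring.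
have x2 : X (- v - p) = X (v + p) by rewrite -(wXe H); congr X; ring.
have u1 : U (- v + p) = - U (v - p) by rewrite -(wUo H); congr U; ring.
have u2 : U (- v - p) = - U (v + p) by rewrite -(wUo H); congr U; ring.
have y1 : Y (- v + p) = - Y (v - p) by rewrite -(wYo H); congr Y; ring.
have y2 : Y (- v - p) = - Y (v + p) by rewrite -(wYo H); congr Y; ring.
by rewrite /vdefect /chord /rise /drift /bend /mid x1 x2 u1 u2 y1 y2; ring.
Qed.

Lemma wave_half_rise (H : wave C A P X U Y) : Y (P / 2) = Y P / 2.
Proof.
have := wYs H (- (P / 2)); rewrite (wYo H) (_ : - (P / 2) + P = P / 2); [lra|by field].
Qed.

Lemma wave_turn_U (H : wave C A P X U Y) : U 0 = 0 /\ U (P / 2) = 0.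
Proof.
split; first by have := wUo H 0; rewrite oppr0; lra.
have := wUs H (- (P / 2)); rewrite (wUo H) (_ : - (P / 2) + P = P / 2); [lra|by field].
Qed.

(* The quotient vdefect / chord grows from 0 with the length of the arc. *)
Lemma vdefect_quarter (H : wave C A P X U Y) : 0 <= vdefect (- (P / 4)) (P / 4).
Proof.
have P0 := wP H; have C0 := wC H.
pose v := - (P / 4).
pose W p := vdefect v p / chord v p.
have Dp (p : R) : 0 < p < P / 2 -> 0 < chord v p.
  by move=> p0; apply: (chord_gt0 H) p0; rewrite /v; apply/andP; split; lra.
have Wmono (p q : R) : 0 < p -> p <= q -> q < P / 2 -> W p <= W q.
  move=> p0 pq qP; have rng t : p <= t <= q -> 0 < t < P / 2.
    by move=> /andP[pt tq]; rewrite (lt_le_trans p0 pt) (le_lt_trans tq qP).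
  apply: (@der_le _ W _ p q pq (fun t tpq => vdefect_dp H (lt0r_neq0 (Dp t (rng t tpq))))).
  move=> t tpq; rewrite divr_ge0 ?addr_ge0 ?sqr_ge0// mulr_ge0 ?sqr_ge0// mulr_ge0// ltW//.
have rngP : 0 < P / 4 < P / 2 by apply/andP; split; lra.
have D4 := Dp _ rngP.
rewrite leNgt; apply/negP => V0.
have W0 : W (P / 4) < 0 by rewrite /W pmulr_llt0// invr_gt0.
have Uv : 0 < U v.
  by rewrite -[v]opprK (wUo H) oppr_gt0 (wUneg H)// /v opprK; apply/andP; split; lra.
have dX := wX H; have dU := wU H; have dY := wY H.
(* The quotient tends to 0 with the half-width. In the form used here, for small [h] the chord
   exceeds [U v * h] and [vdefect] exceeds [W (P / 4) * U v * h], which contradicts monotonicity if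
   [W (P / 4)] is negative. *)
have dD : der (fun p => chord v p - U v * p) 0 (U v).
  by rewrite /chord; der_solve; rewrite addr0 subr0; ring.
have dN : der (fun p => vdefect v p - W (P / 4) * U v * p) 0 (- (W (P / 4) * U v)).
  rewrite /vdefect /chord /rise /drift /bend /mid; der_solve; rewrite ?addr0 ?subr0 ?subrr; ring.
have [d1 d10 H1] := der_pos_right dD Uv.
have l0 : 0 < - (W (P / 4) * U v) by rewrite oppr_gt0 nmulr_rlt0.
have [d2 d20 H2] := der_pos_right dN l0.
pose m := Num.min d1 (Num.min d2 (P / 4)).
have m0 : 0 < m by rewrite !lt_min d10 d20 divr_gt0.
pose h := m / 2.
have h0 : 0 < h by rewrite divr_gt0.
have hm : h < m by rewrite /h; lra.
have /andP[hd1 /andP[hd2 hP]] : (h < d1) && ((h < d2) && (h < P / 4)) by move: hm; rewrite /m !lt_min.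
have c0 : chord v 0 = 0 by rewrite /chord addr0 subr0 subrr.
have n0 : vdefect v 0 = 0 by rewrite /vdefect c0 /rise addr0 subr0 subrr; ring.
have := H1 h h0 hd1; have := H2 h h0 hd2; rewrite !add0r c0 n0 !mulr0 !subr0 => V1 D1.
have Wh : W h <= W (P / 4) by apply: Wmono; lra.
have Dh : 0 < chord v h by apply: Dp; apply/andP; split; lra.
have Vh : vdefect v h = W h * chord v h by rewrite /W divfK// gt_eqF.
have : W h * chord v h <= W (P / 4) * chord v h by rewrite ler_pM2r.
have : W (P / 4) * chord v h <= W (P / 4) * (U v * h) by rewrite ler_nM2l//; lra.
by rewrite -Vh mulrA; lra.
Qed.

(** The centre is moved to [- (P / 4)], where the arcs of half-widths [P / 4] and [3 * (P / 4)] both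
    end at vertices with the two extreme abscissas, so that [U] drops out and the two quotients can
    be compared. *)
Lemma vdefect_3quarter (H : wave C A P X U Y) v : - (P / 2) < v < 0 ->
  0 < vdefect v (3 * (P / 4)) / chord v (3 * (P / 4)).
Proof.
move=> vP; have P0 := wP H; have C0 := wC H.
have Dn w : - (P / 2) < w < 0 -> chord w (3 * (P / 4)) < 0.
  move=> /andP[w1 w2]; rewrite (_ : 3 * (P / 4) = P / 2 + P / 4); last by field.
  rewrite (chord_half H) -[w + _]opprK (chordN H) oppr_lt0 (chord_gt0 H)//; apply/andP; split; lra.
have -> : vdefect v (3 * (P / 4)) / chord v (3 * (P / 4)) =
    vdefect (- (P / 4)) (3 * (P / 4)) / chord (- (P / 4)) (3 * (P / 4)).
  pose f w := vdefect w (3 * (P / 4)) / chord w (3 * (P / 4)).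
  have cst a b : a <= b -> - (P / 2) < a -> b < 0 -> f b = f a.
    move=> ab aP b0; apply: (der_const ab) => t /andP[at_ tb].
    have tr : - (P / 2) < t < 0 by rewrite (lt_le_trans aP at_) (le_lt_trans tb b0).
    exact: vdefect_ds H _ _ (ltr0_neq0 (Dn t tr)).
  have /andP[v1 v2] := vP.
  have [le|/ltW le] := leP (- (P / 4)) v; [apply: cst|apply/esym/cst]; lra.
have rP : - (P / 2) < - (P / 4) < 0 by apply/andP; split; lra.
have q0 := vdefect_quarter H.
have D1 : 0 < chord (- (P / 4)) (P / 4) by apply: (chord_gt0 H) => //; apply/andP; split; lra.
have D3 := Dn _ rP.
have [U0 U2] := wave_turn_U H; have Yh := wave_half_rise H; have h0 := wYP H.
have e1 : - (P / 4) + P / 4 = 0 by ring.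
have e2 : - (P / 4) - P / 4 = - (P / 2) by field.
have e3 : - (P / 4) + 3 * (P / 4) = P / 2 by field.
have e4 : - (P / 4) - 3 * (P / 4) = - P by field.
have Y0 : Y 0 = 0 by have := wYo H 0; rewrite oppr0; lra.
have UP : U P = 0 by rewrite -[P]add0r (wUs H).
have XP : X P = X 0 by rewrite -[P]add0r (wXs H).
move: q0 D1 D3; rewrite /vdefect /chord /rise /drift /bend /mid e1 e2 e3 e4.
rewrite !(wXe H) !(wUo H) !(wYo H) U0 U2 UP XP Yh Y0.
move: (X 0) (X (P / 2)) (Y P) h0 => a b h h0; rewrite !(oppr0, addr0, subr0, add0r, mulr0, mul0r, sub0r, opprK).
move=> q0 D1 D3.
(* The quotient at half-width [P / 4]. At [3 * (P / 4)] the linear terms triple and the cube of the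
   rise is multiplied by 27, which gives [3 * B - h ^+ 3 / 4]. *)
pose B := P / (12 * C) + A * h / (6 * C) + ((a + b) / 2) ^+ 2 * h / 2 - h ^+ 3 / 96.
have B0 : 0 <= B.
  rewrite -(pmulr_rge0 _ D1) /B; move: q0; congr (_ <= _); field; nz.
have h3 : 0 < - h ^+ 3 by rewrite oppr_gt0 exprn_odd_lt0.
have : 0 < 3 * B - h ^+ 3 / 4 by lra.
by congr (_ < _); rewrite /B; field; nz.
Qed.

(** At [P / 2] the chord vanishes and the remaining term, with the square of the fall, is positive;
    at [3 * (P / 4)] the chord is negative and the quotient positive. *)
Lemma wave_root_half (H : wave C A P X U Y) v : - (P / 2) < v < 0 ->
  exists r, [/\ P / 2 <= r <= 3 * (P / 4), vdefect v r = 0 & chord v r != 0].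
Proof.
move=> vP; have P0 := wP H; have C0 := wC H; have /andP[v1 v2] := vP.
have Dn r : P / 2 < r -> r <= 3 * (P / 4) -> chord v r < 0.
  move=> r1 r2; rewrite (_ : r = P / 2 + (r - P / 2)); last by ring.
  rewrite (chord_half H) -[v + _]opprK (chordN H) oppr_lt0 (chord_gt0 H)//; apply/andP; split; lra.
have D0 : chord v (P / 2) = 0.
  by rewrite -[P / 2]addr0 (chord_half H) /chord addr0 subr0 subrr.
have Yd : rise v (P / 2) = Y P.
  rewrite /rise (_ : v + P / 2 = v - P / 2 + P); last by field.
  by rewrite (wYs H); ring.
have Ud : drift v (P / 2) = 2 * U (v + P / 2).
  rewrite /drift (_ : v + P / 2 = v - P / 2 + P); last by field.
  by rewrite (wUs H); ring.
have Up : U (v + P / 2) < 0 by apply: (wUneg H); apply/andP; split; lra.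
have Vp : 0 < vdefect v (P / 2).
  rewrite /vdefect D0 Yd Ud.
  have -> : 0 * (P / 2 / (3 * C) + A * Y P / (3 * C) + mid v (P / 2) * bend v (P / 2) / (3 * C) +
    mid v (P / 2) ^+ 2 * Y P - 0 * (2 * U (v + P / 2)) / (12 * C)) - Y P ^+ 3 * 0 / 12 -
    Y P ^+ 2 * (2 * U (v + P / 2)) / (4 * C) = Y P ^+ 2 * - U (v + P / 2) / (2 * C) by field; nz.
  have h2 : 0 < Y P ^+ 2 by rewrite exprn_even_gt0// ltr0_neq0 ?(wYP H).
  by move: h2; move: (Y P ^+ 2) => h2 h20; rewrite divr_gt0// mulr_gt0// oppr_gt0.
have D3 : chord v (3 * (P / 4)) < 0 by apply: Dn; lra.
have Vn : vdefect v (3 * (P / 4)) < 0.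
  by have := vdefect_3quarter H vP; rewrite nmulr_lgt0 ?invr_lt0.
have P23 : P / 2 <= 3 * (P / 4) by lra.
have dX := wX H; have dU := wU H; have dY := wY H.
have cV t : {for t, continuous (vdefect v)}.
  by rewrite /vdefect /chord /rise /drift /bend /mid; eapply der_cont; der_rec.
have [r /andP[r1 r2] r0] : exists2 r, P / 2 <= r <= 3 * (P / 4) & vdefect v r = 0.
  apply: (ivt P23); first by apply: within_cont.
  by rewrite pmulr_rle0// ltW.
exists r; split; rewrite ?r1 ?r2//; apply: ltr0_neq0; apply: Dn => //.
by rewrite lt_neqAle r1 andbT; apply/eqP => E; move: Vp; rewrite E r0 ltxx.
Qed.

(** The centre is brought into [wave_root_half] by translations by [P] and by the reflection of
    time; the vertices, where [U] is 0, are left out. *)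
Lemma wave_root (H : wave C A P X U Y) v : U v != 0 ->
  exists r, [/\ P / 2 <= r <= 3 * (P / 4), vdefect v r = 0 & chord v r != 0].
Proof.
have P0 := wP H; have [U0 U2] := wave_turn_U H.
have shift w : (exists r, [/\ P / 2 <= r <= 3 * (P / 4), vdefect w r = 0 & chord w r != 0]) <->
    (exists r, [/\ P / 2 <= r <= 3 * (P / 4), vdefect (w + P) r = 0 & chord (w + P) r != 0]).
  have e r : vdefect (w + P) r = vdefect w r /\ chord (w + P) r = chord w r.
    have e1 : w + P + r = w + r + P by ring.
    have e2 : w + P - r = w - r + P by ring.
    rewrite /vdefect /chord /rise /drift /bend /mid e1 e2 !(wXs H) !(wUs H) !(wYs H).
    by have -> : Y (w + r) + Y P - (Y (w - r) + Y P) = Y (w + r) - Y (w - r) by ring.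
  by split=> -[r [r1 r2 r3]]; exists r; have [E1 E2] := e r; rewrite ?E1 ?E2 in r2 r3 *.
have [n] : exists n : nat, `|v| <= P / 2 + n%:R * P.
  exists (Num.bound (`|v| / P)).
  have : `|v| / P < (Num.bound (`|v| / P))%:R by apply: archi_boundP; exact: divr_ge0 (ltW P0).
  by rewrite ltr_pdivrMr// => ?; have := ltW P0; lra.
elim: n v => [v|n IH v vn Uv].
  rewrite mul0r addr0 ler_norml => /andP[vl vr] Uv.
  have v0 : v != 0 by apply: contraNneq Uv => ->; rewrite U0.
  have vl' : - (P / 2) < v.
    by rewrite lt_neqAle vl andbT; apply: contraNneq Uv => <-; rewrite (wUo H) U2 oppr0.
  have vr' : v < P / 2.
    by rewrite lt_neqAle vr andbT; apply: contraNneq Uv => ->; rewrite U2.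
  have [vn|vp] := ltP v 0; first by apply: (wave_root_half H); rewrite vl'.
  have vp' : 0 < v by rewrite lt_def v0.
  have [|r [r1 r2 r3]] := @wave_root_half H (- v); first by apply/andP; split; lra.
  by exists r; rewrite (vdefectN H) (chordN H) in r2 r3; split=> //; [lra|rewrite -oppr_eq0].
have [/IH/(_ Uv)//|big] := leP `|v| (P / 2 + n%:R * P).
have n0 : 0 <= n%:R * P by rewrite mulr_ge0// ltW.
have [v0|v0] := leP 0 v.
  rewrite -[v](subrK P) -shift; apply: IH.
    move: vn big; rewrite (ger0_norm v0) -[n.+1%:R]natr1 (mulrDl _ 1) mul1r ler_norml.
    by move=> ? ?; apply/andP; split; lra.
  by rewrite -(wUs H) subrK.
rewrite shift; apply: IH; last by rewrite (wUs H).
move: vn big; rewrite (ltr0_norm v0) -[n.+1%:R]natr1 (mulrDl _ 1) mul1r ler_norml.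
by move=> ? ?; apply/andP; split; lra.
Qed.

End Wave.

Lemma rev_cartan {R : realType} `(I : @revolving R C A X th y T0 Y P) T :
  cartan_min T X y (fun t => cos (th t)) (fun t => sin (th t)) -> T <= 3 / 2 * P.
Proof.
rev_facts I => M; rewrite leNgt; apply/negP => PT.
have A2 : A ^+ 2 != 1 by rewrite sqrf_eq1 negb_or (lt_eqF A1) andbT; apply/eqP => A1'; lra.
have [s /andP[s1 s2] Us] : exists2 s, 3 * (P / 4) < s < T / 2 & cos (th s) != 0.
  apply: contrapT => H.
  have [|||] := @normal_indep2 _ C A X th y (3 * (P / 4)) (T / 2) 1 0 N A2 _ _ _; try lra.
  move=> t tr; rewrite mul1r mul0r addr0; apply/eqP; apply: contrapT => /negP c; apply: H.
  by exists t.
have [Xg [Ug [Yg [t0 [H G]]]]] := wave_exists I.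
have s0 : 0 <= s by lra.
have [_ Us' _] := G s s0; rewrite Us' in Us.
have [r [/andP[r1 r2] r0 D0]] := wave_root H Us.
have a0 : 0 <= s - r by lra.
have b0 : 0 <= s + r by lra.
have [X1 U1 _] := G _ a0; have [X2 U2 Y2] := G _ b0.
have e1 : s - r + t0 = s + t0 - r by ring.
have e2 : s + r + t0 = s + t0 + r by ring.
have Dr : X (s + r) - X (s - r) = chord Xg (s + t0) r by rewrite X1 X2 e1 e2.
apply: (@maxwell_V _ C A X th y s r T _ _ N A2 a0 _ _ (fun t t0 => normal_primitives N t0) _ _ M).
- lra.
- lra.
- by rewrite Dr.
have C0' := C0.
move: r0; rewrite /vdefect /chord /rise /drift /bend /mid -e1 -e2 -X1 -X2 -U1 -U2 -Y2//.
move: (X (s + r)) (X (s - r)) (cos _) (cos _) (y (s + r)) (y (s - r)) => x x' u u' z z' E.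
transitivity (2 * (0 : R)); last by rewrite mulr0.
by rewrite -E; field; nz.
Qed.

(** * Circles: two loops replaced by two shorter ones *)

Section Arcs.
Context {R : realType}.

(* The joints of the arcs are parametrized from an arbitrary initial time, so
   that arcs are concatenated without a change of time. *)
Definition arc (x0 y0 x1 y1 I1 I2 I3 L : R) : Prop :=
  forall a : R, exists (b : R) (x y v1 v2 : R -> R),
  [/\ [/\ a <= b, prim a b x v1 & prim a b y v2], [/\ x a = x0, y a = y0, x b = x1 & y b = y1],
    plen a b v1 v2 = L & [/\ itg a b (fun t => x t * v2 t) = I1,
    itg a b (fun t => x t ^+ 2 * v2 t) = I2 & itg a b (fun t => y t ^+ 2 * v1 t) = I3]].

Lemma arc_cat (x0 y0 x1 y1 x2 y2 I1 I2 I3 L J1 J2 J3 M : R) :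
  arc x0 y0 x1 y1 I1 I2 I3 L -> arc x1 y1 x2 y2 J1 J2 J3 M ->
  arc x0 y0 x2 y2 (I1 + J1) (I2 + J2) (I3 + J3) (L + M).
Proof.
move=> A1 A2 a.
have [b [x [y [v1 [v2 [[ab Px Py] [xa ya xb yb] l [i1 i2 i3]]]]]]] := A1 a.
have [c [x' [y' [v1' [v2' [[bc Px' Py'] [xa' ya' xb' yb'] l' [j1 j2 j3]]]]]]] := A2 b.
pose g (f f' : R -> R) := fun t => if t <= b then f t else f' t.
have ga (f f' : R -> R) : g f f' a = f a by rewrite /g ab.
have gc (f f' : R -> R) : f b = f' b -> g f f' c = f' c.
  by rewrite /g; case: leP => // cb; have -> : c = b by apply/eqP; rewrite eq_le cb.
have bx := prim_bm Px; have by_ := prim_bm Py; have bx' := prim_bm Px'; have by' := prim_bm Py'.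
have [b1 b2 b1' b2'] : [/\ bm a b v1, bm a b v2, bm b c v1' & bm b c v2'].
  by split; [exact: Px.1|exact: Py.1|exact: Px'.1|exact: Py'.1].
have mom (h : R -> R -> R) f v f' v' : bm a b (fun t => h (f t) (v t)) ->
    bm b c (fun t => h (f' t) (v' t)) -> itg a c (fun t => h (g f f' t) (g v v' t)) =
    itg a b (fun t => h (f t) (v t)) + itg b c (fun t => h (f' t) (v' t)).
  move=> B B'; rewrite -(itg_glue ab bc B B'); apply: itg_ext => t _.
  by rewrite /g; case: ifP.
exists c, (g x x'), (g y y'), (g v1 v1'), (g v2 v2').
rewrite !ga !gc ?xb ?xa' ?yb ?ya'//; split => //.
- split; first exact: le_trans bc.
    by apply: (prim_glue ab bc Px Px'); rewrite xb xa'.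
  by apply: (prim_glue ab bc Py Py'); rewrite yb ya'.
- rewrite -l -l' /plen; apply: (mom (fun p q => Num.sqrt (p ^+ 2 + q ^+ 2))); exact: bm_speed.
- split.
  + by rewrite -i1 -j1; apply: (mom (fun p q => p * q)); apply: bmM.
  + by rewrite -i2 -j2; apply: (mom (fun p q => p ^+ 2 * q)); apply: bmM => //; exact: bmX.
  + by rewrite -i3 -j3; apply: (mom (fun p q => p ^+ 2 * q)); apply: bmM => //; exact: bmX.
Qed.

Lemma arc_beats (T L : R) (x y w1 w2 : R -> R) : cartan_min T x y w1 w2 ->
  arc (x 0) (y 0) (x T) (y T) (itg 0 T (fun t => x t * w2 t))
    (itg 0 T (fun t => x t ^+ 2 * w2 t)) (itg 0 T (fun t => y t ^+ 2 * w1 t)) L -> T <= L.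
Proof.
move=> M /(_ 0)[S [x' [y' [v1 [v2 [[S0 Px Py] [? ? ? ?] <- [? ? ?]]]]]]].
exact: (M S x' y' v1 v2).
Qed.

(* Primitives of x sin p, x^2 sin p and y^2 cos p along the circle
   x = X + sin p / k, y = Y - cos p / k. *)
Definition circ1 (k X p : R) : R := (- X * cos p + (p - sin p * cos p) / (2 * k)) / k.
Definition circ2 (k X p : R) : R :=
  (- X ^+ 2 * cos p + X * (p - sin p * cos p) / k - (cos p - cos p ^+ 3 / 3) / k ^+ 2) / k.
Definition circ3 (k Y p : R) : R :=
  (Y ^+ 2 * sin p - Y * (p + sin p * cos p) / k + (sin p - sin p ^+ 3 / 3) / k ^+ 2) / k.

Lemma circ_der (k X Y l t : R) (p : R -> R) : 0 < k -> der p t (l * k) ->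
  [/\ der (fun t => circ1 k X (p t)) t ((X + sin (p t) / k) * (l * sin (p t))),
    der (fun t => circ2 k X (p t)) t ((X + sin (p t) / k) ^+ 2 * (l * sin (p t))) &
    der (fun t => circ3 k Y (p t)) t ((Y - cos (p t) / k) ^+ 2 * (l * cos (p t)))].
Proof.
move=> k0 d; have := cos2Dsin2 (p t) => E.
by split; rewrite /circ1 /circ2 /circ3; der_solve; rewrite /= ?expr1; move: E;
  move: (cos (p t)) (sin (p t)) => u v E; have u2 : u * u = 1 - v * v by [rewrite -!expr2; lra];
  field: u2; nz.
Qed.

Lemma arc_circle (k X Y p q : R) : 0 < k ->
  arc (X + sin p / k) (Y - cos p / k) (X + sin q / k) (Y - cos q / k)
    (circ1 k X q - circ1 k X p) (circ2 k X q - circ2 k X p) (circ3 k Y q - circ3 k Y p) (`|q - p| / k).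
Proof.
move=> k0 a.
(* Arcs may be run backwards: if the curve makes less than two turns, the competitor runs through
   two full loops and goes back. *)
pose e : R := if p <= q then 1 else -1.
have eq : e * `|q - p| = q - p.
  by rewrite /e; case: leP => pq; [rewrite mul1r ger0_norm ?subr_ge0|rewrite mulN1r ltr0_norm ?subr_lt0// opprK].
have e2 : e ^+ 2 = 1 by rewrite /e; case: leP => _; rewrite ?sqrrN expr1n.
pose b := a + `|q - p| / k.
have ab : a <= b by rewrite lerDl divr_ge0// ltW.
pose f t := p + e * k * (t - a).
have df t : der f t (e * k) by rewrite /f; der_solve; ring.
have fa : f a = p by rewrite /f subrr mulr0 addr0.
have fb : f b = q by rewrite (_ : f b = p + e * `|q - p|); [rewrite eq addrC subrK|rewrite /f /b; field; nz].
have cf t : {for t, continuous (fun t => e * cos (f t))} by eapply der_cont; der_rec.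
have cf' t : {for t, continuous (fun t => e * sin (f t))} by eapply der_cont; der_rec.
have Px : prim a b (fun t => X + sin (f t) / k) (fun t => e * cos (f t)).
  by apply: prim_der => t _; [der_solve; field; nz|exact: cf].
have Py : prim a b (fun t => Y - cos (f t) / k) (fun t => e * sin (f t)).
  by apply: prim_der => t _; [der_solve; field; nz|exact: cf'].
exists b, (fun t => X + sin (f t) / k), (fun t => Y - cos (f t) / k),
  (fun t => e * cos (f t)), (fun t => e * sin (f t)).
have D t := circ_der X Y k0 (df t).
have bx := prim_bm Px; have by_ := prim_bm Py.
split; rewrite ?fa ?fb//.
- rewrite /plen (@itg_ext _ _ _ _ (fun=> 1)); first by rewrite itg_cst// mul1r /b addrC addKr.
  by move=> t _; rewrite !exprMn -mulrDr cos2Dsin2 e2 mulr1 sqrtr1.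
- rewrite -fa -fb; split.
  + by apply: (itg_FTC (F := fun t => circ1 k X (f t)) ab) => [t _|t _]; [case: (D t)|eapply der_cont; der_rec].
  + by apply: (itg_FTC (F := fun t => circ2 k X (f t)) ab) => [t _|t _]; [case: (D t)|eapply der_cont; der_rec].
  + by apply: (itg_FTC (F := fun t => circ3 k Y (f t)) ab) => [t _|t _]; [case: (D t)|eapply der_cont; der_rec].
Qed.

Lemma arc_eq (x0 y0 x1 y1 I1 I2 I3 L x0' y0' x1' y1' I1' I2' I3' L' : R) :
  arc x0 y0 x1 y1 I1 I2 I3 L -> [/\ x0 = x0', y0 = y0', x1 = x1' & y1 = y1'] ->
  [/\ I1 = I1', I2 = I2', I3 = I3' & L = L'] -> arc x0' y0' x1' y1' I1' I2' I3' L'.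
Proof. by move=> + [<- <- <- <-] [<- <- <- <-]. Qed.

Lemma circ_shift (k X p : R) : 0 < k ->
  [/\ circ1 k X (p + 2 * pi) = circ1 k X p + pi / k ^+ 2,
    circ2 k X (p + 2 * pi) = circ2 k X p + 2 * pi * X / k ^+ 2 &
    circ3 k X (p + 2 * pi) = circ3 k X p - 2 * pi * X / k ^+ 2].
Proof.
by move=> k0; rewrite /circ1 /circ2 /circ3 sinDtwopi cosDtwopi; split; field; nz.
Qed.

(** A full circle through the given point; the direction [q] of its centre is free and enters the
    second moments only. *)
Lemma arc_loop (k x y q : R) : 0 < k ->
  arc x y x y (pi / k ^+ 2) (2 * pi * (x - sin q / k) / k ^+ 2)
    (- (2 * pi * (y + cos q / k) / k ^+ 2)) (2 * pi / k).
Proof.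
move=> k0.
have A := @arc_circle k (x - sin q / k) (y + cos q / k) q (q + 2 * pi) k0.
have [c1 c2 _] := circ_shift (x - sin q / k) q k0.
have [_ _ c3] := circ_shift (y + cos q / k) q k0.
have L : `|q + 2 * pi - q| = 2 * pi by rewrite addrC addKr gtr0_norm// mulr_gt0// pi_gt0.
apply: arc_eq A _ _; split.
- by rewrite subrK.
- by rewrite addrK.
- by rewrite sinDtwopi subrK.
- by rewrite cosDtwopi addrK.
- by rewrite c1; ring.
- by rewrite c2; ring.
- by rewrite c3; ring.
- by rewrite L.
Qed.

(** A triangle with sides 2 and the cubes of the two radii, obtained from the law of cosines. The
    radii satisfy [(31 / 25) ^+ 2 + (17 / 25) ^+ 2 = 2], which preserves the area of two unit loops,
    while their sum [48 / 25] is less than 2; the cubes balance the second moments. *)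
Lemma tilted_directions (p : R) : exists q1 q2 : R,
  (31 / 25) ^+ 3 * cos q1 + (17 / 25) ^+ 3 * cos q2 = 2 * cos p /\
  (31 / 25) ^+ 3 * sin q1 + (17 / 25) ^+ 3 * sin q2 = 2 * sin p.
Proof.
pose a : R := (31 / 25) ^+ 3; pose b : R := (17 / 25) ^+ 3.
have [a0 b0] : 0 < a /\ 0 < b by split; rewrite exprn_gt0// divr_gt0.
have [ab ba b2] : [/\ 2 - b <= a, a <= 2 + b & b <= 2] by rewrite /a /b; split; lra.
rewrite -/a -/b; clearbody a b.
pose c : R := (a ^+ 2 + 4 - b ^+ 2) / (4 * a).
pose q := acos c.
have c1 : c \in `[(-1 : R), 1].
  rewrite in_itv /= /c ler_pdivlMr ?ler_pdivrMr ?mulr_gt0//; have : 0 <= (a + 2 - b) * (a + 2 + b) by rewrite mulr_ge0//; lra.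
  have : 0 <= (b - a + 2) * (b + a - 2) by rewrite mulr_ge0//; lra.
  by move=> h1 h2; apply/andP; split; lra.
have qc : cos q = c by rewrite /q acosK.
have E := cos2Dsin2 q.
have [d _ [cd sd]] : exists2 d, - pi <= d <= pi & cos d = (2 - a * cos q) / b /\
   sin d = - (a * sin q) / b.
  apply: unit_angle; rewrite !expr_div_n sqrrN -mulrDl exprMn.
  have -> : sin q ^+ 2 = 1 - c ^+ 2 by rewrite -qc -E; ring.
  by rewrite qc /c; field; nz.
exists (p + q), (p + d); rewrite !cosD !sinD cd sd; split; field; nz.
Qed.

Lemma circle_cartan (x y th : R -> R) (c T : R) : 0 < c ->
  (forall t, 0 <= t -> der x t (cos (th t))) -> (forall t, 0 <= t -> der y t (sin (th t))) ->
  (forall t, 0 <= t -> der th t c) ->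
  cartan_min T x y (fun t => cos (th t)) (fun t => sin (th t)) -> T <= 49 / 25 * (2 * pi / c).
Proof.
move=> c0 dx dy dth M; rewrite leNgt; apply/negP => PT.
have pi0 := pi_gt0 R.
have T0 : 0 <= T by rewrite ltW// (lt_trans _ PT)// mulr_gt0// divr_gt0// mulr_gt0.
have thE (t : R) : 0 <= t -> th t = th 0 + c * t.
  move=> t0; have := @der_eq_incr _ th (fun t => c * t) (fun=> c) _ _ t0.
  rewrite mulr0 subr0 => H; rewrite -H; [ring|by move=> s /andP[s0 _]; exact: dth|].
  by move=> s _; der_solve; ring.
pose X := x 0 - sin (th 0) / c; pose Y := y 0 + cos (th 0) / c.
have xE (t : R) : 0 <= t -> x t = X + sin (th t) / c.
  move=> t0; have := @der_eq_incr _ x (fun t => sin (th t) / c) (fun t => cos (th t)) _ _ t0.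
  move=> H; rewrite /X; have : x t - x 0 = sin (th t) / c - sin (th 0) / c; last by lra.
  by apply: H => s /andP[s0 _]; [exact: dx|have d := dth s s0; der_solve; field; nz].
have yE (t : R) : 0 <= t -> y t = Y - cos (th t) / c.
  move=> t0; have := @der_eq_incr _ y (fun t => - cos (th t) / c) (fun t => sin (th t)) _ _ t0.
  move=> H; rewrite /Y; have : y t - y 0 = - cos (th t) / c - - cos (th 0) / c; last by lra.
  by apply: H => s /andP[s0 _]; [exact: dy|have d := dth s s0; der_solve; field; nz].
have dl t : 0 <= t -> der th t (1 * c) by rewrite mul1r; exact: dth.
have D t (t0 : 0 <= t) := circ_der X Y c0 (dl t t0).
have cc t : 0 <= t <= T -> {for t, continuous (fun t => cos (th t))}.
  by move=> /andP[t0 _]; have d := dth t t0; eapply der_cont; der_rec.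
have cs t : 0 <= t <= T -> {for t, continuous (fun t => sin (th t))}.
  by move=> /andP[t0 _]; have d := dth t t0; eapply der_cont; der_rec.
have Px : prim 0 T x (fun t => cos (th t)) by apply: prim_der cc => t /andP[t0 _]; exact: dx.
have Py : prim 0 T y (fun t => sin (th t)) by apply: prim_der cs => t /andP[t0 _]; exact: dy.
have bx := prim_bm Px; have by_ := prim_bm Py.
have M1 : itg 0 T (fun t => x t * sin (th t)) = circ1 c X (th T) - circ1 c X (th 0).
  apply: (itg_FTC (F := fun t => circ1 c X (th t)) T0) => [t /andP[t0 _]|t /andP[t0 _]]; last first.
    by have d1 := dx t t0; have d2 := dy t t0; have d3 := dth t t0; eapply der_cont; der_rec.
  by have [+ _ _] := D t t0; rewrite (xE t t0) mul1r.
have M2 : itg 0 T (fun t => x t ^+ 2 * sin (th t)) = circ2 c X (th T) - circ2 c X (th 0).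
  apply: (itg_FTC (F := fun t => circ2 c X (th t)) T0) => [t /andP[t0 _]|t /andP[t0 _]]; last first.
    by have d1 := dx t t0; have d2 := dy t t0; have d3 := dth t t0; eapply der_cont; der_rec.
  by have [_ + _] := D t t0; rewrite (xE t t0) mul1r.
have M3 : itg 0 T (fun t => y t ^+ 2 * cos (th t)) = circ3 c Y (th T) - circ3 c Y (th 0).
  apply: (itg_FTC (F := fun t => circ3 c Y (th t)) T0) => [t /andP[t0 _]|t /andP[t0 _]]; last first.
    by have d1 := dx t t0; have d2 := dy t t0; have d3 := dth t t0; eapply der_cont; der_rec.
  by have [_ _] := D t t0; rewrite (yE t t0) mul1r.
have [q1 [q2 [qc qs]]] := tilted_directions (th 0).
pose k1 := c * 25 / 31; pose k2 := c * 25 / 17.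
have k10 : 0 < k1 by rewrite /k1; lra.
have k20 : 0 < k2 by rewrite /k2; lra.
have x0E : x 0 = X + sin (th 0) / c by rewrite /X subrK.
have y0E : y 0 = Y - cos (th 0) / c by rewrite /Y addrK.
have A1 := arc_loop (x 0) (y 0) q1 k10.
have A2 := arc_loop (x 0) (y 0) q2 k20.
have A3 := @arc_circle c X Y (th 0 + 2 * pi + 2 * pi) (th T) c0.
rewrite !sinDtwopi !cosDtwopi -x0E -y0E -xE// -yE// in A3.
have := arc_cat (arc_cat A1 A2) A3.
set L := 2 * pi / k1 + 2 * pi / k2 + `|th T - (th 0 + 2 * pi + 2 * pi)| / c => A.
(* The new loops cost [48 / 25] turns and the rest the distance from [T] to two turns; below two
   turns the total is less than [T] exactly when [T] exceeds [49 / 25] turns. *)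
have LT : L < T.
  have -> : L = 48 / 25 * (2 * pi / c) + `|T - 2 * (2 * pi / c)|.
    rewrite /L /k1 /k2 (thE T T0).
    have -> : th 0 + c * T - (th 0 + 2 * pi + 2 * pi) = c * (T - 2 * (2 * pi / c)) by field; nz.
    by rewrite normrM (gtr0_norm c0); field; nz.
  have P0 : 0 < 2 * pi / c by rewrite divr_gt0// mulr_gt0.
  by case: (leP 0 (T - 2 * (2 * pi / c))) => [?|?]; [rewrite ger0_norm|rewrite ltr0_norm]; lra.
suff : T <= L by rewrite leNgt LT.
apply: (arc_beats M); rewrite M1 M2 M3; apply: arc_eq A _ _; split => //.
- have [-> _ _] := circ_shift X (th 0 + 2 * pi) c0; have [-> _ _] := circ_shift X (th 0) c0.
  by rewrite /k1 /k2; field; nz.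
- have [_ -> _] := circ_shift X (th 0 + 2 * pi) c0; have [_ -> _] := circ_shift X (th 0) c0.
  rewrite /k1 /k2 /X; have -> : sin (th 0) = (31 / 25) ^+ 3 / 2 * sin q1 + (17 / 25) ^+ 3 / 2 * sin q2 by lra.
  by field; nz.
- have [_ _ ->] := circ_shift Y (th 0 + 2 * pi) c0; have [_ _ ->] := circ_shift Y (th 0) c0.
  rewrite /k1 /k2 /Y; have -> : cos (th 0) = (31 / 25) ^+ 3 / 2 * cos q1 + (17 / 25) ^+ 3 / 2 * cos q2 by lra.
  by field; nz.
Qed.
End Arcs.

(** * Comparison of the cut times *)

Section Ratio.
Context {R : realType}.

Lemma cartan_min_affine (T e1 e2 h : R) (x y w1 w2 : R -> R) : e1 ^+ 2 = 1 -> e2 ^+ 2 = 1 ->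
  0 <= T -> prim 0 T x w1 -> prim 0 T y w2 -> cartan_min T x y w1 w2 ->
  cartan_min T (fun t => e1 * x t + h) (fun t => e2 * y t) (fun t => e1 * w1 t) (fun t => e2 * w2 t).
Proof.
move=> e11 e21 T0 Px Py M S x' y' v1 v2 S0 Px' Py' x0 y0 xS yS K1 K2 K3.
have Pz := primZ e1 (primD Px' (prim_cst 0 S (- h))); have Pu := primZ e2 Py'.
have I2 : itg 0 S v2 = e2 * itg 0 T w2.
  by rewrite -(prim_diff Py' (lexx _) S0 (lexx _)) -(prim_diff Py (lexx _) T0 (lexx _)) yS y0; ring.
have Q A B C := itg_quadratic A B C Px' Py'.1; have Q' A B C := itg_quadratic A B C Px Py.1.
have q f g a b : (forall t, f t = g t) -> itg a b f = itg a b g :> R by move=> fg; apply: itg_ext => t _.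
rewrite [RHS](q _ (fun t => (e2 * h + e2 * e1 * x t + 0 * x t ^+ 2) * w2 t)) ?Q' in K1; last by move=> t; ring.
rewrite [RHS](q _ (fun t => (e2 * h ^+ 2 + 2 * e1 * e2 * h * x t + e2 * e1 ^+ 2 * x t ^+ 2) * w2 t)) ?Q' in K2;
  last by move=> t; ring.
rewrite [RHS](q _ (fun t => e1 * (y t ^+ 2 * w1 t))) ?itgZ in K3; first last.
- by move=> t; rewrite exprMn e21; ring.
- exact: (bmM (bmX 2 (prim_bm Py)) Px.1).
have L : plen 0 S v1 v2 = plen 0 S (fun t => e1 * (v1 t + 0)) (fun t => e2 * v2 t).
  by apply: q => t; rewrite !exprMn e11 e21 !mul1r addr0.
rewrite L; apply: M S0 Pz Pu _ _ _ _ _ _ _.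
- by rewrite x0 addrK mulrA -expr2 e11 mul1r.
- by rewrite y0 mulrA -expr2 e21 mul1r.
- by rewrite xS addrK mulrA -expr2 e11 mul1r.
- by rewrite yS mulrA -expr2 e21 mul1r.
- rewrite (q _ (fun t => (- e1 * e2 * h + e1 * e2 * x' t + 0 * x' t ^+ 2) * v2 t)); last by move=> t; ring.
  rewrite Q K1 I2; move: (itg 0 T w2) (itg 0 T _) => i j; move: e11 e21; clear => e11 e21.
  by ring: e11 e21.
- rewrite (q _ (fun t => (e1 ^+ 2 * e2 * h ^+ 2 + (- 2 * e1 ^+ 2 * e2 * h) * x' t + e1 ^+ 2 * e2 * x' t ^+ 2) * v2 t)); last by move=> t; ring.
  rewrite Q K1 K2 I2; move: (itg 0 T w2) (itg 0 T (fun t => x t * w2 t)) (itg 0 T _) => i j k; move: e11 e21; clear => e11 e21.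
  by ring: e11 e21.
- rewrite (q _ (fun t => (e1 * e2 ^+ 2) * (y' t ^+ 2 * v1 t))); last by move=> t; ring.
  rewrite itgZ; last exact: (bmM (bmX 2 (prim_bm Py')) Px'.1).
  by rewrite K3 e21 mulr1 mulrA -expr2 e11 mul1r.
Qed.

(** Either every time is minimal, and both cut times are infinite, or one minimal time in the Engel
    group controls all minimal times in the Cartan group; no exact cut time is involved. *)
Definition cut_ratio (zeta : R) (x y th : R -> R) : Prop :=
  (forall T : R, 0 <= T -> engel_min x (fun t => sin (th t)) T) \/
  exists tE : R, [/\ 0 < tE, engel_min x (fun t => sin (th t)) tE &
    forall T, 0 < T -> cartan_min T x y (fun t => cos (th t)) (fun t => sin (th t)) -> T <= zeta * tE].

Lemma cut_ratio_affine (zeta e1 e2 h : R) (x y th th' : R -> R) : e1 ^+ 2 = 1 -> e2 ^+ 2 = 1 ->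
  (forall t, 0 <= t -> der x t (cos (th t))) -> (forall t, 0 <= t -> der y t (sin (th t))) ->
  (forall t, 0 <= t -> {for t, continuous th}) ->
  (forall t, cos (th' t) = e1 * cos (th t)) -> (forall t, sin (th' t) = e2 * sin (th t)) ->
  cut_ratio zeta (fun t => e1 * x t + h) (fun t => e2 * y t) th' -> cut_ratio zeta x y th.
Proof.
move=> e11 e21 dx dy cth cE sE.
have cE' : (fun t => cos (th' t)) = (fun t => e1 * cos (th t)) by apply/funext.
have sE' : (fun t => sin (th' t)) = (fun t => e2 * sin (th t)) by apply/funext.
have cc t : 0 <= t -> {for t, continuous (fun t => cos (th t))}.
  by move=> t0; apply: continuous_comp (cth t t0) _; exact: continuous_cos.
have cs t : 0 <= t -> {for t, continuous (fun t => sin (th t))}.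
  by move=> t0; apply: continuous_comp (cth t t0) _; exact: continuous_sin.
have Px T : prim 0 T x (fun t => cos (th t)).
  by apply: prim_der => t /andP[t0 _]; [exact: dx|exact: cc].
have Py T : prim 0 T y (fun t => sin (th t)).
  by apply: prim_der => t /andP[t0 _]; [exact: dy|exact: cs].
have En T : 0 <= T -> engel_min (fun t => e1 * x t + h) (fun t => sin (th' t)) T ->
    engel_min x (fun t => sin (th t)) T.
  move=> T0; rewrite sE' => M.
  have := @engel_min_affine _ _ _ T e1 e2 (- (e1 * h)) e11 e21 _ _ M.
  rewrite (_ : (fun t => e1 * (e1 * x t + h) + - (e1 * h)) = x); last first.
    by apply/funext => t; rewrite mulrDr addrK mulrA -expr2 e11 mul1r.
  rewrite (_ : (fun t => e2 * (e2 * sin (th t))) = (fun t => sin (th t))); last first.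
    by apply/funext => t; rewrite mulrA -expr2 e21 mul1r.
  apply; last exact: (bmM (bm_cst _ _ _) (Py T).1).
  by apply: (bmD _ (bm_cst _ _ _)); apply: (bmM (bm_cst _ _ _) (prim_bm (Px T))).
case=> [L|[tE [t0 M H]]]; [left=> T T0; exact: En T0 (L T T0)|right].
exists tE; split => //; first exact: En (ltW t0) M.
move=> T T0 MT; apply: H => //; rewrite cE' sE'.
exact: cartan_min_affine e11 e21 (ltW T0) (Px T) (Py T) MT.
Qed.

(** If the ordinate does not fall the ratio is [3 / 2]. If it falls by little, [kap < 7 * b], so the
    Engel time gains [kap / 14]. The large fall alone determines the constant. *)
Lemma inflectional_ratio (C A : R) (X th y : R -> R) : normal C A X th y -> -1 < A < 1 ->
  cut_ratio (2 - 1 / (51 * 1000)) X y th.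
Proof.
move=> N A1; have [phi [T0 [kap I]]] := inflectional_exists N A1.
move: I; set b := Num.sqrt _ => I.
have k0 := ikap I; have b0 := ib I; right.
have [h0|h0] := leP 0 (y kap - y 0).
  exists (2 * kap); split; [by rewrite mulr_gt0|exact: infl_full_min I h0|].
  by move=> T _ /(infl_cartan_3 I); lra.
have A0 := ltW (infl_A_neg I h0); have up := infl_kap_upper I A0.
have [near|far] := leP (- (2 * (y kap - y 0))) (b / 384).
  exists (kap + b / 2); split; [by rewrite addr_gt0// divr_gt0|exact: infl_near_min I h0 near|].
  move=> T _ M; have := infl_cartan_neg I (q := 0) h0 (lexx _) _ _ M.
  rewrite mulr0 subr0; have : T <= 2 * kap -> T <= (2 - 1 / (51 * 1000)) * (kap + b / 2) by lra.
  by move=> H H'; apply: H; apply: H'; lra.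
exists kap; split => //; first exact: infl_half_min I.
(* If d = y 0 - y kap > b / 768, then kap <= 6 b + d <= 4609 d, so the gain
   q = d / 11 is at least kap / 50699. *)
move=> T _ M; have [qk|kq] := leP (- (2 * (y kap - y 0)) / 22) (2 / 5 * (kap / 2)).
  by have := infl_cartan_neg I (q := - (2 * (y kap - y 0)) / 22) h0 _ qk _ M; lra.
by have := infl_cartan_neg I (q := 2 / 5 * (kap / 2)) h0 _ (lexx _) _ M; lra.
Qed.

Lemma normal_reflect (C A : R) (X th y : R -> R) : normal C A X th y ->
  normal C A (fun t => - X t) (fun t => pi - th t) y.
Proof.
move=> N; have C0 := nC N; split => // t t0.
- by have d := nX N t0; der_solve; rewrite cosB cospi sinpi; ring.
- by have d := ny N t0; der_solve; rewrite sinB cospi sinpi; ring.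
- by have d := nth' N t0; der_solve; ring.
- by rewrite sinB cospi sinpi sqrrN -(nF N t0); ring.
Qed.

(** The axis is then an equilibrium: [cos th ^+ 2 <= 2 * C * X ^+ 2], so [X ^+ 2] times a decaying
    exponential does not increase from 0. *)
Lemma normal_flat (C A : R) (X th y : R -> R) : normal C A X th y -> A ^+ 2 = 1 -> X 0 = 0 ->
  forall t, 0 <= t -> th t = th 0.
Proof.
move=> N A2 X0; have C0 := nC N.
have X00 (t : R) : 0 <= t -> X t = 0.
  move=> t0; pose k := 1 + 2 * C.
  have := @der_le _ (fun t => - (X t ^+ 2 * expR (- (k * t))))
    (fun t => (k * X t ^+ 2 - 2 * X t * cos (th t)) * expR (- (k * t))) 0 t t0.
  rewrite X0 expr0n /= mul0r oppr0 oppr_ge0 pmulr_lle0 ?expR_gt0// => H.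
  apply/eqP; rewrite -sqrf_eq0 eq_le sqr_ge0 andbT; apply: H => s /andP[s0 _].
    by have d := nX N s0; der_solve; rewrite /= ?expr1; ring.
  rewrite pmulr_lge0 ?expR_gt0//; 
  have c2 : cos (th s) ^+ 2 <= 2 * C * X s ^+ 2.
    have := normal_unit N (ltW s0); have : 0 <= (C * X s ^+ 2) ^+ 2 by exact: sqr_ge0.
    have Z0 : 0 <= C * X s ^+ 2 by rewrite mulr_ge0 ?sqr_ge0// ltW.
    move=> q u; have /orP[/eqP A1|/eqP A1] : (A == 1) || (A == -1) by rewrite -sqrf_eq1 A2.
      by move: u; rewrite A1; nra.
    by move: u; rewrite A1; nra.
  by have := sqr_ge0 (X s - cos (th s)); rewrite /k; nra.
move=> t t0; apply: (der_const t0) => s /andP[s0 _].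
by have := nth' N s0; rewrite (X00 s s0) mulr0.
Qed.

(** The parameter [A] classifies: inflectional for [-1 < A < 1], critical or straight at -1,
    non-inflectional below, straight at 1, impossible above. *)
Lemma normal_ratio (C A : R) (X th y : R -> R) : normal C A X th y ->
  cut_ratio (2 - 1 / (51 * 1000)) X y th.
Proof.
move=> N; have C0 := nC N.
have flat : A ^+ 2 = 1 -> X 0 = 0 -> cut_ratio (2 - 1 / (51 * 1000)) X y th.
  move=> A2 X0; left=> T T0; exact: line_min T0 (nX N) (normal_flat N A2 X0).
(* For these values the motion stays on one side of the axis, and the reflection in the axis makes
   the abscissa positive. *)
have pos : A <= -1 -> (forall (X th : R -> R), normal C A X th y -> 0 < X 0 ->
    cut_ratio (2 - 1 / (51 * 1000)) X y th) -> X 0 != 0 -> cut_ratio (2 - 1 / (51 * 1000)) X y th.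
  move=> A1 H X0; have [Xp|Xn] := ltP 0 (X 0); first exact: H.
  apply: (@cut_ratio_affine _ (-1) 1 0 X y th (fun t => pi - th t)); rewrite ?sqrrN ?expr1n//.
  - by move=> t t0; exact: (nX N t0).
  - by move=> t t0; exact: (ny N t0).
  - by move=> t t0; exact: (der_cont (nth' N t0)).
  - by move=> t; rewrite cosB cospi sinpi; ring.
  - by move=> t; rewrite sinB cospi sinpi; ring.
  rewrite (_ : (fun t => _) = (fun t => - X t)); last by apply/funext => t; ring.
  rewrite (_ : (fun t => 1 * _) = y); last by apply/funext => t; ring.
  by apply: H (normal_reflect N) _; rewrite oppr_gt0 lt_neqAle X0.
have x0 := mulr_ge0 (ltW C0) (sqr_ge0 (X 0)).
have [A1|A1] := ltP 1 A.
  by have := nF N (lexx 0); have := sin_le1 (th 0); lra.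
have sX : A = 1 -> X 0 = 0.
  move=> A1'; have := nF N (lexx 0); have := sin_le1 (th 0); rewrite A1' => s1 E.
  have : C * X 0 ^+ 2 = 0 by lra.
  by move/eqP; rewrite mulf_eq0 (gt_eqF C0) sqrf_eq0 => /eqP.
have [A2|A2] := leP A (-1); last first.
  have [A1'|An] := eqVneq A 1; first by apply: flat; rewrite ?A1' ?expr1n ?sX.
  by apply: (inflectional_ratio N); rewrite A2 lt_neqAle An.
have [A3|A3] := ltP A (-1).
  apply: pos => //.
    move=> X' th' N' X0; have [T0 [Y [P I]]] := revolving_exists N' A3 X0.
    right; exists P; split; [exact: vP I|exact: rev_min I|].
    by move=> T _ /(rev_cartan I) TP; have := vP I; lra.
  apply/eqP => X0; have := nF N (lexx 0); have := sin_geN1 (th 0).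
  by rewrite X0 expr0n /= mulr0 addr0; lra.
have AE : A = -1 by apply/eqP; rewrite eq_le A2.
have [X0|X0] := eqVneq (X 0) 0; first by apply: flat; rewrite ?AE ?sqrrN ?expr1n.
apply: pos => //; rewrite AE => X' th' N' X0'; left => T T0.
exact: soliton_min N' X0' T0.
Qed.

Lemma bent_ratio (a : R) (x y th c : R -> R) :
  (forall t, 0 <= t -> der x t (cos (th t))) -> (forall t, 0 <= t -> der y t (sin (th t))) ->
  (forall t, 0 <= t -> der th t (c t)) -> (forall t, 0 <= t -> der c t (a * cos (th t))) ->
  cut_ratio (2 - 1 / (51 * 1000)) x y th.
Proof.
move=> dx dy dth dc; have cth t (t0 : 0 <= t) := der_cont (dth t t0).
have dyN t : 0 <= t -> der (fun t => -1 * y t) t (sin (- th t)).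
  by move=> t0; have d := dy t t0; clear dy; der_solve; rewrite sinN; ring.
have mirror (zeta h : R) : cut_ratio zeta (fun t => x t + h) (fun t => -1 * y t) (fun t => - th t) ->
    cut_ratio zeta x y th.
  move=> H; apply: (@cut_ratio_affine zeta 1 (-1) h x y th (fun t => - th t)); rewrite ?sqrrN ?expr1n//.
  - by move=> t; rewrite cosN mul1r.
  - by move=> t; rewrite sinN mulN1r.
  by rewrite (_ : (fun t => _ + _) = (fun t => x t + h))//; apply/funext => t; rewrite mul1r.
have shift (zeta h : R) : cut_ratio zeta (fun t => x t + h) y th -> cut_ratio zeta x y th.
  move=> H; apply: (@cut_ratio_affine zeta 1 1 h x y th th); rewrite ?expr1n//.
  - by move=> t; rewrite mul1r.
  - by move=> t; rewrite mul1r.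
  rewrite (_ : (fun t => _ + _) = (fun t => x t + h)); last by apply/funext => t; rewrite mul1r.
  by rewrite (_ : (fun t => 1 * _) = y)//; apply/funext => t; rewrite mul1r.
have [a0|an] := eqVneq a 0.
  have cE (t : R) : 0 <= t -> c t = c 0.
    move=> t0; apply: (der_const t0) => s /andP[s0 _].
    by have := dc s s0; rewrite a0 mul0r.
  have dth0 t : 0 <= t -> der th t (c 0) by move=> t0; rewrite -(cE t t0); exact: dth.
  have P0 (k : R) : 0 < k -> 0 < 2 * pi / k by move=> k0; rewrite divr_gt0// mulr_gt0// pi_gt0.
  have [c0|c0|c0] := ltgtP (c 0) 0.
  - apply: (mirror _ 0); rewrite (_ : (fun t => x t + 0) = x); last by apply/funext => t; rewrite addr0.
    have k0 : 0 < - c 0 by rewrite oppr_gt0.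
    have dxN t : 0 <= t -> der x t (cos (- th t)) by rewrite cosN; exact: dx.
    have dthN t : 0 <= t -> der (fun t => - th t) t (- c 0) by move=> t0; have d := dth0 t t0; der_solve.
    right; exists (2 * pi / (- c 0)); split; [exact: P0|exact: circle_min k0 dxN dthN|].
    by move=> T _ /(circle_cartan k0 dxN dyN dthN) TP; have := P0 _ k0; lra.
  - right; exists (2 * pi / c 0); split; [exact: P0|exact: circle_min c0 dx dth0|].
    by move=> T _ /(circle_cartan c0 dx dy dth0) TP; have := P0 _ c0; lra.
  - left=> T T0; apply: line_min T0 dx _ => t t0; apply: (der_const t0) => s /andP[s0 _].
    by rewrite -c0; exact: dth0.
(* The curvature is an affine function of the abscissa; this translation makes it linear. A negative
   [a] is handled by reversing the ordinate. *)
pose h := c 0 / a - x 0.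
have cE (t : R) : 0 <= t -> c t = a * (x t + h).
  move=> t0; have := @der_eq_incr _ c (fun t => a * x t) (fun t => a * cos (th t)) 0 t t0.
  move=> H; have : c t - c 0 = a * x t - a * x 0.
    by apply: H => s /andP[s0 _]; [exact: dc|have d := dx s s0; der_solve; ring].
  rewrite /h mulrDr mulrBr [a * (c 0 / a)]mulrC divfK//; lra.
have dX t : 0 <= t -> der (fun t => x t + h) t (cos (th t)).
  by move=> t0; have d := dx t t0; der_solve; ring.
have fst_int (k : R) (X : R -> R) (f : R -> R) :
    (forall t, 0 <= t -> der X t (cos (f t))) -> (forall t, 0 <= t -> der f t (2 * k * X t)) ->
    forall t : R, 0 <= t -> sin (f t) = sin (f 0) - k * X 0 ^+ 2 + k * X t ^+ 2.
  move=> dX' df t t0; have := @der_const _ (fun t => sin (f t) - k * X t ^+ 2) 0 t t0.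
  move=> H; have : sin (f t) - k * X t ^+ 2 = sin (f 0) - k * X 0 ^+ 2; last by lra.
  by apply: H => s /andP[s0 _]; have d := df s s0; have d' := dX' s s0; der_solve; rewrite /= ?expr1; ring.
have [ap|am] := ltP 0 a.
  apply: (shift _ h).
  have dth2 t : 0 <= t -> der th t (2 * (a / 2) * (x t + h)).
    by move=> t0; have d := dth t t0; apply: der_eq d _; rewrite (cE t t0); field.
  apply: (@normal_ratio (a / 2) (sin (th 0) - a / 2 * (x 0 + h) ^+ 2)); split => //.
    by rewrite divr_gt0.
  exact: (fst_int _ _ _ dX dth2).
apply: (mirror _ h).
have a0 : a < 0 by rewrite lt_neqAle an.
have dXN t : 0 <= t -> der (fun t => x t + h) t (cos (- th t)) by rewrite cosN; exact: dX.
have dth2 t : 0 <= t -> der (fun t => - th t) t (2 * (- a / 2) * (x t + h)).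
  by move=> t0; have d := dth t t0; der_solve; rewrite (cE t t0); field.
apply: (@normal_ratio (- a / 2) (sin (- th 0) - (- a / 2) * (x 0 + h) ^+ 2)); split => //.
  by rewrite divr_gt0// oppr_gt0.
exact: (fst_int _ _ _ dXN dth2).
Qed.

End Ratio.

(** * Lifts *)

Section Halfline.
Context {R : realType}.

(** Affine continuation to negative times: it turns the one-sided derivative at 0 into a
    derivative. *)
Definition extend (f g : R -> R) (t : R) : R := if 0 <= t then f t else f 0 + g 0 * t.

Lemma extendE (f g : R -> R) t : 0 <= t -> extend f g t = f t.
Proof. by rewrite /extend => ->. Qed.

Lemma extend_der (f g : R -> R) : derivative_on_halfline f g ->
  forall t, 0 <= t -> der (extend f g) t (g t).
Proof.
move=> H t t0.
suff C : h^-1 *: ((extend f g \o shift t) (h *: (1 : R^o)) - extend f g t) @[h --> 0^'] --> (g t : R^o).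
  split; first by apply/cvg_ex; exists (g t).
  exact: cvg_lim C.
apply/cvgrPdist_lt => e e0.
have := H t t0; move=> /cvgrPdist_lt/(_ _ e0).
rewrite /within /= near_withinE; move=> /nbhs_ballP[d /= d0 Hd].
have [m m0 [md mt]] : exists2 m : R, 0 < m & m <= d /\ (t = 0 \/ m <= t).
  have [->|tn] := eqVneq t 0; first by exists d => //; split => //; left.
  have tp : 0 < t by rewrite lt_def tn.
  exists (Num.min d t); first by rewrite lt_min d0.
  by rewrite !ge_min !lexx orbT; split => //; right.
apply/nbhs_ballP; exists m => //= h; rewrite /ball /= sub0r normrN => hm hn.
rewrite [_%:A]mulr1 (extendE _ _ t0) /extend /GRing.scale /=.
have [st|st] := leP 0 (h + t).
  have := Hd (h + t); rewrite /ball /= addrK opprD addrCA subrr addr0 normrN.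
  rewrite (lt_le_trans hm md) => /(_ isT); rewrite -subr_eq0 addrK hn => /(_ isT st).
  by rewrite [in X in X -> _]mulrC.
case: mt => [tz|mt].
  by rewrite tz addr0 addrAC subrr add0r mulrC -mulrA divff// mulr1 subrr normr0.
by move: hm st; rewrite ltr_norml => /andP[]; lra.
Qed.
End Halfline.

Section Moments.
Context {R : realType}.
Local Notation mu := (@lebesgue_measure R).

(** Integration by parts shows that the integral depends on the density only through its primitive;
    two controls of the same planar curve have the same moments. *)
Lemma itg_prim_unique (a b : R) (F f G g g' : R -> R) : a <= b -> prim a b F f ->
  prim a b G g -> prim a b G g' ->
  itg a b (fun t => F t * g t) = itg a b (fun t => F t * g' t).
Proof.
move=> ab PF PG PG'.
have H k : prim a b G k -> itg a b (fun t => F t * k t) =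
    F b * G b - F a * G a - itg a b (fun t => G t * f t).
  move=> Pk; have := prim_diff (primM PF Pk) (lexx _) ab (lexx _) => /= ->.
  rewrite itgD; first by ring.
  - exact: (bmM (prim_bm PF) Pk.1).
  - exact: (bmM (prim_bm Pk) PF.1).
by rewrite !H.
Qed.

(** Integration by parts in x dy, and the exact forms x^2 dx and y^2 dy, reduce the coordinates z,
    v, w of the lift to the moments of x dy, x^2 dy, y^2 dx and the planar end point. *)
Lemma prim_moment (S : R) (x y u1 u2 : R -> R) : 0 <= S -> prim 0 S x u1 -> prim 0 S y u2 ->
  x 0 = 0 -> y 0 = 0 ->
  [/\ itg 0 S (fun s => (- u1 s * y s + u2 s * x s) / 2) =
       itg 0 S (fun s => x s * u2 s) - x S * y S / 2,
    itg 0 S (fun s => u2 s * ((x s ^+ 2 + y s ^+ 2) / 2)) =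
      (itg 0 S (fun s => x s ^+ 2 * u2 s) + y S ^+ 3 / 3) / 2 &
    itg 0 S (fun s => - u1 s * ((x s ^+ 2 + y s ^+ 2) / 2)) =
      - (itg 0 S (fun s => y s ^+ 2 * u1 s) + x S ^+ 3 / 3) / 2].
Proof.
move=> S0 Px Py x0 y0.
have bx := prim_bm Px; have by_ := prim_bm Py; have b1 := Px.1; have b2 := Py.1.
have cube (w v : R -> R) : prim 0 S w v -> w 0 = 0 -> itg 0 S (fun s => w s ^+ 2 * v s) = w S ^+ 3 / 3.
  move=> Pw w0.
  have dc (z : R) : der (fun z => z ^+ 3 / 3) z (z ^+ 2) by der_solve; rewrite /=; field.
  have cc : continuous (fun z : R => z ^+ 2) by move=> z; eapply der_cont; der_rec.
  have := prim_diff (prim_comp dc cc Pw) (lexx _) S0 (lexx _) => /= <-.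
  by rewrite w0 expr0n /= mul0r subr0.
have xy := prim_diff (primM Px Py) (lexx _) S0 (lexx _).
rewrite /= x0 mul0r subr0 itgD in xy; try exact: bmM.
split.
- rewrite (@itg_ext _ _ _ _ (fun s => 2^-1 * (x s * u2 s) + (- 2^-1) * (y s * u1 s))); last by move=> t _; field.
  rewrite itgD ?itgZ; try by repeat (apply: bmM || apply: bm_cst || assumption).
  by rewrite xy; field.
- rewrite (@itg_ext _ _ _ _ (fun s => 2^-1 * (x s ^+ 2 * u2 s) + 2^-1 * (y s ^+ 2 * u2 s))); last by move=> t _; field.
  rewrite itgD ?itgZ; try by repeat (apply: bmM || apply: bmX || apply: bm_cst || assumption).
  by rewrite (cube y u2)//; field.
- rewrite (@itg_ext _ _ _ _ (fun s => (- 2^-1) * (y s ^+ 2 * u1 s) + (- 2^-1) * (x s ^+ 2 * u1 s))); last by move=> t _; field.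
  rewrite itgD ?itgZ; try by repeat (apply: bmM || apply: bmX || apply: bm_cst || assumption).
  by rewrite (cube x u1)//; field.
Qed.

Lemma cartan_prim (T : R) q u1 u2 : horizontal (@cartan_velocity R) T q u1 u2 ->
  prim 0 T (fun t => xc (q t)) u1 /\ prim 0 T (fun t => yc (q t)) u2.
Proof.
move=> [B1 B2 H]; split; split => // t tT; rewrite /xc /yc H//; congr (_ + _);
  by apply: itg_ext => s _; rewrite mxE.
Qed.

Lemma engel_prim (T : R) q u1 u2 : horizontal (@engel_velocity R) T q u1 u2 ->
  prim 0 T (fun t => xc (q t)) u1 /\ prim 0 T (fun t => yc (q t)) u2.
Proof.
move=> [B1 B2 H]; split; split => // t tT; rewrite /xc /yc H//; congr (_ + _);
  by apply: itg_ext => s _; rewrite mxE.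
Qed.

Definition cartan_end (x y I1 I2 I3 : R) : 'rV[R]_5 :=
  \row_(i < 5) [:: x; y; I1 - x * y / 2; (I2 + y ^+ 3 / 3) / 2; - (I3 + x ^+ 3 / 3) / 2]`_i.

Definition engel_end (x y I1 I2 : R) : 'rV[R]_4 :=
  \row_(i < 4) [:: x; y; I1 - x * y / 2; (I2 + y ^+ 3 / 3) / 2]`_i.

Lemma cartan_endE (T : R) q u1 u2 : 0 <= T -> q 0 = 0 -> horizontal (@cartan_velocity R) T q u1 u2 ->
  q T = cartan_end (xc (q T)) (yc (q T)) (itg 0 T (fun t => xc (q t) * u2 t))
   (itg 0 T (fun t => xc (q t) ^+ 2 * u2 t)) (itg 0 T (fun t => yc (q t) ^+ 2 * u1 t)).
Proof.
move=> T0 q0 H; have [Px Py] := cartan_prim H.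
have [||m1 m2 m3] := prim_moment T0 Px Py; try by rewrite /xc /yc q0 mxE.
have TT : 0 <= T <= T by rewrite T0 lexx.
apply/rowP; case=> -[|[|[|[|[|//]]]]] iP; rewrite !mxE /=.
- by congr (q T 0 _); apply: val_inj.
- by congr (q T 0 _); apply: val_inj.
- case: H => _ _ /(_ _ _ TT) ->; rewrite q0 mxE add0r -m1.
  by apply: itg_ext => s _; rewrite mxE.
- case: H => _ _ /(_ _ _ TT) ->; rewrite q0 mxE add0r -m2.
  by apply: itg_ext => s _; rewrite mxE.
- case: H => _ _ /(_ _ _ TT) ->; rewrite q0 mxE add0r -m3.
  by apply: itg_ext => s _; rewrite mxE.
Qed.

Lemma engel_endE (T : R) q u1 u2 : 0 <= T -> q 0 = 0 -> horizontal (@engel_velocity R) T q u1 u2 ->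
  q T = engel_end (xc (q T)) (yc (q T)) (itg 0 T (fun t => xc (q t) * u2 t))
   (itg 0 T (fun t => xc (q t) ^+ 2 * u2 t)).
Proof.
move=> T0 q0 H; have [Px Py] := engel_prim H.
have [||m1 m2 m3] := prim_moment T0 Px Py; try by rewrite /xc /yc q0 mxE.
have TT : 0 <= T <= T by rewrite T0 lexx.
apply/rowP; case=> -[|[|[|[|//]]]] iP; rewrite !mxE /=.
- by congr (q T 0 _); apply: val_inj.
- by congr (q T 0 _); apply: val_inj.
- case: H => _ _ /(_ _ _ TT) ->; rewrite q0 mxE add0r -m1.
  by apply: itg_ext => s _; rewrite mxE.
- case: H => _ _ /(_ _ _ TT) ->; rewrite q0 mxE add0r -m2.
  by apply: itg_ext => s _; rewrite mxE.
Qed.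

Lemma cartan_lift_exists (T : R) x y u1 u2 : 0 <= T -> prim 0 T x u1 -> prim 0 T y u2 ->
  x 0 = 0 -> y 0 = 0 -> exists q, [/\ horizontal (@cartan_velocity R) T q u1 u2, q 0 = 0 &
    forall t, xc (q t) = x t /\ yc (q t) = y t].
Proof.
move=> T0 Px Py x0 y0.
exists (fun t => \row_(i < 5) [:: x t; y t; itg 0 t (fun s => (- u1 s * y s + u2 s * x s) / 2);
   itg 0 t (fun s => u2 s * ((x s ^+ 2 + y s ^+ 2) / 2));
   itg 0 t (fun s => - u1 s * ((x s ^+ 2 + y s ^+ 2) / 2))]`_i).
split; last by move=> t; rewrite /xc /yc !mxE.
  split; [exact: Px.1|exact: Py.1|].
  move=> t; case=> -[|[|[|[|[|//]]]]] iP tT; rewrite !mxE /= ?itg_same ?add0r.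
  - by rewrite Px.2//; congr (_ + _); apply: itg_ext => s _; rewrite mxE.
  - by rewrite Py.2//; congr (_ + _); apply: itg_ext => s _; rewrite mxE.
  - by apply: itg_ext => s _; rewrite !mxE /xc /yc !mxE.
  - by apply: itg_ext => s _; rewrite !mxE /xc /yc !mxE.
  - by apply: itg_ext => s _; rewrite !mxE /xc /yc !mxE.
by apply/rowP; case=> -[|[|[|[|[|//]]]]] iP; rewrite !mxE /= ?itg_same.
Qed.

Lemma engel_lift_exists (T : R) x y u1 u2 : 0 <= T -> prim 0 T x u1 -> prim 0 T y u2 ->
  x 0 = 0 -> y 0 = 0 -> exists q, [/\ horizontal (@engel_velocity R) T q u1 u2, q 0 = 0 &
    forall t, xc (q t) = x t /\ yc (q t) = y t].
Proof.
move=> T0 Px Py x0 y0.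
exists (fun t => \row_(i < 4) [:: x t; y t; itg 0 t (fun s => (- u1 s * y s + u2 s * x s) / 2);
   itg 0 t (fun s => u2 s * ((x s ^+ 2 + y s ^+ 2) / 2))]`_i).
split; last by move=> t; rewrite /xc /yc !mxE.
  split; [exact: Px.1|exact: Py.1|].
  move=> t; case=> -[|[|[|[|//]]]] iP tT; rewrite !mxE /= ?itg_same ?add0r.
  - by rewrite Px.2//; congr (_ + _); apply: itg_ext => s _; rewrite mxE.
  - by rewrite Py.2//; congr (_ + _); apply: itg_ext => s _; rewrite mxE.
  - by apply: itg_ext => s _; rewrite !mxE /xc /yc !mxE.
  - by apply: itg_ext => s _; rewrite !mxE /xc /yc !mxE.
by apply/rowP; case=> -[|[|[|[|//]]]] iP; rewrite !mxE /= ?itg_same.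
Qed.

End Moments.

Section CutTime.
Context {R : realType}.
Variables (gamma : R -> 'rV[R]_2) (x y th c : R -> R).
Hypothesis x0 : x 0 = 0.
Hypothesis y0 : y 0 = 0.
Hypothesis dx : forall t, 0 <= t -> der x t (cos (th t)).
Hypothesis dy : forall t, 0 <= t -> der y t (sin (th t)).
Hypothesis dth : forall t, 0 <= t -> der th t (c t).
Hypothesis cc : forall t, 0 <= t -> {for t, continuous c}.
Hypothesis gE : forall t, 0 <= t -> xc (gamma t) = x t /\ yc (gamma t) = y t.

Let U t := cos (th t).
Let V t := sin (th t).

Let prim_x T : prim 0 T x U.
Proof.
apply: prim_der => t /andP[t0 _]; first exact: dx.
by apply: continuous_comp (der_cont (dth t0)) _; exact: continuous_cos.
Qed.

Let prim_y T : prim 0 T y V.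
Proof.
apply: prim_der => t /andP[t0 _]; first exact: dy.
by apply: continuous_comp (der_cont (dth t0)) _; exact: continuous_sin.
Qed.

Let plen_gamma T : 0 <= T -> plen 0 T U V = T.
Proof.
move=> T0; rewrite /plen (@itg_ext _ _ _ _ (fun=> 1)) ?itg_cst// ?mul1r ?subr0//.
by move=> t _; rewrite cos2Dsin2 sqrtr1.
Qed.

Lemma lift_prim n (T : R) (q : R -> 'rV[R]_n.+2) u1 u2 :
  prim 0 T (fun t => xc (q t)) u1 -> prim 0 T (fun t => yc (q t)) u2 ->
  (forall t, 0 <= t <= T -> xc (q t) = xc (gamma t) /\ yc (q t) = yc (gamma t)) ->
  prim 0 T x u1 /\ prim 0 T y u2.
Proof.
move=> P1 P2 H; split; [apply: prim_ext_eq P1 => // t tT|apply: prim_ext_eq P2 => // t tT].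
  by have [-> _] := H t tT; have [->] := gE (proj1 (andP tT)).
by have [_ ->] := H t tT; have [_ ->] := gE (proj1 (andP tT)).
Qed.

(* The controls of a lift are only known through their primitives x and y. *)
Lemma lift_moments (T : R) u1 u2 : 0 <= T -> prim 0 T x u1 -> prim 0 T y u2 ->
  [/\ itg 0 T (fun t => x t * u2 t) = itg 0 T (fun t => x t * V t),
    itg 0 T (fun t => x t ^+ 2 * u2 t) = itg 0 T (fun t => x t ^+ 2 * V t),
    itg 0 T (fun t => y t ^+ 2 * u1 t) = itg 0 T (fun t => y t ^+ 2 * U t) &
    T <= plen 0 T u1 u2].
Proof.
move=> T0 P1 P2.
have sq (w v : R -> R) : prim 0 T w v -> prim 0 T (fun t => w t ^+ 2) (fun t => 2 * w t * v t).
  have dq (s : R) : der (fun s => s ^+ 2) s (2 * s) by der_solve; rewrite /= expr1; ring.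
  have cq : continuous (fun s : R => 2 * s) by move=> s; eapply der_cont; der_rec.
  by move=> Pw; exact: (prim_comp dq cq Pw).
split; [exact: (itg_prim_unique T0 P1 P2 (prim_y T))|exact: (itg_prim_unique T0 (sq _ _ P1) P2 (prim_y T))|
  exact: (itg_prim_unique T0 (sq _ _ P2) P1 (prim_x T))|].
have cn (f : R -> R) : (forall s : R, {for s, continuous f}) ->
    forall t, 0 <= t <= T -> {for t, continuous (fun t => f (th t) * c t)}.
  move=> cf t /andP[t0 _]; apply: continuousM (cc t0).
  by apply: continuous_comp (der_cont (dth t0)) _; exact: cf.
have PU : prim 0 T U (fun t => - sin (th t) * c t).
  apply: prim_der; first by move=> t /andP[t0 _]; have d := dth t0; rewrite /U; der_solve; ring.
  by apply: (cn (fun s => - sin s)) => s; have d := is_derive_sin s; eapply der_cont; der_rec.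
have PV : prim 0 T V (fun t => cos (th t) * c t).
  apply: prim_der; first by move=> t /andP[t0 _]; have d := dth t0; rewrite /V; der_solve; ring.
  by apply: (cn (fun s => cos s)) => s; exact: continuous_cos.
have bU := prim_bm PU; have bV := prim_bm PV; have b1 := P1.1; have b2 := P2.1.
(* The inner product with the unit tangent [(U, V)] has the same integral for the given controls as
   for the smooth ones, namely [T]; by Cauchy-Schwarz it bounds the length from below. *)
have E1 := itg_prim_unique T0 PU P1 (prim_x T); have E2 := itg_prim_unique T0 PV P2 (prim_y T).
have E : itg 0 T (fun t => U t * u1 t + V t * u2 t) = T.
  rewrite itgD ?E1 ?E2; try exact: bmM.
  rewrite -itgD; try exact: bmM.
  rewrite (@itg_ext _ _ _ _ (fun=> 1)) ?itg_cst// ?mul1r ?subr0//.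
  by move=> t _; rewrite -!expr2 cos2Dsin2.
rewrite -[X in X <= _]E; apply: itg_le; [by apply: bmD; exact: bmM|exact: bm_speed|move=> t _].
apply: le_sqrt; rewrite -subr_ge0.
have -> : u1 t ^+ 2 + u2 t ^+ 2 - (U t * u1 t + V t * u2 t) ^+ 2 =
    (U t ^+ 2 + V t ^+ 2) * (u1 t ^+ 2 + u2 t ^+ 2) - (U t * u1 t + V t * u2 t) ^+ 2.
  by rewrite cos2Dsin2 mul1r.
have -> : (U t ^+ 2 + V t ^+ 2) * (u1 t ^+ 2 + u2 t ^+ 2) - (U t * u1 t + V t * u2 t) ^+ 2 =
    (U t * u2 t - V t * u1 t) ^+ 2 by ring.
exact: sqr_ge0.
Qed.

Lemma cartan_lift_min (T : R) : 0 <= T -> (exists (q : R -> 'rV[R]_5) (u1 u2 : R -> R),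
    horizontal_lift (@cartan_velocity R) T gamma q u1 u2 /\
    length_minimizing (@cartan_velocity R) T q u1 u2) <-> cartan_min T x y U V.
Proof.
move=> T0; split=> [[q [u1 [u2 [[Hq q0 qg] [_ M]]]]]|M].
  have [Q1 Q2] := cartan_prim Hq; have [Px Py] := lift_prim Q1 Q2 qg.
  have [m1 m2 m3 Tl] := lift_moments T0 Px Py.
  have qx t : 0 <= t <= T -> xc (q t) = x t /\ yc (q t) = y t.
    by move=> tT; have [-> ->] := qg t tT; exact: gE (proj1 (andP tT)).
  move=> S x' y' v1 v2 S0 Px' Py' x0' y0' xS yS K1 K2 K3.
  have [||p [Hp p0 pE]] := cartan_lift_exists S0 Px' Py'; rewrite ?x0' ?y0'//.
  apply: le_trans Tl _; apply: (M S _ _ _ S0 Hp); first by rewrite p0 q0.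
  rewrite (cartan_endE S0 p0 Hp) (cartan_endE T0 q0 Hq).
  have [-> ->] := pE S; have [|-> ->] := qx T; first by rewrite T0 lexx.
  rewrite xS yS; congr (cartan_end _ _ _ _ _).
  - transitivity (itg 0 S (fun t => x' t * v2 t)); first by apply: itg_ext => t _; have [->] := pE t.
    by rewrite K1 -m1; apply: itg_ext => t /qx[->].
  - transitivity (itg 0 S (fun t => x' t ^+ 2 * v2 t)); first by apply: itg_ext => t _; have [->] := pE t.
    by rewrite K2 -m2; apply: itg_ext => t /qx[->].
  - transitivity (itg 0 S (fun t => y' t ^+ 2 * v1 t)); first by apply: itg_ext => t _; have [_ ->] := pE t.
    by rewrite K3 -m3; apply: itg_ext => t /qx[_ ->].
have [q [Hq q0 qE]] := cartan_lift_exists T0 (prim_x T) (prim_y T) x0 y0.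
exists q, U, V; split; first split => //.
  by move=> t /andP[t0 _]; have [-> ->] := qE t; have [-> ->] := gE t0.
split => // S p v1 v2 S0 Hp p0 pS; rewrite q0 in p0.
have [P1 P2] := cartan_prim Hp.
rewrite [X in X <= _](plen_gamma T0); have E := cartan_endE S0 p0 Hp.
have [xT yT] := qE T; rewrite pS xT yT (cartan_endE T0 q0 Hq) xT yT in E.
move/rowP: E => E.
have x1 : xc (p S) = x T by rewrite pS xT.
have y1 : yc (p S) = y T by rewrite pS yT.
have := E (Ordinal (isT : (2 < 5)%N)); have := E (Ordinal (isT : (3 < 5)%N)); have := E (Ordinal (isT : (4 < 5)%N)).
rewrite !mxE /= => e3 e2 e1.
have qx (f : R -> R -> R -> R) a b : itg a b (fun t => f t (xc (q t)) (yc (q t))) = itg a b (fun t => f t (x t) (y t)).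
  by apply: itg_ext => t _; have [-> ->] := qE t.
rewrite (qx (fun t x _ => x * V t)) in e1; rewrite (qx (fun t x _ => x ^+ 2 * V t)) in e2.
rewrite (qx (fun t _ y => y ^+ 2 * U t)) in e3.
have p0' : xc (p 0) = 0 /\ yc (p 0) = 0 by rewrite p0 /xc /yc !mxE.
apply: (M S _ _ _ _ S0 P1 P2 _ _ x1 y1).
- by rewrite x0; case: p0'.
- by rewrite y0; case: p0'.
- by move: e1; lra.
- by move: e2; lra.
- by move: e3; lra.
Qed.

Lemma engel_lift_min (T : R) : 0 <= T -> (exists (q : R -> 'rV[R]_4) (u1 u2 : R -> R),
    horizontal_lift (@engel_velocity R) T gamma q u1 u2 /\
    length_minimizing (@engel_velocity R) T q u1 u2) <-> engel_min x V T.
Proof.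
move=> T0; split=> [[q [u1 [u2 [[Hq q0 qg] [_ M]]]]]|M].
  have [Q1 Q2] := engel_prim Hq; have [Px Py] := lift_prim Q1 Q2 qg.
  have [m1 m2 _ Tl] := lift_moments T0 Px Py.
  have qx t : 0 <= t <= T -> xc (q t) = x t /\ yc (q t) = y t.
    by move=> tT; have [-> ->] := qg t tT; exact: gE (proj1 (andP tT)).
  move=> S x' v1 v2 S0 Px' b2 x0' xS K0 K1 K2.
  (* The competitors of [engel_min] carry no ordinate; it is rebuilt from its velocity. *)
  pose y' t := itg 0 t v2.
  have Py' : prim 0 S y' v2 by split => // t _; rewrite /y' itg_same add0r.
  have [||p [Hp p0 pE]] := engel_lift_exists S0 Px' Py'; rewrite ?x0' ?x0//; first exact: itg_same.
  apply: le_trans Tl _; apply: (M S _ _ _ S0 Hp); first by rewrite p0 q0.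
  rewrite (engel_endE S0 p0 Hp) (engel_endE T0 q0 Hq).
  have [-> ->] := pE S; have [|-> ->] := qx T; first by rewrite T0 lexx.
  have yS : y' S = y T.
    by rewrite /y' K0 -(prim_diff (prim_y T) (lexx _) T0 (lexx _)) y0 subr0.
  rewrite xS yS; congr (engel_end _ _ _ _).
  - transitivity (itg 0 S (fun t => x' t * v2 t)); first by apply: itg_ext => t _; have [->] := pE t.
    by rewrite K1 -m1; apply: itg_ext => t /qx[->].
  - transitivity (itg 0 S (fun t => x' t ^+ 2 * v2 t)); first by apply: itg_ext => t _; have [->] := pE t.
    by rewrite K2 -m2; apply: itg_ext => t /qx[->].
have [q [Hq q0 qE]] := engel_lift_exists T0 (prim_x T) (prim_y T) x0 y0.
exists q, U, V; split; first split => //.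
  by move=> t /andP[t0 _]; have [-> ->] := qE t; have [-> ->] := gE t0.
split => // S p v1 v2 S0 Hp p0 pS; rewrite q0 in p0.
have [P1 P2] := engel_prim Hp.
rewrite [X in X <= _](plen_gamma T0); have E := engel_endE S0 p0 Hp.
have [xT yT] := qE T; rewrite pS xT yT (engel_endE T0 q0 Hq) xT yT in E.
move/rowP: E => E.
have x1 : xc (p S) = x T by rewrite pS xT.
have y1 : yc (p S) = y T by rewrite pS yT.
have := E (Ordinal (isT : (2 < 4)%N)); have := E (Ordinal (isT : (3 < 4)%N)).
rewrite !mxE /= => e2 e1.
have qx (f : R -> R -> R -> R) a b : itg a b (fun t => f t (xc (q t)) (yc (q t))) = itg a b (fun t => f t (x t) (y t)).
  by apply: itg_ext => t _; have [-> ->] := qE t.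
rewrite (qx (fun t x _ => x * V t)) in e1; rewrite (qx (fun t x _ => x ^+ 2 * V t)) in e2.
have p0' : xc (p 0) = 0 /\ yc (p 0) = 0 by rewrite p0 /xc /yc !mxE.
apply: (M S _ _ _ S0 P1 P2.1 _ x1).
- by rewrite x0; case: p0'.
- rewrite -(prim_diff P2 (lexx _) S0 (lexx _)) -(prim_diff (prim_y T) (lexx _) T0 (lexx _)) y1 y0.
  by case: p0' => _ ->.
- by move: e1; lra.
- by move: e2; lra.
Qed.

(** A Cartan competitor satisfies all Engel constraints; this is the comparison of the two groups by
    projection, hence the left inequality of the theorem. *)
Lemma engel_cartan_min (T : R) : 0 <= T -> engel_min x V T -> cartan_min T x y U V.
Proof.
move=> T0 M S x' y' v1 v2 S0 Px' Py' x0' y0' xS yS K1 K2 _.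
apply: (M S x' v1 v2 S0 Px' Py'.1 x0' xS _ K1 K2).
by rewrite -(prim_diff Py' (lexx _) S0 (lexx _)) -(prim_diff (prim_y T) (lexx _) T0 (lexx _)) yS y0'.
Qed.

Lemma engel_cut_ge (T : R) : 0 < T -> engel_min x V T -> (T%:E <= engel_cut_time gamma)%E.
Proof.
move=> T0 M; apply: ereal_sup_ubound; exists T => //; split => //.
by apply/engel_lift_min => //; exact: ltW.
Qed.

Lemma cut_time_ratio (zeta : R) : 0 < zeta -> cut_ratio zeta x y th ->
  [/\ (0 < engel_cut_time gamma)%E,
      (engel_cut_time gamma <= cartan_cut_time gamma)%E &
      (cartan_cut_time gamma <= zeta%:E * engel_cut_time gamma)%E].
Proof.
move=> z0 H; split.
- case: H => [L|[tE [t0 M _]]].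
    by apply: lt_le_trans (engel_cut_ge ltr01 (L 1 ler01)); rewrite lte_fin.
  by apply: lt_le_trans (engel_cut_ge t0 M); rewrite lte_fin.
- apply: ereal_sup_le => _ [T [T0 E] <-]; exists T => //; split => //.
  have T0' := ltW T0; apply/cartan_lift_min => //; apply: engel_cartan_min => //.
  exact/engel_lift_min.
case: H => [L|[tE [t0 M H]]].
  (* All times being minimal, the cut time is infinite and the inequality is trivial in the extended
     reals. *)
  have -> : engel_cut_time gamma = +oo%E.
    apply/eqyP => T T0; exact: engel_cut_ge T0 (L T (ltW T0)).
  by rewrite gt0_muley ?lte_fin// leey.
have le : (zeta%:E * tE%:E <= zeta%:E * engel_cut_time gamma)%E.
  by rewrite lee_pmul2l// ?lte_fin//; exact: engel_cut_ge.
apply: le_trans le; apply: ge_ereal_sup => _ [T [T0 E] <-].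
by rewrite -EFinM lee_fin; apply: (H T T0); exact: (proj1 (cartan_lift_min (ltW T0)) E).
Qed.

End CutTime.

Theorem theorem1p6 (R : realType) :
  exists zeta : R, zeta < 2 /\
    forall gamma : R -> 'rV[R]_2,
      elastica gamma -> engel_elastica gamma ->
      [/\ (0 < engel_cut_time gamma)%E,
          (engel_cut_time gamma <= cartan_cut_time gamma)%E &
          (cartan_cut_time gamma <= zeta%:E * engel_cut_time gamma)%E].
Proof.
have [zeta [z0 z2 ratio]] : exists zeta : R, [/\ 0 < zeta, zeta < 2 & forall (a : R) (x y th c : R -> R),
    (forall t, 0 <= t -> der x t (cos (th t))) -> (forall t, 0 <= t -> der y t (sin (th t))) ->
    (forall t, 0 <= t -> der th t (c t)) -> (forall t, 0 <= t -> der c t (a * cos (th t))) ->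
    cut_ratio zeta x y th].
  exists (2 - 1 / (51 * 1000)); split; [by lra|by lra|exact: bent_ratio].
exists zeta; split; first exact: z2.
move=> gamma _ [alpha [beta [_ ab [g0 [theta [c [dx dy dth dc]]]]]]].
pose th := extend theta c; pose cu := extend c (fun t => - alpha * sin (theta t - beta)).
pose x := extend (xc \o gamma) (cos \o theta); pose y := extend (yc \o gamma) (sin \o theta).
have thE t : 0 <= t -> th t = theta t by exact: extendE.
have cE t : 0 <= t -> cu t = c t by exact: extendE.
have dx' t : 0 <= t -> der x t (cos (th t)) by move=> t0; rewrite thE//; exact: extend_der dx t t0.
have dy' t : 0 <= t -> der y t (sin (th t)) by move=> t0; rewrite thE//; exact: extend_der dy t t0.
have dth' t : 0 <= t -> der th t (cu t) by move=> t0; rewrite cE//; exact: extend_der dth t t0.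
(* Expanding the sine of the difference, the term with [alpha * cos beta] vanishes and the
   coefficient is [a = alpha * sin beta]. *)
have dc' t : 0 <= t -> der cu t (alpha * sin beta * cos (th t)).
  move=> t0; apply: der_eq (extend_der dc t0) _; rewrite thE// sinB.
  transitivity (alpha * sin beta * cos (theta t) - alpha * cos beta * sin (theta t)); first by ring.
  by rewrite ab mul0r subr0.
apply: (@cut_time_ratio _ gamma x y th cu) => //.
- by rewrite /x extendE//= g0 /xc mxE.
- by rewrite /y extendE//= g0 /yc mxE.
- by move=> t t0; exact: (der_cont (dc' t t0)).
- by move=> t t0; rewrite /x /y !extendE.
- exact: (ratio _ x y th cu dx' dy' dth' dc').
Qed.
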